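(* Let $X$ be an admissible $n$-dimensional Euclidean complex with degree bounded above by $M$, solid angle bounded by $\alpha$, and edge lengths bounded below. For any $R_0>0$ there exists a constant $C=C(X,R_0)$ such that for all $x,y\in X$ and all $t>0$, $$h_t(x,y)\le\frac{C}{M\,\mu(S^{(n-1)})\,(\min(t,R_0^2))^{n/2}}\;e^{-\frac{d^2(x,y)}{4t}}\Bigl(1+\frac{d^2(x,y)}{t}\Bigr)^{N/2}.$$ Here $2^N$ is a volume doubling constant for balls of $X$ at scales up to $R_0$.
   Context: A polyhedral complex $X$ is a union of a countable, locally finite collection of convex polyhedra such that any two distinct polyhedra of the collection meet in a (possibly empty) common face of dimension smaller than the maximum of the two dimensions. The $p$-skeleton $X^{(p)}$ is the union of all faces of dimension at most $p$. Each polyhedron carries a Euclidean metric and these agree on shared faces; $d(x,y)$ is the infimum of the lengths of paths consisting of finitely many line segments, each in a single maximal polyhedron; $\mu$ is the sum of the Lebesgue measures on the maximal polyhedra. $X$ is admissible if all maximal polyhedra have dimension $n$ and, in some triangulation, $U-X^{(n-2)}$ is connected for every connected open $U\subset X$. A Euclidean complex is an admissible polyhedral complex with $d$ and $\mu$; it is assumed connected. Degree bounded by $M$: at most $M$ edges share any given vertex. Edge lengths bounded below: $\inf_{v\ne w\in X^{(0)}}d(v,w)>0$. Solid angle bound $\alpha$ ($\alpha>0$): whenever $z\in X^{(D)}-X^{(D-1)}$, $r<d(z,X^{(D-1)})$ and $B=B(z,r)$ meets no $D$-dimensional face other than the one containing $z$, the closure $W$ of each connected component of $B-X^{(n-1)}$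 satisfies $\alpha\le\mu(W)/(r^n\mu(S^{(n-1)}))\le1$. $\mu(S^{(n-1)})$ is the measure of the unit sphere of $\mathbb R^n$. $2^N$ is a volume doubling constant at scales up to $R_0$ if $\mu(B(z,2r))\le2^N\mu(B(z,r))$ for all $z\in X$, $0<r\le R_0$. $h_t(x,y)$ is the integral kernel of $e^{-t\Delta}$, where $\Delta\ge0$ is the self-adjoint operator associated with the Dirichlet form on $L^2(X,\mu)$ obtained by closing $f\mapsto\sum_P\int_P|\nabla f|^2d\mu$ ($P$ running over maximal polyhedra) from the compactly supported Lipschitz functions.
   Formalization: The convex polyhedra of the complex are taken to be compact; with unbounded polyhedra (e.g. prisms without vertices over a tapering planar strip) the vertex-based conditions are vacuous and the bound fails. *)

(* Defs.v *)
From HB Require Import structures.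
From mathcomp Require Import all_boot all_order all_algebra.
From mathcomp Require Import all_classical all_reals all_analysis.
From mathcomp Require Import measurable_realfun.
Import numFieldNormedType.Exports.
Import Order.TTheory GRing.Theory Num.Theory.

Set Implicit Arguments.
Unset Strict Implicit.
Unset Printing Implicit Defensive.

Local Open Scope classical_set_scope.
Local Open Scope ring_scope.

Notation Rk R k := (k.-tuple (measurableTypeR R)).

Section Euclidean_space.
Context {R : realType}.

Definition dot k (u v : 'rV[R]_k) : R := \sum_j u 0 j * v 0 j.

(* The library norm on ['rV[R]_k] is the sup norm. *)
Definition enorm k (u : 'rV[R]_k) : R := Num.sqrt (dot u u).

Definition affdim_ge k (F : set 'rV[R]_k) (m : nat) : Prop :=
  exists x (v : 'M[R]_(m, k)),
    [/\ F x, row_free v & forall i, F (x + row i v)].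

Definition affdim k (F : set 'rV[R]_k) (m : nat) : Prop :=
  affdim_ge F m /\ ~ affdim_ge F m.+1.

(* Polyhedra are compact and presented full-dimensionally, so that [k] is the
   dimension. *)
Record polytope (k : nat) := Polytope {
  body : set 'rV[R]_k;
  body_halfspaces : exists m (a : 'I_m -> 'rV[R]_k) (b : 'I_m -> R),
    body = [set x | forall i, dot (a i) x <= b i];
  body_bounded : exists r, forall x, body x -> enorm x <= r;
  body_full : body° !=set0 }.

(* [c = 0] gives the polytope itself; every other nonempty face is cut out by
   a supporting hyperplane. *)
Definition face k (P : polytope k) (F : set 'rV[R]_k) : Prop :=
  F = set0 \/
  exists c, F = [set x | body P x /\ forall y, body P y -> dot c y <= dot c x].

Definition simplex k (P : polytope k) : Prop :=
  exists v : 'I_k.+1 -> 'rV[R]_k,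
    body P =
    [set x | exists w : 'I_k.+1 -> R,
      [/\ forall i, 0 <= w i, \sum_i w i = 1 & x = \sum_i w i *: v i]].

Definition vec k (t : Rk R k) : 'rV[R]_k := \row_j tnth t j.

Definition consT k (p : measurableTypeR R * Rk R k) : Rk R k.+1 :=
  [the Rk R k.+1 of p.1 :: p.2].

Lemma measurable_consT k : measurable_fun [set: _] (@consT k).
Proof. exact: measurable_cons. Qed.

Section step.
Local Open Scope ereal_scope.
Context k (m : {sigma_finite_measure set (Rk R k) -> \bar R}).

Definition leb_step : set (Rk R k.+1) -> \bar R :=
  pushforward (lebesgue_measure \x m) (@consT k).

Let mpre (A : set (Rk R k.+1)) : measurable A -> measurable (@consT k @^-1` A).
Proof. by move=> mA; rewrite -[X in measurable X]setTI; exact: measurable_consT. Qed.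

Let step0 : leb_step set0 = 0.
Proof. by rewrite /leb_step /pushforward preimage_set0 measure0. Qed.

Let step_ge0 A : 0 <= leb_step A.
Proof. by rewrite /leb_step /pushforward; exact: measure_ge0. Qed.

Let step_sigma_additive : semi_sigma_additive leb_step.
Proof.
move=> F mF tF mUF; rewrite /leb_step /pushforward preimage_bigcup.
apply: measure_semi_sigma_additive.
- by move=> i; exact: mpre.
- apply/trivIsetP => /= i j _ _ ij; rewrite -preimage_setI.
  by move/trivIsetP : tF => /(_ _ _ _ _ ij) ->//; rewrite preimage_set0.
- by rewrite -preimage_bigcup; exact: mpre.
Qed.

HB.instance Definition _ := isMeasure.Build _ _ _ leb_step
  step0 step_ge0 step_sigma_additive.

Let step_sigma_finite : sigma_finite setT leb_step.
Proof.
have /sigma_finiteP[F [FT Fnd Foo]] := sigma_finiteT (@lebesgue_measure R).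
have /sigma_finiteP[G [GT Gnd Goo]] := sigma_finiteT m.
pose unc (t : Rk R k.+1) : measurableTypeR R * Rk R k :=
  (thead t, [tuple of behead t]).
have munc : measurable_fun setT unc.
  apply/measurable_fun_pairP; split; first exact: measurable_tnth.
  exact: measurable_behead.
have consK : cancel (@consT k) unc.
  case=> x t; rewrite /unc /consT /=; congr pair; apply: val_inj; exact: erefl.
exists (fun i => unc @^-1` (F i `*` G i)).
  rewrite -preimage_bigcup -[LHS](preimage_setT unc); congr (_ @^-1` _).
  apply/seteqP; split=> // -[x t] _.
  have [i _ Fx] : (\bigcup_i F i) x by rewrite -FT.
  have [j _ Gt] : (\bigcup_i G i) t by rewrite -GT.
  exists (maxn i j) => //; split=> /=.
  - by move: x Fx; exact/subsetPset/Fnd/leq_maxl.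
  - by move: t Gt; exact/subsetPset/Gnd/leq_maxr.
move=> i; have [mF Fi] := Foo i; have [mG Gi] := Goo i; split.
  by rewrite -[X in measurable X]setTI; apply: munc => //; exact: measurableX.
suff -> : leb_step (unc @^-1` (F i `*` G i)) = lebesgue_measure (F i) * m (G i).
  by rewrite lte_mul_pinfty// ge0_fin_numE.
rewrite /leb_step /pushforward -comp_preimage -product_measure1E//.
by rewrite (_ : unc \o @consT k = id) ?preimage_id//; apply/funext.
Qed.

HB.instance Definition _ := @Measure_isSigmaFinite.Build _ _ _ leb_step
  step_sigma_finite.

End step.

(* Lebesgue measure on [R^k]. *)
Fixpoint leb k : {sigma_finite_measure set (Rk R k) -> \bar R} :=
  match k with
  | 0 => [the {sigma_finite_measure set (Rk R 0) -> \bar R} of dirac [tuple]]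
  | j.+1 => [the {sigma_finite_measure set (Rk R j.+1) -> \bar R} of
             leb_step (leb j)]
  end.

Lemma measurable_polytope k (P : polytope k) : measurable (@vec k @^-1` body P).
Proof.
have [m [a [b PE]]] := body_halfspaces P.
have -> : @vec k @^-1` body P =
    \bigcap_(i in [set: 'I_m]) ([set: Rk R k] `&` [set t | dot (a i) (vec t) <= b i]).
  rewrite PE; apply/seteqP; split=> t /= => [h i _|h i]; first by split=> //; exact: h.
  by have [] := h i I.
apply: fin_bigcap_measurable => [|i _]; first exact: finite_finset.
apply: measurable_fun_le => //.
apply: measurable_sum => j; apply: measurable_funM => //.
rewrite (_ : (fun _ => _) = (fun t : Rk R k => tnth t j)); last first.
  by apply/funext => t; rewrite mxE.
exact: measurable_tnth.
Qed.

Definition cone k (E : set 'rV[R]_k) : set 'rV[R]_k :=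
  [set x | exists r u, [/\ 0 < r <= 1, E u & x = r *: u]].

(* The standard construction of surface measure on the unit sphere. *)
Definition sphere_area k (E : set 'rV[R]_k) : \bar R :=
  ((k%:R)%:E * leb k (@vec k @^-1` cone E))%E.

Definition sphere_measure (n : nat) : R :=
  fine (sphere_area [set u : 'rV[R]_n | enorm u = 1]).

End Euclidean_space.

(* The points of the complex form the type [T]; the [i]-th polyhedron is the
   image of [cpoly i] under [chart i], whose values outside [cpoly i] are
   irrelevant. *)
Record pcomplex (R : realType) (T : pointedType) := PComplex {
  cell : countType;
  cdim : cell -> nat;
  cpoly : forall i, @polytope R (cdim i);
  chart : forall i, 'rV[R]_(cdim i) -> T }.

Definition points (R : realType) (T : pointedType) (X : pcomplex R T) : Type := T.

HB.instance Definition _ R T (X : pcomplex R T) :=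
  Pointed.copy (points X) T.

Section metric_and_measure.
Context {R : realType} {T : pointedType} (X : pcomplex R T).
Local Notation S := (points X).
Implicit Types (x y z : S) (i j : cell X) (A : set S).

Definition cellset i : set S := @chart _ _ X i @` body (cpoly i).

Definition maximal_cell i : Prop := forall j, cellset i `<=` cellset j -> j = i.

Inductive segment_path : S -> S -> R -> Prop :=
| SegmentNil x : segment_path x x 0
| SegmentCons i (a b : 'rV[R]_(cdim i)) z l :
    maximal_cell i -> body (cpoly i) a -> body (cpoly i) b ->
    segment_path (chart b) z l ->
    segment_path (chart a) z (enorm (b - a) + l).

Definition path_edist x y : \bar R :=
  ereal_inf [set l%:E | l in [set l | segment_path x y l]].

Definition path_dist x y : R := fine (path_edist x y).

Definition path_edist_set x A : \bar R := ereal_inf [set path_edist x y | y in A].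

Definition cball x (r : R) : set S := [set y | (path_edist x y < r%:E)%E].

Definition dopen A : Prop :=
  forall x, A x -> exists2 r, 0 < r & cball x r `<=` A.

Let dopenT : dopen setT.
Proof. by move=> x _; exists 1. Qed.

Let dopenI : setI_closed dopen.
Proof.
move=> A B oA oB x [Ax Bx].
have [r r0 rA] := oA x Ax; have [s s0 sB] := oB x Bx.
exists (Num.min r s); first by rewrite lt_min r0.
move=> y xy; split; [apply: rA|apply: sB]; apply: (lt_le_trans xy);
  by rewrite lee_fin ge_min lexx ?orbT.
Qed.

Let dopen_bigU (I : Type) (f : I -> set S) :
  (forall k, dopen (f k)) -> dopen (\bigcup_k f k).
Proof.
move=> of_ x [k _ fx]; have [r r0 rf] := of_ k x fx.
by exists r => // y /rf; exists k.
Qed.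

HB.instance Definition _ := isOpenTopological.Build S dopenT dopenI dopen_bigU.

(* The sets that are Borel in every chart; for a locally finite complex this is
   the Borel sigma-algebra of [S]. *)
Definition chart_pre i A : set (Rk R (cdim i)) :=
  [set t | body (cpoly i) (vec t) /\ A (chart (vec t))].
Arguments chart_pre : clear implicits.

Definition msets : set (set S) := [set A | forall i, measurable (chart_pre i A)].

Let msets0 : msets set0.
Proof.
move=> i; rewrite (_ : chart_pre i set0 = set0)//.
by apply/seteqP; split=> // t [].
Qed.

Let msetsC A : msets A -> msets (~` A).
Proof.
move=> mA i; rewrite (_ : chart_pre i (~` A) =
  (@vec R _ @^-1` body (cpoly i)) `\` chart_pre i A).
  by apply: measurableD; [exact: measurable_polytope|exact: mA].
apply/seteqP; split=> t /= [Pt nA]; split=> //; first by case.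
by move=> At; exact: nA.
Qed.

Let chart_pre_bigcup i (F : (set S)^nat) :
  chart_pre i (\bigcup_k F k) = \bigcup_k chart_pre i (F k).
Proof.
apply/seteqP; split=> t /=; first by move=> [Pt [k _ Fk]]; exists k.
by move=> [k _ [Pt Fk]]; split=> //; exists k.
Qed.

Let msets_bigcup (F : (set S)^nat) :
  (forall k, msets (F k)) -> msets (\bigcup_k F k).
Proof.
move=> mF i; rewrite chart_pre_bigcup.
by apply: bigcup_measurable => k _; exact: mF.
Qed.

HB.instance Definition _ := @isMeasurable.Build default_measure_display S
  msets msets0 msetsC msets_bigcup.

Definition mu A : \bar R :=
  (\esum_(i in maximal_cell) leb (cdim i) (chart_pre i A))%E.

Let mu0 : mu set0 = 0%E.
Proof.
apply: esum1 => i _; rewrite (_ : chart_pre i set0 = set0) ?measure0//.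
by apply/seteqP; split=> // t [].
Qed.

Let mu_ge0 A : (0 <= mu A)%E.
Proof. by apply: esum_ge0 => i _; exact: measure_ge0. Qed.

Let mu_sigma_additive : semi_sigma_additive mu.
Proof.
move=> F mF tF mUF.
rewrite [X in _ --> X](_ : _ =
  lim ((fun n => \sum_(0 <= i < n) mu (F i))%E @ \oo)); last first.
  transitivity (\esum_(i in maximal_cell) \esum_(k in [set: nat])
      leb (cdim i) (chart_pre i (F k)))%E.
    apply: eq_esum => i _; rewrite chart_pre_bigcup.
    rewrite measure_semi_bigcup//.
    - by rewrite nneseries_esumT.
    - by move=> k; exact: mF.
    - apply/trivIsetP => a b _ _ ab; apply/seteqP; split=> // t [[_ Fa] [_ Fb]].
      have /seteqP[+ _] : F a `&` F b = set0 by move/trivIsetP : tF; exact.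
      by apply; split; [exact: Fa|exact: Fb].
    - by rewrite -chart_pre_bigcup; exact: mUF.
  rewrite nneseries_esumT//.
  rewrite (@esum_esum _ _ _ maximal_cell (fun=> setT))//.
  rewrite (@esum_esum _ _ _ setT (fun=> maximal_cell))//.
  rewrite (reindex_esum ([set: nat] `*`` (fun=> maximal_cell)) _
    (fun p => (p.2, p.1)))//; split=> //=.
  - by move=> [k i] [/=].
  - by move=> [k1 i1] [k2 i2] /= _ _ [] -> ->.
  - by move=> [i k] [Mi _] /=; exists (k, i).
by apply: is_cvg_ereal_nneg_natsum => k _; exact: mu_ge0.
Qed.

HB.instance Definition _ := isMeasure.Build _ _ _ mu mu0 mu_ge0
  mu_sigma_additive.

End metric_and_measure.

Arguments maximal_cell {R T} X i.
Arguments mu {R T} X A.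

Section complexes.
Context {R : realType} {T : pointedType}.
Implicit Types (X Y : pcomplex R T).

Definition is_face X (E : set (points X)) (m : nat) : Prop :=
  exists (i : cell X) (F : set 'rV[R]_(cdim i)),
    [/\ face (cpoly i) F, affdim F m & E = @chart R T X i @` F].

(* [p : int] so that [p = -1] gives the empty skeleton. *)
Definition skeleton X (p : int) : set (points X) :=
  [set x | exists E m, [/\ @is_face X E m, (m%:Z <= p)%R & E x]].

Definition isometric_charts X Y (i : cell X) (j : cell Y) : Prop :=
  forall a a' b b', body (cpoly i) a -> body (cpoly i) a' ->
    body (cpoly j) b -> body (cpoly j) b' ->
    chart a = chart b -> chart a' = chart b' -> enorm (a - a') = enorm (b - b').

Record polyhedral_complex X : Prop := {
  chart_inj : forall i, set_inj (body (cpoly i)) (@chart R T X i);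
  cells_cover : \bigcup_i @cellset R T X i = setT;
  cells_meet : forall i j : cell X, i <> j -> exists F G,
    [/\ face (cpoly i) F, face (cpoly j) G,
        cellset i `&` cellset j = @chart R T X i @` F,
        cellset i `&` cellset j = @chart R T X j @` G &
        forall m, affdim F m -> (m < maxn (cdim i) (cdim j))%N];
  cells_metric : forall i j : cell X, isometric_charts i j;
  cells_locally_finite : forall x : points X, exists2 r, 0 < r &
    finite_set [set i | cellset i `&` cball x r !=set0] }.

(* A triangulation is a subdivision of [X] into Euclidean simplices, on the
   same set of points. *)
Definition triangulation X Y : Prop :=
  [/\ polyhedral_complex Y, forall j : cell Y, simplex (cpoly j) &
      forall j : cell Y, exists i : cell X,
        (cellset j : set T) `<=` (cellset i : set T) /\ isometric_charts i j].

Definition admissible X (n : nat) : Prop :=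
  (forall i : cell X, maximal_cell X i -> cdim i = n) /\
  exists Y, triangulation X Y /\
    forall U : set (points X), open U -> connected U ->
      connected (U `\` (@skeleton Y (n%:Z - 2) : set T)).

Definition euclidean_complex X (n : nat) : Prop :=
  [/\ polyhedral_complex X, admissible X n & connected [set: points X]].

Definition degree_le X (M : nat) : Prop :=
  forall v, @skeleton X 0 v ->
    ([set E | is_face E 1 /\ E v] #<= `I_M)%card.

Definition edges_bounded_below X : Prop :=
  (0 < ereal_inf [set path_edist p.1 p.2 | p in
    [set p : points X * points X |
      [/\ @skeleton X 0 p.1, @skeleton X 0 p.2 & p.1 <> p.2]]])%E.

Definition solid_angle_bound X (n : nat) (alpha : R) : Prop :=
  forall (D : nat) (z : points X) (r : R), 0 < r ->
    (@skeleton X D%:Z `\` @skeleton X (D%:Z - 1)) z ->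
    (r%:E < path_edist_set z (@skeleton X (D%:Z - 1)))%E ->
    (forall E, is_face E D -> E `&` cball z r !=set0 -> E z) ->
    let B := cball z r `\` @skeleton X (n%:Z - 1) in
    forall w, B w ->
      (alpha%:E <=
        mu X (closure (connected_component B w)) *
          ((r ^+ n * sphere_measure n)^-1)%:E <= 1)%E.

Definition volume_doubling X (N R0 : R) : Prop :=
  forall (z : points X) (r : R), 0 < r <= R0 ->
    (mu X (cball z (2 * r)) <= (2 `^ N)%:E * mu X (cball z r))%E.

End complexes.

Section heat_kernel.
Context {R : realType} {T : pointedType} (X : pcomplex R T).
Local Notation S := (points X).
Implicit Types (f g : S -> R) (P : R -> (S -> R) -> (S -> R)).

Definition L2 f : Prop := f \in Lfun (mu X) 2%:E.

Definition norm2 f : \bar R := 'N[mu X]_2%:E[EFin \o f]%E.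

Definition inner2 f g : R := fine (\int[mu X]_x (f x * g x)%:E)%E.

Definition grad_sq f (i : cell X) (v : 'rV[R]_(cdim i)) : R :=
  \sum_j ('D_(delta_mx 0 j) (fun w : 'rV[R]_(cdim i) => f (chart w)) v) ^+ 2.

(* The boundary of a polyhedron is a null set, and on it the derivatives of
   [f] in the chart are not meaningful. *)
Definition energy f : \bar R :=
  (\esum_(i in maximal_cell X)
     \int[leb (cdim i)]_(t in @vec R _ @^-1` (body (cpoly i))°)
        (grad_sq f (vec t))%:E)%E.

Definition energy_form f g : R :=
  (fine (energy (f \+ g)) - fine (energy (f \- g))) / 4.

Definition lipschitz_compact f : Prop :=
  (exists2 L, 0 <= L & forall x y,
    (`|f x - f y|%:E <= L%:E * path_edist x y)%E) /\
  compact (closure [set x | f x != 0]).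

Definition form_approx (u : nat -> S -> R) f : Prop :=
  [/\ forall k, lipschitz_compact (u k), L2 f,
      norm2 (u k \- f) @[k --> \oo] --> 0%E &
      forall e, 0 < e -> exists K, forall k l, (K <= k)%N -> (K <= l)%N ->
        (energy (u k \- u l)%R < e%:E)%E].

Definition form_dom f : Prop := exists u, form_approx u f.

Definition closed_form f g (e : R) : Prop :=
  exists u v, [/\ form_approx u f, form_approx v g &
    energy_form (u k) (v k) @[k --> \oo] --> e].

(* The graph of [Delta]. *)
Definition laplacian f g : Prop :=
  [/\ form_dom f, L2 g &
      forall phi, form_dom phi -> closed_form f phi (inner2 g phi)].

(* [P] is [t |-> exp (- t Delta)], the strongly continuous semigroup on
   [L^2(X, mu)] with generator [- Delta]. *)
Record heat_semigroup P : Prop := {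
  heat_L2 : forall t f, 0 <= t -> L2 f -> L2 (P t f);
  heat_linear : forall t a f g, 0 <= t -> L2 f -> L2 g ->
    {ae mu X, forall x, P t (fun y => a * f y + g y) x = a * P t f x + P t g x};
  heat_bounded : forall t, 0 <= t -> exists K : R, forall f, L2 f ->
    (norm2 (P t f) <= K%:E * norm2 f)%E;
  heat_0 : forall f, L2 f -> {ae mu X, forall x, P 0 f x = f x};
  heat_add : forall s t f, 0 <= s -> 0 <= t -> L2 f ->
    {ae mu X, forall x, P (s + t) f x = P s (P t f) x};
  heat_continuous : forall f, L2 f ->
    norm2 (P t f \- f) @[t --> 0^'+] --> 0%E;
  heat_generator : forall f g, laplacian f g <->
    [/\ L2 f, L2 g &
      norm2 (fun x => t^-1 * (f x - P t f x) - g x) @[t --> 0^'+] --> 0%E] }.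

(* The kernel is determined by the semigroup only almost everywhere; its
   continuous version is the one that has pointwise values. *)
Definition heat_kernel (h : R -> S -> S -> R) : Prop :=
  (forall t, 0 < t -> continuous (fun p : S * S => h t p.1 p.2)) /\
  exists2 P, heat_semigroup P & forall t f, 0 < t -> L2 f ->
    {ae mu X, forall x, (P t f x)%:E = (\int[mu X]_y (h t x y * f y)%:E)%E}.

End heat_kernel.

(* Main.v *)
Require Import Defs.
From HB Require Import structures.
From mathcomp Require Import all_boot all_order all_algebra.
From mathcomp Require Import all_classical all_reals all_analysis.
From mathcomp Require Import measurable_realfun ring lra zify.
Import numFieldNormedType.Exports.
Import Order.TTheory GRing.Theory Num.Theory.
Set Implicit Arguments.
Unset Strict Implicit.
Unset Printing Implicit Defensive.
Local Open Scope classical_set_scope.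
Local Open Scope ring_scope.

(** The bound combines three ingredients: an on-diagonal estimate from a Nash
   inequality, Davies' exponentially weighted [L^2] estimate, and a localized form of
   the former that costs a power of [1 + d ^ 2 / t] only.

   _Geometry._ The solid angle bound at the vertices, together with the lower bound
   [l0] on the edge lengths, forces a maximal cell to contain every vertex closer than
   [l0], and hence to fill a fixed proportion of small balls at each of its vertices
   ([vertex_fat]). Every point of a cell is carried from a vertex by a contraction with
   controlled factor, so cells are uniformly fat at all of their points ([cell_fat]):
   a cell occupies at least [c * r ^+ n] of the ball of radius [r <= l0] around any of
   its points. The functional inequalities below are proved cell by cell and summed.

   _Nash inequality._ Averaging
   [u(x)^2 + u(y)^2 <= 2 |u(x)| |u(y)| + (u(x) - u(y))^2] over the pairs in a cell at
   distance at most [s] bounds [c * s ^+ n] times the squared [L^2] norm by the squared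
   [L^1] norm plus [s ^+ (n + 2)] times the energy ([near_pairs], [pre_nash]). Along an
   orbit of the heat semigroup the [L^1] norm does not increase ([mass_approx]), so
   this is a differential inequality for the squared norm ([nash_step]), which
   integrates over geometrically shrinking times and scales to
   [|P_t f|_2 <= C t ^ (- n / 4) |f|_1] for [t <= R0 ^ 2] ([nash]).

   _Semigroup._ The semigroup is only given through its generator, so its elementary
   properties are derived for abstract semidefinite forms: closability of the energy
   is a consequence of the generator being single valued ([closable]), local bounds
   come from a gliding hump ([P_near0]), and every decay statement is an instance of
   one differential inequality for a convex functional along orbits ([evolve]):
   contraction, symmetry, Davies' estimate
   [|w P_t f|_2 <= e ^ (xi ^ 2 t) |w f|_2] for [w = e ^ (xi psi)] with [psi] a bounded
   1-Lipschitz function ([davies]), and [L^1] contraction. The test functions needed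
   there are Lipschitz images of approximants of the orbit ([heat_test]).

   _Off-diagonal bound._ If [xi ^ 2 s <= 1], Davies' estimate and ultracontractivity on
   the times [4 ^- k * s] with rates [2 ^+ k * xi] show that
   [|e ^ (xi psi) P_s f|_2 <= C s ^ (- n / 4) e ^ (xi rho) |f|_1] when [f] lives where
   [psi <= rho] ([weighted_excess], [weighted]). Writing
   [<P_t f, g> = <P_(t - 2 s) P_s f, P_s g>] with [psi = min (d (x, .), d (x, y))],
   [xi = d (x, y) / (2 t)] and [s = min (t, R0 ^ 2) / (2 (1 + d ^ 2 / t))], the choice
   being the largest time compatible with [xi ^ 2 s <= 1], gives the Gaussian factor
   [e ^ (- d ^ 2 / 4 t)] exactly and the polynomial factor with exponent [n / 2]
   ([off_diagonal], [kernel_bound]). Continuity of the kernel turns this into a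
   pointwise bound, and [n <= N] because small balls inside a cell are Euclidean
   ([doubling_dim]). The factor [M * sphere_measure n] is a positive constant
   ([degree_pos], [vertex_fat]). *)

(** * Euclidean space *)

Section euclid.
Context {R : realType} {k : nat}.
Implicit Types (u v w : 'rV[R]_k).

Lemma dotC u v : dot u v = dot v u.
Proof. by apply: eq_bigr => j _; rewrite mulrC. Qed.

Lemma dotDl u v w : dot (u + v) w = dot u w + dot v w.
Proof. by rewrite -big_split; apply: eq_bigr => j _; rewrite mxE mulrDl. Qed.

Lemma dotZl a u v : dot (a *: u) v = a * dot u v.
Proof. by rewrite /dot mulr_sumr; apply: eq_bigr => j _; rewrite mxE mulrA. Qed.

Lemma dotDr u v w : dot w (u + v) = dot w u + dot w v.
Proof. by rewrite dotC dotDl !(dotC w). Qed.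

Lemma dotZr a u v : dot v (a *: u) = a * dot v u.
Proof. by rewrite dotC dotZl dotC. Qed.

Lemma dotNl u v : dot (- u) v = - dot u v.
Proof. by rewrite -scaleN1r dotZl mulN1r. Qed.

Lemma dotNr u v : dot u (- v) = - dot u v.
Proof. by rewrite dotC dotNl dotC. Qed.

Lemma dotBr u v w : dot w (u - v) = dot w u - dot w v.
Proof. by rewrite dotDr dotNr. Qed.

Lemma dot0l u : dot 0 u = 0.
Proof. by apply: big1 => j _; rewrite mxE mul0r. Qed.

Lemma dot0r u : dot u 0 = 0.
Proof. by rewrite dotC dot0l. Qed.

Lemma dot_ge0 u : 0 <= dot u u.
Proof. by apply: sumr_ge0 => j _; rewrite -expr2 sqr_ge0. Qed.

Lemma dot_eq0 u : dot u u = 0 -> u = 0.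
Proof.
move=> /eqP; rewrite psumr_eq0 => [/allP u0|j _]; last by rewrite -expr2 sqr_ge0.
apply/rowP => j; rewrite mxE; apply/eqP.
by have := u0 j (mem_index_enum _); rewrite mulf_eq0 orbb.
Qed.

Lemma dot_delta u j : dot u (delta_mx 0 j) = u 0 j.
Proof.
rewrite /dot (bigD1 j)//= mxE !eqxx mulr1 big1 ?addr0// => i ij.
by rewrite mxE (negbTE ij) andbF mulr0.
Qed.

Lemma sqr_enorm u : enorm u ^+ 2 = dot u u.
Proof. by rewrite sqr_sqrtr// dot_ge0. Qed.

Lemma enorm_ge0 u : 0 <= enorm u.
Proof. exact: sqrtr_ge0. Qed.

Lemma enorm0 : enorm (0 : 'rV[R]_k) = 0.
Proof. by rewrite /enorm dot0l sqrtr0. Qed.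

Lemma enorm_eq0 u : enorm u = 0 -> u = 0.
Proof. by move=> u0; apply: dot_eq0; rewrite -sqr_enorm u0 expr0n. Qed.

Lemma dot_le_enorm u v : `|dot u v| <= enorm u * enorm v.
Proof.
rewrite -sqrtrM ?dot_ge0// -sqrtr_sqr ler_wsqrtr//.
have [/dot_eq0 ->|v0] := eqVneq (dot v v) 0; first by rewrite !dot0r expr0n mulr0.
have vv : 0 < dot v v by rewrite lt_neqAle eq_sym v0 dot_ge0.
rewrite -(ler_pM2l vv).
have := dot_ge0 (dot v v *: u - dot u v *: v).
rewrite dotDl dotNl !dotBr !dotZl !dotZr (dotC v u); nra.
Qed.

Lemma enormD u v : enorm (u + v) <= enorm u + enorm v.
Proof.
rewrite -(@ler_pXn2r _ 2)// ?nnegrE ?addr_ge0 ?enorm_ge0//.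
rewrite sqr_enorm dotDl !dotDr sqrrD !sqr_enorm (dotC v u).
have := dot_le_enorm u v; have := ler_norm (dot u v); lra.
Qed.

Lemma enormZ a u : enorm (a *: u) = `|a| * enorm u.
Proof. by rewrite /enorm dotZl dotZr mulrA -expr2 sqrtrM ?sqr_ge0// sqrtr_sqr. Qed.

Lemma enormN u : enorm (- u) = enorm u.
Proof. by rewrite -scaleN1r enormZ normrN1 mul1r. Qed.

Lemma enormC u v : enorm (u - v) = enorm (v - u).
Proof. by rewrite -enormN opprB. Qed.

Lemma enorm_triangle w u v : enorm (u - v) <= enorm (u - w) + enorm (w - v).
Proof. by rewrite -[u - v](subrKA w) enormD. Qed.

Lemma enorm_delta j : enorm (delta_mx 0 j : 'rV[R]_k) = 1.
Proof. by rewrite /enorm dot_delta mxE !eqxx sqrtr1. Qed.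

Lemma coord_le_enorm u j : `|u 0 j| <= enorm u.
Proof.
rewrite -dot_delta; apply: (le_trans (dot_le_enorm _ _)).
by rewrite enorm_delta mulr1.
Qed.

Lemma norm_le_enorm u : `|u| <= enorm u.
Proof.
rewrite /Num.norm/= mx_normrE; apply: bigmax_le; first exact: enorm_ge0.
by move=> [i j] _ /=; rewrite (ord1 i) coord_le_enorm.
Qed.

Lemma coord_le_norm u j : `|u 0 j| <= `|u|.
Proof.
rewrite [leRHS]/Num.norm/= mx_normrE.
exact: (le_bigmax _ (fun ij : 'I_1 * 'I_k => `|u ij.1 ij.2|) (ord0, j)).
Qed.

Lemma enorm_le_norm u : enorm u <= k%:R * `|u|.
Proof.
rewrite -[leRHS]ger0_norm ?mulr_ge0// -sqrtr_sqr ler_wsqrtr//.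
apply: (@le_trans _ _ (\sum_(j < k) `|u| ^+ 2)).
  apply: ler_sum => j _; rewrite -expr2 -[leLHS]ger0_norm ?sqr_ge0// normrX.
  by rewrite ler_pXn2r ?nnegrE// coord_le_norm.
rewrite sumr_const card_ord exprMn -[leLHS]mulr_natl ler_wpM2r ?sqr_ge0//.
by rewrite -natrX ler_nat; case: k => // m; rewrite expnS expn1 leq_pmulr.
Qed.

(* The topology is the one of the sup norm. *)
Lemma nbhs_enormP u (A : set 'rV[R]_k) :
  nbhs u A <-> exists2 r, 0 < r & forall v, enorm (v - u) < r -> A v.
Proof.
split=> [/nbhs_ballP[r /= r0 rA]|[r r0 rA]].
  exists r => // v uv; apply: rA; rewrite -ball_normE/= -normrN opprB.
  exact: le_lt_trans (norm_le_enorm _) uv.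
apply/nbhs_ballP; exists (r / k.+1%:R) => /=; first by rewrite divr_gt0.
move=> v; rewrite -ball_normE/= => uv; apply: rA.
apply: le_lt_trans (enorm_le_norm _) _.
rewrite -normrN opprB; apply: (@le_lt_trans _ _ (k.+1%:R * `|u - v|)).
  by rewrite ler_wpM2r// ler_nat.
by rewrite mulrC -ltr_pdivlMr.
Qed.

Lemma continuous_enormP (f : 'rV[R]_k -> R) u :
  (exists2 L, 0 <= L & forall v, `|f v - f u| <= L * enorm (v - u)) ->
  {for u, continuous f}.
Proof.
move=> [L L0 fL]; apply/(@cvgrPdist_lt _ _ _ (nbhs u) _) => e e0; apply/nbhs_enormP.
exists (e / (L + 1)); first by rewrite divr_gt0// ltr_wpDl.
move=> v; rewrite ltr_pdivlMr ?ltr_wpDl// => ve; rewrite distrC.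
apply: (le_lt_trans (fL v)); apply: le_lt_trans ve.
by rewrite mulrC ler_wpM2l ?enorm_ge0// lerDl.
Qed.

Lemma dot_continuous u : continuous (dot u).
Proof.
move=> v; apply: continuous_enormP; exists (enorm u); first exact: enorm_ge0.
by move=> w; rewrite -dotBr dot_le_enorm.
Qed.

Lemma enorm_distB u v w : `|enorm (v - u) - enorm (w - u)| <= enorm (v - w).
Proof.
rewrite ler_norml; have := enorm_triangle v w u; have := enorm_triangle w v u.
by rewrite (enormC w v) => *; apply/andP; split; lra.
Qed.

Lemma enormB_continuous u : continuous (fun v : 'rV[R]_k => enorm (v - u)).
Proof.
move=> v; apply: continuous_enormP; exists 1 => // w.
by rewrite mul1r enorm_distB.
Qed.

Lemma open_ltc (f : 'rV[R]_k -> R) c : continuous f -> open [set x | f x < c].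
Proof.
by move=> cf; rewrite (_ : mkset _ = f @^-1` [set y | y < c])//;
  apply: open_comp => [x _|]; [exact: cf|exact: open_lt].
Qed.

Lemma closed_lec (f : 'rV[R]_k -> R) c : continuous f -> closed [set x | f x <= c].
Proof.
by move=> cf; rewrite (_ : mkset _ = f @^-1` [set y | y <= c])//;
  apply: closed_comp => [x _|]; [exact: cf|exact: closed_le].
Qed.

End euclid.

(** * Convex geometry of a polytope *)

Section polytope.
Context {R : realType} {k : nat}.
Variable P : @polytope R k.
Implicit Types (x y z u v : 'rV[R]_k).

Lemma body_convex x y t : body P x -> body P y -> 0 <= t <= 1 ->
  body P (x + t *: (y - x)).
Proof.
have [m [a [b PE]]] := body_halfspaces P.
rewrite PE => /= Px Py /andP[t0 t1] i.
rewrite dotDr dotZr dotBr.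
have := Px i; have := Py i; set p := dot _ x; set q := dot _ y; nra.
Qed.

Lemma body_closed : closed (body P).
Proof.
have [m [a [b PE]]] := body_halfspaces P.
rewrite PE (_ : mkset _ = \bigcap_(i in setT) [set x | dot (a i) x <= b i]).
  by apply: closed_bigI => i _; apply: closed_lec; exact: dot_continuous.
by apply/seteqP; split=> x /= h i; [move=> _|]; exact: h.
Qed.

Lemma body_compact : compact (body P).
Proof.
apply: bounded_closed_compact; last exact: body_closed.
have [r Pr] := body_bounded P.
exists r; split; first exact: num_real.
move=> M rM x Px; apply: le_trans (norm_le_enorm _) _.
exact: le_trans (Pr _ Px) (ltW rM).
Qed.

Lemma interior_enormP (A : set 'rV[R]_k) x :
  A° x <-> exists2 r, 0 < r & forall v, enorm (v - x) < r -> A v.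
Proof. exact: nbhs_enormP. Qed.

Lemma interior_segment x p t : body P x -> (body P)° p -> 0 < t <= 1 ->
  (body P)° (x + t *: (p - x)).
Proof.
move=> Px /interior_enormP[r r0 rP] /andP[t0 t1]; apply/interior_enormP.
exists (t * r) => [|v vr]; first exact: mulr_gt0.
have -> : v = x + t *: ((p + t^-1 *: (v - (x + t *: (p - x)))) - x).
  rewrite [p + _ - x]addrAC scalerDr scalerA divff ?gt_eqF// scale1r.
  by rewrite addrA addrC subrK.
apply: body_convex => //; last by rewrite ltW.
apply: rP; rewrite addrC addKr enormZ gtr0_norm ?invr_gt0//.
by rewrite mulrC ltr_pdivrMr// mulrC.
Qed.

Lemma closure_interior x e : body P x -> 0 < e ->
  exists2 p, (body P)° p & enorm (p - x) < e.
Proof.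
move=> Px e0; have [p Pp] := body_full P.
pose t := Num.min 1 (e / (enorm (p - x) + 1)).
have q0 : 0 < enorm (p - x) + 1 by rewrite ltr_wpDl// enorm_ge0.
have t0 : 0 < t by rewrite lt_min ltr01 divr_gt0.
exists (x + t *: (p - x)).
  by apply: interior_segment => //; rewrite t0 ge_min lexx.
rewrite addrC addKr enormZ gtr0_norm//.
apply: (@le_lt_trans _ _ (e / (enorm (p - x) + 1) * enorm (p - x))).
  by rewrite ler_wpM2r ?enorm_ge0// ge_min lexx orbT.
by rewrite -mulrA gtr_pMr// mulrC ltr_pdivrMr// mul1r ltrDl.
Qed.

Lemma boundary_active m (a : 'I_m -> 'rV[R]_k) b x :
  body P = [set x | forall i, dot (a i) x <= b i] ->
  body P x -> ~ (body P)° x -> exists2 i, a i != 0 & dot (a i) x = b i.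
Proof.
move=> PE Px; apply: contra_notP => noi.
rewrite PE; have {}Px : forall i, dot (a i) x <= b i by move: Px; rewrite PE.
have ai i : nbhs x [set y | dot (a i) y <= b i].
  have [ai0|ai0] := eqVneq (a i) 0.
    apply: filterS filterT => y _ /=; rewrite ai0 dot0l.
    by have := Px i; rewrite ai0 dot0l.
  have xi : dot (a i) x < b i.
    rewrite lt_neqAle Px andbT; apply/eqP => e; apply: noi; by exists i.
  apply: (@filterS _ _ _ [set y | dot (a i) y < b i]) => [y /ltW//|].
  apply: open_nbhs_nbhs; split => //; apply: open_ltc; exact: dot_continuous.
rewrite /interior; near=> y => i; move: i; near: y.
exact: filter_forall.
Unshelve. all: by end_near. Qed.

Lemma face_interior F x : face P F -> F x -> (body P)° x -> F = body P.
Proof.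
move=> [->//|[c ->]] [Px cx] /interior_enormP[r r0 rP].
suff -> : c = 0.
  by apply/seteqP; split=> y /= => [[]//|Py]; split=> // z _; rewrite !dot0l.
have [//|c0] := eqVneq c 0.
have c1 : 0 < enorm c.
  by rewrite lt_neqAle enorm_ge0 andbT eq_sym; apply: contra_neq c0 => /enorm_eq0.
have : dot c (x + (r / 2 / enorm c) *: c) <= dot c x.
  apply/cx/rP; rewrite addrC addKr enormZ gtr0_norm ?divr_gt0//.
  by rewrite divfK ?gt_eqF//; lra.
rewrite dotDr dotZr -sqr_enorm gerDl leNgt => /negP[].
by rewrite mulr_gt0 ?exprn_gt0// divr_gt0// divr_gt0.
Qed.

Lemma face_closed F : face P F -> closed F.
Proof.
move=> [->|[c ->]]; first exact: closed0.
rewrite (_ : mkset _ = body P `&`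
    \bigcap_(y in body P) [set x | (- dot c x) <= - dot c y]).
  apply: closedI; first exact: body_closed.
  apply: closed_bigI => y _; apply: closed_lec.
  by move=> x; apply: continuousN; exact: dot_continuous.
apply/seteqP; split=> x /= [Px cx]; split=> // y Py; first by rewrite /= lerN2 cx.
by have /= := cx _ Py; rewrite lerN2.
Qed.

Lemma face_sub F : face P F -> F `<=` body P.
Proof. by move=> [->//|[c ->]] x []. Qed.

Lemma affdim_ge_body m : (m <= k)%N -> affdim_ge (body P) m.
Proof.
move=> mk; have [p Pp] := body_full P.
have /interior_enormP[r r0 rP] := Pp.
exists p, ((r / 2) *: pid_mx m); split; first exact: interior_subset.
  rewrite /row_free mxrank_scale_nz ?rank_pid_mx//.
  by rewrite gt_eqF// divr_gt0.
move=> i; apply: rP; rewrite addrC addKr linearZ/= enormZ gtr0_norm ?divr_gt0//.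
suff -> : row i (pid_mx m : 'M[R]_(m, k)) = delta_mx 0 (widen_ord mk i).
  by rewrite enorm_delta; lra.
by apply/rowP => j; rewrite !mxE ltn_ord andbT -val_eqE/= eq_sym.
Qed.

Lemma affdim_le (F : set 'rV[R]_k) m : affdim_ge F m -> (m <= k)%N.
Proof. by move=> [x [v [_ /eqP rv _]]]; rewrite -rv rank_leq_col. Qed.

Lemma affdim_ex (F : set 'rV[R]_k) : F !=set0 -> exists m, affdim F m.
Proof.
move=> [x Fx].
have ex0 : exists m, `[< affdim_ge F m >].
  exists 0%N; apply/asboolP; exists x, 0; split=> // [|[]//].
  by rewrite /row_free mxrank0.
have exk m : `[< affdim_ge F m >] -> (m <= k)%N by move/asboolP/affdim_le.
case: (ex_maxnP ex0 exk) => m /asboolP Fm mmax; exists m; split=> // Fm1.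
by have /asboolT/mmax := Fm1; rewrite ltnn.
Qed.

Lemma affdim_body m : affdim (body P) m -> m = k.
Proof.
move=> [/affdim_le mk nm]; apply/eqP; rewrite eqn_leq mk leqNgt.
by apply/negP => km; apply: nm; exact: affdim_ge_body.
Qed.

(* Points of the boundary lie in faces of smaller dimension. *)
Lemma boundary_face x : body P x -> ~ (body P)° x ->
  exists F m, [/\ face P F, affdim F m, (m < k)%N & F x].
Proof.
move=> Px nPx; have [m [a [b PE]]] := body_halfspaces P.
have [i ai0 aib] := boundary_active PE Px nPx.
pose F := [set x | body P x /\ forall y, body P y -> dot (a i) y <= dot (a i) x].
have Fx : F x by split=> // y; rewrite PE aib => /(_ i).
have [d Fd] := affdim_ex (ex_intro _ x Fx).
exists F, d; split=> //; first by right; exists (a i).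
rewrite ltnNge; apply/negP => kd.
have [[y [v [[Py yF] v_free vF]]] _] := Fd.
have := affdim_le Fd.1 => dk; have {kd dk} dk : d = k by lia.
have v0 : v *m (a i)^T = 0.
  apply/matrixP => l c; rewrite (ord1 c) !mxE.
  have [Pyv yvF] := vF l.
  have e : dot (a i) (y + row l v) = dot (a i) y.
    by apply/eqP; rewrite eq_le yF//= yvF.
  move: e; rewrite dotDr => /eqP; rewrite -subr_eq0 addrC addKr => /eqP e.
  by rewrite -[RHS]e /dot; apply: eq_bigr => q _; rewrite !mxE mulrC.
case/eqP: ai0; apply: trmx_inj; rewrite trmx0.
move: v v_free v0 {vF}; rewrite dk => v v_free v0.
have vu : v \in unitmx by rewrite -row_free_unit.
by rewrite -(mulKmx vu (a i)^T) v0 mulmx0.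
Qed.

(* The normals of the constraints active at [x]. *)
Definition active_mx m (a : 'I_m -> 'rV[R]_k) (b : 'I_m -> R) x : 'M[R]_(m, k) :=
  \matrix_i (if dot (a i) x == b i then a i else 0).

Section halfspaces.
Variables (m : nat) (a : 'I_m -> 'rV[R]_k) (b : 'I_m -> R).
Hypothesis PE : body P = [set x | forall i, dot (a i) x <= b i].
Let N := active_mx a b.
Let r x := \rank (N x).

Lemma active_mxP x u :
  N x *m u^T = 0 <-> forall i, dot (a i) x = b i -> dot (a i) u = 0.
Proof.
have NE i : (N x *m u^T) i 0 = if dot (a i) x == b i then dot (a i) u else 0.
  rewrite mxE /dot; case: ifPn => ai; first by apply: eq_bigr => j _; rewrite !mxE ai.
  by apply: big1 => j _; rewrite !mxE (negbTE ai) mxE mul0r.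
split=> [N0 i /eqP ai|au]; first by have := NE i; rewrite N0 ai mxE.
apply/matrixP => i c; rewrite (ord1 c) NE mxE.
by case: ifPn => // /eqP; exact: au.
Qed.

Lemma active_kernel x : (r x < k)%N ->
  exists2 u, u != 0 & forall i, dot (a i) x = b i -> dot (a i) u = 0.
Proof.
move=> rk; have : kermx (N x)^T != 0.
  by rewrite -mxrank_eq0 mxrank_ker mxrank_tr -lt0n subn_gt0.
case/rowV0Pn => u /sub_kermxP u0 nz; exists u => //; apply/active_mxP.
by apply: trmx_inj; rewrite trmx_mul trmxK u0 trmx0.
Qed.

Lemma active_full x y : (k <= r x)%N -> (forall i, dot (a i) x = b i ->
  dot (a i) y = b i) -> x = y.
Proof.
move=> rk xy; have /active_mxP : forall i, dot (a i) x = b i -> dot (a i) (y - x) = 0.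
  by move=> i ai; rewrite dotBr xy// ai subrr.
move=> /(congr1 trmx); rewrite trmx_mul trmxK trmx0 => e.
have : row_free (N x)^T.
  by rewrite /row_free mxrank_tr eqn_leq rank_leq_col.
move/row_freeP => [B NB]; apply/eqP; rewrite eq_sym -subr_eq0; apply/eqP.
by rewrite -[_ - _]mulmx1 -NB mulmxA e mul0mx.
Qed.

(* Leaving the polytope along [u]. *)
Lemma exit_point x u : body P x -> u != 0 ->
  exists (t : R) j, [/\ 0 <= t, body P (x + t *: u), 0 < dot (a j) u &
    dot (a j) (x + t *: u) = b j].
Proof.
move=> Px u0; have [e Pe] := body_bounded P.
have aE i t : dot (a i) (x + t *: u) = dot (a i) x + t * dot (a i) u.
  by rewrite dotDr dotZr.
have xb i : dot (a i) x <= b i by move: Px; rewrite PE; exact.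
have eu : 0 < enorm u.
  by rewrite lt_neqAle enorm_ge0 andbT eq_sym; apply: contra_neq u0 => /enorm_eq0.
have [j aj] : exists j, 0 < dot (a j) u.
  apply: contrapT => /forallNP noj.
  pose t := (e + enorm x + 1) / enorm u.
  have e0 : 0 <= e by apply: le_trans (Pe _ Px); exact: enorm_ge0.
  have t0 : 0 <= t by rewrite divr_ge0// ?addr_ge0// enorm_ge0.
  have : body P (x + t *: u).
    rewrite PE => /= i; rewrite aE; have /negP := noj i; rewrite -leNgt => ui.
    by have := xb i; nra.
  move/Pe; have := enorm_triangle (x + t *: u) (t *: u) 0.
  rewrite !subr0 opprD addrCA subrr addr0 enormN enormZ ger0_norm//.
  rewrite {1}/t divfK ?gt_eqF//; lra.
case: (@Order.TotalTheory.arg_minP _ _ _ j (fun i => 0 < dot (a i) u)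
  (fun i => (b i - dot (a i) x) / dot (a i) u) aj) => l al lmin.
exists ((b l - dot (a l) x) / dot (a l) u), l; split=> //.
- by rewrite divr_ge0 ?subr_ge0// ltW.
- rewrite PE => /= i; rewrite aE.
  have [ui|ui] := ltP 0 (dot (a i) u).
    by have := lmin i ui; rewrite ler_pdivlMr// lerBrDl.
  have : 0 <= (b l - dot (a l) x) / dot (a l) u by rewrite divr_ge0 ?subr_ge0// ltW.
  by have := xb i; nra.
- by rewrite aE divfK ?gt_eqF// addrC subrK.
Qed.

Lemma exit_rank x u t j : (forall i, dot (a i) x = b i -> dot (a i) u = 0) ->
  0 < dot (a j) u -> dot (a j) (x + t *: u) = b j ->
  (r x < r (x + t *: u))%N.
Proof.
move=> xu aj ajb; set y := x + _.
have xy i : dot (a i) x = b i -> dot (a i) y = b i.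
  by move=> ai; rewrite dotDr dotZr xu// mulr0 addr0.
have sub : (N x <= N y)%MS.
  apply/row_subP => i; rewrite rowK; case: ifPn => [/eqP ai|_]; last exact: sub0mx.
  have -> : a i = row i (N y) by rewrite rowK xy// eqxx.
  exact: row_sub.
have Nx : N x *m u^T = 0 by apply/active_mxP.
apply: rank_ltmx; rewrite ltmxE sub; apply/negP => /submxP[D NyE].
have /active_mxP : N y *m u^T = 0 by rewrite NyE -mulmxA Nx mulmx0.
by move=> /(_ j ajb) e; rewrite e ltxx in aj.
Qed.

(* A point that is no vertex is the midpoint of a point with more active
   constraints and another point of the polytope. *)
Lemma active_descent x : body P x -> (r x < k)%N ->
  exists y z, [/\ body P y, body P z, (r x < r y)%N & x = 2^-1 *: (y + z)].
Proof.
move=> Px rk; have [u u0 xu] := active_kernel rk.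
have nu0 : - u != 0 by rewrite oppr_eq0.
have xnu i : dot (a i) x = b i -> dot (a i) (- u) = 0.
  by move=> ai; rewrite dotNr xu// oppr0.
have [t [i [t0 Pt ai abi]]] := exit_point Px u0.
have [s [j [s0 Ps aj abj]]] := exit_point Px nu0.
have mid w : x = 2^-1 *: ((x + w) + (x - w)).
  rewrite addrACA subrr addr0 -[x in x + x]scale1r -scalerDl scalerA.
  by rewrite mulVf// ?scale1r.
have rev (p q : R) : p <= q -> 0 <= p -> 0 <= p / q <= 1 /\ p / q * q = p.
  move=> pq p0; have [q0|q0] := eqVneq q 0.
    by rewrite q0 invr0 !mulr0 lexx ler01; split=> //; lra.
  have {}q0 : 0 < q by rewrite lt_neqAle eq_sym q0 (le_trans p0).
  by rewrite divr_ge0 ?(ltW q0)// ler_pdivrMr// mul1r pq divfK// gt_eqF.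
have [ts|/ltW st] := leP t s.
- exists (x + t *: u), (x - t *: u); split=> //; last exact: exit_rank abi.
  have [ts1 tsE] := rev _ _ ts t0.
  have := body_convex Px Ps ts1.
  by rewrite [x + _ - x]addrAC subrr add0r scalerA tsE scalerN.
- exists (x + s *: - u), (x - s *: - u); split=> //; last exact: exit_rank abj.
  have [st1 stE] := rev _ _ st s0.
  have := body_convex Px Pt st1.
  by rewrite [x + _ - x]addrAC subrr add0r scalerA stE scalerN opprK.
Qed.

Definition minimal_face x := [set y | body P y /\
  forall i, dot (a i) x = b i -> dot (a i) y = b i].

Lemma minimal_faceP x : body P x -> face P (minimal_face x).
Proof.
move=> Px; right; pose c := \sum_(i | dot (a i) x == b i) a i.
have cE y : dot c y = \sum_(i | dot (a i) x == b i) dot (a i) y.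
  by rewrite dotC /c; elim/big_rec2: _ => [|i p q _ <-]; rewrite ?dot0r// dotDr dotC.
have PbE y : body P y -> forall i, dot (a i) y <= b i by rewrite PE.
have cx : dot c x = \sum_(i | dot (a i) x == b i) b i.
  by rewrite cE; apply: eq_bigr => i /eqP.
exists c; apply/seteqP; split=> y /= [Py yF]; split=> //.
  move=> z Pz; rewrite !cE; apply: ler_sum => i /eqP ai.
  by rewrite (yF i ai) PbE.
move=> i ai; have := yF x Px; rewrite cx cE => h.
have /eqP : \sum_(i | dot (a i) x == b i) (b i - dot (a i) y) == 0.
  rewrite sumrB subr_eq0 eq_le h/=; apply: ler_sum => l _; exact: PbE.
move/eqP; rewrite psumr_eq0 => [/allP/(_ i (mem_index_enum _))|l _]; last first.
  by rewrite subr_ge0 PbE.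
by rewrite ai eqxx/= subr_eq0 => /eqP.
Qed.

Lemma minimal_face_vertex x : body P x -> (k <= r x)%N -> minimal_face x = [set x].
Proof.
move=> Px rk; apply/seteqP; split=> y /= => [[_ yF]|->]; last by split.
by rewrite (active_full rk yF).
Qed.

End halfspaces.

Definition vertex v := body P v /\ face P [set v].

Lemma affdim_set1 v : affdim [set v] 0.
Proof.
split; first by exists v, 0; split=> // [|[]//]; rewrite /row_free mxrank0.
move=> [x [w [/= -> w_free wF]]].
have w0 : w = 0.
  by apply/row_matrixP => i; rewrite (ord1 i); apply: (addrI v); rewrite wF row0 addr0.
by move: w_free; rewrite w0 /row_free mxrank0.
Qed.

(* Going down to a vertex, each of the at most [k] steps halves the weight. *)
Lemma vertex_descent x : body P x ->
  exists v z, [/\ vertex v, body P z & x = z + (2 ^- k) *: (v - z)].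
Proof.
move=> Px; have [m [a [b PE]]] := body_halfspaces P.
have vtx y : body P y -> (k <= \rank (active_mx a b y))%N -> vertex y.
  move=> Py ry; split=> //; rewrite -(minimal_face_vertex Py ry).
  exact: minimal_faceP.
suff /(_ k x Px) : forall d y, body P y -> (k - \rank (active_mx a b y) <= d)%N ->
    exists v z, [/\ vertex v, body P z & y = z + (2 ^- d) *: (v - z)].
  by apply; exact: leq_subr.
elim=> [|d IH] y Py.
  rewrite leqn0 subn_eq0 => ry; exists y, y.
  by split=> //; [exact: vtx|rewrite subrr scaler0 addr0].
have [ry _|ry hd] := leqP k (\rank (active_mx a b y)).
  by exists y, y; split=> //; [exact: vtx|rewrite subrr scaler0 addr0].
have [y' [z' [Py' Pz' ryy' yE]]] := active_descent PE Py ry.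
have [|v [z [Vv Pz y'E]]] := IH y' Py'.
  by move: hd ryy' ry; lia.
have l0 : 0 < (2 ^- d : R) by rewrite invr_gt0 exprn_gt0.
have l1 : (2 ^- d : R) <= 1 by rewrite invf_le1 ?exprn_gt0// exprn_ege1// ler1n.
move: y'E l0 l1; rewrite exprS invfM; set l := 2 ^- d => y'E l0 l1.
pose s := (1 - l) / (2 - l).
have l2 : 2 - l != 0 by rewrite gt_eqF//; lra.
exists v, (z' + s *: (z - z')); split=> //.
  apply: body_convex => //; apply/andP; split; first by rewrite divr_ge0//; lra.
  by rewrite ler_pdivrMr; lra.
rewrite yE y'E; apply/rowP => i; rewrite !mxE /s; field.
by rewrite l2.
Qed.

(** Among the non-vertices take one, [x], with the most active constraints.
   Every way of leaving the polytope from [x] inside its minimal face ends in a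
   vertex; as there are finitely many vertices, that face has dimension one. *)
Lemma edge_at_vertex : (0 < k)%N ->
  exists E v, [/\ face P E, affdim E 1, vertex v & E v].
Proof.
move=> k0; have [m [a [b PE]]] := body_halfspaces P.
pose r x := \rank (active_mx a b x).
pose Q q := `[< exists x, [/\ body P x, r x = q & (q < k)%N] >].
have exQ : exists q, Q q.
  have [p Pp] := body_full P; exists (r p); apply/asboolP; exists p.
  have bp := interior_subset Pp; split=> //; rewrite ltnNge; apply/negP => rp.
  have pE := minimal_face_vertex bp rp.
  have := minimal_faceP PE bp; rewrite pE => /face_interior/(_ erefl Pp) e.
  have := affdim_set1 p; rewrite e => -[_]; apply; exact: affdim_ge_body.
have Qk q : Q q -> (q <= k)%N by move/asboolP => [x [_ _ /ltnW]].
case: (ex_maxnP exQ Qk) => q /asboolP[x [Px rx qk]] qmax {exQ Qk}.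
have rmax y : body P y -> (q < r y)%N -> (k <= r y)%N.
  move=> Py qr; rewrite leqNgt; apply/negP => rk.
  have /qmax : Q (r y) by apply/asboolP; exists y.
  by rewrite leqNgt qr.
have vtx y : body P y -> (q < r y)%N -> vertex y.
  move=> Py /(rmax _ Py) ry; split=> //; rewrite -(minimal_face_vertex Py ry).
  exact: minimal_faceP.
have leave u : u != 0 -> (forall i, dot (a i) x = b i -> dot (a i) u = 0) ->
    exists t : R, [/\ 0 < t, body P (x + t *: u) & (q < r (x + t *: u)%R)%N].
  move=> u0 xu; have [t [j [t0 Pt aj abj]]] := exit_point PE Px u0.
  have qr : (q < r (x + t *: u)%R)%N by rewrite -rx; exact: exit_rank abj.
  exists t; split=> //; rewrite lt_neqAle t0 andbT eq_sym; apply/eqP => t00.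
  by move: qr; rewrite t00 scale0r addr0 rx ltnn.
have [u u0 xu] : exists2 u, u != 0 & forall i, dot (a i) x = b i -> dot (a i) u = 0.
  by apply: (active_kernel (x := x)); rewrite -/(r x) rx.
have [t [t0 Pt rt]] := leave u u0 xu.
exists (minimal_face a b x), (x + t *: u); split; last 2 first.
- exact: vtx.
- by split=> // i ai; rewrite dotDr dotZr xu// mulr0 addr0.
- exact: minimal_faceP.
split.
  exists x, (t *: u); split; first by split.
    by rewrite /row_free rank_rV scaler_eq0 negb_or (gt_eqF t0) u0.
  move=> i; rewrite row_id; split=> // l al.
  by rewrite dotDr dotZr xu// mulr0 addr0.
move=> [w [v [[Pw wF] v_free vF]]].
have vx l i : dot (a i) x = b i -> dot (a i) (row l v) = 0.
  move=> ai; have [_ /(_ i ai)] := vF l.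
  by rewrite dotDr wF// => /eqP; rewrite -subr_eq0 addrC addKr => /eqP.
pose c (s : R) : 'rV[R]_2 := \row_l (if l == 0 then 1 else s).
have cvE s : c s *m v = row 0 v + s *: row 1 v.
  apply/rowP => j; rewrite !mxE big_ord_recl big_ord1 !mxE/= mul1r.
  by congr (_ + _ * v _ j); exact: val_inj.
have cv0 s : c s *m v != 0.
  apply/eqP => e; have : c s = 0 by apply: (row_free_inj v_free); rewrite e mul0mx.
  by move/rowP/(_ 0); rewrite !mxE/= => /eqP; rewrite oner_eq0.
have cvx s i : dot (a i) x = b i -> dot (a i) (c s *m v) = 0.
  by move=> ai; rewrite cvE dotDr dotZr !vx// mulr0 addr0.
have /choice[T TP] : forall s : nat, exists t : R, [/\ 0 < t,
    body P (x + t *: (c s%:R *m v)) & (q < r (x + t *: (c s%:R *m v))%R)%N].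
  by move=> s; apply: leave; [exact: cv0|exact: cvx].
pose y s := x + T s *: (c s%:R *m v).
have y_inj : injective y.
  move=> s s' /addrI; rewrite !scalemxAl => /(row_free_inj v_free) e.
  have [Ts _ _] := TP s; have := congr1 (fun M : 'rV_2 => M 0 1) e.
  have := congr1 (fun M : 'rV_2 => M 0 0) e; rewrite !mxE/= !mulr1 => ->.
  have [Ts' _ _] := TP s'; move/(mulfI (lt0r_neq0 Ts')) => /eqP.
  by rewrite eqr_nat => /eqP.
pose act (s : 'I_(2 ^ m).+1) := [set i : 'I_m | dot (a i) (y s) == b i]%SET.
have act_inj : injective act.
  move=> s s' e; apply: val_inj; apply: y_inj.
  have [_ Py qy] := TP s; apply: (active_full (a := a) (b := b)); first exact: rmax.
  move=> i ai; apply/eqP.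
  have : i \in act s' by rewrite -e inE; exact/eqP.
  by rewrite inE.
have := leq_card _ act_inj.
by rewrite -[#|{set _}|]cardsT -powersetT card_powerset cardsT !card_ord ltnn.
Qed.

End polytope.

(** * Lipschitz functions of one variable *)

Section cumulative_lipschitz.
Context {R : realType}.
Variables (g : R -> R) (K : R).
Hypothesis K0 : 0 < K.
Hypothesis g_nd : {homo g : x y / x <= y}.
Hypothesis g_lip : forall x y, x <= y -> g y - g x <= K * (y - x).

Let g_cont : continuous g.
Proof.
move=> x; apply/(@cvgrPdist_le _ _ _ (nbhs x) _) => e e0.
apply/nbhs_ballP; exists (e / K) => /=; first by rewrite divr_gt0.
move=> y; rewrite /ball/= => xy.
have ky : K * `|x - y| <= e by rewrite mulrC -ler_pdivlMr// ltW.
apply: le_trans ky; have [le_xy|/ltW yx] := leP x y.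
  by rewrite distrC [`|x - y|]distrC !ger0_norm ?subr_ge0 ?g_nd ?g_lip.
by rewrite !ger0_norm ?subr_ge0 ?g_nd ?g_lip.
Qed.

HB.instance Definition _ := isCumulative.Build R _ R g g_nd (right_continuousW g_cont).

Let h x := K * x - g x.

Let h_nd : {homo h : x y / x <= y}.
Proof. by move=> x y xy; have := g_lip xy; rewrite /h; lra. Qed.

Let h_cont : continuous h.
Proof.
move=> x; apply: cvgB; last exact: g_cont.
by apply: cvgM; [exact: cvg_cst|exact: cvg_id].
Qed.

HB.instance Definition _ := isCumulative.Build R _ R h h_nd (right_continuousW h_cont).

Let nu := lebesgue_stieltjes_measure g.
Let nu' := lebesgue_stieltjes_measure h.

Lemma stieltjes_ocitv (f : cumulative R R) (a b : R) : a <= b ->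
  lebesgue_stieltjes_measure f `]a, b] = (f b - f a)%:E.
Proof.
move=> ab; rewrite /lebesgue_stieltjes_measure/= /measure_extension/= measurable_mu_extE/=;
  last exact: is_ocitv.
by rewrite wlength_itv_bnd.
Qed.

Let nu_dominated : nu `<< @lebesgue_measure R.
Proof.
pose k := NngNum (ltW (divr_gt0 ltr01 K0)).
pose m := mscale k (measure_add nu nu').
have mE A : m A = ((1 / K)%:E * (nu A + nu' A))%E by rewrite -measure_addE.
have lebE A : measurable A -> lebesgue_measure A = m A.
  apply: lebesgue_measure_unique => X [[a b] _ <-]/=.
  have [ab|ab] := leP a b; last by rewrite set_itv_ge ?measure0// bnd_simp -leNgt ltW.
  transitivity (m `]a, b]%classic); last by [].
  rewrite mE lebesgue_measure_itv/= lte_fin.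
  rewrite /nu /nu' !stieltjes_ocitv// -EFinD -EFinM.
  have [_|ba] := ltP a b.
    congr EFin; rewrite /= /h; field; rewrite gt_eqF//.
  have -> : b = a by apply/eqP; rewrite eq_le ba ab.
  by rewrite !subrr addr0 mulr0.
apply/null_content_dominatesP => A mA A0.
have := lebE A mA; rewrite [m A]mE A0 => /esym/eqP; rewrite mule_eq0 => /orP[|].
  by rewrite eqe gt_eqF// divr_gt0.
rewrite padde_eq0 ?measure_ge0// => /andP[/eqP //].
Qed.

Section window.
Variable c : R.
Hypothesis c0 : 0 < c.
Let D : set (measurableTypeR R) := `]-c, c]%classic.
Let mD : measurable D. Proof. exact: measurable_itv. Qed.
Let nuD := mrestr nu mD.

Let nuD_fin : fin_num_fun nuD.
Proof.
move=> A mA; rewrite ge0_fin_numE ?measure_ge0//.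
apply: (@le_lt_trans _ _ (nu D)); rewrite /nuD /mrestr.
  by apply: le_measure; rewrite ?inE//; exact: measurableI.
rewrite /nu stieltjes_ocitv ?ltry//.
by apply: le_trans (ltW c0); rewrite oppr_le0 ltW.
Qed.

HB.instance Definition _ := Measure.on nuD.
HB.instance Definition _ := @Measure_isFinite.Build _ _ _ nuD nuD_fin.

Lemma nondecreasing_lipschitz_ae_derivable_window :
  {ae (@lebesgue_measure R), forall x, -c < x < c -> derivable g x 1}.
Proof.
have nuD_dom : nuD `<< @lebesgue_measure R.
  apply/null_content_dominatesP => A mA A0; rewrite /nuD /mrestr.
  have /null_content_dominatesP/(_ A mA A0) := nu_dominated.
  move=> nuA; apply/eqP; rewrite eq_le measure_ge0 andbT -nuA.
  by apply: le_measure; rewrite ?inE//; exact: measurableI.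
have [rho [rho0 rho_fin rho_int nuE]] := radon_nikodym_sigma_finite nuD_dom.
pose r x := fine (rho x).
have rE : EFin \o r = rho by apply/funext => x /=; rewrite fineK.
have r_int A : measurable A -> (@lebesgue_measure R).-integrable A (EFin \o r).
  by move=> mA; rewrite rE; apply: integrableS rho_int.
have r_loc : locally_integrable [set: R] r.
  by apply: open_integrable_locally => //; [exact: openT|exact: r_int].
have := @FTC1 R r (BRight (-c)) (fun y => r_int _ (measurable_itv _)) r_loc.
apply: filterS; first exact: (ae_filter_ringOfSetsType (@lebesgue_measure R)).
move=> x Fx /andP[cx xc].
have {Fx}[dF _] := Fx cx.
set F := (fun x => _) in dF.
have gF y : -c < y < c -> F y + g (- c) = g y.
  move=> /andP[cy yc]; rewrite /F.
  have nuDE : nuD `]-c, y]%classic = (g y - g (- c))%:E.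
    rewrite /nuD /mrestr setIidl; first by rewrite /nu stieltjes_ocitv// ltW.
    move=> z /=; rewrite in_itv/= => /andP[cz zy].
    by rewrite /D/= in_itv/= cz (le_trans zy)// ltW.
  pose A := `]-c, y]%classic.
  have e : nuD A = (\int[lebesgue_measure]_(x in A) rho x)%E.
    exact: nuE (measurable_itv _).
  rewrite /Rintegral (_ : (fun x => (r x)%:E) = rho)// -/A -e nuDE/=.
  by rewrite subrK.
apply: (@near_eq_derivable _ _ _ (F + cst (g (- c)))).
- near=> y; apply: gF; apply/andP; split; near: y.
  + exact: lt_nbhsr.
  + exact: lt_nbhsl.
- by apply: derivableD.
Unshelve. all: by end_near. Qed.

End window.

Lemma nondecreasing_lipschitz_ae_derivable :
  {ae (@lebesgue_measure R), forall x, derivable g x 1}.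
Proof.
have h1 (n : nat) := nondecreasing_lipschitz_ae_derivable_window (ltr0Sn R n).
have F := ae_filter_ringOfSetsType (@lebesgue_measure R).
have := ae_foralln h1; apply: filterS => x hx; apply: (hx (Num.truncn `|x|)).
rewrite -ltr_norml.
by have := truncnS_gt `|x|.
Qed.

End cumulative_lipschitz.

(** Adding a linear function makes a Lipschitz function nondecreasing; its
   Stieltjes measure is then dominated by Lebesgue measure, and the
   differentiation theorem applies to the density. *)
Lemma lipschitz_ae_derivable {R : realType} (f : R -> R) (L : R) :
  (forall x y, `|f x - f y| <= L * `|x - y|) ->
  {ae (@lebesgue_measure R), forall x, derivable f x 1}.
Proof.
move=> fL; pose K := Num.max L 0 + 1.
have LK : L <= K.
  have : L <= Num.max L 0 by rewrite le_max lexx.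
  by rewrite /K; lra.
pose g x := f x + K * x.
have K0 : 0 < K by rewrite ltr_wpDl// le_max lexx orbT.
have fK x y : x <= y -> `|f y - f x| <= K * (y - x).
  move=> xy; apply: le_trans (fL _ _) _; rewrite ger0_norm ?subr_ge0//.
  by rewrite ler_wpM2r// subr_ge0.
have g_nd : {homo g : x y / x <= y}.
  by move=> x y xy; have := fK x y xy; rewrite ler_norml /g => /andP[? ?]; lra.
have g_lip x y : x <= y -> g y - g x <= (K + K) * (y - x).
  by move=> xy; have := fK x y xy; rewrite ler_norml /g => /andP[? ?]; lra.
have := nondecreasing_lipschitz_ae_derivable (addr_gt0 K0 K0) g_nd g_lip.
apply: filterS; first exact: (ae_filter_ringOfSetsType (@lebesgue_measure R)).
move=> x dg; rewrite (_ : f = g - ( *%R K)); last first.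
  by apply/funext => y; rewrite /g !fctE addrK.
by apply: derivableB => //; exact: derivableM.
Qed.

(** * Lebesgue measure in several variables *)

(** The image of a measure, with the measurability proof as an argument. *)
Definition push d1 d2 (T1 : measurableType d1) (T2 : measurableType d2)
    (R : realType) (m : {measure set T1 -> \bar R}) (f : T1 -> T2)
    (mf : measurable_fun setT f) : set T2 -> \bar R :=
  pushforward m f.

Section push.
Context d1 d2 (T1 : measurableType d1) (T2 : measurableType d2) (R : realType).
Variables (m : {measure set T1 -> \bar R}) (f : T1 -> T2).
Hypothesis mf : measurable_fun setT f.

Let push0 : push m mf set0 = 0%E.
Proof. by rewrite /push /pushforward preimage_set0 measure0. Qed.

Let push_ge0 A : (0 <= push m mf A)%E.
Proof. exact: measure_ge0. Qed.

Let push_sigma_additive : semi_sigma_additive (push m mf).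
Proof. exact: (@measure_semi_sigma_additive _ _ _ (pushforward m f)). Qed.

HB.instance Definition _ := isMeasure.Build _ _ _ (push m mf)
  push0 push_ge0 push_sigma_additive.

Lemma measurable_preimage A : measurable A -> measurable (f @^-1` A).
Proof. by move=> mA; rewrite -[X in measurable X]setTI; exact: mf. Qed.

End push.

Section affine.
Context {R : realType}.

Definition affine1 (c a : R) : measurableTypeR R -> measurableTypeR R :=
  fun x => c * x + a.

Lemma measurable_affine1 c a : measurable_fun setT (affine1 c a).
Proof. by apply: measurable_funD => //; exact: measurable_funM. Qed.

Lemma lebesgue_affine1 c a (A : set (measurableTypeR R)) : 0 < c -> measurable A ->
  lebesgue_measure (affine1 c a @^-1` A) = (c^-1%:E * lebesgue_measure A)%E.
Proof.
move=> c0 mA; pose k := NngNum (ltW c0).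
pose m := mscale k (push (@lebesgue_measure R) (measurable_affine1 c a)).
suff -> : lebesgue_measure A = m A.
  by rewrite /m /mscale/= muleA -EFinM mulVf ?gt_eqF// mul1e.
apply: lebesgue_measure_unique => // X [[u v] _ <-]/=.
transitivity (m `]u, v]%classic); last by [].
rewrite /m /mscale/= /push /pushforward.
have -> : affine1 c a @^-1` `]u, v] = `](u - a) / c, (v - a) / c]%classic.
  apply/seteqP; split => x /=; rewrite !in_itv/= /affine1;
    by rewrite ltr_pdivrMr// ler_pdivlMr// ltrBlDr lerBrDr mulrC.
rewrite !lebesgue_measure_itv/= !lte_fin.
rewrite ltr_pM2r ?invr_gt0// ltrD2r; case: ifP => _; last by rewrite mule0.
by rewrite -!EFinD -EFinM; congr EFin; field; rewrite gt_eqF.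
Qed.

Definition affine k (c : R) (a : 'rV[R]_k) (t : Rk R k) : Rk R k :=
  [tuple c * tnth t j + a 0 j | j < k].

Lemma vec_affine k c (a : 'rV[R]_k) t : vec (affine c a t) = c *: vec t + a.
Proof. by apply/rowP => j; rewrite !mxE tnth_mktuple. Qed.

Definition unvec k (u : 'rV[R]_k) : Rk R k := [tuple u 0 j | j < k].

Lemma unvecK k : cancel (@unvec k) (@vec R k).
Proof. by move=> u; apply/rowP => j; rewrite mxE tnth_mktuple. Qed.

Lemma vecK k : cancel (@vec R k) (@unvec k).
Proof. by move=> t; apply: eq_from_tnth => j; rewrite tnth_mktuple mxE. Qed.

Lemma measurable_affine k c (a : 'rV[R]_k) : measurable_fun setT (affine c a).
Proof.
apply/measurable_fun_tnthP => j.
rewrite (_ : _ \o _ = (fun t : Rk R k => c * tnth t j + a 0 j)); last first.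
  by apply/funext => t /=; rewrite tnth_mktuple.
apply: measurable_funD => //; apply: measurable_funM => //; exact: measurable_tnth.
Qed.

Lemma affine_cons k c (a : 'rV[R]_k.+1) (x : measurableTypeR R) (t : Rk R k) :
  affine c a (consT (x, t)) =
  consT (affine1 c (a 0 ord0) x, affine c (\row_j a 0 (lift ord0 j)) t).
Proof.
apply: eq_from_tnth => j; rewrite tnth_mktuple.
case: (unliftP ord0 j) => [i|] ->; last by rewrite !tnth0.
by rewrite !tnthS tnth_mktuple mxE.
Qed.

Lemma leb_affine k c (a : 'rV[R]_k) (A : set (Rk R k)) : 0 < c -> measurable A ->
  leb k (affine c a @^-1` A) = ((c ^- k)%:E * leb k A)%E.
Proof.
move=> c0; elim: k a A => [|k IH] a A mA.
  rewrite expr0 invr1 mul1e; congr (leb 0 _); apply/seteqP; split=> t /=;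
  by rewrite (tuple0 t) (tuple0 (affine _ _ _)).
pose a' := \row_j a 0 (lift ord0 j).
pose phi (p : measurableTypeR R * Rk R k) := (affine1 c (a 0 ord0) p.1, affine c a' p.2).
have mphi : measurable_fun setT phi.
  apply/measurable_fun_pairP; split.
    by apply: (measurableT_comp (measurable_affine1 _ _)); exact: measurable_fst.
  by apply: (measurableT_comp (measurable_affine _ _)); exact: measurable_snd.
have cj : 0 <= c ^+ k.+1 by rewrite exprn_ge0// ltW.
pose m := mscale (NngNum cj) (push ((@lebesgue_measure R) \x (leb k))%E mphi).
have mE B : measurable B -> ((@lebesgue_measure R) \x (leb k))%E B = m B.
  apply: product_measure_unique => U V mU mV.
  transitivity (m (U `*` V)); first by [].
  rewrite /m /mscale/= /push /pushforward.
  rewrite (_ : _ @^-1` _ = (affine1 c (a 0 ord0) @^-1` U) `*` (affine c a' @^-1` V))//.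
  rewrite product_measure1E.
  - transitivity ((c ^+ k.+1)%:E * ((c^-1%:E * lebesgue_measure U) *
      ((c ^- k)%:E * leb k V)))%E; [congr (_ * (_ * _))%E|].
    + exact: lebesgue_affine1.
    + exact: IH.
    + rewrite muleACA -!EFinM -invfM -exprS [LHS]muleA -EFinM.
      by rewrite divff ?expf_neq0 ?gt_eqF// mul1e.
  - exact: (measurable_preimage (@measurable_affine1 _ _)).
  - exact: (measurable_preimage (@measurable_affine _ _ _)).
have mcA : measurable (@consT R k @^-1` A).
  exact: (measurable_preimage (@measurable_consT R k)).
have legE B : leb k.+1 B = ((@lebesgue_measure R) \x (leb k))%E (@consT R k @^-1` B) by [].
rewrite !legE [in RHS]mE// /m /mscale/= /push /pushforward muleA -EFinM.
rewrite mulVf ?expf_neq0 ?gt_eqF// mul1e; congr (_ _).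
by apply/seteqP; split=> -[x t] /=; rewrite affine_cons.
Qed.

End affine.

Section sublevel.
Context d (T : measurableType d) (R : realType).
Implicit Types f g : T -> R.

Lemma measurable_ler f g : measurable_fun setT f -> measurable_fun setT g ->
  measurable [set x | f x <= g x].
Proof. by move=> mf mg; rewrite -[X in measurable X]setTI; exact: measurable_fun_le. Qed.

Lemma measurable_ltr f g : measurable_fun setT f -> measurable_fun setT g ->
  measurable [set x | f x < g x].
Proof.
move=> mf mg; rewrite (_ : mkset _ = ~` [set x | g x <= f x]); last first.
  by apply/seteqP; split=> x /=; rewrite ltNge => /negP.
by apply: measurableC; exact: measurable_ler.
Qed.

End sublevel.

Section lebesgue.
Context {R : realType} {k : nat}.
Implicit Types (U : set 'rV[R]_k) (A D : set (Rk R k)) (f : 'rV[R]_k -> R).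

Lemma measurable_coord (j : 'I_k) : measurable_fun setT (fun t : Rk R k => vec t 0 j).
Proof.
rewrite (_ : (fun _ => _) = (fun t : Rk R k => tnth t j)); last first.
  by apply/funext => t; rewrite mxE.
exact: measurable_tnth.
Qed.

Lemma measurable_open U : open U -> measurable (@vec R k @^-1` U).
Proof.
move=> oU.
pose box (qm : (k.-tuple rat * nat)%type) : set (Rk R k) :=
  \bigcap_(j in [set: 'I_k]) [set t | `|vec t 0 j - ratr (tnth qm.1 j)| < qm.2.+1%:R^-1].
pose F qm := if `[< box qm `<=` @vec R k @^-1` U >] then box qm else set0.
have mF qm : measurable (F qm).
  rewrite /F; case: ifPn => // _; apply: fin_bigcap_measurable => [|j _].
    exact: finite_finset.
  apply: measurable_ltr => //; apply: (measurableT_comp (@normr_measurable _ _)).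
  by apply: measurable_funB => //; exact: measurable_coord.
suff -> : @vec R k @^-1` U = \bigcup_qm F qm.
  by apply: countable_bigcupT_measurable => //; exact: countableP.
apply/seteqP; split => t /=; last first.
  by move=> [qm _]; rewrite /F; case: ifPn => // /asboolP; exact.
move=> Ut; have /nbhs_ballP[e /= e0 eU] : nbhs (vec t) U.
  by apply: open_nbhs_nbhs; split.
pose m := Num.truncn (2 / e).
have m0 : 0 < m.+1%:R^-1 :> R by rewrite invr_gt0.
have me : 2 * m.+1%:R^-1 < e.
  by rewrite ltr_pdivrMr// mulrC -ltr_pdivrMr// truncnS_gt.
have /choice[q qP] : forall j, exists q : rat, `|vec t 0 j - ratr q| < m.+1%:R^-1.
  move=> j; have [|q] := @rat_in_itvoo R (vec t 0 j - m.+1%:R^-1) (vec t 0 j).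
    by rewrite ltrBlDr ltrDl.
  rewrite in_itv/= => /andP[lq ql]; exists q.
  by rewrite ger0_norm ?subr_ge0 ?(ltW ql)// ltrBlDr -ltrBlDl.
pose qm := ([tuple q j | j < k], m).
have tqm : box qm t by move=> j _ /=; rewrite tnth_mktuple.
suff subU : box qm `<=` @vec R k @^-1` U by exists qm => //; rewrite /F asboolT.
move=> s /= sqm; apply: eU; rewrite -ball_normE/=.
apply: le_lt_trans me; rewrite [leLHS]/Num.norm/= mx_normrE.
apply: bigmax_le => [|[i j] _ /=]; first by rewrite mulr_ge0// ltW.
have := sqm j I; have := qP j; rewrite /= tnth_mktuple (ord1 i) !mxE => h1 h2.
rewrite (_ : _ + _ = (tnth t j - ratr (q j)) - (tnth s j - ratr (q j))); last by ring.
by apply: le_trans (ler_normB _ _) _; rewrite mulr_natl mulr2n lerD ?(ltW h1) ?(ltW h2).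
Qed.

Lemma measurable_closed U : closed U -> measurable (@vec R k @^-1` U).
Proof.
move=> cU; rewrite -[X in measurable X]setCK preimage_setC; apply: measurableC.
by apply: measurable_open; exact: closed_openC.
Qed.

Lemma measurable_continuous f : continuous f -> measurable_fun setT (f \o @vec R k).
Proof.
move=> cf; apply: (measurability _ (RGenOInfty.measurableE R)) => //.
move=> _ [_ [x ->] <-]; rewrite setTI comp_preimage; apply: measurable_open.
rewrite (_ : _ @^-1` _ = f @^-1` [set y | x < y]); last first.
  by apply/seteqP; split => y /=; rewrite in_itv/= andbT.
by apply: open_comp => [y _|]; [exact: cf|exact: open_gt].
Qed.

Definition eball (x : 'rV[R]_k) (r : R) : set (Rk R k) :=
  [set t | enorm (vec t - x) <= r].

Lemma measurable_eball x r : measurable (eball x r).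
Proof.
apply: measurable_ler => //.
apply: (measurable_continuous (f := fun v => enorm (v - x))).
exact: enormB_continuous.
Qed.

Lemma measurable_translate (a : 'rV[R]_k) A : measurable A ->
  measurable (affine 1 a @^-1` A).
Proof. exact: (measurable_preimage (@measurable_affine _ _ _ _)). Qed.

Lemma leb_translate (a : 'rV[R]_k) A : measurable A ->
  leb k (affine 1 a @^-1` A) = leb k A.
Proof. by move=> mA; rewrite leb_affine// expr1n invr1 mul1e. Qed.

Lemma integral_translate (a : 'rV[R]_k) D (g : Rk R k -> \bar R) :
  measurable D -> measurable_fun D g -> (forall t, 0 <= g t)%E ->
  (\int[leb k]_(t in affine 1 a @^-1` D) g (affine 1 a t) = \int[leb k]_(t in D) g t)%E.
Proof.
move=> mD mg g0.
rewrite -(@ge0_integral_pushforward _ _ _ _ _ _ (measurable_affine 1 a))//.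
apply: eq_measure_integral; first exact: measurable_affine.
by move=> *; exact: leb_translate.
Qed.

End lebesgue.

Lemma leb_box {R : realType} k (r : R) :
  (leb k [set t : Rk R k | forall j, (`|tnth t j| <= r)%R] < +oo)%E.
Proof.
have mbox m : measurable [set t : Rk R m | forall j, `|tnth t j| <= r].
  rewrite (_ : mkset _ =
      \bigcap_(j in [set: 'I_m]) [set t : Rk R m | `|tnth t j| <= r]); last first.
    by apply/seteqP; split => t /= h i; [move=> _|]; exact: h.
  apply: fin_bigcap_measurable => [|j _]; first exact: finite_finset.
  apply: measurable_ler => //; apply: (measurableT_comp (@normr_measurable _ _)).
  exact: measurable_tnth.
elim: k => [|k IH].
  by rewrite /= /dirac indicE ltry.
pose A := [set t : Rk R k.+1 | forall j, `|tnth t j| <= r].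
rewrite -/A (_ : leb k.+1 A = ((@lebesgue_measure R) \x (leb k))%E (@consT R k @^-1` A))//.
rewrite (_ : @consT R k @^-1` A =
    `[-r, r]%classic `*` [set t : Rk R k | forall j, `|tnth t j| <= r]); last first.
  apply/seteqP; split=> -[x t]; rewrite /A /=.
    move=> h; split => [|j].
      by have := h ord0; rewrite in_itv/= -ler_norml tnth0.
    by have := h (lift ord0 j); rewrite tnthS.
  move=> [+ h] j; rewrite in_itv/= -ler_norml => xr.
  by case: (unliftP ord0 j) => [i|] ->; rewrite ?tnthS// tnth0.
have rfin : (@lebesgue_measure R `[(- r)%R, r]%classic < +oo)%E.
  by rewrite lebesgue_measure_itv/=; case: ifP => // _; rewrite ltry.
rewrite product_measure1E//.
by apply: lte_mul_pinfty => //; rewrite ge0_fin_numE.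
exact: mbox.
Qed.

Section lebesgue_finite.
Context {R : realType} {k : nat}.
Implicit Types (A D : set (Rk R k)).

Lemma leb_bounded A x r : measurable A -> A `<=` eball x r -> (leb k A < +oo)%E.
Proof.
move=> mA Ar; apply: le_lt_trans (leb_box k (r + enorm x)).
apply: le_measure; rewrite ?inE//.
  rewrite (_ : mkset _ =
      \bigcap_(j in [set: 'I_k]) [set t : Rk R k | `|tnth t j| <= r + enorm x]).
    apply: fin_bigcap_measurable => [|j _]; first exact: finite_finset.
    apply: measurable_ler => //; apply: (measurableT_comp (@normr_measurable _ _)).
    exact: measurable_tnth.
  by apply/seteqP; split => t /= h i; [move=> _|]; exact: h.
move=> t /Ar /= tr j; rewrite (_ : tnth t j = vec t 0 j); last by rewrite mxE.
apply: le_trans (coord_le_enorm (vec t) j) _.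
rewrite -[vec t](subrK x); apply: le_trans (enormD _ _) _.
by rewrite lerD2r.
Qed.

Lemma leb_eball_lty (x : 'rV[R]_k) r : (leb k (eball x r) < +oo)%E.
Proof. exact: (leb_bounded (measurable_eball x r) (@subset_refl _ _)). Qed.

(** A bounded piece of a hyperplane has infinitely many disjoint translates in a
   bounded set. *)
Lemma leb_hyperplane A (c : 'rV[R]_k) b x r : measurable A -> c != 0 ->
  A `<=` eball x r -> (forall t, A t -> dot c (vec t) = b) -> leb k A = 0%E.
Proof.
move=> mA c0 Ar Ab.
pose s (m : nat) : R := m.+1%:R^-1.
have cc : 0 < dot c c.
  by rewrite lt_neqAle dot_ge0 andbT eq_sym; apply: contra_neq c0 => /dot_eq0.
pose F m := affine 1 (s m *: c) @^-1` A.
have mF m : measurable (F m) by exact: measurable_translate.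
have tF : trivIset setT F.
  apply/trivIsetP => i j _ _ ij; apply/seteqP; split=> // t [].
  rewrite /F /= => /Ab + /Ab; rewrite !vec_affine !scale1r !dotDr !dotZr => <- /addrI.
  move/(mulIf (lt0r_neq0 cc))/invr_inj => /eqP; rewrite eqr_nat eqSS => /eqP ji.
  by rewrite ji eqxx in ij.
have Fb m : F m `<=` eball x (r + enorm c).
  move=> t /Ar; rewrite /eball /= vec_affine scale1r => h.
  rewrite (_ : vec t - x = (vec t + s m *: c - x) - s m *: c); last first.
    by rewrite addrAC addrK.
  apply: le_trans (enormD _ _) _; rewrite enormN lerD// enormZ.
  rewrite ger0_norm; last by rewrite invr_ge0.
  by rewrite ler_piMl ?enorm_ge0// invf_le1// ler1n.
have sumF N : (\sum_(m < N) leb k (F m) <= leb k (eball x (r + enorm c)))%E.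
  rewrite -(@measure_bigsetU _ _ _ (leb k) F mF tF N).
  apply: le_measure; rewrite ?inE; [|exact: measurable_eball|].
    by apply: bigsetU_measurable => i _; exact: mF.
  by move=> t; rewrite -bigcup_mkord => -[m _]; exact: Fb.
have FE m : leb k (F m) = leb k A by exact: leb_translate.
have fA : leb k A \is a fin_num.
  by rewrite ge0_fin_numE// (leb_bounded mA Ar).
have fB : leb k (eball x (r + enorm c)) \is a fin_num.
  by rewrite ge0_fin_numE// leb_eball_lty.
apply/eqP; rewrite eq_le measure_ge0 andbT -(fineK fA) lee_fin leNgt.
apply/negP => A0; set a := fine _ in A0.
have := sumF (Num.truncn (fine (leb k (eball x (r + enorm c))) / a)).+1.
rewrite (eq_bigr (fun=> a%:E)) => [|m _]; last by rewrite FE fineK.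
rewrite sumEFin sumr_const card_ord -(fineK fB) lee_fin -mulr_natl.
by rewrite -ler_pdivlMr// leNgt truncnS_gt.
Qed.

(** If every line in the direction [v] meets [A] in a Lebesgue null set then [A]
   is null: average [leb (A - s v) = leb A] over [0 <= s <= 1] and exchange the
   integrals. *)
Lemma leb_lines A (v : 'rV[R]_k) : measurable A ->
  (forall t, (@lebesgue_measure R).-negligible [set s | A (affine 1 (s *: v) t)]) ->
  leb k A = 0%E.
Proof.
move=> mA A0.
pose phi (p : measurableTypeR R * Rk R k) : Rk R k := affine 1 (p.1 *: v) p.2.
have mphi : measurable_fun setT phi.
  apply/measurable_fun_tnthP => j.
  rewrite (_ : _ \o _ = (fun p : measurableTypeR R * Rk R k =>
      1 * tnth p.2 j + p.1 * v 0 j)); last first.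
    by apply/funext => p /=; rewrite tnth_mktuple mxE.
  apply: measurable_funD; apply: measurable_funM => //.
    by apply: (measurableT_comp (measurable_tnth j)); exact: measurable_snd.
pose B := (`[0%R, 1%R]%classic `*` [set: Rk R k]) `&` (phi @^-1` A).
have mB : measurable B.
  apply: measurableI; first by apply: measurableX => //; exact: measurable_itv.
  by rewrite -[X in measurable X]setTI; exact: mphi.
have := @indic_fubini_tonelli _ _ _ _ R (@lebesgue_measure R) (leb k) B mB.
rewrite indic_fubini_tonelli_FE// indic_fubini_tonelli_GE//.
rewrite [RHS]integral0_eq; last first.
  move=> t _ /=; apply/eqP; rewrite -measure_le0.
  have [N [mN N0 sN]] := A0 t; rewrite -N0; apply: le_measure; rewrite ?inE//.
    exact: measurable_ysection.
  move=> s; rewrite /ysection/= inE => -[_ /= As]; exact: sN.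
move=> e; rewrite -e.
transitivity (\int[lebesgue_measure]_(s in `[0%R, 1%R]) (leb k A))%E.
  have l01 : (@lebesgue_measure R `[0%R, 1%R]%classic = 1)%E.
    by rewrite lebesgue_measure_itv/= lte01 oppr0 adde0.
  by rewrite -[LHS]mule1 -l01; apply/esym/integral_cst; exact: measurable_itv.
rewrite integral_mkcond; apply: eq_integral => s _ /=.
rewrite patchE; case: ifPn => s01.
  rewrite -(leb_translate (s *: v) mA); congr (leb k _).
  apply/seteqP; split=> t /=; rewrite /xsection/= inE.
    by move=> ?; split => //; split => //=; rewrite inE in s01.
  by case.
apply/esym; rewrite (_ : xsection _ _ = set0) ?measure0//.
apply/seteqP; split=> t //=; rewrite /xsection/= inE => -[[/= + _] _].
by move=> s01'; move/negP: s01; apply; rewrite inE.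
Qed.

End lebesgue_finite.

(** * Lipschitz functions of several variables *)

Section measurable_quantifiers.
Context d (T : measurableType d) (I : countType).

Lemma measurable_exists (P : I -> T -> Prop) :
  (forall i, measurable [set t | P i t]) -> measurable [set t | exists i, P i t].
Proof.
move=> mP; rewrite (_ : mkset _ = \bigcup_i [set t | P i t]); last first.
  by apply/seteqP; split => t /= [i]; [exists i|move=> _ ?; exists i].
by apply: countable_bigcupT_measurable => //; exact: countableP.
Qed.

Lemma measurable_forall (P : I -> T -> Prop) :
  (forall i, measurable [set t | P i t]) -> measurable [set t | forall i, P i t].
Proof.
move=> mP; rewrite (_ : mkset _ = ~` [set t | exists i, ~ P i t]).
  apply: measurableC; apply: measurable_exists => i.
  by rewrite (_ : mkset _ = ~` [set t | P i t])//; exact: measurableC.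
by apply/seteqP; split => t /=; [move=> h [i]; apply|move/forallNP => h i; exact: contrapT].
Qed.

End measurable_quantifiers.

Lemma measurable_imply d (T : measurableType d) (b : bool) (P : T -> Prop) :
  measurable [set t | P t] -> measurable [set t | b -> P t].
Proof.
case: b => mP; last by rewrite (_ : mkset _ = setT)//; apply/seteqP; split.
by rewrite (_ : mkset _ = [set t | P t])//; apply/seteqP; split => t //=; exact.
Qed.

Lemma cvge0_lt {R : realType} (u : (\bar R)^nat) (e : R) : u @ \oo --> 0%E -> 0 < e ->
  \forall n \near \oo, (u n < e%:E)%E.
Proof.
move=> u0 e0; apply: (u0 [set y | (y < e%:E)%E]).
by apply: open_ereal_lt'; rewrite lte_fin.
Qed.

Section lipschitz.
Context {R : realType} {k : nat}.
Variables (F : 'rV[R]_k -> R) (L : R).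
Hypothesis L0 : 0 <= L.
Hypothesis FL : forall x y, `|F x - F y| <= L * enorm (x - y).
Implicit Types (v w x y : 'rV[R]_k).

Lemma lipschitz_continuous : continuous F.
Proof. by move=> x; apply: continuous_enormP; exists L. Qed.

(* The difference quotient, in the form used in the definition of ['D_v F x]. *)
Definition quot v x (h : R) : R := h^-1 * (F (h *: v + x) - F x).

Lemma quot_le v x h : `|quot v x h| <= L * enorm v.
Proof.
have [->|h0] := eqVneq h 0.
  by rewrite /quot invr0 mul0r normr0 mulr_ge0// enorm_ge0.
rewrite /quot normrM normfV ler_pdivrMl ?normr_gt0//.
by apply: le_trans (FL _ _) _; rewrite addrK enormZ mulrCA.
Qed.

Lemma measurable_lip (c : R) v :
  measurable_fun setT (fun t : Rk R k => F (c *: v + vec t)).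
Proof.
apply: (measurable_continuous (f := fun x => F (c *: v + x))) => x.
apply: continuous_enormP; exists L => // y.
by apply: le_trans (FL _ _) _; rewrite opprD addrACA subrr add0r.
Qed.

Lemma measurable_quot v h : measurable_fun setT (fun t : Rk R k => quot v (vec t) h).
Proof.
apply: measurable_funM => //; apply: measurable_funB; first exact: measurable_lip.
rewrite (_ : (fun _ => _) = fun t : Rk R k => F (0 *: v + vec t)).
  exact: measurable_lip.
by apply/funext => t; rewrite scale0r add0r.
Qed.

Lemma quot_continuous v x h : h != 0 -> {for h, continuous (quot v x)}.
Proof.
move=> h0; apply: cvgM; first exact: cvgV.
apply: cvgB; last exact: cvg_cst.
apply: (@cvg_comp _ _ _ (fun h => h *: v + x) F _ (nbhs (h *: v + x))).
  by apply: cvgD; [apply: cvgZr_tmp; exact: cvg_id|exact: cvg_cst].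
exact: lipschitz_continuous.
Qed.

(** Derivability restated through rational increments, which makes the set of
   points of derivability visibly measurable. *)
Lemma derivable_cauchyP v x : derivable F x v <->
  forall n : nat, exists m : nat, forall r s : rat,
    [&& (ratr r : R) != 0, `|ratr r : R| < m.+1%:R^-1, (ratr s : R) != 0
      & `|ratr s : R| < m.+1%:R^-1] ->
    `|quot v x (ratr r) - quot v x (ratr s)| <= n.+1%:R^-1.
Proof.
split=> [dF n|hC].
  have := dF : cvg (quot v x h @[h --> 0^']).
  move=> /cvg_cauchy/cauchyP/(_ (2^-1 * n.+1%:R^-1)); case.
    by rewrite mulr_gt0.
  move=> l; rewrite /nbhs/= /dnbhs /within/= => /nbhs_ballP[e /= e0 he].
  pose m := Num.truncn e^-1; exists m => r s /and4P[r0 rm s0 sm].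
  have me : m.+1%:R^-1 < e.
    by rewrite invf_plt ?posrE// truncnS_gt.
  have he' q : `|q| < e -> q != 0 -> `|l - quot v x q| < 2^-1 * n.+1%:R^-1.
    by move=> qe q0; apply: he => //; rewrite /ball/= sub0r normrN.
  have h1 := he' _ (lt_trans rm me) r0; have h2 := he' _ (lt_trans sm me) s0.
  rewrite -(subrKA l); apply: le_trans (ler_normD _ _) _.
  rewrite [`|_ - l|]distrC [leRHS](splitr n.+1%:R^-1) [_ / 2]mulrC.
  by rewrite lerD// ltW.
pose Q := quot v x.
have close (h e : R) : h != 0 -> 0 < e -> forall d : R, `|h| < d ->
    exists2 r : rat, (ratr r : R) != 0 /\ `|ratr r : R| < d & `|Q h - Q (ratr r)| < e.
  move=> h0 e0 d hd.
  have /cvgrPdist_lt/(_ e e0) Qh := @quot_continuous v x h h0.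
  have nh0 : nbhs h [set y | y != 0].
    by apply: open_nbhs_nbhs; split => //; exact: open_neq.
  have nhd : nbhs h [set y | `|y| < d].
    apply: open_nbhs_nbhs; split => //.
    apply: (@open_comp _ _ (@Num.norm R R) [set y | y < d]); last exact: open_lt.
    by move=> y _; exact: norm_continuous.
  pose A := [set y | y != 0] `&` [set y | `|y| < d] `&` [set y | `|Q h - Q y| < e].
  have hA : (interior A) h by apply: filterI => //; exact: filterI.
  have [|y [Ay [r _ ry]]] := @dense_rat R A° _ (open_interior A); first by exists h.
  have := interior_subset Ay; rewrite -ry => -[[r0 rd] Qr].
  by exists r.
rewrite /derivable; apply/cauchy_cvgP/cauchyP => e e0.
pose n := Num.truncn (2 / e); have [m hm] := hC n.
have ne : n.+1%:R^-1 < e / 2.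
  by rewrite -[e / 2]invrK ltf_pV2 ?posrE ?invr_gt0 ?divr_gt0// invf_div truncnS_gt.
have m0 : 0 < m.+1%:R^-1 :> R by rewrite invr_gt0.
pose h1 : R := m.+1%:R^-1 / 2.
have h10 : 0 < h1 by rewrite divr_gt0.
have [|r1 [r10 r1m] _] := close h1 e (lt0r_neq0 h10) e0 m.+1%:R^-1.
  by rewrite gtr0_norm// ltr_pdivrMr// mulr2n mulrDr mulr1 ltrDl.
exists (Q (ratr r1)); rewrite /nbhs/= /dnbhs /within/=.
apply/nbhs_ballP; exists m.+1%:R^-1 => //= y; rewrite /ball/= sub0r normrN => ym y0.
have e20 : 0 < e / 2 by rewrite divr_gt0.
have [r [r0 rm] Qr] := close y (e / 2) y0 e20 m.+1%:R^-1 ym.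
have := hm r1 r; rewrite r10 r1m r0 rm => /(_ isT) h2.
rewrite -[X in _ < X]/e (splitr e) -[Q _ - _](subrKA (Q (ratr r))).
apply: le_lt_trans (ler_normD _ _) _; rewrite ltrD ?(le_lt_trans h2)//.
by rewrite distrC.
Qed.

Definition derivable_set v : set (Rk R k) := [set t | derivable F (vec t) v].

Lemma measurable_derivable_set v : measurable (derivable_set v).
Proof.
rewrite /derivable_set (_ : mkset _ = [set t : Rk R k |
  forall n : nat, exists m : nat, forall r s : rat,
    [&& (ratr r : R) != 0, `|ratr r : R| < m.+1%:R^-1, (ratr s : R) != 0
      & `|ratr s : R| < m.+1%:R^-1] ->
    `|quot v (vec t) (ratr r) - quot v (vec t) (ratr s)| <= n.+1%:R^-1]); last first.
  by apply/seteqP; split => t /= /derivable_cauchyP.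
apply: measurable_forall => n; apply: measurable_exists => m.
apply: measurable_forall => r; apply: measurable_forall => s.
apply: measurable_imply; apply: measurable_ler => //.
apply: (measurableT_comp (@normr_measurable _ _)).
by apply: measurable_funB; exact: measurable_quot.
Qed.

(** Rademacher's theorem in a fixed direction: the restriction to each line in that
   direction is a Lipschitz function of one variable. *)
Lemma derivable_setC0 v : leb k (~` derivable_set v) = 0%E.
Proof.
apply: (@leb_lines _ _ _ v); 
  first by apply: measurableC; exact: measurable_derivable_set.
move=> t; pose phi (s : R) := F (s *: v + vec t).
have phiL (a b : R) : `|phi a - phi b| <= (L * enorm v) * `|a - b|.
  apply: le_trans (FL _ _) _.
  by rewrite opprD addrACA subrr addr0 -scalerBl enormZ [`|_| * _]mulrC mulrA.
apply: negligibleS (lipschitz_ae_derivable phiL) => s /=.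
apply: contra_not; rewrite /derivable_set /= vec_affine scale1r /derivable.
rewrite (_ : (fun h => h^-1 *: ((phi \o shift s) _ - _)) =
  (fun h : R => h^-1 *: ((F \o shift (vec t + s *: v)) (h *: v) - F (vec t + s *: v))))//.
apply/funext => h; rewrite /phi /= [h *: 1]mulr1 scalerDl.
by rewrite -addrA [s *: v + _]addrC.
Qed.

Lemma ae_derivable v : {ae leb k, forall t, derivable F (vec t) v}.
Proof.
exists (~` derivable_set v); split=> //; last exact: derivable_setC0.
by apply: measurableC; exact: measurable_derivable_set.
Qed.

Lemma derive_le v x : `|'D_v F x| <= L * enorm v.
Proof.
have [dF|ndF] := pselect (derivable F x v); last first.
  by rewrite /derive dvgP// normr0 mulr_ge0// enorm_ge0.
rewrite ler_norml; apply/andP; split.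
  by apply: limr_ge => //; apply: nearW => h;
    have := quot_le v x h; rewrite ler_norml => /andP[].
by apply: limr_le => //; apply: nearW => h;
  have := quot_le v x h; rewrite ler_norml => /andP[].
Qed.

Lemma quot_cvg v x (u : R^nat) : derivable F x v -> (forall n, u n != 0) ->
  u @ \oo --> 0 -> quot v x (u n) @[n --> \oo] --> 'D_v F x.
Proof.
move=> dF u0 uc; have /cvgr_dnbhsP := dF : quot v x h @[h --> 0^'] --> 'D_v F x.
by apply.
Qed.

Definition harm (n : nat) : R := n.+1%:R^-1.

Lemma harm_gt0 n : 0 < harm n. Proof. by rewrite invr_gt0. Qed.

Lemma harm_cvg : harm @ \oo --> 0.
Proof. exact: cvg_harmonic. Qed.

Lemma measurable_derive v : measurable_fun setT (fun t : Rk R k => 'D_v F (vec t)).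
Proof.
pose f n (t : Rk R k) := \1_(derivable_set v) t * quot v (vec t) (harm n).
apply: (@measurable_fun_cvg _ _ _ _ f) => [n|t _].
  by apply: measurable_funM; [by apply: measurable_indic; exact: measurable_derivable_set|
    exact: measurable_quot].
rewrite /f indicE; case: (boolP (t \in derivable_set v)) => [|].
  rewrite inE => dF; rewrite (_ : (fun _ => _) = (fun n => quot v (vec t) (harm n))).
    by apply: quot_cvg => // [n|]; [exact/lt0r_neq0/harm_gt0|exact: harm_cvg].
  by apply/funext => n; rewrite mul1r.
rewrite notin_setE => ndF; rewrite /derive dvgP//.
rewrite (_ : (fun _ => _) = cst 0); first exact: cvg_cst.
by apply/funext => n; rewrite mul0r.
Qed.

End lipschitz.

Lemma lte_sum6 {R : realDomainType} (x1 x2 x3 x4 x5 x6 : \bar R) (e : R) :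
  (x1 < e%:E -> x2 < e%:E -> x3 < e%:E -> x4 < e%:E -> x5 < e%:E -> x6 < e%:E ->
  x1 + (x2 + (x3 + (x4 + (x5 + x6)))) < (6 * e)%:E)%E.
Proof.
move=> h1 h2 h3 h4 h5 h6.
rewrite (_ : 6 * e = e + (e + (e + (e + (e + e))))); last by ring.
by rewrite !EFinD; do ?apply: lteD.
Qed.

Section gradient.
Context {R : realType} {k : nat}.
Variables (F : 'rV[R]_k -> R) (L : R).
Hypothesis L0 : 0 <= L.
Hypothesis FL : forall x y, `|F x - F y| <= L * enorm (x - y).
Implicit Types (v w x y a : 'rV[R]_k) (g : Rk R k -> R).

Let Q n v (t : Rk R k) := quot F v (vec t) (harm n).
Let D v (t : Rk R k) := 'D_v F (vec t).
Let N rho g := (\int[leb k]_(t in eball 0%R rho) (`|g t|)%:E)%E.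

Let mQ n v : measurable_fun setT (Q n v).
Proof. exact: measurable_quot L0 FL _ _. Qed.

Let mD v : measurable_fun setT (D v).
Proof. exact: measurable_derive L0 FL _. Qed.

Let mabs g : measurable_fun setT g -> measurable_fun setT (fun t => (`|g t|)%:E).
Proof.
by move=> mg; apply/measurable_EFinP; apply: (measurableT_comp (@normr_measurable _ _)).
Qed.

Let mshift a g : measurable_fun setT g -> measurable_fun setT (g \o affine 1 a).
Proof. by move=> mg; apply: (measurableT_comp mg); exact: measurable_affine. Qed.

Let N_triangle rho g g1 g2 : measurable_fun setT g -> measurable_fun setT g1 ->
  measurable_fun setT g2 -> (forall t, g t = g1 t + g2 t) ->
  (N rho g <= N rho g1 + N rho g2)%E.
Proof.
move=> mg mg1 mg2 gE; rewrite /N -ge0_integralD//; [|exact: measurable_eball|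
  by apply: measurable_funTS; exact: mabs|by apply: measurable_funTS; exact: mabs].
- apply: ge0_le_integral => //; first exact: measurable_eball.
  + by apply: measurable_funTS; exact: mabs.
  + by apply: measurable_funTS; apply: emeasurable_funD; exact: mabs.
  + by move=> t _; rewrite gE -EFinD lee_fin ler_normD.
Qed.

Let N_shift rho a g : measurable_fun setT g ->
  (N rho (g \o affine 1 a) <= N (rho + enorm a)%R g)%E.
Proof.
move=> mg.
have <- : (\int[leb k]_(t in affine 1 a @^-1` eball 0%R (rho + enorm a)%R)
    (`|g (affine 1 a t)|)%:E = N (rho + enorm a)%R g)%E.
  apply: (integral_translate a (g := fun t => (`|g t|)%:E)) => //.
    exact: measurable_eball.
  by apply: measurable_funTS; exact: mabs.
apply: ge0_subset_integral => //.
- exact: measurable_eball.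
- apply: measurable_translate; exact: measurable_eball.
- by apply: measurable_funTS; apply: mabs; exact: (mshift a mg).
move=> t /=; rewrite /eball /= !subr0 vec_affine scale1r => tr.
by apply: le_trans (enormD _ _) _; rewrite lerD2r.
Qed.

Let NS rho rho' g : rho <= rho' -> measurable_fun setT g -> (N rho g <= N rho' g)%E.
Proof.
move=> rr mg; apply: ge0_subset_integral => //; try exact: measurable_eball.
  by apply: measurable_funTS; exact: mabs.
by move=> t; rewrite /eball /= => /le_trans; exact.
Qed.

Let integrable_cst_eball rho (c : R) : (leb k).-integrable (eball 0%R rho) (cst c%:E).
Proof.
apply/integrableP; split; first exact: measurable_cst.
rewrite (eq_integral (cst (`|c|)%:E))//.
rewrite integral_cst; last exact: measurable_eball.
by apply: lte_mul_pinfty => //; exact: leb_eball_lty.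
Qed.

Let N_quot rho v : N rho (fun t => (Q n v t - D v t)%R) @[n --> \oo] --> 0%E.
Proof.
have := @dominated_convergence _ _ _ (leb k) (eball 0 rho) (measurable_eball _ _)
  (fun n t => (Q n v t)%:E) (fun t => (D v t)%:E) (cst (L * enorm v)%:E).
case=> //.
- by move=> n; apply: measurable_funTS; exact/measurable_EFinP.
- by apply: measurable_funTS; exact/measurable_EFinP.
- have AF : Filter (almost_everywhere (leb k : set (Rk R k) -> \bar R)) by exact: ae_filter_ringOfSetsType.
  have := ae_derivable L0 FL v; apply: filterS => t dF _.
  apply/fine_cvgP; split; first exact: nearW.
  by apply: (quot_cvg dF) => [n|]; [exact/lt0r_neq0/harm_gt0|exact: harm_cvg].
- by apply: aeW => t n _; rewrite lee_fin; exact: quot_le.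
Qed.

Let N_quot_shift rho m w a : (N rho (fun t => (Q m w (affine 1 a t) - Q m w t)%R) <=
  (2 * L * enorm a * m.+1%:R)%:E * leb k (eball 0%R rho))%E.
Proof.
rewrite -integral_cst; last exact: measurable_eball.
apply: ge0_le_integral => //; first exact: measurable_eball.
- apply: measurable_funTS; apply: mabs; apply: measurable_funB; last exact: mQ.
  exact: (mshift a (mQ m w)).
move=> t _ /=; rewrite lee_fin /Q /quot vec_affine scale1r /harm invrK -mulrBr.
rewrite normrM ger0_norm// mulrC ler_wpM2r//.
set x := vec t; set b := _ *: w.
have := FL (b + (x + a)) (b + x); have := FL (x + a) x.
rewrite opprD addrACA subrr add0r [x + a - x]addrAC subrr add0r => h1 h2.
rewrite [X in `|X|](_ : _ = (F (b + (x + a)) - F (b + x)) - (F (x + a) - F x)); last by ring.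
by apply: le_trans (ler_normB _ _) _; lra.
Qed.

Let N_derive_add rho v w e : 0 < e ->
  (N rho (fun t => (D (v + w)%R t - (D v t + D w t))%R) < (6 * e)%:E)%E.
Proof.
move=> e0; pose rho' := rho + enorm v.
have rr : rho <= rho' by rewrite lerDl enorm_ge0.
have mQD n u : measurable_fun setT (fun t => Q n u t - D u t).
  by apply: measurable_funB; [exact: mQ|exact: mD].
have [m _ /(_ m (leqnn m)) /= hm] := cvge0_lt (N_quot rho' w) e0.
have fB : leb k (eball 0 rho) \is a fin_num by rewrite ge0_fin_numE// leb_eball_lty.
pose B := fine (leb k (eball 0 rho)).
pose C := 2 * L * enorm v * m.+1%:R * B.
have C0 : 0 <= C by rewrite !mulr_ge0// ?enorm_ge0// fine_ge0.
have h4 : \forall n \near \oo, C * harm n < e.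
  have : C * harm n @[n --> \oo] --> C * 0.
    by apply: cvgM; [exact: cvg_cst|exact: harm_cvg].
  by rewrite mulr0 => /cvgr_lt; apply.
have [n [h1 [h2 [h3 hn]]]] := filter_ex (filterI (cvge0_lt (N_quot rho (v + w)) e0)
  (filterI (cvge0_lt (N_quot rho v) e0) (filterI (cvge0_lt (N_quot rho' w) e0) h4))).
pose a := harm n *: v.
have av : enorm a <= enorm v.
  rewrite enormZ gtr0_norm ?harm_gt0// ler_piMl ?enorm_ge0//.
  by rewrite /harm invf_le1// ler1n.
have ra : rho + enorm a <= rho' by rewrite lerD2l.
have QE t : Q n (v + w) t = Q n v t + Q n w (affine 1 a t).
  rewrite /Q /quot vec_affine scale1r -mulrDr; congr (_ * _).
  have -> : harm n *: (v + w) + vec t = harm n *: w + (vec t + a).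
    by rewrite scalerDr addrC addrA addrC.
  by rewrite [harm n *: v + _]addrC -/a [RHS]addrC subrKA.
pose g1 t := - (Q n (v + w)%R t - D (v + w)%R t).
pose g2 t := Q n v t - D v t.
pose g3 t := Q n w (affine 1 a t) - D w (affine 1 a t).
pose g4 t := - (Q m w (affine 1 a t) - D w (affine 1 a t)).
pose g5 t := Q m w (affine 1 a t) - Q m w t.
pose g6 t := Q m w t - D w t.
have m2 : measurable_fun setT g2 by exact: mQD.
have m1 : measurable_fun setT g1 by apply: measurableT_comp => //; exact: mQD.
have m3 : measurable_fun setT g3 := mshift a (mQD n w).
have m4 : measurable_fun setT g4.
  by apply: measurableT_comp => //; exact: (mshift a (mQD m w)).
have m6 : measurable_fun setT g6 by exact: mQD.
have m5 : measurable_fun setT g5.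
  by apply: measurable_funB; [exact: (mshift a (mQ m w))|exact: mQ].
have m56 : measurable_fun setT (g5 \+ g6) by exact: measurable_funD.
have m46 : measurable_fun setT (g4 \+ (g5 \+ g6)) by exact: measurable_funD.
have m36 : measurable_fun setT (g3 \+ (g4 \+ (g5 \+ g6))) by exact: measurable_funD.
have m26 : measurable_fun setT (g2 \+ (g3 \+ (g4 \+ (g5 \+ g6)))) by exact: measurable_funD.
have mX : measurable_fun setT (fun t => (D (v + w)%R t - (D v t + D w t))%R).
  by apply: measurable_funB => //; exact: measurable_funD.
have n1 : (N rho g1 < e%:E)%E.
  by apply: le_lt_trans h1; rewrite le_eqVlt; apply/orP; left; apply/eqP;
    apply: eq_integral => t _; rewrite normrN.
have n3 : (N rho g3 < e%:E)%E.
  apply: le_lt_trans h3; apply: (le_trans (N_shift rho a (mQD n w))); exact: NS.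
have n4 : (N rho g4 < e%:E)%E.
  apply: (@le_lt_trans _ _ (N rho ((fun t => (Q m w t - D w t)%R) \o affine 1 a))).
    by rewrite le_eqVlt; apply/orP; left; apply/eqP;
      apply: eq_integral => t _; rewrite normrN.
  apply: le_lt_trans hm; apply: (le_trans (N_shift rho a (mQD m w))); exact: NS.
have n6 : (N rho g6 < e%:E)%E by apply: le_lt_trans hm; exact: NS.
have n5 : (N rho g5 < e%:E)%E.
  apply: (le_lt_trans (N_quot_shift rho m w a)).
  rewrite -(fineK fB) -EFinM lte_fin; apply: le_lt_trans hn.
  rewrite /C /a enormZ gtr0_norm ?harm_gt0// -/B le_eqVlt; apply/orP; left.
  by apply/eqP; ring.
have chain : (N rho (fun t => (D (v + w)%R t - (D v t + D w t))%R) <=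
    N rho g1 + (N rho g2 + (N rho g3 + (N rho g4 + (N rho g5 + N rho g6)))))%E.
  apply: (le_trans (N_triangle rho mX m1 m26 _)).
    by move=> t; rewrite /g1 /g2 /g3 /g4 /g5 /g6 /= QE; ring.
  apply: leeD => //; apply: (le_trans (N_triangle rho m26 m2 m36 _)) => //.
  apply: leeD => //; apply: (le_trans (N_triangle rho m36 m3 m46 _)) => //.
  apply: leeD => //; apply: (le_trans (N_triangle rho m46 m4 m56 _)) => //.
  by apply: leeD => //; exact: (N_triangle rho m56 m5 m6).
apply: (le_lt_trans chain).
exact (lte_sum6 n1 h2 n3 n4 n5 n6).
Qed.

(** The difference quotients in the directions [v], [w] and [v + w] are related by a
   translation of size [h], which is continuous in [L^1]; this gives additivity
   almost everywhere without differentiability in the full sense. *)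
Lemma derive_add v w : {ae leb k, forall t, D (v + w) t = D v t + D w t}.
Proof.
have mX : measurable_fun setT (fun t => (D (v + w)%R t - (D v t + D w t))%R).
  by apply: measurable_funB => //; exact: measurable_funD.
have AF : Filter (almost_everywhere (leb k : set (Rk R k) -> \bar R)) by exact: ae_filter_ringOfSetsType.
have h (m : nat) : {ae leb k, forall t, eball 0 m%:R t -> D (v + w) t = D v t + D w t}.
  have N0 : (N m%:R (fun t => (D (v + w)%R t - (D v t + D w t))%R) = 0)%E.
    apply/eqP; rewrite eq_le; apply/andP; split; last first.
      by apply: integral_ge0 => t _; rewrite lee_fin.
    apply/lee_addgt0Pr => e e0; rewrite add0e.
    have e6 : 0 < e / 6 by rewrite divr_gt0.
    by have := N_derive_add m%:R v w e6; rewrite mulrCA divff// mulr1 => /ltW.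
  have mE : measurable_fun (eball 0 m%:R) (fun t => (D (v + w) t - (D v t + D w t))%:E).
    by apply: measurable_funTS; exact/measurable_EFinP.
  have := (ae_eq_integral_abs (leb k) (measurable_eball 0 m%:R) mE).1 N0.
  apply: filterS => t ht tm; apply/eqP; rewrite -subr_eq0; apply/eqP.
  by apply: EFin_inj; exact: ht tm.
have := ae_foralln h; apply: filterS => t ht.
apply: (ht (Num.truncn (enorm (vec t))).+1); rewrite /eball /= subr0.
exact/ltW/truncnS_gt.
Qed.

Definition grad (x : 'rV[R]_k) : 'rV[R]_k := \row_j 'D_(delta_mx 0 j) F x.

Lemma derive_scale (c : R) v : {ae leb k, forall t, D (c *: v) t = c * D v t}.
Proof.
have AF : Filter (almost_everywhere (leb k : set (Rk R k) -> \bar R)) by exact: ae_filter_ringOfSetsType.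
have [->|c0] := eqVneq c 0.
  by apply: aeW => t; rewrite mul0r /D scale0r derive0.
have h1 := ae_derivable L0 FL v; have h2 := ae_derivable L0 FL (c *: v).
apply: filterS2 h1 h2 => t d1 d2.
have hn n : (harm n : R) != 0 by exact/lt0r_neq0/harm_gt0.
have c2 := quot_cvg d2 hn (@harm_cvg R).
have c1 : quot F v (vec t) (c * harm n) @[n --> \oo] --> D v t.
  apply: (quot_cvg d1) => [n|]; first by rewrite mulf_neq0.
  by rewrite -(mulr0 c); apply: cvgM; [exact: cvg_cst|exact: harm_cvg].
have c3 : c * quot F v (vec t) (c * harm n) @[n --> \oo] --> c * D v t.
  by apply: cvgM => //; exact: cvg_cst.
have e n : quot F (c *: v) (vec t) (harm n) = c * quot F v (vec t) (c * harm n).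
  by rewrite /quot scalerA [harm n * c]mulrC invfM !mulrA divff// mul1r.
have c2' : c * quot F v (vec t) (c * harm n) @[n --> \oo] --> D (c *: v) t.
  by under eq_cvg => n do rewrite -e.
exact: (cvg_unique _ c2' c3).
Qed.

Lemma derive_linear v :
  {ae leb k, forall t, 'D_v F (vec t) = dot v (grad (vec t))}.
Proof.
have AF : Filter (almost_everywhere (leb k : set (Rk R k) -> \bar R)) by exact: ae_filter_ringOfSetsType.
have -> : v = \sum_j v 0 j *: delta_mx 0 j by exact: row_sum_delta.
suff h (s : seq 'I_k) : {ae leb k, forall t, D (\sum_(j <- s) v 0 j *: delta_mx 0 j) t =
    \sum_(j <- s) v 0 j * D (delta_mx 0 j) t}.
  have := h (index_enum 'I_k); apply: filterS => t.
  rewrite -row_sum_delta /D => ->; apply: eq_bigr => j _.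
  by rewrite /grad mxE.
elim: s => [|j s IH].
  by apply: aeW => t; rewrite !big_nil /D derive0.
have h1 := derive_add (v 0 j *: delta_mx 0 j) (\sum_(j <- s) v 0 j *: delta_mx 0 j).
have h2 := derive_scale (v 0 j) (delta_mx 0 j).
apply: filterS3 h1 h2 IH => t e1 e2 e3.
by rewrite !big_cons e1 e2 e3.
Qed.

(** The bound holds for countably many directions outside one null set, and the
   direction of the gradient is a limit of those. *)
Lemma grad_le : {ae leb k, forall t, enorm (grad (vec t)) <= L}.
Proof.
have AF : Filter (almost_everywhere (leb k : set (Rk R k) -> \bar R)) by exact: ae_filter_ringOfSetsType.
pose V (n : nat) : 'rV[R]_k := if @unpickle (k.-tuple rat) n is Some q
  then \row_j ratr (tnth q j) else 0.
have := ae_foralln (fun n => derive_linear (V n)); apply: filterS => t ht.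
set g := grad (vec t).
have dotV n : dot (V n) g <= L * enorm (V n).
  by rewrite -ht; apply: le_trans (ler_norm _) _; exact: derive_le.
have key e : 0 < e -> enorm g ^+ 2 <= L * enorm g + (L + enorm g) * e.
  move=> e0.
  have e1 : 0 < e / k.+1%:R by rewrite divr_gt0.
  have /choice[q qP] : forall j, exists q : rat, `|g 0 j - ratr q| <= e / k.+1%:R.
    move=> j; have [|q] := @rat_in_itvoo R (g 0 j - e / k.+1%:R) (g 0 j).
      by rewrite ltrBlDr ltrDl.
    rewrite in_itv/= => /andP[lq ql]; exists q.
    by rewrite ger0_norm ?subr_ge0 ?(ltW ql)// lerBlDr -lerBlDl ltW.
  pose n := pickle [tuple q j | j < k].
  have VE j : V n 0 j = ratr (q j) by rewrite /V /n pickleK mxE tnth_mktuple.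
  have gV : enorm (g - V n) <= e.
    apply: le_trans (enorm_le_norm _) _.
    apply: (@le_trans _ _ (k%:R * (e / k.+1%:R))).
      rewrite ler_wpM2l//; rewrite /Num.norm/= mx_normrE.
      apply: bigmax_le => [|[i j] _ /=]; first exact: ltW.
      rewrite (ord1 i) (_ : (g - V n) 0 j = g 0 j - V n 0 j); last by rewrite !mxE.
      by rewrite VE qP.
    by rewrite mulrCA ler_piMr ?(ltW e0)// ler_pdivrMr// mul1r ler_nat.
  rewrite sqr_enorm (_ : dot g g = dot (V n) g + dot (g - V n) g); last first.
    by rewrite -dotDl addrC subrK.
  have h1 := dotV n; have h2 := le_trans (ler_norm _) (dot_le_enorm (g - V n) g).
  have h3 : enorm (V n) <= enorm g + e.
    by have := enorm_triangle g (V n) 0; rewrite !subr0 (enormC (V n) g); lra.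
  have h4 := ler_wpM2l L0 h3; have h5 := ler_wpM2r (enorm_ge0 g) gV; lra.
rewrite leNgt; apply/negP => Lg.
have g0 : 0 < enorm g by exact: le_lt_trans Lg.
have Lg0 : 0 < L + enorm g by rewrite ltr_wpDl.
pose e := enorm g * (enorm g - L) / (L + enorm g) / 2.
have e0 : 0 < e by rewrite !divr_gt0// mulr_gt0// subr_gt0.
have := key e e0.
rewrite (_ : (L + enorm g) * e = enorm g * (enorm g - L) / 2); last first.
  by rewrite /e; field; rewrite gt_eqF.
have : 0 < enorm g * (enorm g - L) by rewrite mulr_gt0// subr_gt0.
nra.
Qed.

End gradient.

(** * Integrals of nonnegative real functions *)

Section nonnegative_integrals.
Context {R : realType} {d : measure_display} {T : measurableType d}.
Variables (m : {measure set T -> \bar R}) (D : set T).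
Hypothesis mD : measurable D.
Implicit Types f g : T -> R.

Lemma rintegralZ f (c : R) : measurable_fun D f -> (forall t, 0 <= f t) -> 0 <= c ->
  (\int[m]_(t in D) (c * f t)%:E = c%:E * \int[m]_(t in D) (f t)%:E)%E.
Proof.
move=> mf f0 c0; under eq_integral do rewrite EFinM.
rewrite ge0_integralZl_EFin//; last exact/measurable_EFinP.
by move=> t _; rewrite lee_fin.
Qed.

Lemma rintegralD f g : measurable_fun D f -> measurable_fun D g ->
  (forall t, 0 <= f t) -> (forall t, 0 <= g t) ->
  (\int[m]_(t in D) (f t + g t)%:E =
   \int[m]_(t in D) (f t)%:E + \int[m]_(t in D) (g t)%:E)%E.
Proof.
move=> mf mg f0 g0; under eq_integral do rewrite EFinD.
rewrite ge0_integralD//; [|exact/measurable_EFinP| |exact/measurable_EFinP];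
  by move=> t _; rewrite lee_fin.
Qed.

Lemma rintegral_le f g : measurable_fun D f -> measurable_fun D g ->
  (forall t, 0 <= f t) -> (forall t, D t -> f t <= g t) ->
  (\int[m]_(t in D) (f t)%:E <= \int[m]_(t in D) (g t)%:E)%E.
Proof.
move=> mf mg f0 fg; apply: ge0_le_integral => //.
- by move=> t _; rewrite lee_fin.
- exact/measurable_EFinP.
- exact/measurable_EFinP.
Qed.

End nonnegative_integrals.

(** * Lipschitz functions on a polytope *)

(** The infimum of the cones [G y + L * |x - y|] over [y] in [A] is the largest
   extension with the same constant. *)
Lemma lipschitz_extension {R : realType} k (A : set 'rV[R]_k) (G : 'rV[R]_k -> R) (L : R) :
  0 <= L -> A !=set0 -> (forall x y, A x -> A y -> `|G x - G y| <= L * enorm (x - y)) ->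
  exists2 F : 'rV[R]_k -> R, (forall x, A x -> F x = G x) &
    forall x y, `|F x - F y| <= L * enorm (x - y).
Proof.
move=> L0 [a Aa] GL; pose B x := [set G y + L * enorm (x - y) | y in A].
have lbB x y : A x -> lbound (B y) (G x - L * enorm (x - y)).
  move=> Ax _ [z Az <-]; have := GL _ _ Ax Az.
  rewrite ler_norml => /andP[_ h]; have := ler_wpM2l L0 (enorm_triangle y x z).
  lra.
have infB x : has_inf (B x).
  by split; [exists (G a + L * enorm (x - a)), a|exists (G a - L * enorm (a - x)); exact: lbB].
pose F x := inf (B x).
have Fle x y : A y -> F x <= G y + L * enorm (x - y).
  by move=> Ay; apply: ge_inf; [exact: (infB x).2|exists y].
have lip x y : F x - F y <= L * enorm (x - y).
  rewrite lerBlDr -lerBlDl; apply: lb_le_inf; first exact: (infB y).1.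
  move=> _ [z Az <-]; rewrite lerBlDl.
  have := Fle x z Az; have := ler_wpM2l L0 (enorm_triangle y x z); lra.
exists F => [x Ax|x y]; last first.
  rewrite ler_norml; apply/andP; split; last exact: lip.
  by rewrite lerNl opprB enormC lip.
apply/eqP; rewrite eq_le; apply/andP; split.
  by have := Fle x x Ax; rewrite subrr enorm0 mulr0 addr0.
apply: lb_le_inf; first exact: (infB x).1.
by move=> z Bz; have := lbB x x Ax z Bz; rewrite subrr enorm0 mulr0 subr0.
Qed.

Lemma sqr_sum_le {R : realType} m (d : 'I_m -> R) :
  (\sum_i d i) ^+ 2 <= m%:R * \sum_i d i ^+ 2.
Proof.
have := dot_le_enorm (\row_i (1 : R)) (\row_i d i).
have e0 : 0 <= enorm (\row_(i < m) (1 : R)) * enorm (\row_i d i).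
  by rewrite mulr_ge0 ?enorm_ge0.
rewrite -(@ler_pXn2r _ 2)// ?nnegrE// real_normK ?num_real// exprMn !sqr_enorm.
rewrite /dot; under eq_bigr do rewrite !mxE mul1r.
under [X in _ <= X * _ -> _]eq_bigr do rewrite !mxE mul1r.
rewrite sumr_const card_ord; under [X in _ <= _ * X -> _]eq_bigr do rewrite !mxE -expr2.
by [].
Qed.

Section polytope_lipschitz.
Context {R : realType} {k : nat}.
Variables (P : @polytope R k) (G : 'rV[R]_k -> R) (L : R).
Hypothesis L0 : 0 <= L.
Hypothesis GL : forall x y, body P x -> body P y -> `|G x - G y| <= L * enorm (x - y).
Implicit Types (v x z : 'rV[R]_k).

Definition inner : set (Rk R k) := @vec R k @^-1` (body P)°.

Lemma measurable_inner : measurable inner.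
Proof. by apply: measurable_open; exact: open_interior. Qed.

Let mU := measurable_inner.

Lemma inner_body t : inner t -> body P (vec t).
Proof. exact: interior_subset. Qed.

Lemma leb_inner_lty : (leb k inner < +oo)%E.
Proof.
have [r Pr] := body_bounded P; apply: (@leb_bounded _ _ _ 0 r); first exact: mU.
by move=> t /inner_body/Pr; rewrite /eball /= subr0.
Qed.

Let body_ex : body P !=set0.
Proof. by have [p Pp] := body_full P; exists p; exact: interior_subset. Qed.

Let F := sval (cid2 (lipschitz_extension L0 body_ex GL)).

Let FG x : body P x -> F x = G x.
Proof. by rewrite /F; case: cid2 => f /= h _; exact: h. Qed.

Let FL x y : `|F x - F y| <= L * enorm (x - y).
Proof. by rewrite /F; case: cid2 => f /= _ h; exact: h. Qed.

Let near_FG x : (body P)° x -> \forall y \near x, F y = G y.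
Proof.
rewrite {1}/interior => nx; near=> y; apply: FG; near: y; exact: nx.
Unshelve. all: by end_near. Qed.

Let near_GF x : (body P)° x -> \forall y \near x, G y = F y.
Proof. by move=> Px; near do apply/esym; exact: near_FG. Unshelve. all: by end_near. Qed.

Lemma derive_ext v x : (body P)° x -> 'D_v G x = 'D_v F x.
Proof.
have [->|v0] := eqVneq v 0; first by rewrite !derive0.
by move=> Px; apply: near_eq_derive => //; exact: near_GF.
Qed.

Lemma derivable_ext v x : (body P)° x -> derivable F x v -> derivable G x v.
Proof.
have [->|v0] := eqVneq v 0; first by move=> _ _; exact: derivable0.
by move=> Px; apply: near_eq_derivable => //; exact: near_FG.
Qed.

Lemma ae_derivable_inner :
  {ae leb k, forall t, inner t -> forall j, derivable G (vec t) (delta_mx 0 j)}.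
Proof.
have AF : Filter (almost_everywhere (leb k : set (Rk R k) -> \bar R)).
  exact: ae_filter_ringOfSetsType.
suff : {ae leb k, forall t, forall j, derivable F (vec t) (delta_mx 0 j)}.
  by apply: filterS => t dF Ut j; apply: derivable_ext => //; exact: dF.
by apply: filter_forall => j; exact: ae_derivable L0 FL _.
Qed.

Lemma measurable_derive_inner v : measurable_fun inner (fun t => 'D_v G (vec t)).
Proof.
apply: (eq_measurable_fun (fun t => 'D_v F (vec t))) => [t|].
  by rewrite inE => Ut; rewrite derive_ext.
by apply: measurable_funTS; exact: measurable_derive L0 FL _.
Qed.

Lemma grad_inner t : inner t -> grad G (vec t) = grad F (vec t).
Proof. by move=> Ut; apply/rowP => j; rewrite !mxE derive_ext. Qed.

Lemma grad_le_inner : {ae leb k, forall t, inner t -> enorm (grad G (vec t)) <= L}.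
Proof.
have AF : Filter (almost_everywhere (leb k : set (Rk R k) -> \bar R)).
  exact: ae_filter_ringOfSetsType.
by apply: filterS (grad_le L0 FL) => t h Ut; rewrite grad_inner.
Qed.

Lemma measurable_dot_grad z : measurable_fun inner (fun t => dot z (grad G (vec t))).
Proof.
apply: measurable_sum => j; apply: measurable_funM => //.
rewrite (_ : (fun _ => _) = (fun t => 'D_(delta_mx 0 j) G (vec t))).
  exact: measurable_derive_inner.
by apply/funext => t; rewrite mxE.
Qed.

Lemma measurable_grad_sq :
  measurable_fun inner (fun t => dot (grad G (vec t)) (grad G (vec t))).
Proof.
apply: measurable_sum => j.
rewrite (_ : (fun _ => _) = (fun t => 'D_(delta_mx 0 j) G (vec t) ^+ 2)).
  by apply: measurable_funX; exact: measurable_derive_inner.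
by apply/funext => t; rewrite !mxE expr2.
Qed.

Let Q n z (t : Rk R k) := quot F z (vec t) (harm n).

Let mQ n z : measurable_fun setT (Q n z).
Proof. exact: measurable_quot L0 FL _ _. Qed.

(* Points of the interior that stay there under translation by [z]. *)
Definition inner_shift z : set (Rk R k) := inner `&` (affine 1 z @^-1` inner).

Lemma measurable_inner_shift z : measurable (inner_shift z).
Proof. exact (measurableI _ _ mU (measurable_translate z mU)). Qed.

Let integrable_cst_inner (c : R) : (leb k).-integrable inner (cst c%:E).
Proof.
apply/integrableP; split; first exact: measurable_cst.
rewrite (eq_integral (cst (`|c|)%:E))// integral_cst//.
by apply: lte_mul_pinfty => //; exact: leb_inner_lty.
Qed.

Let Q_cvg (z : 'rV[R]_k) : (\int[leb k]_(t in inner) (Q n z t ^+ 2)%:E)%E @[n --> \oo] -->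
  (\int[leb k]_(t in inner) (dot z (grad G (vec t)) ^+ 2)%:E)%E.
Proof.
have AF : Filter (almost_everywhere (leb k : set (Rk R k) -> \bar R)).
  exact: ae_filter_ringOfSetsType.
have := @dominated_convergence _ _ _ (leb k) inner mU
  (fun n t => (Q n z t ^+ 2)%:E) (fun t => (dot z (grad G (vec t)) ^+ 2)%:E)
  (cst ((L * enorm z) ^+ 2)%:E).
case=> //.
- by move=> n; apply: measurable_funTS; apply/measurable_EFinP; exact: measurable_funX.
- by apply/measurable_EFinP; apply: measurable_funX; exact: measurable_dot_grad.
- apply: filterS2 (ae_derivable L0 FL z) (derive_linear L0 FL z) => t dF lF Ut.
  apply/fine_cvgP; split; first exact: nearW.
  rewrite grad_inner// -lF /=.
  have Qc : Q n z t @[n --> \oo] --> 'D_z F (vec t).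
    by apply: (quot_cvg dF) => [n|]; [exact/lt0r_neq0/harm_gt0|exact: harm_cvg].
  rewrite expr2; apply: cvg_trans (cvgM Qc Qc).
  by apply: near_eq_cvg; apply: nearW => m; rewrite /= expr2.
- apply: aeW => t n _; rewrite lee_fin normrX ler_pXn2r ?nnegrE// ?mulr_ge0 ?enorm_ge0//.
  exact: quot_le.
Qed.

(** Cut the displacement [z] into [n + 1] equal steps; by convexity all
   intermediate points stay in the polytope. *)
Lemma translate_le z :
  (\int[leb k]_(t in inner_shift z) ((G (vec t + z) - G (vec t)) ^+ 2)%:E <=
   \int[leb k]_(t in inner) (dot z (grad G (vec t)) ^+ 2)%:E)%E.
Proof.
have Qz := @Q_cvg z.
apply: (cvge_to_ge Qz); apply: nearW => n.
pose s (i : 'I_n.+1) : R := i%:R * harm n.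
pose d (i : 'I_n.+1) (t : Rk R k) := harm n * Q n z (affine 1 (s i *: z) t).
have md i : measurable_fun setT (d i).
  apply: measurable_funM => //; apply: (measurableT_comp (mQ n z)).
  exact: measurable_affine.
have dE t : F (vec t + z) - F (vec t) = \sum_i d i t.
  pose f (i : nat) := F (vec t + (i%:R * harm n) *: z).
  transitivity (\sum_(0 <= i < n.+1) (f i.+1 - f i)).
    rewrite telescope_sumr// /f mul0r scale0r addr0 /harm divff// scale1r//.
  rewrite big_mkord; apply: eq_bigr => i _.
  rewrite /d /Q /quot vec_affine scale1r mulrA divff ?mul1r; last exact/lt0r_neq0/harm_gt0.
  by rewrite /f -natr1 mulrDl mul1r scalerDl addrA addrC.
have step i : (\int[leb k]_(t in inner_shift z) (d i t ^+ 2)%:E <=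
    \int[leb k]_(t in inner) ((harm n * Q n z t) ^+ 2)%:E)%E.
  rewrite -(integral_translate (s i *: z) mU); last 2 first.
  - by apply: measurable_funTS; apply/measurable_EFinP; apply: measurable_funX; exact: measurable_funM.
  - by move=> t; rewrite lee_fin sqr_ge0.
  apply: ge0_subset_integral.
  - exact: measurable_inner_shift.
  - exact: measurable_translate.
  - by apply: measurable_funTS; apply/measurable_EFinP; apply: measurable_funX; exact: md.
  - by move=> t _; rewrite lee_fin sqr_ge0.
  move=> t [Ut Uzt]; rewrite /inner /= vec_affine scale1r.
  have s01 : 0 <= s i <= 1.
    rewrite /s /harm mulr_ge0//= ?invr_ge0// ler_pdivrMr// mul1r ler_nat.
    by rewrite ltnW.
  have Uz : (body P)° (vec t + z) by move: Uzt; rewrite /inner /= vec_affine scale1r.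
  have [s0|s0] := eqVneq (s i) 0; first by rewrite s0 scale0r addr0; exact Ut.
  have := @interior_segment _ _ P (vec t) (vec t + z) (s i) (inner_body Ut) Uz.
  rewrite [vec t + z - _]addrAC subrr add0r; apply.
  by case/andP: s01 => s1 ->; rewrite lt_neqAle eq_sym s0 s1.
apply: (@le_trans _ _ (\int[leb k]_(t in inner_shift z)
    (n.+1%:R * \sum_i d i t ^+ 2)%:E)%E).
  apply: ge0_le_integral.
  - exact: measurable_inner_shift.
  - by move=> t _; rewrite lee_fin sqr_ge0.
  - apply: (eq_measurable_fun (fun t => ((\sum_i d i t) ^+ 2)%:E)) => [t|].
      rewrite inE => -[Ut Uzt]; have := inner_body Uzt; rewrite vec_affine scale1r => Pzt.
      by rewrite -dE (FG (inner_body Ut)) (FG Pzt).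
    apply/measurable_EFinP; apply: measurable_funX; apply: measurable_sum => i.
    exact: measurable_funTS.
  - apply/measurable_EFinP; apply: measurable_funM => //; apply: measurable_sum => i.
    by apply: measurable_funTS; exact: measurable_funX.
  - move=> t [Ut Uzt]; have := inner_body Uzt; rewrite vec_affine scale1r => Pzt.
    rewrite lee_fin -(FG (inner_body Ut)) -(FG Pzt) dE; exact: sqr_sum_le.
under eq_integral do rewrite EFinM -sumEFin.
rewrite ge0_integralZl_EFin//; last 3 first.
- exact: measurable_inner_shift.
- by move=> t _; apply: sume_ge0 => i _; rewrite lee_fin sqr_ge0.
- apply: emeasurable_sum => i; apply: measurable_funTS; apply/measurable_EFinP.
  exact: measurable_funX.
rewrite ge0_integral_sum//; last 3 first.
- exact: measurable_inner_shift.
- by move=> i; apply: measurable_funTS; apply/measurable_EFinP; exact: measurable_funX.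
- by move=> i t _; rewrite lee_fin sqr_ge0.
apply: (@le_trans _ _ (n.+1%:R%:E * \sum_(i < n.+1)
    \int[leb k]_(t in inner) ((harm n * Q n z t) ^+ 2)%:E)%E).
  by apply: lee_wpmul2l => //; apply: lee_sum => i _; exact: step.
rewrite (eq_integral (fun t => (harm n ^+ 2)%:E * (Q n z t ^+ 2)%:E)%E); last first.
  by move=> t _; rewrite exprMn EFinM.
rewrite ge0_integralZl_EFin//; last 3 first.
- by move=> t _; rewrite lee_fin sqr_ge0.
- by apply: measurable_funTS; apply/measurable_EFinP; exact: measurable_funX.
- exact: sqr_ge0.
set I := (\int[leb k]_(t in inner) _)%E.
have [->|I_fin] := eqVneq I +oo%E; first exact: leey.
have fI : I \is a fin_num.
  rewrite ge0_fin_numE; last by apply: integral_ge0 => t _; rewrite lee_fin sqr_ge0.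
  by rewrite ltey.
rewrite -(fineK fI) -EFinM sumEFin -EFinM lee_fin sumr_const card_ord.
rewrite -(mulr_natr (harm n ^+ 2 * fine I)) /harm le_eqVlt; apply/orP; left; apply/eqP.
by field; rewrite addrC natr1 pnatr_eq0.
Qed.

(** By convexity the segment from [t] to [t + z] stays in the polytope, so an [L^2]
   mean value inequality holds with constant one. *)
Lemma translate_le_grad z :
  (\int[leb k]_(t in inner_shift z) ((G (vec t + z) - G (vec t)) ^+ 2)%:E <=
   (dot z z)%:E * \int[leb k]_(t in inner) (dot (grad G (vec t)) (grad G (vec t)))%:E)%E.
Proof.
apply: (le_trans (translate_le z)).
rewrite -rintegralZ//; last 3 first.
- exact: measurable_grad_sq.
- by move=> t; exact: dot_ge0.
- exact: dot_ge0.
apply: rintegral_le => //.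
- by apply: measurable_funX; exact: measurable_dot_grad.
- by apply: measurable_funM => //; exact: measurable_grad_sq.
- by move=> t; exact: sqr_ge0.
move=> t _; rewrite -[X in X <= _]real_normK ?num_real//.
rewrite -!sqr_enorm -exprMn lerXn2r ?nnegrE ?mulr_ge0 ?enorm_ge0//.
exact: dot_le_enorm.
Qed.

End polytope_lipschitz.

(** * Paths and stars in a polyhedral complex *)

Lemma finite_min {R : realType} (I : choiceType) (A : set I) (Q : I -> R -> Prop) :
  finite_set A -> (forall i, A i -> exists2 e, 0 < e & Q i e) ->
  (forall i e e', Q i e -> e' <= e -> Q i e') ->
  exists2 e, 0 < e & forall i, A i -> Q i e.
Proof.
case/finite_seqP => s -> h mono.
suff : exists2 e, 0 < e & forall i, i \in s -> Q i e by case=> e; exists e.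
have : forall i, i \in s -> exists2 e, 0 < e & Q i e by [].
elim: s {A h} => [_|i s IH h]; first by exists 1.
have [|e e0 se] := IH; first by move=> j js; apply: h; rewrite inE js orbT.
have [|f f0 fi] := h i; first by rewrite inE eqxx.
exists (Num.min e f) => [|j]; first by rewrite lt_min e0.
rewrite inE => /orP[/eqP ->|js].
- by apply: (mono _ f) => //; rewrite ge_min lexx orbT.
- by apply: (mono _ e); [exact: se|rewrite ge_min lexx].
Qed.

Section paths.
Context {R : realType} {T : pointedType} (X : pcomplex R T).
Local Notation S := (points X).
Implicit Types (x y z : S) (i j : cell X).
Local Notation spath := (@segment_path R T X).
Local Notation ed := (@path_edist R T X).

Lemma path_ge0 x y l : spath x y l -> 0 <= l.
Proof. by elim=> // i a b z m _ _ _ _ m0; rewrite addr_ge0 ?enorm_ge0. Qed.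

Lemma path_cat x y z l m : spath x y l -> spath y z m -> spath x z (l + m).
Proof.
elim=> [w|i a b w l' Mi Pa Pb _ IH] yz; first by rewrite add0r.
by rewrite -addrA; apply: SegmentCons => //; exact: IH.
Qed.

Lemma path_maximal i a b : maximal_cell X i -> body (cpoly i) a -> body (cpoly i) b ->
  spath (chart a) (chart b) (enorm (b - a)).
Proof.
by move=> Mi Pa Pb; have := SegmentCons Mi Pa Pb (SegmentNil _); rewrite addr0.
Qed.

Lemma path_sym x y l : spath x y l -> spath y x l.
Proof.
elim=> [w|i a b z m Mi Pa Pb _ IH]; first exact: SegmentNil.
by rewrite addrC enormC; apply: (path_cat IH); exact: path_maximal.
Qed.

Lemma edist_le x y l : spath x y l -> (ed x y <= l%:E)%E.
Proof. by move=> xy; apply: ereal_inf_lbound; exists l. Qed.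

Lemma path_edist_ge0 x y : (0 <= ed x y)%E.
Proof. by apply: le_ereal_inf_tmp => _ [l xy <-]; rewrite lee_fin (path_ge0 xy). Qed.

Lemma edist_ltP x y r : (ed x y < r%:E)%E <-> exists2 l, spath x y l & l < r.
Proof.
split=> [/ereal_inf_lt[_ [l xy <-]]|[l xy lr]].
- by rewrite lte_fin => lr; exists l.
- by apply: le_lt_trans (edist_le xy) _; rewrite lte_fin.
Qed.

Lemma edist_path x y z l : spath y z l -> (ed x z <= ed x y + l%:E)%E.
Proof.
move=> yz; rewrite -leeBlDr//; apply: le_ereal_inf_tmp => _ [m xy <-].
by rewrite leeBlDr// -EFinD; apply: edist_le; exact: path_cat yz.
Qed.

Lemma dopen_cball x r : dopen (cball x r).
Proof.
move=> y /edist_ltP[l xy lr]; exists (r - l); first by rewrite subr_gt0.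
move=> z /edist_ltP[m yz mr]; apply/edist_ltP; exists (l + m); last by lra.
exact: path_cat yz.
Qed.

Lemma nbhs_cballP x (A : set S) : nbhs x A <-> exists2 r, 0 < r & cball x r `<=` A.
Proof.
split=> [[B [oB Bx BA]]|[r r0 rA]].
- by have [r r0 rB] := oB x Bx; exists r => //; exact: subset_trans BA.
- exists (cball x r); split=> //; first exact: dopen_cball.
  by apply/edist_ltP; exists 0 => //; exact: SegmentNil.
Qed.

Lemma open_dopenP (A : set S) : open A <-> dopen A.
Proof.
rewrite openE; split=> h x Ax; first by have /nbhs_cballP := h x Ax.
by apply/nbhs_cballP; exact: h.
Qed.

Lemma closed_edist x (r : R) : closed [set y | (ed x y <= r%:E)%E].
Proof.
rewrite -openC; apply/open_dopenP => y /negP; rewrite -ltNge => ry.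
have [q] : exists q : R, r < q /\ (q%:E <= ed x y)%E.
  move: ry; case: (ed x y) => [d||] //; rewrite ?lte_fin => rd.
  - by exists d.
  - by exists (r + 1); rewrite leey; split=> //; lra.
move=> [rq qy]; exists (q - r); first by rewrite subr_gt0.
move=> z /edist_ltP[l /path_sym zy lq] /= xz.
have := le_trans qy (edist_path x zy).
move/le_trans => /(_ _ (leeD2r l%:E xz)); rewrite -EFinD lee_fin; lra.
Qed.

Section structure.
Hypothesis PX : polyhedral_complex X.

Lemma chartI i a b : body (cpoly i) a -> body (cpoly i) b ->
  chart a = chart b :> S -> a = b.
Proof. by move=> Pa Pb ab; apply: (chart_inj PX) => //; rewrite inE. Qed.

Lemma cellset_dim i j : i <> j -> cellset i `<=` cellset j -> (cdim i < cdim j)%N.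
Proof.
move=> ij sij; have [F [G [fF _ iF _ dF]]] := cells_meet PX ij.
have FE : F = body (cpoly i).
  apply/seteqP; split; first exact: face_sub.
  move=> b Pb; have : (cellset i `&` cellset j) (chart b).
    by split; [exists b|apply: sij; exists b].
  by rewrite iF => -[c Fc /(chartI (face_sub fF Fc) Pb) <-].
have [p Pp] := body_full (cpoly i).
have [|m dm] := @affdim_ex R _ F; first by exists p; rewrite FE; exact: interior_subset.
have := dF _ dm; move: dm; rewrite FE => /affdim_body ->.
by rewrite leq_max ltnn.
Qed.

Lemma maximal_ex i : exists2 j, maximal_cell X j & cellset i `<=` cellset j.
Proof.
have [p Pp] := body_full (cpoly i); have {}Pp := interior_subset Pp.
have [r r0 /finite_seqP[s sE]] := cells_locally_finite PX (chart p).
pose B := (\max_(k <- s) cdim k)%N.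
have Bk (k : cell X) : cellset k (chart p : S) -> (cdim k <= B)%N.
  move=> kp; suff ks : k \in s by exact: leq_bigmax_seq.
  have : [set` s] k by rewrite -sE; exists (chart p); split=> //;
    apply/edist_ltP; exists 0 => //; exact: SegmentNil.
  by [].
have : cellset i (chart p : S) by exists p.
move: {sE Pp} (chart p : S) Bk => x Bk.
have [m] := ubnP (B - cdim i)%N; elim: m i {p} => // m IH i im ip.
have [Mi|/existsNP[j /not_implyP[sij nji]]] := pselect (maximal_cell X i).
  by exists i.
have ij : i <> j by move=> ij; apply: nji.
have jp := sij _ ip; have dij := cellset_dim ij sij; have jB := Bk _ jp.
have [|k Mk jk] := IH j _ jp; first by lia.
by exists k => //; exact: subset_trans jk.
Qed.

Lemma maximal_cover x : exists2 i, maximal_cell X i & cellset i x.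
Proof.
have [i _ ix] : (\bigcup_i @cellset R T X i) x by rewrite (cells_cover PX).
by have [j Mj ij] := maximal_ex i; exists j => //; exact: ij.
Qed.

Lemma path_chart i a b : body (cpoly i) a -> body (cpoly i) b ->
  spath (chart a) (chart b) (enorm (b - a)).
Proof.
move=> Pa Pb; have [j Mj ij] := maximal_ex i.
have [a' Pa' aE] : cellset j (chart a) by apply: ij; exists a.
have [b' Pb' bE] : cellset j (chart b) by apply: ij; exists b.
rewrite (cells_metric PX Pb Pa Pb' Pa')// -aE -bE; exact: path_maximal.
Qed.

Lemma closed_chart_pre i (A : set S) : closed A ->
  closed [set b | body (cpoly i) b /\ A (chart b)].
Proof.
move=> cA b clb.
have Pb : body (cpoly i) b.
  by apply: body_closed => B Bb; have [c [[Pc _] Bc]] := clb B Bb; exists c.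
split=> //; apply: cA => B /nbhs_cballP[r r0 rB].
have [|c [[Pc Ac] cb]] := clb [set c | enorm (c - b) < r].
  by apply/nbhs_enormP; exists r.
exists (chart c); split=> //; apply: rB; apply/edist_ltP.
by exists (enorm (c - b)) => //; exact: path_chart.
Qed.

(** Along a path from [x] each visited cell contains [x] as long as the cells
   reached at distance less than [e] do; the distance to [x] inside the current
   cell then grows by at most the length of each segment. *)
Lemma star_path x e :
  (forall i j a b m, maximal_cell X i -> maximal_cell X j -> body (cpoly i) a ->
     body (cpoly i) b -> chart a = x -> spath x (chart b) m -> enorm (b - a) <= m ->
     m < e -> cellset j (chart b : S) -> cellset j x) ->
  forall y l, spath x y l -> l < e -> forall j, maximal_cell X j -> cellset j y ->
  exists a b, [/\ body (cpoly j) a, body (cpoly j) b, chart a = x, chart b = y &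
    enorm (b - a) <= l].
Proof.
move=> H; pose star y m := forall j, maximal_cell X j -> cellset j y ->
  exists a b, [/\ body (cpoly j) a, body (cpoly j) b, chart a = x, chart b = y &
    enorm (b - a) <= m].
suff key y z l : spath y z l -> forall m, spath x y m -> m + l < e -> star y m ->
    star z (m + l).
  move=> y l xy le; rewrite -(add0r l); apply: (key x) => //.
  - exact: SegmentNil.
  - by rewrite add0r.
  - by move=> j _ [a Pa ax]; exists a, a; split; rewrite // subrr enorm0.
elim=> [w m|i a b w l' Mi Pa Pb bw IH m xa]; first by rewrite addr0.
rewrite addrA => ml sta; have l0 := path_ge0 bw.
have xb : spath x (chart b) (m + enorm (b - a)).
  by apply: path_cat xa _; exact: path_maximal.
apply: IH => // j Mj jb.
have [|a0 [a1 [Pa0 Pa1 a0x /(chartI Pa1 Pa) a1E h]]] := sta i Mi; first by exists a.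
rewrite {a1}a1E in h Pa1.
have hb : enorm (b - a0) <= m + enorm (b - a).
  by apply: le_trans (enorm_triangle a b a0) _; lra.
have me : m + enorm (b - a) < e by lra.
have [c Pc cx] : cellset j x by exact: (H i j a0 b _ Mi Mj Pa0 Pb a0x xb hb me jb).
have [d Pd db] := jb; exists c, d; split=> //.
by rewrite (cells_metric PX Pd Pc Pb Pa0) ?cx.
Qed.

(** Cells are closed and locally finite, so short paths from [x] only visit cells
   containing [x]. *)
Lemma near_star x : exists2 e, 0 < e &
  forall y l, spath x y l -> l < e -> forall j, maximal_cell X j -> cellset j y ->
  exists a b, [/\ body (cpoly j) a, body (cpoly j) b, chart a = x, chart b = y &
    enorm (b - a) <= l].
Proof.
have [r r0 fA] := cells_locally_finite PX x; set A := [set i | _] in fA.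
pose Q (p : cell X * cell X) (e : R) := forall a b,
  body (cpoly p.1) a -> body (cpoly p.1) b -> chart a = x ->
  cellset p.2 (chart b : S) -> ~ cellset p.2 x -> e <= enorm (b - a).
have [|[i j] _|p e e' Qe e'e a b Pa Pb ax jb njx|e e0 eQ] := @finite_min R _ (A `*` A) Q.
- exact: finite_setX.
- have [jx|njx] := pselect (cellset j x); first by exists 1.
  have [[a Pa ax]|nix] := pselect (cellset i x); last first.
    by exists 1 => // a b Pa _ ax; case: nix; exists a.
  have ij : i <> j by move=> ij; apply: njx; rewrite -ij; exists a.
  have [F [_ [fF _ iF _ _]]] := cells_meet PX ij.
  have nFa : (~` F) a.
    move=> Fa; apply: njx; suff [] : (cellset i `&` cellset j) x by [].
    by rewrite iF; exists a.
  have : nbhs a (~` F) by apply: open_nbhs_nbhs; split=> //; rewrite openC; exact: face_closed fF.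
  move/nbhs_enormP => [s s0 sF]; exists s => // a' b /= Pa' Pb a'x jb _.
  rewrite (_ : a' = a); last by apply: (chartI Pa' Pa); rewrite a'x ax.
  rewrite leNgt; apply/negP => /sF; apply.
  have : (cellset i `&` cellset j) (chart b) by split=> //; exists b.
  by rewrite iF => -[c Fc /(chartI (face_sub fF Fc) Pb) <-].
- by apply: le_trans e'e _; exact: Qe.
exists (Num.min e r); first by rewrite lt_min e0.
apply: star_path => i j a b m Mi Mj Pa Pb ax xb bm; rewrite lt_min => /andP[me mr] jb.
apply: contrapT => njx.
have : e <= enorm (b - a).
  apply: (eQ (i, j)) => //; split=> /=.
  - exists x; split; first by exists a.
    by apply/edist_ltP; exists 0 => //; exact: SegmentNil.
  - by exists (chart b); split=> //; apply/edist_ltP; exists m.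
lra.
Qed.

Lemma closed_cellset i : maximal_cell X i -> closed (@cellset R T X i).
Proof.
move=> Mi; rewrite -openC; apply/open_dopenP => y niy.
have [e e0 ste] := near_star y; exists e => // z /edist_ltP[l yz le] iz.
by have [a [b [Pa _ ax _ _]]] := ste _ _ yz le _ Mi iz; apply: niy; exists a.
Qed.

(** Two distinct cells meet in proper faces, and a proper face avoids the interior. *)
Lemma single_cell i j a c : maximal_cell X i -> (body (cpoly i))° a ->
  body (cpoly j) c -> chart a = chart c :> S -> j = i.
Proof.
move=> Mi Ia Pc ac; apply: contrapT => ji.
have ij : i <> j by move=> ij; apply: ji.
have [F [_ [fF _ iF _ _]]] := cells_meet PX ij.
have Pa := interior_subset Ia.
have Fa : F a.
  have : (cellset i `&` cellset j) (chart a).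
    by split; [exists a|exists c].
  by rewrite iF => -[d Fd /(chartI (face_sub fF Fd) Pa) <-].
apply: ji; apply: Mi => _ [b Pb <-].
suff [] : (cellset i `&` cellset j) (chart b) by [].
by rewrite iF; exists b; rewrite // (face_interior fF Fa Ia).
Qed.

(** A path starting in a ball inside the interior of a cell either stays in the
   ball or pays the radius to leave it. *)
Lemma path_escape i a0 rho : maximal_cell X i ->
  (forall v, enorm (v - a0) <= rho -> (body (cpoly i))° v) ->
  forall y z l, spath y z l -> forall a : 'rV[R]_(cdim i), y = chart a -> enorm (a - a0) <= rho ->
  (exists a' : 'rV[R]_(cdim i), [/\ z = chart a', enorm (a' - a) <= l & enorm (a' - a0) <= rho]) \/
  (exists (b : 'rV[R]_(cdim i)) l', [/\ enorm (b - a0) = rho, spath (chart b) z l' & enorm (b - a) + l' <= l]).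
Proof.
move=> Mi ball y z l.
elim=> [w a wa aa|j c d w l' Mj Pc Pd dw IH a ca aa].
  by left; exists a; split; rewrite // subrr enorm0.
have Ia := ball _ aa; have Pa := interior_subset Ia.
have ji := single_cell Mi Ia Pc (esym ca); subst j.
have ca' : c = a by exact: (chartI Pc Pa).
rewrite {c Pc ca}ca'.
have [da|da] := leP (enorm (d - a0)) rho.
  have [[a' [za' a'd a'a0]]|[b [m [ba0 bz bm]]]] := IH d erefl da.
  - left; exists a'; split=> //.
    by have := enorm_triangle d a' a; lra.
  - right; exists b, m; split=> //.
    by have := enorm_triangle d b a; lra.
right; pose f (t : R) := enorm (a + t *: (d - a) - a0).
have cf : continuous f.
  move=> t; apply: (@continuous_comp _ _ _ (fun t : R => a + t *: (d - a))
    (fun v => enorm (v - a0))); last exact: enormB_continuous.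
  by apply: cvgD; [exact: cvg_cst|apply: cvgZl; exact: cvg_id].
have [||t /andP[t0 t1] ft] := @IVT R f 0 1 rho ler01.
- exact: continuous_subspaceT.
- by rewrite ge_min le_max /f scale0r addr0 scale1r [a + (d - a)]addrC subrK aa (ltW da) orbT.
pose b := a + t *: (d - a); have Pb : body (cpoly i) b.
  by apply: body_convex => //; apply/andP.
exists b, (enorm (d - b) + l'); split=> //; first exact: SegmentCons.
have -> : b - a = t *: (d - a) by rewrite /b addrC addKr.
have -> : d - b = (1 - t) *: (d - a).
  by rewrite /b scalerBl scale1r opprD addrA.
by rewrite !enormZ !ger0_norm ?subr_ge0//; lra.
Qed.

End structure.
End paths.

(** * Volume of cells near vertices *)

Section null_sets.
Context {R : realType} {k : nat} (P : @polytope R k).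

Let bounded : exists r, @vec R k @^-1` body P `<=` eball 0 r.
Proof. by have [r Pr] := body_bounded P; exists r => t /Pr; rewrite /eball /= subr0. Qed.

Lemma face_null F : face P F -> F <> body P -> leb k (@vec R k @^-1` F) = 0%E.
Proof.
move=> fF FP; have [r Pr] := bounded.
have FE := fF; case: FE => [->|[c FE]]; first by rewrite preimage_set0 measure0.
have [c0|c0] := eqVneq c 0.
  case: FP; rewrite FE c0; apply/seteqP; split=> x /= => [[]//|Px].
  by split=> // y _; rewrite !dot0l.
have [[x Fx]|/forallNP F0] := pselect (F !=set0); last first.
  rewrite (_ : _ @^-1` _ = set0) ?measure0//; apply/seteqP; split=> // t.
  exact: F0.
apply: (@leb_hyperplane _ _ _ c (dot c x) 0 r) => //.
- by apply: measurable_closed; exact: face_closed fF.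
- by move=> t Ft; apply: Pr; exact: face_sub fF _ Ft.
move: Fx; rewrite FE => -[Px mx] t; rewrite /preimage /= => -[Pt mt].
by apply/eqP; rewrite eq_le mx// mt.
Qed.

(** A point satisfying all the nontrivial constraints strictly is interior, so the
   boundary lies in finitely many hyperplanes. *)
Lemma boundary_null : leb k ((@vec R k @^-1` body P) `\` inner P) = 0%E.
Proof.
have [m [a [b PE]]] := body_halfspaces P; have [r Pr] := bounded.
have mP : measurable (@vec R k @^-1` body P) by exact: measurable_polytope.
pose F j := [set t | body P (vec t) /\ exists i : 'I_m,
  [/\ val i = j, a i != 0 & dot (a i) (vec t) = b i]].
apply/(negligibleP (leb k) (measurableD mP (measurable_inner P))).
apply: (@negligibleS _ _ _ _ (\bigcup_j F j)) => [t [Pt It]|].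
  have [i ai ab] := boundary_active PE Pt It.
  by exists (val i) => //; split=> //; exists i.
apply: negligible_bigcup => j.
have [jm|mj] := ltnP j m; last first.
  apply: (@negligibleS _ _ _ _ set0); last exact: negligible_set0.
  by move=> t [_ [i [ij _ _]]]; move: (ltn_ord i); rewrite ij ltnNge mj.
pose i := Ordinal jm; have [ai|ai] := eqVneq (a i) 0.
  apply: (@negligibleS _ _ _ _ set0); last exact: negligible_set0.
  move=> t [_ [i' [ij ai' _]]]; suff ii : i' = i by rewrite ii ai eqxx in ai'.
  exact: val_inj.
pose A := [set t : Rk R k | body P (vec t) /\ dot (a i) (vec t) = b i].
have mA : measurable A.
  apply: (@measurableI _ _ (@vec R k @^-1` body P) [set t | dot (a i) (vec t) = b i]) => //.
  rewrite (_ : [set t | _] = [set t : Rk R k | dot (a i) (vec t) <= b i] `&`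
    [set t : Rk R k | b i <= dot (a i) (vec t)]); last first.
    apply/seteqP; split=> t /=; first by move=> ->.
    by case=> h1 h2; apply/eqP; rewrite eq_le h1.
  have mf : measurable_fun setT (fun t : Rk R k => dot (a i) (vec t)).
    exact: (measurable_continuous (@dot_continuous _ _ (a i))).
  by apply: measurableI; exact: measurable_ler.
apply: (@negligibleS _ _ _ _ A) => [t [Pt [i' [ij _ ab]]]|].
  by split=> //; rewrite (_ : i = i')//; apply: val_inj; rewrite ij.
apply/(negligibleP (leb k) mA); apply: (@leb_hyperplane _ _ _ (a i) (b i) 0 r) => //.
- by move=> t [Pt _]; exact: Pr.
- by move=> t [].
Qed.

End null_sets.

Lemma connected_sub_open {T : topologicalType} (A U V : set T) :
  connected A -> open U -> open V -> A `<=` U `|` V -> U `&` V = set0 ->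
  A `&` U !=set0 -> A `<=` U.
Proof.
move=> cA oU oV AUV UV AU; suff <- : A `&` U = A by [].
apply: cA => //; first by exists U.
exists (~` V); first exact: open_closedC.
apply/seteqP; split=> x [Ax].
- by move=> Ux; split=> // Vx; have : (U `&` V) x by []; rewrite UV.
- by move=> nVx; split=> //; case: (AUV _ Ax).
Qed.

Section cell_measure.
Context {R : realType} {T : pointedType} (X : pcomplex R T).
Hypothesis PX : polyhedral_complex X.
Local Notation S := (points X).
Implicit Types (x y z : S) (i j : cell X).
Local Notation spath := (@segment_path R T X).
Local Notation ed := (@path_edist R T X).

Lemma interior_ball i a0 : (body (cpoly i))° a0 ->
  exists2 rho, 0 < rho & forall v, enorm (v - a0) <= rho -> (body (cpoly i))° v.
Proof.
move=> Ia; have : nbhs a0 (body (cpoly i))°.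
  by apply: open_nbhs_nbhs; split=> //; exact: open_interior.
move/nbhs_enormP => [r r0 rI]; exists (r / 2); first by lra.
by move=> v vr; apply: rI; lra.
Qed.

Lemma interior_path i a0 rho : maximal_cell X i ->
  (forall v, enorm (v - a0) <= rho -> (body (cpoly i))° v) ->
  forall z l, spath (chart a0) z l -> l < rho ->
  exists2 a : 'rV[R]_(cdim i), z = chart a & enorm (a - a0) <= l.
Proof.
move=> Mi ball z l zl lrho; have l0 := path_ge0 zl.
have [|[a [za h _]]|[b [l' [brho /path_ge0 l'0]]]] :=
  path_escape PX Mi ball zl (a := a0) erefl.
- by rewrite subrr enorm0; lra.
- by exists a.
- by rewrite brho; lra.
Qed.

Lemma open_chart_interior i : maximal_cell X i ->
  open (@chart _ _ X i @` (body (cpoly i))° : set S).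
Proof.
move=> Mi; apply/open_dopenP => _ [a Ia <-].
have [rho rho0 ball] := interior_ball Ia; exists rho => // z /edist_ltP[l al lrho].
have [b -> ba] := interior_path Mi ball al lrho; exists b => //.
by apply: ball; lra.
Qed.

Lemma closed_msets (A : set S) : closed A -> measurable A.
Proof.
move=> cA; suff : @msets R T X A by [].
move=> i; exact: (measurable_closed (closed_chart_pre PX (i := i) cA)).
Qed.

Lemma measurable_chart_pre i (A : set S) : measurable A ->
  measurable (@chart_pre R T X i A).
Proof. by move=> mA; have /(_ i) : @msets R T X A by []. Qed.

Lemma open_msets (A : set S) : open A -> measurable A.
Proof.
by move=> oA; rewrite -[A]setCK; apply: measurableC; apply: closed_msets; rewrite closedC.
Qed.

Lemma mu_cell i (A : set S) : maximal_cell X i -> measurable A -> A `<=` cellset i ->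
  mu X A = leb (cdim i) (@chart_pre R T X i A).
Proof.
move=> Mi mA Ai; rewrite /mu esum_mkcond.
transitivity (\esum_(j in [set i]) leb (cdim j) (@chart_pre R T X j A))%E; last first.
  by rewrite esum_set1.
rewrite [RHS]esum_mkcond; apply: eq_esum => j _.
have [->|ji] := eqVneq j i; first by rewrite !mem_set.
rewrite [j \in [set i]]memNset; last exact/eqP.
case: ifPn => // /set_mem Mj.
have ij : i <> j by move=> ij; rewrite ij eqxx in ji.
have [F [G [_ fG iF iG _]]] := cells_meet PX ij.
apply: (@subset_measure0 _ _ _ (leb (cdim j)) _ (@vec R (cdim j) @^-1` G)).
- exact: mA.
- by apply: measurable_closed; exact: face_closed fG.
- move=> t [Pt At]; have : (cellset i `&` cellset j) (chart (vec t)).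
    by split; [exact: Ai|exists (vec t)].
  by rewrite iG /preimage /= => -[c Gc /(chartI PX (face_sub fG Gc) Pt) <-].
apply: (face_null fG) => GE; apply: ij; apply: Mj => y jy.
suff [] : (cellset i `&` cellset j) y by [].
by rewrite iG GE.
Qed.

Section solid.
Variables (n : nat) (alpha l0 : R).
Hypothesis dimn : forall i, maximal_cell X i -> cdim i = n.
Hypothesis alpha0 : 0 < alpha.
Hypothesis hsolid : solid_angle_bound X n alpha.
Hypothesis l00 : 0 < l0.
Hypothesis hl0 : forall p q : S, @skeleton R T X 0 p -> @skeleton R T X 0 q ->
  p <> q -> (l0%:E <= ed p q)%E.
Local Notation sigma := (sphere_measure (R := R) n).

Lemma interior_skeleton i a : maximal_cell X i -> (body (cpoly i))° a ->
  ~ @skeleton R T X (n%:Z - 1) (chart a).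
Proof.
move=> Mi Ia [E [m [[j [F [fF dF ->]]] mn [c Fc ca]]]].
have ji := single_cell PX Mi Ia (face_sub fF Fc) (esym ca); subst j.
have {ca} ca := chartI PX (face_sub fF Fc) (interior_subset Ia) ca; subst c.
move: dF; rewrite (face_interior fF Fc Ia) => /affdim_body mi.
by move: mn; rewrite mi (dimn Mi); lia.
Qed.

Lemma skeleton_interior (w : S) : ~ @skeleton R T X (n%:Z - 1) w ->
  exists i (a : 'rV[R]_(cdim i)), [/\ maximal_cell X i, (body (cpoly i))° a & w = chart a].
Proof.
move=> nw; have [i Mi [a Pa aw]] := maximal_cover PX w.
exists i, a; split=> //; apply: contrapT => nIa; apply: nw.
have [F [m [fF dF mk Fa]]] := boundary_face Pa nIa.
exists (@chart _ _ X i @` F), m; split; [by exists i, F| |by exists a].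
by move: mk; rewrite (dimn Mi); lia.
Qed.

(** The interior of a maximal cell, intersected with a ball, is open and closed in the
   complement of the codimension-one skeleton, so it contains the components that it
   meets. *)
Lemma component_cell v r i a : maximal_cell X i -> (body (cpoly i))° a ->
  let B := cball v r `\` @skeleton R T X (n%:Z - 1) in B (chart a) ->
  connected_component B (chart a : S) `<=` @chart _ _ X i @` (body (cpoly i))°.
Proof.
move=> Mi Ia B Ba.
pose V := \bigcup_(j in [set j | maximal_cell X j /\ j <> i])
  (@chart _ _ X j @` (body (cpoly j))° : set S).
apply: (@connected_sub_open _ _ _ V).
- exact: component_connected.
- exact: open_chart_interior.
- by apply: bigcup_open => j [Mj _]; exact: open_chart_interior.
- move=> w /connected_component_sub[_ /skeleton_interior[j [b [Mj Ib ->]]]].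
  have [ji|ji] := pselect (j = i); first by subst j; left; exists b.
  by right; exists j => //; exists b.
- apply/seteqP; split=> // _ [[b Ib <-] [j [Mj ji] [c Ic cb]]].
  by apply: ji; apply: (single_cell PX Mi Ib (interior_subset Ic)).
- exists (chart a); split; last by exists a.
  exact: connected_component_refl.
Qed.

Let near_part i v r := @chart_pre R T X i [set y | (ed v y <= r%:E)%E].

Let measurable_near_part i v r : measurable (@near_part i v r).
Proof. exact: (closed_msets (@closed_edist R T X v r)). Qed.

Lemma solid_lower v r i a : @skeleton R T X 0 v -> 0 < r -> r <= l0 ->
  maximal_cell X i -> (body (cpoly i))° a -> cball v r (chart a) ->
  0 < sigma /\ ((alpha * (r ^+ n * sigma))%:E <= leb (cdim i) (@near_part i v r))%E.
Proof.
move=> v0 r0 rl Mi Ia va.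
have noskel : @skeleton R T X (0%:Z - 1) = set0.
  by apply/seteqP; split=> // y [E [m [_ m1 _]]]; lia.
pose B := cball v r `\` @skeleton R T X (n%:Z - 1).
have Ba : B (chart a) by split=> //; exact: interior_skeleton.
have := @hsolid 0 v r r0; rewrite noskel; case/(_ _ _ _ (chart a) Ba)/andP.
- by split=> //; rewrite noskel.
- by rewrite /path_edist_set image_set0 ereal_inf0 ltry.
- move=> E fE [y [Ey vy]]; have [->//|vny] := pselect (v = y).
  have : (l0%:E <= ed v y)%E by apply: hl0 => //; exists E, 0%N.
  move/le_lt_trans => /(_ _ vy); rewrite lte_fin; lra.
rewrite -/B; set W := closure _ => lowW _.
have cW : closed W by exact: closed_closure.
have Wi : W `<=` cellset i `&` [set y | (ed v y <= r%:E)%E].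
  have cl : closed (cellset i `&` [set y | (ed v y <= r%:E)%E] : set S).
    by apply: closedI; [exact: closed_cellset|exact: closed_edist].
  rewrite [X in _ `<=` X](closure_id _).1//; apply: closureS => w Cw; split.
  - by have [b Ib <-] := component_cell Mi Ia Ba Cw; exists b => //; exact: interior_subset.
  - by have [vw _] := connected_component_sub Cw; exact: ltW.
have sigma_ge0 : 0 <= sigma.
  by apply: fine_ge0; apply: mule_ge0; rewrite ?lee_fin//; exact: measure_ge0.
have sigma0 : 0 < sigma.
  rewrite lt_neqAle sigma_ge0 andbT; apply/eqP => s0; move: lowW.
  by rewrite -s0 mulr0 invr0 mule0 lee_fin leNgt alpha0.
split=> //; have rs : 0 < r ^+ n * sigma by rewrite mulr_gt0// exprn_gt0.
move: lowW; rewrite lee_pdivlMr// -EFinM => /le_trans; apply.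
rewrite (mu_cell Mi); last 2 first.
- exact: closed_msets.
- by move=> w /Wi[].
apply: le_measure; rewrite ?inE.
- by apply: measurable_chart_pre; exact: closed_msets.
- exact: measurable_near_part.
- by move=> t [Pt /Wi[]].
Qed.

(** A maximal cell missing the vertex [v] but closer than [l0] would have, just
   beyond its distance to [v], pieces of volume bounded below; their intersection
   contains an interior point, which is not closest. *)
Lemma vertex_cells v i b l : @skeleton R T X 0 v -> maximal_cell X i ->
  body (cpoly i) b -> spath v (chart b) l -> l < l0 -> cellset i v.
Proof.
move=> v0 Mi Pb vb ll; apply: contrapT => niv.
pose A := [set l | exists2 b, body (cpoly i) b & spath v (chart b) l].
have Al : A l by exists b.
have lbA : lbound A 0 by move=> m [c _ /path_ge0].
have infA : has_inf A by split; [exists l|exists 0].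
pose delta := inf A.
have delta_le m : A m -> delta <= m by move=> Am; apply: ge_inf => //; exact: infA.2.
have delta0 : 0 < delta.
  have : open (~` (cellset i : set S)) by rewrite openC; exact: closed_cellset.
  move/open_dopenP => /(_ v niv)[r r0 rni]; apply: lt_le_trans r0 _.
  apply: lb_le_inf; first exact: infA.1.
  move=> m [c Pc vc]; rewrite leNgt; apply/negP => mr.
  by apply: (rni (chart c)); [apply/edist_ltP; exists m|exists c].
have deltal : delta < l0 by apply: le_lt_trans (delta_le _ Al) ll.
have low r : delta < r -> r <= l0 ->
    0 < sigma /\ ((alpha * (r ^+ n * sigma))%:E <= leb (cdim i) (@near_part i v r))%E.
  move=> dr rl; have [m [c Pc vc] mr] := inf_lt infA.1 dr.
  have [|p Ip pc] := @closure_interior _ _ (cpoly i) c (r - m) Pc; first by rewrite subr_gt0.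
  apply: (@solid_lower v r i p) => //; first exact: lt_trans dr.
  apply/edist_ltP; exists (m + enorm (p - c)); last by lra.
  by apply: path_cat vc _; apply: path_maximal => //; exact: interior_subset.
pose r_ (k : nat) := delta + (l0 - delta) / k.+1%:R.
have r_gt k : delta < r_ k by rewrite ltrDl divr_gt0// subr_gt0.
have r_le k : r_ k <= l0.
  by rewrite /r_ -lerBrDl ler_pdivrMr// ler_peMr ?ler1n// subr_ge0 ltW.
have [sigma0 _] := low _ (r_gt 0%N) (r_le 0%N).
pose D k := @near_part i v (r_ k).
have DE : \bigcap_k D k = @near_part i v delta.
  apply/seteqP; split=> t => [Dt|[Pt vt] k _]; last first.
    by split=> //=; apply: le_trans vt _; rewrite lee_fin ltW.
  split; first by have [] := Dt 0%N I.
  apply/lee_addgt0Pr => e e0.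
  pose k := Num.truncn ((l0 - delta) / e); have [_ /= h] := Dt k I.
  apply: le_trans h _; rewrite -EFinD lee_fin lerD2l.
  rewrite ler_pdivrMr// mulrC -ler_pdivrMr//; exact/ltW/truncnS_gt.
have cvD : leb (cdim i) (D k) @[k --> \oo] --> leb (cdim i) (@near_part i v delta).
  rewrite -DE; apply: nonincreasing_cvg_mu.
  - have [r Pr] := body_bounded (cpoly i).
    apply: (@leb_bounded _ _ _ 0 r); first exact: measurable_near_part.
    by move=> t [/Pr + _]; rewrite /eball /= subr0.
  - by move=> k; exact: measurable_near_part.
  - by rewrite DE; exact: measurable_near_part.
  - move=> k m km; apply/subsetPset => t [Pt h]; split=> //=; apply: le_trans h _.
    by rewrite lee_fin lerD2l ler_pM2l ?subr_gt0// lef_pV2 ?posrE// ler_nat.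
have pos : (0 < leb (cdim i) (@near_part i v delta))%E.
  apply: (@lt_le_trans _ _ (alpha * (delta ^+ n * sigma))%:E).
    by rewrite lte_fin mulr_gt0// mulr_gt0// exprn_gt0.
  apply: (cvge_to_ge cvD); apply: nearW => k.
  have [_] := low _ (r_gt k) (r_le k); apply: le_trans.
  rewrite lee_fin ler_pM2l// ler_pM2r// lerXn2r ?nnegrE ?ltW//.
  exact: lt_trans (r_gt k).
have [t [Pt vt] It] : exists2 t, @near_part i v delta t & inner (cpoly i) t.
  apply: contrapT => h; move: pos; apply/negP; rewrite -leNgt -(boundary_null (cpoly i)).
  apply: le_measure; rewrite ?inE.
  - exact: measurable_near_part.
  - by apply: measurableD; [exact: measurable_polytope|exact: measurable_inner].
  - by move=> t nt; split; [exact: nt.1|move=> It; apply: h; exists t].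
have [rho rho0 ball] := interior_ball It.
have /edist_ltP[m /path_sym vm mr] : (ed v (chart (vec t)) < (delta + rho)%:E)%E.
  by apply: le_lt_trans vt _; rewrite lte_fin ltrDl.
have [|[a [va _ arho]]|[c [m' [crho /path_sym cm h]]]] :=
  path_escape PX Mi ball vm (a := vec t) erefl.
- by rewrite subrr enorm0 ltW.
- by apply: niv; exists a => //; apply: interior_subset; exact: ball.
- have : A m' by exists c => //; apply: interior_subset; apply: ball; rewrite crho.
  move/delta_le; rewrite crho in h; lra.
Qed.

Lemma vertex_star v y l i : @skeleton R T X 0 v -> maximal_cell X i -> spath v y l ->
  l < l0 -> cellset i y ->
  exists a b, [/\ body (cpoly i) a, body (cpoly i) b, chart a = v, chart b = y &
    enorm (b - a) <= l].
Proof.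
move=> v0 Mi vy ll iy.
apply: (star_path PX _ vy ll Mi iy) => j k a b m _ Mk _ _ _ vb _ ml [c Pc cb].
by rewrite -cb in vb; exact: vertex_cells vb ml.
Qed.

Lemma vertex_skeleton i a : vertex (cpoly i) a -> @skeleton R T X 0 (chart a).
Proof.
move=> [_ va]; exists (@chart _ _ X i @` [set a]), 0%N; split=> //; last by exists a.
by exists i, [set a]; split=> //; exact: affdim_set1.
Qed.

Lemma vertex_fat i a r : maximal_cell X i -> vertex (cpoly i) a -> 0 < r -> r <= l0 ->
  0 < sigma /\ ((alpha * ((r / 2) ^+ n * sigma))%:E <=
    leb (cdim i) (@vec R _ @^-1` body (cpoly i) `&` eball a r))%E.
Proof.
move=> Mi va r0 rl; have va0 := vertex_skeleton va; have [Pa _] := va.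
have [|p Ip pa] := @closure_interior _ _ (cpoly i) a (r / 2) Pa; first by lra.
have r20 : 0 < r / 2 by lra.
have rl2 : r / 2 <= l0 by lra.
have ap : @cball R T X (chart a) (r / 2) (chart p).
  apply/edist_ltP; exists (enorm (p - a)) => //.
  by apply: path_maximal => //; exact: interior_subset.
have [s0 low] := solid_lower va0 r20 rl2 Mi Ip ap.
split=> //; apply: le_trans low _; apply: le_measure; rewrite ?inE.
- exact: measurable_near_part.
- by apply: measurableI; [exact: measurable_polytope|exact: measurable_eball].
move=> t [Pt at_]; split=> //.
have /edist_ltP[l al lr] : (ed (chart a) (chart (vec t)) < r%:E)%E.
  by apply: le_lt_trans at_ _; rewrite lte_fin; lra.
have [||c [d [Pc Pd ca dt cd]]] := vertex_star va0 Mi al; first by lra.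
  by exists (vec t).
rewrite /eball /= -(chartI PX Pd Pt dt) -(chartI PX Pc Pa ca); lra.
Qed.

(** Every point of a cell is the image of a vertex under a contraction by [2 ^- n]
   of the cell into itself, which transports the volume near the vertex. *)
Lemma cell_fat : exists2 c : R, 0 < c & forall i (x : 'rV[R]_(cdim i)) (r : R), maximal_cell X i ->
  body (cpoly i) x -> 0 < r -> r <= l0 ->
  ((c * r ^+ n)%:E <= leb (cdim i) (@vec R _ @^-1` body (cpoly i) `&` eball x r))%E.
Proof.
exists (alpha * sigma * (2 ^- n) * (2 ^- n) ^+ n).
  have [i Mi _] := maximal_cover PX (point : S).
  have [p Ip] := body_full (cpoly i).
  have [v [z [va _ _]]] := vertex_descent (interior_subset Ip).
  have [s0 _] := vertex_fat Mi va l00 (lexx _).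
  by rewrite !mulr_gt0 ?exprn_gt0 ?invr_gt0 ?exprn_gt0.
move=> i x r Mi Px r0 rl; have in_ := dimn Mi.
have [v [z [va Pz xE]]] := vertex_descent Px.
have [s0 low] := vertex_fat Mi va r0 rl.
set A := (_ `&` _) in low.
have mA : measurable A.
  by apply: measurableI; [exact: measurable_polytope|exact: measurable_eball].
pose q : R := 2 ^+ cdim i; have q0 : 0 < q by rewrite exprn_gt0.
pose B := affine q ((1 - q) *: z) @^-1` A.
have BA : B `<=` @vec R _ @^-1` body (cpoly i) `&` eball x r.
  move=> t; rewrite /B /A /preimage /eball /= vec_affine => -[Pw vw].
  set w := _ + _ in Pw vw.
  have tE : vec t = z + q^-1 *: (w - z).
    rewrite (_ : w - z = q *: (vec t - z)).
      by rewrite scalerA mulVf ?lt0r_neq0// scale1r addrC subrK.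
    by rewrite /w scalerBl scale1r scalerBr -addrA [z - _]addrC addrK.
  have q1 : q^-1 <= 1 by rewrite invf_le1// exprn_ege1// ler1n.
  have qV0 : 0 <= q^-1 by rewrite invr_ge0 ltW.
  split.
  - by rewrite /= tE; apply: body_convex; rewrite // qV0 q1.
  - rewrite /eball /= tE {1}xE opprD addrACA subrr add0r -scalerBr opprB addrA subrK.
    rewrite enormZ ger0_norm//; apply: le_trans vw.
    by rewrite ler_piMl ?enorm_ge0.
apply: (@le_trans _ _ (leb (cdim i) B)); last first.
  apply: le_measure; rewrite ?inE//.
  - exact: (measurable_preimage (@measurable_affine _ _ _ _) mA).
  - by apply: measurableI; [exact: measurable_polytope|exact: measurable_eball].
rewrite leb_affine//; apply: (@le_trans _ _ ((q ^- cdim i)%:E * (alpha * ((r / 2) ^+ n * sigma))%:E)%E).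
  rewrite -EFinM lee_fin /q in_ -[in X in _ <= X](exprVn (2 ^+ n)) exprMn [2^-1 ^+ n]exprVn.
  set u := 2 ^- n; set w := u ^+ n.
  by rewrite le_eqVlt; apply/orP; left; apply/eqP; ring.
by apply: lee_wpmul2l => //; rewrite lee_fin invr_ge0 exprn_ge0// ltW.
Qed.

(** Small balls around an interior point scale like Euclidean balls. *)
Lemma doubling_dim N R0 : 0 < R0 -> volume_doubling X N R0 -> n%:R <= N.
Proof.
move=> R00 dbl; have [i Mi _] := maximal_cover PX (point : S).
have [a Ia] := body_full (cpoly i); have [rho rho0 ball] := interior_ball Ia.
pose r := Num.min (Num.min R0 l0) (rho / 2) / 2.
have r0 : 0 < r by rewrite divr_gt0// !lt_min R00 l00 divr_gt0.
have rR : r <= R0 /\ r <= l0 /\ 2 * r < rho.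
  have : r * 2 <= Num.min (Num.min R0 l0) (rho / 2) by rewrite divfK.
  rewrite !le_min => /andP[/andP[h1 h2] h3].
  by split; [lra|split; [lra|lra]].
have [rR0 [rl r2]] := rR.
have muE s : 0 < s -> s < rho ->
    mu X (@cball R T X (chart a) s) = leb (cdim i) [set t | enorm (vec t - a) < s].
  move=> s0 srho; rewrite (mu_cell Mi).
  - congr (leb _ _); apply/seteqP; split=> t /=.
    + move=> [Pt /edist_ltP[l al ls]].
      have [|b tb ba] := interior_path Mi ball al; first by lra.
      have Pb : body (cpoly i) b by apply: interior_subset; apply: ball; lra.
      rewrite (chartI PX Pt Pb tb); lra.
    + move=> ts; have Pt : body (cpoly i) (vec t).
        by apply: interior_subset; apply: ball; lra.
      split=> //; apply/edist_ltP; exists (enorm (vec t - a)) => //.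
      by apply: path_maximal => //; exact: interior_subset.
  - by apply: open_msets; apply/open_dopenP; exact: dopen_cball.
  - move=> y /edist_ltP[l al ls].
    have [|b -> ba] := interior_path Mi ball al; first by lra.
    by exists b => //; apply: interior_subset; apply: ball; lra.
have := dbl (chart a) r; rewrite r0 rR0 => /(_ isT).
rewrite !muE//; last 2 first.
- by lra.
- by lra.
set D := [set t | enorm (vec t - a) < r].
have mD s : measurable [set t : Rk R (cdim i) | enorm (vec t - a) < s].
  by apply: (@measurable_open R (cdim i) [set v | enorm (v - a) < s]); apply: open_ltc; exact: enormB_continuous.
have -> : [set t | enorm (vec t - a) < 2 * r] = affine 2^-1 (2^-1 *: a) @^-1` D.
  have half (t : Rk R (cdim i)) :
      2^-1 *: vec t + 2^-1 *: a - a = 2^-1 *: (vec t - a).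
    rewrite scalerBr -addrA; congr (_ + _).
    by rewrite -[X in _ - X]scale1r -scalerBl -scaleNr; congr (_ *: _); lra.
  have half0 : 0 <= 2^-1 :> R by lra.
  by apply/seteqP; split=> t; rewrite /D /preimage /= vec_affine half enormZ ger0_norm// => h;
    lra.
rewrite leb_affine//; last exact: mD.
have Doo : (leb (cdim i) D < +oo)%E.
  by apply: (@leb_bounded _ _ _ a r); [exact: mD|move=> t /ltW].
have D0 : (0 < leb (cdim i) D)%E.
  have [c c0 fat] := cell_fat.
  have r20 : 0 < r / 2 by lra.
  have rl2 : r / 2 <= l0 by lra.
  have := fat i a _ Mi (interior_subset Ia) r20 rl2.
  move=> fat_a; apply: (@lt_le_trans _ _ (c * (r / 2) ^+ n)%:E).
    by rewrite lte_fin mulr_gt0// exprn_gt0.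
  apply: le_trans fat_a _; apply: le_measure; rewrite ?inE//; last by move=> t [_ h]; rewrite /D /=; rewrite /eball /= in h; lra.
  - by apply: measurableI; [exact: measurable_polytope|exact: measurable_eball].
  - exact: mD.
have cancel_vol (u w : R) (v : \bar R) : (0 < v)%E -> (v < +oo)%E ->
    (u%:E * v <= w%:E * v)%E -> u <= w.
  by case: v => // v v0 _; rewrite -!EFinM lee_fin ler_pM2r.
move/(cancel_vol _ _ _ D0 Doo).
rewrite (dimn Mi) -exprVn invrK -powR_mulrn// => h.
rewrite leNgt; apply/negP => Nn; move: h; apply/negP; rewrite -ltNge.
by rewrite /powR gt_eqF// ltr_expR ltr_pM2r// ln_gt0// ltr1n.
Qed.

Lemma degree_pos M : (0 < n)%N -> degree_le X M -> (0 < M)%N.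
Proof.
move=> n0 deg; have [i Mi _] := maximal_cover PX (point : S).
have [|E [v [fE dE vv Ev]]] := @edge_at_vertex _ _ (cpoly i); first by rewrite (dimn Mi).
rewrite lt0n; apply/eqP => M0; have := deg _ (vertex_skeleton vv); rewrite M0.
rewrite II0 card_le0 => /eqP/seteqP[/(_ (@chart _ _ X i @` E)) h _].
by apply: h; split; [exists i, E|exists v].
Qed.

End solid.
End cell_measure.

(** * Integration over a complex *)

Section restriction.
Context {d} {T : measurableType d} {R : realType}.
Variables (m : {measure set T -> \bar R}) (D : set T) (mD : measurable D).

Definition restricted of measurable D : set T -> \bar R := fun A => m (A `&` D).

Let restricted0 : restricted mD set0 = 0%E.
Proof. by rewrite /restricted set0I measure0. Qed.

Let restricted_ge0 A : (0 <= restricted mD A)%E.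
Proof. exact: measure_ge0. Qed.

Let restricted_sigma_additive : semi_sigma_additive (restricted mD).
Proof.
move=> F mF tF mU; rewrite /restricted setI_bigcupl.
apply: measure_semi_sigma_additive.
- by move=> i; exact: measurableI.
- exact: trivIset_setIr.
- by rewrite -setI_bigcupl; exact: measurableI.
Qed.

HB.instance Definition _ := isMeasure.Build _ _ _ (restricted mD)
  restricted0 restricted_ge0 restricted_sigma_additive.

Lemma integral_restricted (f : T -> \bar R) :
  measurable_fun setT f -> (forall x, 0 <= f x)%E ->
  (\int[restricted mD]_x f x = \int[m]_(x in D) f x)%E.
Proof.
move=> mf f0; have DD : [disjoint D & ~` D] by apply/disj_setPCl.
have := @ge0_integral_setU _ _ _ (restricted mD) D (~` D) mD (measurableC mD) f.
rewrite setUv => /(_ mf (fun x _ => f0 x) DD) ->.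
rewrite [X in (X + _)%E](@eq_measure_integral _ _ _ D m); last first.
  by move=> A mA AD; rewrite /restricted; congr (m _); apply/setIidPl.
rewrite [X in (_ + X)%E](@eq_measure_integral _ _ _ (~` D) mzero); last first.
  move=> A mA AD; transitivity (m (A `&` D)) => //; rewrite (_ : A `&` D = set0) ?measure0//.
  by apply/seteqP; split=> // x [/AD].
by rewrite integral_measure_zero adde0.
Qed.

End restriction.

Definition by_pickle {R : realType} (I : countType) (Q : set I) (a : I -> \bar R) (k : nat) :
  \bar R := (if pickle_inv k is Some i then if `[< Q i >] then a i else 0 else 0)%E.

Lemma nneseries_pickle {R : realType} (I : countType) (Q : set I) (a : I -> \bar R) :
  (forall i, 0 <= a i)%E ->
  (\sum_(0 <= k <oo) by_pickle Q a k = \esum_(i in Q) a i)%E.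
Proof.
move=> a0; set b := by_pickle Q a.
have b0 k : (0 <= b k)%E.
  by rewrite /b /by_pickle; case: pickle_inv => // i; case: asboolP.
rewrite nneseries_esumT// (_ : \esum_(i in Q) a i = \esum_(i in Q) b (pickle i))%E.
  rewrite -(@reindex_esum _ _ _ Q (pickle @` Q)); last first.
    split=> [i Qi|i j _ _ /(pcan_inj (@pickleK I))//|k [i Qi <-]]; first by exists i.
    by exists i.
  rewrite [RHS]esum_mkcond; apply: eq_esum => k _.
  case: ifPn => // kQ; rewrite /b /by_pickle; case E : (pickle_inv k) => [i|//].
  case: asboolP => // Qi; case/negP: kQ; rewrite inE; exists i => //.
  by have := @pickle_invK I k; rewrite E.
by apply: eq_esum => i Qi; rewrite /b /by_pickle pickleK_inv; case: asboolP.
Qed.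

Section integration.
Context {R : realType} {T : pointedType} (X : pcomplex R T).
Local Notation S := (points X).
Implicit Types (x y z : S) (i j : cell X).

Definition cell_chart i (t : Rk R (cdim i)) : S := chart (vec t).

Definition cell_body i : set (Rk R (cdim i)) := @vec R _ @^-1` body (cpoly i).
Arguments cell_body : clear implicits.

Lemma measurable_cell_body i : measurable (cell_body i).
Proof. exact: measurable_polytope. Qed.

Let total_chart i (t : Rk R (cdim i)) : S :=
  if `[< cell_body i t >] then cell_chart t else point.

Let measurable_total_chart i : measurable_fun setT (@total_chart i).
Proof.
move=> _ A mA; rewrite setTI.
rewrite (_ : _ @^-1` _ = @chart_pre R T X i A `|`
  (~` cell_body i `&` [set _ | A point])); last first.
  apply/seteqP; split=> t; rewrite /total_chart /preimage /=.
  - by case: asboolP => Pt At; [left|right].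
  - by case: asboolP => Pt [[]|[]].
apply: measurableU; first exact: measurable_chart_pre.
apply: measurableI; first by apply: measurableC; exact: measurable_cell_body.
have [pA|npA] := pselect (A point).
- by rewrite (_ : [set _ | _] = setT)//; apply/seteqP; split.
- by rewrite (_ : [set _ | _] = set0)//; apply/seteqP; split.
Qed.

Let cell_measure i : {measure set S -> \bar R} :=
  [the {measure set S -> \bar R} of
     push (restricted (leb (cdim i)) (@measurable_cell_body i)) (@measurable_total_chart i)].

Let cell_measureE i (A : set S) :
  cell_measure i A = leb (cdim i) (@chart_pre R T X i A).
Proof.
rewrite /cell_measure /= /push /pushforward /restricted; congr (leb _ _).
apply/seteqP; split=> t; rewrite /total_chart /preimage /=.
- by case: asboolP => Pt [At Pt'].
- by case=> Pt At; case: asboolP.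
Qed.

Let m_ (k : nat) : {measure set S -> \bar R} :=
  if pickle_inv k is Some i then
    if `[< maximal_cell X i >] then cell_measure i else mzero
  else mzero.

Lemma mu_integral (f : S -> \bar R) : measurable_fun setT f -> (forall x, 0 <= f x)%E ->
  (\int[mu X]_x f x =
   \esum_(i in maximal_cell X) \int[leb (cdim i)]_(t in cell_body i) f (cell_chart t))%E.
Proof.
move=> mf f0; rewrite (@eq_measure_integral _ _ _ setT (mseries m_ 0)); last first.
  move=> A mA _.
  transitivity (\esum_(i in maximal_cell X) leb (cdim i) (@chart_pre R T X i A))%E => //.
  rewrite -nneseries_pickle//.
  apply: eq_eseriesr => k _; rewrite /m_ /by_pickle; case: pickle_inv => [i|//].
  by case: asboolP => // _; rewrite cell_measureE.
rewrite ge0_integral_measure_series// -nneseries_pickle; last first.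
  by move=> i; apply: integral_ge0 => t _.
apply: eq_eseriesr => k _; rewrite /m_ /by_pickle; case: pickle_inv => [i|]; last first.
  exact: integral_measure_zero.
case: asboolP => Mi; last exact: integral_measure_zero.
have h := @ge0_integral_pushforward _ _ _ _ _ _ (@measurable_total_chart i)
  (restricted (leb (cdim i)) (@measurable_cell_body i)) setT f measurableT mf (fun x _ => f0 x).
rewrite preimage_setT in h; apply: (etrans h).
rewrite (@integral_restricted _ _ _ _ _ (@measurable_cell_body i) _
  (measurableT_comp mf (@measurable_total_chart i)) (fun t => f0 _)).
by apply: eq_integral => t /set_mem Pt; rewrite /total_chart /= asboolT.
Qed.

Lemma measurable_cell_chart i d (U : measurableType d) (f : S -> U) :
  measurable_fun setT f -> measurable_fun (cell_body i) (f \o @cell_chart i).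
Proof.
move=> mf; apply: (eq_measurable_fun (f \o @total_chart i)) => [t|].
  by move=> /set_mem Pt; rewrite /total_chart /= asboolT.
by apply: measurable_funTS; apply: (measurableT_comp mf); exact: measurable_total_chart.
Qed.

Section structure.
Hypothesis PX : polyhedral_complex X.

Lemma interior_unique i j (a : 'rV[R]_(cdim i)) (b : 'rV[R]_(cdim j)) :
  maximal_cell X i -> (body (cpoly i))° a -> body (cpoly j) b ->
  chart a = chart b :> S -> existT (fun k : cell X => 'rV[R]_(cdim k)) j b = existT _ i a.
Proof.
move=> Mi Ia Pb ab; have ji := single_cell PX Mi Ia Pb ab; subst j.
by rewrite (chartI PX (interior_subset Ia) Pb ab).
Qed.

Definition cellwise (N : forall i, set (Rk R (cdim i))) : set S :=
  [set x | exists i (t : Rk R (cdim i)),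
    [/\ maximal_cell X i, inner (cpoly i) t, N i t & x = chart (vec t)]].

Lemma chart_pre_cellwise N j : maximal_cell X j ->
  @chart_pre R T X j (cellwise N) = inner (cpoly j) `&` N j.
Proof.
move=> Mj; apply/seteqP; split=> t.
- move=> [Pt [i [s [Mi Is Ns e]]]].
  have ji := single_cell PX Mi Is Pt (esym e); subst j.
  suff -> : t = s by [].
  by apply: (can_inj (@vecK R _)); exact: (chartI PX Pt (interior_subset Is) e).
- by move=> [It Nt]; split; [exact: interior_subset|exists j, t].
Qed.

Lemma chart_pre_cellwise0 N j : ~ maximal_cell X j -> @chart_pre R T X j (cellwise N) = set0.
Proof.
move=> nMj; apply/seteqP; split=> // t [Pt [i [s [Mi Is Ns e]]]].
by have ji := single_cell PX Mi Is Pt (esym e); subst j.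
Qed.

Lemma measurable_cellwise (N : forall i, set (Rk R (cdim i))) :
  (forall i, maximal_cell X i -> measurable (inner (cpoly i) `&` N i)) ->
  measurable (cellwise N).
Proof.
move=> mN; suff : @msets R T X (cellwise N) by [].
move=> j; have [Mj|nMj] := pselect (maximal_cell X j).
- by rewrite chart_pre_cellwise//; exact: mN.
- by rewrite chart_pre_cellwise0.
Qed.

Lemma ae_cells (Q : S -> Prop) :
  (forall i, maximal_cell X i ->
     {ae leb (cdim i), forall t, inner (cpoly i) t -> Q (chart (vec t))}) ->
  {ae mu X, forall x, Q x}.
Proof.
move=> aeQ.
have H : forall i, exists N : set (Rk R (cdim i)), maximal_cell X i ->
    [/\ measurable N, leb (cdim i) N = 0%E & forall t, inner (cpoly i) t -> ~ N t -> Q (chart (vec t))].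
  move=> i; have [Mi|nMi] := pselect (maximal_cell X i); last by exists set0.
  have [N [mN N0 QN]] := aeQ i Mi; exists N => _; split=> // t It nNt.
  by apply: contrapT => nQ; apply: nNt; apply: QN => /(_ It).
pose N i := sval (cid (H i)); have NP i := svalP (cid (H i)).
pose G := cellwise (fun i => ~` N i).
have mG : measurable G.
  apply: measurable_cellwise => i Mi; have [mN _ _] := NP i Mi.
  by apply: measurableI; [exact: measurable_inner|exact: measurableC].
exists (~` G); split; first exact: measurableC.
- apply: esum1 => i Mi; have [mN N0 _] := NP i Mi.
  apply: (@subset_measure0 _ _ _ (leb (cdim i)) _ ((cell_body i `\` inner (cpoly i)) `|` N i)).
  + by apply: measurable_chart_pre; exact: measurableC.
  + apply: measurableU => //; apply: measurableD; last exact: measurable_inner.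
    exact: measurable_cell_body.
  + move=> t [Pt nGt]; have [It|nIt] := pselect (inner (cpoly i) t); last by left.
    by right; apply: contrapT => nNt; apply: nGt; exists i, t.
  + have mB : measurable (cell_body i `\` inner (cpoly i)).
      by apply: measurableD; [exact: measurable_cell_body|exact: measurable_inner].
    exact: (etrans (@measureU0 _ _ _ (leb (cdim i)) _ _ mB mN N0) (boundary_null _)).
- move=> x nQx [i [t [Mi It nNt xE]]]; apply: nQx; rewrite xE.
  by have [_ _] := NP i Mi; exact.
Qed.

End structure.
End integration.

(** * Square-integrable functions *)

Lemma exp2V_cvg {R : realType} (c : R) : (c * 2 ^- k) @[k --> \oo] --> 0.
Proof.
rewrite -(mulr0 c); apply: cvgMr; rewrite (_ : (fun _ => _) = GRing.exp (2^-1 : R)).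
  by apply: cvg_expr; rewrite ger0_norm; lra.
by apply/funext => k; rewrite exprVn.
Qed.

Lemma geometric_cauchy {R : realType} (u : nat -> R) C : 0 <= C ->
  (forall k, `|u k.+1 - u k| <= C * 2 ^- k) ->
  exists2 l, u k @[k --> \oo] --> l & forall k, `|u k - l| <= 2 * C * 2 ^- k.
Proof.
move=> C0 uC; have E k : 2 ^- k.+1 = 2 ^- k / 2 :> R by rewrite exprSr invfM mulrC.
pose a k := u k + 2 * C * 2 ^- k; pose b k := u k - 2 * C * 2 ^- k.
have na : nonincreasing_seq a.
  apply/nonincreasing_seqP => k; rewrite /a E; have := uC k.
  by rewrite ler_norml => /andP[_ h]; lra.
have nb : nondecreasing_seq b.
  apply/nondecreasing_seqP => k; rewrite /b E; have := uC k.
  by rewrite ler_norml => /andP[h _]; lra.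
have ba k : b k <= a k.
  have : 0 <= 2 * C * 2 ^- k by rewrite !mulr_ge0 ?invr_ge0 ?exprn_ge0.
  by rewrite /a /b; lra.
have cva : cvgn a.
  apply: nonincreasing_is_cvgn => //; exists (b 0%N) => _ [k _ <-].
  by apply: le_trans (ba k); exact: nb.
have ul : u k @[k --> \oo] --> limn a.
  rewrite -[limn a]subr0 (_ : (fun k => u k) = (fun k => a k - 2 * C * 2 ^- k)).
    by apply: cvgB => //; exact: exp2V_cvg.
  by apply/funext => k; rewrite /a addrK.
have bl : b k @[k --> \oo] --> limn a.
  by rewrite -[limn a]subr0; apply: cvgB => //; exact: exp2V_cvg.
exists (limn a) => // k; rewrite ler_distlC; apply/andP; split.
- have -> : limn a = limn b by apply/esym/cvg_lim.
  by apply: (@nondecreasing_cvgn_le _ b) => //; apply/cvg_ex; exists (limn a).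
- exact: nonincreasing_cvgn_ge.
Qed.

Lemma fine_integral_lin d (T : measurableType d) (R : realType)
    (m : {measure set T -> \bar R}) (a : R) (f g h : T -> R) :
  m.-integrable setT (fun x => (f x)%:E) -> m.-integrable setT (fun x => (g x)%:E) ->
  measurable_fun setT h -> {ae m, forall x, h x = a * f x + g x} ->
  fine (\int[m]_x (h x)%:E) = a * fine (\int[m]_x (f x)%:E) + fine (\int[m]_x (g x)%:E).
Proof.
move=> intf intg mh hE; apply/EFin_inj; rewrite EFinD EFinM.
rewrite (@ae_eq_integral _ _ _ _ _ (fun x => a%:E * (f x)%:E + (g x)%:E)%E); last 4 first.
- exact: measurableT.
- exact/measurable_EFinP.
- apply: emeasurable_funD; last exact: measurable_int intg.
  by apply: measurable_funeM; exact: measurable_int intf.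
- have AF : Filter (almost_everywhere m) by exact: ae_filter_ringOfSetsType.
  by apply: filterS hE => x -> _; rewrite EFinD EFinM.
rewrite integralD//; last by apply: integrableZl.
rewrite integralZl// fineD ?fineM ?EFinD ?EFinM ?fineK//.
all: try exact: integrable_fin_num.
by rewrite fin_numM// integrable_fin_num.
Qed.

Section square_integrable.
Context d (T : measurableType d) (R : realType).
Variable m : {measure set T -> \bar R}.
Implicit Types (f g h : T -> R) (w : T -> R).

Definition sqi f := measurable_fun setT f /\ (\int[m]_x (f x ^+ 2)%:E < +oo)%E.

(* Locked, so that comparing two inner products never unfolds the integrals. *)
Definition ip : (T -> R) -> (T -> R) -> R :=
  locked (fun f g => fine (\int[m]_x (f x * g x)%:E)%E).

Lemma ip_def f g : ip f g = fine (\int[m]_x (f x * g x)%:E)%E.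
Proof. by rewrite /ip -lock. Qed.

Lemma sqi_integrable f g : sqi f -> sqi g -> m.-integrable setT (fun x => (f x * g x)%:E).
Proof.
move=> [mf ff] [mg gg]; apply/integrableP; split.
  by apply/measurable_EFinP; exact: measurable_funM.
apply: (@le_lt_trans _ _ (\int[m]_x (f x ^+ 2 + g x ^+ 2)%:E)%E).
  under eq_integral do rewrite abse_EFin.
  apply: rintegral_le => //.
  - by apply: measurableT_comp => //; exact: measurable_funM.
  - by apply: measurable_funD; exact: measurable_funX.
  - move=> x _; rewrite ler_norml; have := sqr_ge0 (f x + g x); have := sqr_ge0 (f x - g x).
    have := sqr_ge0 (f x); have := sqr_ge0 (g x).
    by rewrite !expr2 => h1 h2 h3 h4; apply/andP; split; nra.
rewrite rintegralD//; last 4 first.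
- exact: measurable_funX.
- exact: measurable_funX.
- by move=> x; exact: sqr_ge0.
- by move=> x; exact: sqr_ge0.
exact: lte_add_pinfty.
Qed.

Lemma sqiZ (a : R) f : sqi f -> sqi (fun x => a * f x).
Proof.
move=> [mf ff]; split; first exact: measurable_funM.
under eq_integral do rewrite exprMn.
rewrite rintegralZ//.
- by apply: lte_mul_pinfty => //; rewrite lee_fin sqr_ge0.
- exact: measurable_funX.
- by move=> x; exact: sqr_ge0.
- exact: sqr_ge0.
Qed.

Lemma sqiD f g : sqi f -> sqi g -> sqi (fun x => f x + g x).
Proof.
move=> sf sg; have [mf ff] := sf; have [mg gg] := sg; split; first exact: measurable_funD.
apply: (@le_lt_trans _ _ (\int[m]_x (2 * f x ^+ 2 + 2 * g x ^+ 2)%:E)%E).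
  apply: rintegral_le => //.
  - by apply: measurable_funX; exact: measurable_funD.
  - by apply: measurable_funD; apply: measurable_funM => //; exact: measurable_funX.
  - by move=> x; exact: sqr_ge0.
  - by move=> x _; have := sqr_ge0 (f x - g x); rewrite !expr2; nra.
rewrite rintegralD//; last 4 first.
- by apply: measurable_funM => //; exact: measurable_funX.
- by apply: measurable_funM => //; exact: measurable_funX.
- by move=> x; rewrite mulr_ge0// sqr_ge0.
- by move=> x; rewrite mulr_ge0// sqr_ge0.
rewrite !rintegralZ//; last 4 first.
- exact: measurable_funX.
- by move=> x; exact: sqr_ge0.
- exact: measurable_funX.
- by move=> x; exact: sqr_ge0.
by apply: lte_add_pinfty; apply: lte_mul_pinfty.
Qed.

Lemma sqi_lin (a : R) f g : sqi f -> sqi g -> sqi (fun x => a * f x + g x).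
Proof. by move=> sf sg; apply: sqiD => //; exact: sqiZ. Qed.

Lemma sqi_mul w f B : measurable_fun setT w -> (forall x, `|w x| <= B) -> sqi f ->
  sqi (fun x => w x * f x) /\ ip (fun x => w x * f x) (fun x => w x * f x) <= B ^+ 2 * ip f f.
Proof.
move=> mw wB sf; have [mf ff] := sf.
have le : (\int[m]_x ((w x * f x) ^+ 2)%:E <= (B ^+ 2)%:E * \int[m]_x (f x ^+ 2)%:E)%E.
  rewrite -rintegralZ//; last 3 first.
  - exact: measurable_funX.
  - by move=> x; exact: sqr_ge0.
  - exact: sqr_ge0.
  apply: rintegral_le => //.
  - by apply: measurable_funX; exact: measurable_funM.
  - by apply: measurable_funM => //; exact: measurable_funX.
  - by move=> x; exact: sqr_ge0.
  - move=> x _; rewrite exprMn ler_wpM2r ?sqr_ge0//.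
    rewrite -[w x ^+ 2]real_normK ?num_real// lerXn2r ?nnegrE//.
    exact: le_trans (wB x).
have fin_f : (\int[m]_x (f x ^+ 2)%:E)%E \is a fin_num.
  by rewrite ge0_fin_numE//; apply: integral_ge0 => x _; rewrite lee_fin sqr_ge0.
have swf : sqi (fun x => w x * f x).
  split; first exact: measurable_funM.
  by apply: le_lt_trans le _; rewrite -(fineK fin_f) -EFinM ltry.
split=> //; rewrite !ip_def -lee_fin EFinM fineK; last first.
  rewrite ge0_fin_numE; first exact: swf.2.
  by apply: integral_ge0 => x _; rewrite lee_fin -expr2 sqr_ge0.
rewrite fineK//.
Qed.

Lemma ip_EFin f g : sqi f -> sqi g -> (\int[m]_x (f x * g x)%:E)%E = (ip f g)%:E.
Proof.
by move=> sf sg; rewrite ip_def fineK//; apply: integrable_fin_num => //; exact: sqi_integrable.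
Qed.

Lemma ipE f : sqi f -> (\int[m]_x (f x ^+ 2)%:E)%E = (ip f f)%:E.
Proof. by move=> sf; rewrite -ip_EFin//; apply: eq_integral => x _; rewrite expr2. Qed.

Lemma ipC f g : ip f g = ip g f.
Proof. by rewrite !ip_def; congr fine; apply: eq_integral => x _; rewrite mulrC. Qed.

Lemma ip_ge0 f : 0 <= ip f f.
Proof.
by rewrite ip_def; apply: fine_ge0; apply: integral_ge0 => x _; rewrite lee_fin -expr2 sqr_ge0.
Qed.

Lemma ip_lin (a : R) f g h : sqi f -> sqi g -> sqi h ->
  ip (fun x => a * f x + g x) h = a * ip f h + ip g h.
Proof.
move=> sf sg sh; apply/EFin_inj; rewrite -ip_EFin//; last exact: sqi_lin.
rewrite EFinD EFinM -!ip_EFin// -integralZl//; last exact: sqi_integrable.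
rewrite -integralD//.
- by apply: eq_integral => x _; rewrite mulrDl -mulrA.
- by apply: integrableZl => //; exact: sqi_integrable.
- exact: sqi_integrable.
Qed.

Lemma ip_ae f f' g : measurable_fun setT f -> measurable_fun setT f' ->
  measurable_fun setT g -> {ae m, forall x, f x = f' x} -> ip f g = ip f' g.
Proof.
move=> mf mf' mg ff'; rewrite !ip_def; congr fine; apply: ae_eq_integral => //.
- by apply/measurable_EFinP; exact: measurable_funM.
- by apply/measurable_EFinP; exact: measurable_funM.
have AF : Filter (almost_everywhere m) by exact: ae_filter_ringOfSetsType.
by apply: filterS ff' => x -> _.
Qed.

(** The Riesz-Fischer theorem, for geometrically Cauchy sequences. *)
Lemma sqi_complete (u : nat -> T -> R) :
  (forall k, sqi (u k)) ->
  (forall k, ip (fun x => u k.+1 x - u k x) (fun x => u k.+1 x - u k x) <= 8 ^- k) ->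
  exists2 f, sqi f &
    ip (fun x => u k x - f x) (fun x => u k x - f x) @[k --> \oo] --> 0.
Proof.
move=> su uC; pose q k x := 4 ^+ k * (u k.+1 x - u k x) ^+ 2.
have sd k : sqi (fun x => u k.+1 x - u k x).
  rewrite (_ : (fun x => _) = (fun x => -1 * u k x + u k.+1 x)); first exact: sqi_lin.
  by apply/funext => x; rewrite mulN1r addrC.
have mq k : measurable_fun setT (q k).
  by apply: measurable_funM => //; apply: measurable_funX; have [] := sd k.
have q0 k x : 0 <= q k x by apply: mulr_ge0; [exact: exprn_ge0|exact: sqr_ge0].
pose g x := (\sum_(0 <= k <oo) (q k x)%:E)%E.
have mg : measurable_fun setT g.
  apply: ge0_emeasurable_sum => // [k x _ _|k _]; first by rewrite lee_fin.
  exact/measurable_EFinP.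
have g0 x : (0 <= g x)%E by apply: nneseries_ge0 => k _ _; rewrite lee_fin.
have qg k x : ((q k x)%:E <= g x)%E.
  have h := @nneseries_lim_ge R (fun k => (q k x)%:E) xpredT 0 k.+1.
  apply: le_trans (h _) => [|i _ _]; last by rewrite lee_fin.
  rewrite big_nat_recr//= leeDr//; apply: sume_ge0 => i _; by rewrite lee_fin.
have ig : (\int[m]_x g x < +oo)%E.
  rewrite integral_nneseries//; last 2 first.
  - by move=> k; exact/measurable_EFinP.
  - by move=> k x _; rewrite lee_fin.
  apply: (@le_lt_trans _ _ (\sum_(0 <= k <oo) ((1 / 2 ^+ k)%R%:E))%E).
    apply: lee_nneseries => [k _ _|k _].
      by apply: integral_ge0 => x _; rewrite lee_fin.
    rewrite rintegralZ//; last 2 first.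
    - by apply: measurable_funX; have [] := sd k.
    - by move=> x; exact: sqr_ge0.
    rewrite ipE// -EFinM lee_fin; apply: le_trans (ler_wpM2l _ (uC k)) _ => //.
    rewrite -expr_div_n (_ : 4 / 8 = 2^-1); last lra.
    by rewrite exprVn div1r.
  have h := @cvg_geometric_eseries_half R 2 0; rewrite expr0 divr1 in h.
  rewrite (_ : (\sum_(0 <= k <oo) _)%E = 2%:E) ?ltry//; apply/cvg_lim => //.
  apply: cvg_trans h; apply: near_eq_cvg; apply: nearW => k.
  rewrite /eseries; apply: eq_bigr => i _; rewrite natrX addn1 exprS; congr (_%:E).
  by field; rewrite expf_neq0.
pose D := [set x | (g x < +oo)%E].
have mD : measurable D.
  by rewrite -[D]setTI; apply: emeasurable_fun_infty_o => //.
pose v k x := \1_D x * u k x.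
have V4 k : (2 ^- k) ^+ 2 = 4 ^- k :> R.
  by rewrite -exprVn exprAC -[RHS]exprVn; congr (_ ^+ _); field.
have b0 x k : 0 <= Num.sqrt (fine (g x)) * 2 ^- k.
  by rewrite mulr_ge0 ?sqrtr_ge0 ?invr_ge0 ?exprn_ge0.
have vq k x : `|v k.+1 x - v k x| <= Num.sqrt (fine (g x)) * 2 ^- k.
  rewrite /v -mulrBr normrM.
  have [Dx|nDx] := pselect (D x); last first.
    by rewrite indicE memNset// normr0 mul0r mulr_ge0 ?sqrtr_ge0 ?invr_ge0 ?exprn_ge0.
  rewrite indicE mem_set// normr1 mul1r -(@ler_pXn2r _ 2) ?nnegrE ?b0//.
  rewrite real_normK ?num_real// exprMn sqr_sqrtr ?fine_ge0//.
  rewrite V4 ler_pdivlMr ?exprn_gt0// mulrC.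
  by have := qg k x; rewrite -(@fineK _ (g x)) ?ge0_fin_numE// lee_fin /q.
have cv x := geometric_cauchy (sqrtr_ge0 (fine (g x))) (vq ^~ x).
pose f x := sval (cid2 (cv x)).
have fP x : v k x @[k --> \oo] --> f x by rewrite /f; case: cid2.
have fQ x k : `|v k x - f x| <= 2 * Num.sqrt (fine (g x)) * 2 ^- k.
  by rewrite /f; case: cid2 => l /= _ h; exact: h.
have mf : measurable_fun setT f.
  apply: (measurable_fun_cvg (h := v)) => [k|x _]; last exact: fP.
  by apply: measurable_funM; [exact: measurable_indic|have [] := su k].
have near_f k : (\int[m]_x ((u k x - f x) ^+ 2)%:E <=
    (4 * 4 ^- k)%:E * \int[m]_x g x)%E.
  rewrite -ge0_integralZl_EFin//.
  apply: ge0_le_integral => //.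
  - by move=> x _; rewrite lee_fin sqr_ge0.
  - by apply/measurable_EFinP; apply: measurable_funX; apply: measurable_funB => //; have [] := su k.
  - by apply: measurable_funeM.
  move=> x _; have [Dx|nDx] := pselect (D x); last first.
    have -> : g x = +oo%E by apply/eqP; rewrite eq_le leey leNgt; apply/negP.
    by rewrite gt0_muley ?leey// lte_fin mulr_gt0// invr_gt0 exprn_gt0.
  rewrite -(@fineK _ (g x)) ?ge0_fin_numE// -EFinM lee_fin.
  have uf : `|u k x - f x| <= 2 * (Num.sqrt (fine (g x)) * 2 ^- k).
    by have := fQ x k; rewrite {1}/v indicE mem_set// mul1r mulrA.
  rewrite -[X in X <= _]real_normK ?num_real//.
  apply: le_trans (_ : _ <= (2 * (Num.sqrt (fine (g x)) * 2 ^- k)) ^+ 2) _.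
    by rewrite lerXn2r ?nnegrE// mulr_ge0.
  by rewrite !exprMn sqr_sqrtr ?fine_ge0// V4; lra.
have ig_fin : (\int[m]_x g x)%E \is a fin_num.
  by rewrite ge0_fin_numE//; apply: integral_ge0.
have sr k : sqi (fun x => u k x - f x).
  split; first by apply: measurable_funB => //; have [] := su k.
  by apply: le_lt_trans (near_f k) _; rewrite -(fineK ig_fin) -EFinM ltry.
exists f.
  rewrite (_ : f = (fun x => -1 * (u 0%N x - f x) + u 0%N x)); first exact: sqi_lin.
  by apply/funext => x; rewrite mulN1r opprB subrK.
apply: (@squeeze_cvgr _ _ _ _ (cst 0) (fun k => 4 * fine (\int[m]_x g x)%E * 2 ^- k)).
- apply: nearW => k; rewrite ip_ge0 /= -lee_fin -ipE//.
  apply: le_trans (near_f k) _; rewrite -(fineK ig_fin) -EFinM lee_fin.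
  rewrite mulrAC ler_wpM2l ?mulr_ge0 ?fine_ge0//; first by apply: integral_ge0.
  rewrite lef_pV2 ?posrE ?exprn_gt0//.
  by rewrite lerXn2r ?nnegrE//; lra.
- exact: cvg_cst.
- exact: exp2V_cvg.
Qed.

End square_integrable.

Lemma Lfun_sqi d (T : measurableType d) (R : realType) (m : {measure set T -> \bar R}) (f : T -> R) :
  f \in Lfun m 2%:E <-> sqi m f.
Proof.
have sq0 : (0 <= \int[m]_x (f x ^+ 2)%:E)%E.
  by apply: integral_ge0 => x _; rewrite lee_fin sqr_ge0.
have E : ('N[m]_2%:E[EFin \o f] `^ 2 = \int[m]_x (f x ^+ 2)%:E)%E.
  rewrite poweR_Lnorm//; apply: eq_integral => x _.
  by rewrite (_ : `|(EFin \o f) x|%E = (`|f x|)%:E)// poweR_EFin powR_mulrn// real_normK ?num_real.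
split=> [|[mf ff]].
- rewrite inE => /andP[]; rewrite !inE /= => mf; rewrite /finite_norm => nf.
  by split=> //; rewrite -E; apply: poweR_lty.
- rewrite inE; apply/andP; split; rewrite inE //=.
  rewrite /finite_norm ltNge leye_eq; apply/eqP => h; move: ff; rewrite -E h.
  by rewrite poweRyr.
Qed.

Lemma norm2_sqi d (T : measurableType d) (R : realType) (m : {measure set T -> \bar R}) (f : T -> R) :
  sqi m f -> ('N[m]_2%:E[EFin \o f])%E = (Num.sqrt (ip m f f))%:E.
Proof.
move=> sf; have N0 := Lnorm_ge0 m 2%:E (EFin \o f).
have : ('N[m]_2%:E[EFin \o f] `^ 2 = (ip m f f)%:E)%E.
  rewrite poweR_Lnorm// -ipE//; apply: eq_integral => x _.
  by rewrite (_ : `|(EFin \o f) x|%E = (`|f x|)%:E)// poweR_EFin powR_mulrn// real_normK ?num_real.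
case: ('N[m]_2%:E[EFin \o f])%E N0 => [r||]//.
- rewrite lee_fin => r0; rewrite poweR_EFin powR_mulrn// => -[<-].
  by rewrite sqrtr_sqr ger0_norm.
- by rewrite poweRyr.
Qed.

(** * Lipschitz functions and their gradients on a complex *)

Lemma seq_le {R : realType} (u v : nat -> R) l l' :
  u k @[k --> \oo] --> l -> v k @[k --> \oo] --> l' -> (forall k, u k <= v k) -> l <= l'.
Proof.
move=> cu cv uv; rewrite -subr_ge0; apply: (cvgr_to_ge (cvgB cv cu)).
by apply: nearW => k; rewrite -[X in 0 <= X]/(v k - u k) subr_ge0.
Qed.

Section lipschitz_complex.
Context {R : realType} {T : pointedType} (X : pcomplex R T).
Hypothesis PX : polyhedral_complex X.
Local Notation S := (points X).
Implicit Types (x y z : S) (i : cell X) (f g h u : S -> R).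
Local Notation spath := (@segment_path R T X).
Local Notation ed := (@path_edist R T X).

(** Lipschitz along paths; unlike a bound by the possibly infinite distance this
   composes well. *)
Definition lipX (L : R) f := forall y z l, spath y z l -> `|f y - f z| <= L * l.

Lemma lipX_edist L f : 0 <= L -> (forall x y, (`|f x - f y|%:E <= L%:E * ed x y)%E) ->
  lipX L f.
Proof.
move=> L0 fL y z l yz; rewrite -lee_fin; apply: le_trans (fL y z) _.
by rewrite EFinM; apply: lee_wpmul2l; rewrite ?lee_fin//; exact: edist_le.
Qed.

Lemma edist_lipX L f : 0 < L -> lipX L f ->
  forall x y, (`|f x - f y|%:E <= L%:E * ed x y)%E.
Proof.
move=> L0 fL x y; rewrite -lee_pdivrMl// -EFinM.
apply: le_ereal_inf_tmp => _ [l xy <-]; rewrite lee_fin ler_pdivrMl//; exact: fL.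
Qed.

Lemma lipX_le L L' f : L <= L' -> lipX L f -> lipX L' f.
Proof.
move=> LL fL y z l yz; apply: le_trans (fL _ _ _ yz) _.
by apply: ler_wpM2r => //; exact: path_ge0 yz.
Qed.

Lemma lipX_lin a L L' f g : lipX L f -> lipX L' g ->
  lipX (`|a| * L + L') (fun x => a * f x + g x).
Proof.
move=> fL gL y z l yz; rewrite mulrDl.
rewrite (_ : _ - _ = a * (f y - f z) + (g y - g z)); last ring.
apply: le_trans (ler_normD _ _) _; rewrite normrM -mulrA.
by apply: lerD; [apply: ler_wpM2l => //; exact: fL|exact: gL].
Qed.

Lemma lipX_mul A B L L' f g : (forall x, `|f x| <= A) -> (forall x, `|g x| <= B) ->
  lipX L f -> lipX L' g -> lipX (A * L' + B * L) (fun x => f x * g x).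
Proof.
move=> fA gB fL gL y z l yz; rewrite mulrDl.
rewrite (_ : _ - _ = f y * (g y - g z) + g z * (f y - f z)); last ring.
apply: le_trans (ler_normD _ _) _; rewrite !normrM -!mulrA.
by apply: lerD; apply: ler_pM => //; [exact: gL|exact: fL].
Qed.

Lemma lipX_comp K L (th : R -> R) f : 0 <= K -> (forall a b, `|th a - th b| <= K * `|a - b|) ->
  lipX L f -> lipX (K * L) (fun x => th (f x)).
Proof.
move=> K0 thK fL y z l yz; apply: le_trans (thK _ _) _; rewrite -mulrA.
by apply: ler_wpM2l => //; exact: fL.
Qed.

Lemma lipX_cell L f i (a b : 'rV[R]_(cdim i)) : lipX L f -> body (cpoly i) a ->
  body (cpoly i) b -> `|f (chart a) - f (chart b)| <= L * enorm (a - b).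
Proof.
by move=> fL Pa Pb; rewrite enormC; apply: fL; exact: path_chart.
Qed.

Lemma lipX_continuous L f : 0 <= L -> lipX L f -> continuous f.
Proof.
move=> L0 fL x; apply/(@cvgrPdist_lt _ _ _ _ (nbhs_filter x)) => e e0; apply/nbhs_cballP.
exists (e / (L + 1)); first by rewrite divr_gt0//; lra.
move=> y /edist_ltP[l xy]; rewrite ltr_pdivlMr; last lra.
have l0 := path_ge0 xy => le /=; apply: le_lt_trans (fL _ _ _ xy) _; nra.
Qed.

Lemma lipX_measurable L f : 0 <= L -> lipX L f -> measurable_fun setT f.
Proof.
move=> L0 fL; have cf := lipX_continuous L0 fL.
apply: (measurability _ (RGenOInfty.measurableE R)) => //.
move=> _ [_ [x ->] <-]; rewrite setTI; apply: open_msets => //.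
rewrite (_ : _ @^-1` _ = f @^-1` [set y | x < y]); last first.
  by apply/seteqP; split => y /=; rewrite in_itv/= andbT.
by apply: open_comp => [y _|]; [exact: cf|exact: open_gt].
Qed.

(** ** The squared gradient *)

Definition located x (p : {i : cell X & 'rV[R]_(cdim i)}) :=
  [/\ maximal_cell X (tag p), (body (cpoly (tag p)))° (tagged p) & x = chart (tagged p)].

Lemma located_unique x p q : located x p -> located x q -> p = q.
Proof.
case: p => i a; case: q => j b [/= Mi Ia ->] [/= Mj Ib ab].
by rewrite -(interior_unique PX Mi Ia (interior_subset Ib) ab).
Qed.

Definition cgrad f i (a : 'rV[R]_(cdim i)) := grad (fun w : 'rV[R]_(cdim i) => f (chart w)) a.

(** The carre du champ as a function of the points of the complex rather than of the
   charts, which makes energies single integrals; the interior of a maximal cell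
   carries a unique chart and the rest is a null set. *)
Definition Gam f g x : R :=
  if pselect (exists p, located x p) is left h then
    dot (cgrad f (tagged (sval (cid h)))) (cgrad g (tagged (sval (cid h))))
  else 0.

Lemma GamE f g i (a : 'rV[R]_(cdim i)) : maximal_cell X i -> (body (cpoly i))° a ->
  Gam f g (chart a) = dot (cgrad f a) (cgrad g a).
Proof.
move=> Mi Ia; rewrite /Gam; case: pselect => [h|[]]; last by exists (existT _ i a).
have lp := svalP (cid h).
have la : located (chart a) (existT _ i a) by [].
by rewrite (located_unique lp la).
Qed.

Lemma Gam_out f g x : ~ (exists p, located x p) -> Gam f g x = 0.
Proof. by rewrite /Gam; case: pselect. Qed.

Lemma GamC f g x : Gam f g x = Gam g f x.
Proof. by rewrite /Gam; case: pselect => // h; rewrite dotC. Qed.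

Lemma Gam_ge0 f x : 0 <= Gam f f x.
Proof. by rewrite /Gam; case: pselect => // h; rewrite dot_ge0. Qed.

Definition diffpt f x := (exists p, located x p) /\
  forall p, located x p ->
    forall j, derivable (fun w : 'rV[R]_(cdim (tag p)) => f (chart w)) (tagged p) (delta_mx 0 j).

Lemma ae_located (Q : S -> Prop) :
  (forall i, maximal_cell X i -> {ae leb (cdim i), forall t, inner (cpoly i) t ->
     forall x, located x (existT _ i (vec t)) -> Q x}) -> {ae mu X, forall x, Q x}.
Proof.
move=> h; apply: ae_cells => // i Mi.
have AF : Filter (almost_everywhere (leb (cdim i) : set (Rk R (cdim i)) -> \bar R)).
  exact: ae_filter_ringOfSetsType.
by apply: filterS (h i Mi) => t ht It; apply: ht.
Qed.

Lemma ae_diffpt L f : 0 <= L -> lipX L f -> {ae mu X, forall x, diffpt f x}.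
Proof.
move=> L0 fL; apply: ae_located => i Mi.
have AF : Filter (almost_everywhere (leb (cdim i) : set (Rk R (cdim i)) -> \bar R)).
  exact: ae_filter_ringOfSetsType.
apply: filterS (ae_derivable_inner (P := cpoly i) L0 (fun a b => lipX_cell fL)) => t dt It x lx.
split; first by exists (existT _ i (vec t)).
by move=> p /(located_unique lx) <-; exact: dt.
Qed.

Lemma ae_Gam_le L f : 0 <= L -> lipX L f -> {ae mu X, forall x, Gam f f x <= L ^+ 2}.
Proof.
move=> L0 fL; apply: ae_located => i Mi.
have AF : Filter (almost_everywhere (leb (cdim i) : set (Rk R (cdim i)) -> \bar R)).
  exact: ae_filter_ringOfSetsType.
apply: filterS (grad_le_inner (P := cpoly i) L0 (fun a b => lipX_cell fL)) => t dt It x [_ _ ->].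
by rewrite GamE// -sqr_enorm lerXn2r ?nnegrE ?enorm_ge0//; exact: dt.
Qed.

Lemma measurable_Gam L L' f g : 0 <= L -> 0 <= L' -> lipX L f -> lipX L' g ->
  measurable_fun setT (Gam f g).
Proof.
move=> L0 L'0 fL gL; pose G i t := dot (cgrad f (vec t)) (cgrad g (vec t) : 'rV[R]_(cdim i)).
have mG i : measurable_fun (inner (cpoly i)) (@G i).
  apply: measurable_sum => j; rewrite /cgrad /grad.
  under eq_fun do rewrite !mxE; apply: measurable_funM.
  - exact: (measurable_derive_inner (P := cpoly i) L0 (fun a b => lipX_cell fL)).
  - exact: (measurable_derive_inner (P := cpoly i) L'0 (fun a b => lipX_cell gL)).
apply: (measurability _ (RGenOInfty.measurableE R)) => //.
move=> _ [_ [r ->] <-]; rewrite setTI.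
have mgl (N : forall i, set (Rk R (cdim i))) :
    (forall i, maximal_cell X i -> measurable (inner (cpoly i) `&` N i)) -> measurable (cellwise N).
  exact: measurable_cellwise.
rewrite (_ : _ @^-1` _ = cellwise (fun i => [set t | r < @G i t]) `|`
    (~` (cellwise (fun i => setT)) `&` [set _ | r < 0])); last first.
  apply/seteqP; split=> x /=; rewrite in_itv/= andbT.
  - have [[[i a] [/= Mi Ia xE]]|nl] := pselect (exists p, located x p).
    + rewrite xE GamE// => ra; left; exists i, (unvec a).
      by rewrite /inner /G /preimage /= unvecK.
    + rewrite Gam_out// => r0; right; split=> // -[i [t [Mi It _ xE]]].
      by apply: nl; exists (existT _ i (vec t)).
  - move=> [[i [t [Mi It rG ->]]]|[nG r0]]; first by rewrite GamE.
    rewrite Gam_out// => -[[i a] [/= Mi Ia xE]]; apply: nG; exists i, (unvec a).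
    by rewrite /inner /preimage /= unvecK.
apply: measurableU.
- apply: mgl => i Mi; rewrite -[X in measurable X]/(inner (cpoly i) `&` @G i @^-1` [set y | r < y]).
  apply: mG; first exact: measurable_inner.
  rewrite (_ : [set y | r < y] = `]r, +oo[%classic)//.
  by apply/seteqP; split => y /=; rewrite in_itv/= andbT.
- apply: measurableI.
  + by apply: measurableC; apply: mgl => i Mi; rewrite setIT; exact: measurable_inner.
  + have [r0|r0] := ltP r 0.
      by rewrite (_ : [set _ | _] = setT)//; apply/seteqP; split.
    by rewrite (_ : [set _ | _] = set0)//; apply/seteqP; split.
Qed.

Lemma Gam_lin a f g h x : diffpt f x -> diffpt g x ->
  Gam (fun y => a * f y + g y) h x = a * Gam f h x + Gam g h x.
Proof.
move=> [[[i b] lx] df] [_ dg]; have [/= Mi Ib xE] := lx.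
rewrite xE !GamE// -dotZl -dotDl; congr dot; apply/rowP => j; rewrite !mxE.
have dfj := df _ lx j; have dgj := dg _ lx j.
transitivity ('D_(delta_mx 0 j) (a *: (fun w : 'rV[R]_(cdim i) => f (chart w)) +
    (fun w : 'rV[R]_(cdim i) => g (chart w))) b) => //.
by rewrite (deriveD (derivableZ dfj) dgj) (deriveZ _ dfj).
Qed.

Lemma cgradM f g x p : diffpt f x -> diffpt g x -> located x p ->
  cgrad (fun y => f y * g y) (tagged p) =
  f x *: cgrad g (tagged p) + g x *: cgrad f (tagged p).
Proof.
move=> [_ df] [_ dg] lx; have [_ _ xE] := lx; apply/rowP => j; rewrite !mxE.
have dfj := df _ lx j; have dgj := dg _ lx j.
transitivity ('D_(delta_mx 0 j) ((fun w : 'rV[R]_(cdim (tag p)) => f (chart w)) *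
    (fun w : 'rV[R]_(cdim (tag p)) => g (chart w))) (tagged p)) => //.
by rewrite (deriveM dfj dgj) -xE.
Qed.

(** Difference quotients along [delta_mx 0 j] suffice for the sign. *)
Lemma Gam_mono (th : R -> R) u x : {homo th : a b / a <= b} ->
  diffpt u x -> diffpt (fun y => th (u y)) x -> 0 <= Gam u (fun y => th (u y)) x.
Proof.
move=> mth [[[i b] lx] du] [_ dth]; have [/= Mi Ib xE] := lx.
rewrite xE GamE//; apply: sumr_ge0 => j _; rewrite !mxE.
have h0 k : harm k != 0 :> R by apply/lt0r_neq0/harm_gt0.
have cu := quot_cvg (du _ lx j) h0 harm_cvg.
have cth := quot_cvg (dth _ lx j) h0 harm_cvg.
apply: (cvgr_to_ge (cvgM cu cth)); apply: nearW => k; rewrite /quot /= mulrACA.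
apply: mulr_ge0; first by rewrite -expr2 sqr_ge0.
set p := u _; set q := u _.
have [pq|qp] := leP p q.
- by apply: mulr_le0; rewrite subr_le0// mth.
- by apply: mulr_ge0; rewrite subr_ge0 ?mth// ltW.
Qed.

Lemma cgrad_exp (xi : R) f x p : diffpt f x -> diffpt (fun y => expR (xi * f y)) x ->
  located x p ->
  cgrad (fun y => expR (xi * f y)) (tagged p) = (xi * expR (xi * f x)) *: cgrad f (tagged p).
Proof.
move=> [_ df] [_ dw] lx; have [_ _ xE] := lx; apply/rowP => j; rewrite !mxE.
have h0 k : harm k != 0 :> R by apply/lt0r_neq0/harm_gt0.
have Nh0 k : - harm k != 0 :> R by rewrite oppr_eq0.
have Nhc : (fun k => - harm k : R) @ \oo --> 0 by rewrite -oppr0; apply: cvgN; exact: harm_cvg.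
have ex (s t : R) : expR s * (t - s) <= expR t - expR s.
  have -> : expR t = expR s * expR (t - s) by rewrite -expRD addrC subrK.
  by have := ler_wpM2l (expR_ge0 s) (expR_ge1Dx (t - s)); lra.
set A := 'D_ _ (fun _ => expR _) _; set B := 'D_ _ _ _.
have cx : (xi * expR (xi * f x) * B) = expR (xi * f x) * (xi * B) by ring.
apply/eqP; rewrite eq_le cx; apply/andP; split; rewrite -subr_ge0.
- have cf := quot_cvg (df _ lx j) Nh0 Nhc; have cw := quot_cvg (dw _ lx j) Nh0 Nhc.
  rewrite subr_ge0; apply: (seq_le cw (cvgMr (a := expR (xi * f x)) (cvgMr (a := xi) cf))) => k.
  pose s := f (chart ((- harm k) *: delta_mx 0 j + tagged p)).
  rewrite -[X in X <= _]/((- harm k)^-1 * (expR (xi * s) - expR (xi * f (chart (tagged p))))).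
  rewrite -[X in _ <= _ * (_ * X)]/((- harm k)^-1 * (s - f (chart (tagged p)))) -xE invrN.
  have := ex (xi * f x) (xi * s).
  have := harm_gt0 (R := R) k; rewrite -invr_gt0; set q := _^-1 => q0 h.
  by have := ler_wpM2l (ltW q0) h; lra.
- have cf := quot_cvg (df _ lx j) h0 harm_cvg; have cw := quot_cvg (dw _ lx j) h0 harm_cvg.
  rewrite subr_ge0; apply: (seq_le (cvgMr (a := expR (xi * f x)) (cvgMr (a := xi) cf)) cw) => k.
  pose s := f (chart (harm k *: delta_mx 0 j + tagged p)).
  rewrite -[X in _ <= X]/((harm k)^-1 * (expR (xi * s) - expR (xi * f (chart (tagged p))))).
  rewrite -[X in _ * (_ * X) <= _]/((harm k)^-1 * (s - f (chart (tagged p)))) -xE.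
  have := ex (xi * f x) (xi * s).
  have := harm_gt0 (R := R) k; rewrite -invr_gt0; set q := _^-1 => q0 h.
  by have := ler_wpM2l (ltW q0) h; lra.
Qed.

(** Completing the square in [Gam (w * u) (w * u)]. *)
Lemma Gam_weight xi f u x : let w y := expR (xi * f y) in
  diffpt f x -> diffpt w x -> diffpt u x -> Gam f f x <= 1 ->
  - xi ^+ 2 * (w x * u x) ^+ 2 <= Gam u (fun y => w y * (w y * u y)) x.
Proof.
move=> w df dw du f1; have [[p lx] du'] := du.
have dwu : diffpt (fun y => w y * u y) x.
  by split; [exists p|move=> q lq j; apply: derivableM; [exact: dw.2|exact: du']].
case: p lx {du'} => i b lx; have [/= Mi Ib xE] := lx.
have gw := cgrad_exp df dw lx; have gwu := cgradM dw du lx.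
have gwwu := cgradM dw dwu lx; rewrite /= in gw gwu gwwu.
rewrite -/w in gw; move: f1; rewrite xE !GamE//; rewrite xE in gw gwu gwwu.
rewrite gwwu gwu gw -[expR _]/(w (chart b)).
set U := cgrad u b; set F := cgrad f b; set W := w _; set V := u _ => f1.
rewrite !(dotDr, dotZr).
have := dot_ge0 (U + (xi * V) *: F); rewrite !(dotDl, dotDr, dotZl, dotZr).
rewrite [dot F U]dotC; move: (dot U U) (dot U F) (dot F F) f1 => a c e f1 h.
have W2 := sqr_ge0 W; have := mulr_ge0 W2 h.
have : 0 <= W ^+ 2 * (xi * V) ^+ 2 * (1 - e).
  by rewrite mulr_ge0// ?subr_ge0// mulr_ge0// sqr_ge0.
lra.
Qed.

(** ** Compactly supported Lipschitz functions *)

Local Notation lipc := (@lipschitz_compact R T X).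

Lemma lipc_lipX f : lipc f -> exists2 L, 0 <= L & lipX L f.
Proof. by move=> [[L L0 fL] _]; exists L => //; exact: lipX_edist. Qed.

Lemma lipX_lipc L f : lipX L f -> compact (closure [set x | f x != 0]) -> lipc f.
Proof.
move=> fL cf; split=> //; exists (`|L| + 1); first by rewrite addr_ge0.
apply: edist_lipX; first by have := normr_ge0 L; lra.
by apply: lipX_le fL; have := ler_norm L; lra.
Qed.

Lemma lipc_sub L f g : lipc f -> lipX L g -> (forall x, f x = 0 -> g x = 0) -> lipc g.
Proof.
move=> [_ cf] gL fg; apply: (lipX_lipc gL); apply: (subclosed_compact _ cf).
- exact: closed_closure.
- by apply: closureS => x /=; apply: contra_neq; exact: fg.
Qed.

Lemma lipc_lin a f g : lipc f -> lipc g -> lipc (fun x => a * f x + g x).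
Proof.
move=> cf cg; have [L L0 fL] := lipc_lipX cf; have [L' L'0 gL] := lipc_lipX cg.
apply: (lipX_lipc (lipX_lin a fL gL)); apply: (subclosed_compact _ (compactU cf.2 cg.2)).
- exact: closed_closure.
- rewrite -closureU; apply: closureS => x /=; have [->|] := eqVneq (f x) 0; last by left.
  by rewrite mulr0 add0r; right.
Qed.

Lemma lipc_bounded f : lipc f -> exists2 B, 0 <= B & forall x, `|f x| <= B.
Proof.
move=> cf; have [L L0 fL] := lipc_lipX cf.
have : compact (f @` closure [set x | f x != 0]).
  apply: continuous_compact; last exact: cf.2.
  by apply: continuous_subspaceT; exact: lipX_continuous fL.
move/compact_bounded => [B [_ hB]]; exists (`|B| + 1); first by rewrite addr_ge0.
move=> x; have [->|fx] := eqVneq (f x) 0; first by rewrite normr0 addr_ge0.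
apply: hB; first by have := ler_norm B; lra.
by exists x => //; exact: subset_closure.
Qed.

(** A compact set meets finitely many cells, and each cell has finite volume. *)
Lemma compact_finite_measure (K : set S) : closed K -> compact K -> (mu X K < +oo)%E.
Proof.
move=> cK; rewrite compact_cover => cov.
pose r x := sval (cid2 (cells_locally_finite PX x)).
have r0 x : 0 < r x by rewrite /r; case: cid2.
have rf x : finite_set [set i | cellset i `&` cball x (r x) !=set0] by rewrite /r; case: cid2.
have self x : cball x (r x) x by apply/edist_ltP; exists 0; [exact: SegmentNil|exact: r0].
have [||D _ KD] := cov S K (fun x => cball x (r x)).
- by move=> x _; apply/open_dopenP; exact: dopen_cball.
- by move=> x Kx; exists x.
move: KD; set E := (E in cover E _) => KD; have fE : finite_set E by exact: finite_fset.
have : finite_set (\bigcup_(x in E) [set i | cellset i `&` cball x (r x) !=set0]).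
  by apply: bigcup_finite.
move/finite_seqP => [s sE].
pose U (s : seq (cell X)) := [set y : S | exists2 i, i \in s & maximal_cell X i /\ cellset i y].
have KU : K `<=` U s.
  move=> y Ky; have [x Dx xy] := KD _ Ky; have [i Mi iy] := maximal_cover PX y.
  exists i => //; have : [set` s] i by rewrite -sE; exists x => //; exists y.
  by [].
have mcell i : maximal_cell X i -> measurable (cellset i : set S).
  by move=> Mi; apply: closed_msets => //; exact: closed_cellset.
have [mU Uoo] : measurable (U s) /\ (mu X (U s) < +oo)%E.
  elim: {sE KU} s => [|i s [mU Uoo]].
    rewrite (_ : U [::] = set0); first by rewrite measure0.
    by apply/seteqP; split=> // y [i].
  have [Mi|nMi] := pselect (maximal_cell X i); last first.
    rewrite (_ : U (i :: s) = U s)//; apply/seteqP; split=> y [j js [Mj jy]].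
    - by exists j => //; move: js; rewrite inE => /orP[/eqP ji|//]; rewrite ji in Mj.
    - by exists j => //; rewrite inE js orbT.
  rewrite (_ : U (i :: s) = (cellset i : set S) `|` U s); last first.
    apply/seteqP; split=> y.
    - move=> [j js [Mj jy]]; move: js; rewrite inE => /orP[/eqP ji|js]; last by right; exists j.
      by left; rewrite -ji.
    - move=> [iy|[j js h]]; last by exists j => //; rewrite inE js orbT.
      by exists i => //; rewrite inE eqxx.
  have mi := mcell i Mi; split; first exact: measurableU.
  apply: (@le_lt_trans _ _ (mu X (cellset i) + mu X (U s))%E); first exact: measureU2.
  apply: lte_add_pinfty => //.
  rewrite (mu_cell PX Mi mi)//; have [q Pq] := body_bounded (cpoly i).
  apply: (@leb_bounded _ _ _ 0 q); first exact: measurable_chart_pre.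
  by move=> t [/Pq + _]; rewrite /eball /= subr0.
by apply: le_lt_trans Uoo; apply: le_measure; rewrite ?inE//; exact: closed_msets.
Qed.

Lemma lipc_support f : lipc f -> exists K : set S,
  [/\ closed K, (mu X K < +oo)%E & forall x, ~ K x -> f x = 0].
Proof.
move=> cf; exists (closure [set x | f x != 0]); split.
- exact: closed_closure.
- by apply: compact_finite_measure; [exact: closed_closure|exact: cf.2].
- by move=> x nK; apply/eqP; apply: contrapT => /negP fx; apply: nK; exact: subset_closure.
Qed.

Lemma Gam_support f x : (\forall y \near x, f y = 0) -> Gam f f x = 0.
Proof.
move=> fx0; have [[[i a] [/= Mi Ia xE]]|nl] := pselect (exists p, located x p); last exact: Gam_out.
rewrite xE GamE// (_ : cgrad f a = 0) ?dot0l//; apply/rowP => j; rewrite !mxE.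
rewrite (@near_eq_derive _ _ _ _ (cst 0)) ?derive_cst//.
move: fx0; rewrite xE => /nbhs_cballP[r r0 rf].
have /interior_enormP[s s0 sP] := Ia.
apply/nbhs_enormP; exists (Num.min r s); first by rewrite lt_min r0.
move=> b; rewrite lt_min => /andP[br bs]; apply: rf; apply/edist_ltP.
exists (enorm (b - a)) => //; apply: path_maximal => //; last exact: sP.
exact: interior_subset.
Qed.

Lemma lipc_sqi f : lipc f -> sqi (mu X) f.
Proof.
move=> cf; have [L L0 fL] := lipc_lipX cf; have [B B0 fB] := lipc_bounded cf.
have [K [cK Koo fK]] := lipc_support cf; have mK := closed_msets PX cK.
have mf := lipX_measurable L0 fL; split=> //.
apply: (@le_lt_trans _ _ (\int[mu X]_x (B ^+ 2 * \1_K x)%:E)%E).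
  apply: rintegral_le => //.
  - exact: measurable_funX.
  - by apply: measurable_funM => //; exact: measurable_indic.
  - by move=> x; exact: sqr_ge0.
  - move=> x _; have [Kx|nKx] := pselect (K x).
      by rewrite indicE mem_set// mulr1 -real_normK ?num_real// lerXn2r ?nnegrE.
    by rewrite fK// expr0n /= mulr_ge0 ?sqr_ge0.
have i0 x : 0 <= \1_K x :> R by rewrite indicE.
rewrite (rintegralZ (mu X) measurableT (measurable_indic mK) i0 (sqr_ge0 _)).
rewrite integral_indic// setIT; apply: lte_mul_pinfty => //.
by rewrite lee_fin sqr_ge0.
Qed.

Lemma Gam_lty f : lipc f -> (\int[mu X]_x (Gam f f x)%:E < +oo)%E.
Proof.
move=> cf; have [L L0 fL] := lipc_lipX cf.
have [K [cK Koo fK]] := lipc_support cf; have mK := closed_msets PX cK.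
have mG := measurable_Gam L0 L0 fL fL.
have AF : Filter (almost_everywhere (mu X)) by exact: ae_filter_ringOfSetsType.
apply: (@le_lt_trans _ _ (\int[mu X]_x (L ^+ 2 * \1_K x)%:E)%E).
  apply: ae_ge0_le_integral => //.
  - by move=> x _; rewrite lee_fin Gam_ge0.
  - exact/measurable_EFinP.
  - by move=> x _; rewrite lee_fin mulr_ge0 ?sqr_ge0.
  - by apply/measurable_EFinP; apply: measurable_funM => //; exact: measurable_indic.
  - apply: filterS (ae_Gam_le L0 fL) => x xL _; rewrite lee_fin.
    have [Kx|nKx] := pselect (K x); first by rewrite indicE mem_set// mulr1.
    rewrite Gam_support ?mulr_ge0 ?sqr_ge0//.
    have nK : nbhs x (~` K) by apply: open_nbhs_nbhs; split=> //; rewrite openC.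
    by apply: filterS nK => y /fK.
have i0 x : 0 <= \1_K x :> R by rewrite indicE.
rewrite (rintegralZ (mu X) measurableT (measurable_indic mK) i0 (sqr_ge0 _)).
rewrite integral_indic// setIT; apply: lte_mul_pinfty => //.
by rewrite lee_fin sqr_ge0.
Qed.

Lemma Gam_integrable f g : lipc f -> lipc g ->
  (mu X).-integrable setT (fun x => (Gam f g x)%:E).
Proof.
move=> cf cg; have [L L0 fL] := lipc_lipX cf; have [L' L'0 gL] := lipc_lipX cg.
have mG := measurable_Gam L0 L'0 fL gL.
have mGf := measurable_Gam L0 L0 fL fL; have mGg := measurable_Gam L'0 L'0 gL gL.
apply/integrableP; split; first exact/measurable_EFinP.
apply: (@le_lt_trans _ _ (\int[mu X]_x (Gam f f x + Gam g g x)%:E)%E).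
  under eq_integral do rewrite abse_EFin.
  apply: rintegral_le => //.
  - exact: measurableT_comp.
  - exact: measurable_funD.
  - move=> x _; have [[[i a] [/= Mi Ia ->]]|nl] := pselect (exists p, located x p); last first.
      by rewrite !Gam_out// normr0 addr0.
    rewrite !GamE//; set U := cgrad f a; set V := cgrad g a.
    have := dot_ge0 (U + V); have := dot_ge0 (U - V).
    rewrite !(dotDl, dotDr, dotNl, dotNr) [dot V U]dotC ler_norml.
    have := dot_ge0 U; have := dot_ge0 V.
    move: (dot U U) (dot V V) (dot U V) => p q r h1 h2 h3 h4; apply/andP; split; lra.
rewrite rintegralD//; last 2 first.
- exact: Gam_ge0.
- exact: Gam_ge0.
by apply: lte_add_pinfty; exact: Gam_lty.
Qed.

Definition en : (S -> R) -> (S -> R) -> R :=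
  locked (fun f g => fine (\int[mu X]_x (Gam f g x)%:E)%E).

Lemma en_def f g : en f g = fine (\int[mu X]_x (Gam f g x)%:E)%E.
Proof. by rewrite /en -lock. Qed.

Lemma en_EFin f g : lipc f -> lipc g -> (\int[mu X]_x (Gam f g x)%:E)%E = (en f g)%:E.
Proof. by move=> cf cg; rewrite en_def fineK//; apply: integrable_fin_num => //; exact: Gam_integrable. Qed.

Lemma enC f g : en f g = en g f.
Proof. by rewrite !en_def (_ : Gam f g = Gam g f)//; apply/funext => x; exact: GamC. Qed.

Lemma en_ge0 f : 0 <= en f f.
Proof. by rewrite en_def; apply: fine_ge0; apply: integral_ge0 => x _; rewrite lee_fin Gam_ge0. Qed.

Lemma en_lin a f g h : lipc f -> lipc g -> lipc h ->
  en (fun x => a * f x + g x) h = a * en f h + en g h.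
Proof.
move=> cf cg ch; have [L L0 fL] := lipc_lipX cf; have [L' L'0 gL] := lipc_lipX cg.
have [L2 L20 hL] := lipc_lipX ch; have cfg := lipc_lin a cf cg.
have [L3 L30 fgL] := lipc_lipX cfg.
have AF : Filter (almost_everywhere (mu X)) by exact: ae_filter_ringOfSetsType.
rewrite !en_def; apply: (fine_integral_lin (Gam_integrable cf ch) (Gam_integrable cg ch)).
- exact: measurable_Gam L30 L20 fgL hL.
- by apply: filterS2 (ae_diffpt L0 fL) (ae_diffpt L'0 gL) => x df dg; rewrite Gam_lin.
Qed.

Lemma energyE f : lipc f -> energy f = (en f f)%:E.
Proof.
move=> cf; have [L L0 fL] := lipc_lipX cf; rewrite -en_EFin//.
rewrite mu_integral//; last 2 first.
- by apply/measurable_EFinP; exact (measurable_Gam L0 L0 fL fL).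
- by move=> x; rewrite lee_fin Gam_ge0.
apply: eq_esum => i Mi; rewrite [LHS]integral_mkcond [RHS]integral_mkcond.
apply: eq_integral => t _; rewrite /patch.
have [It|nIt] := pselect (inner (cpoly i) t).
- rewrite !mem_set//; last exact: interior_subset It.
  rewrite /cell_chart GamE//; congr (_%:E); apply: eq_bigr => j _.
  by rewrite !mxE expr2.
- rewrite memNset//; case: ifPn => // /set_mem Pt; rewrite Gam_out// => -[[j a] [/= Mj Ia ta]].
  have ji := single_cell PX Mj Ia Pt (esym ta); subst j.
  by apply: nIt; rewrite /inner /preimage /= (chartI PX Pt (interior_subset Ia) ta).
Qed.

Lemma en_sq a f g : lipc f -> lipc g ->
  en (fun x => a * f x + g x) (fun x => a * f x + g x) =
  a ^+ 2 * en f f + 2 * a * en f g + en g g.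
Proof.
move=> cf cg; have ch := lipc_lin a cf cg; rewrite (en_lin a cf cg ch).
rewrite (enC f (fun x => a * f x + g x)) (enC g (fun x => a * f x + g x)).
rewrite (en_lin a cf cg cf) (en_lin a cf cg cg) (enC g f); ring.
Qed.

Lemma energy_formE f g : lipc f -> lipc g -> energy_form f g = en f g.
Proof.
move=> cf cg; rewrite /energy_form.
have -> : f \+ g = (fun x => 1 * f x + g x) by apply/funext => x /=; rewrite mul1r.
have -> : f \- g = (fun x => -1 * g x + f x) by apply/funext => x /=; rewrite mulN1r addrC.
rewrite (energyE (lipc_lin 1 cf cg)) (energyE (lipc_lin (-1) cg cf)) /=.
by rewrite (en_sq 1 cf cg) (en_sq (-1) cg cf) (enC g f); field.
Qed.

End lipschitz_complex.

(** * Semigroups generated by quadratic forms *)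

Section real_lemmas.
Context {R : realType}.
Implicit Types (y : R -> R).

Lemma quad_disc (a b c : R) : (forall s, 0 <= s ^+ 2 * a + 2 * s * b + c) -> b ^+ 2 <= a * c.
Proof.
move=> h; have [a0|a0] := eqVneq a 0.
  rewrite a0 mul0r; have [->|b0] := eqVneq b 0; first by rewrite expr0n.
  have := h (- (c + 1) / (2 * b)); rewrite a0 mulr0 add0r.
  rewrite (_ : 2 * (- (c + 1) / (2 * b)) * b = - (c + 1)); last by field.
  lra.
have ap : 0 < a.
  rewrite lt_neqAle eq_sym a0 /= leNgt; apply/negP => an.
  have c0 : 0 <= c by have := h 0; rewrite expr0n /= !mul0r mulr0 mul0r !add0r.
  pose s := (c + 1 + `|b|) / - a + 1.
  have := h s; have := h (- s); rewrite sqrrN => h1 h2.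
  have s1 : 1 <= s by rewrite /s lerDr divr_ge0//; have := normr_ge0 b; lra.
  have sa : s * a <= - (c + 1).
    rewrite /s mulrDl mul1r (_ : _ / - a * a = - (c + 1 + `|b|)); last by field.
    by have := normr_ge0 b; lra.
  have : s ^+ 2 * a <= - (c + 1) by rewrite expr2 -mulrA; nra.
  lra.
have := h (- b / a); rewrite (_ : _ + _ + c = (a * c - b ^+ 2) / a); last by field.
by rewrite pmulr_lge0 ?invr_gt0// subr_ge0.
Qed.

Lemma cauchy_real (u : nat -> R) :
  (forall e, 0 < e -> exists K, forall k l, (K <= k)%N -> (K <= l)%N -> `|u k - u l| < e) ->
  exists l : R, u k @[k --> \oo] --> l.
Proof.
move=> h; apply/cvg_ex; apply: cauchy_cvg; apply/cauchy_exP => e e0.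
have [K hK] := h e e0; exists (u K); exists K => // k Kk /=.
by rewrite /ball /= distrC; apply: hK.
Qed.

Lemma seq_eq (u : nat -> R) (l l' : R) :
  u k @[k --> \oo] --> l -> u k @[k --> \oo] --> l' -> l = l'.
Proof.
move=> c c'; apply/eqP; rewrite eq_le; apply/andP.
by split; [apply: (seq_le c c')|apply: (seq_le c' c)].
Qed.

Lemma cvg_scale (a : R) (u : nat -> R) l :
  u k @[k --> \oo] --> l -> a * u k @[k --> \oo] --> a * l.
Proof. by move=> ul; apply: cvgM => //; exact: cvg_cst. Qed.

Lemma squeeze0 (a b : R) (u v w : nat -> R) :
  u k @[k --> \oo] --> 0 -> v k @[k --> \oo] --> 0 ->
  (forall k, 0 <= w k <= a * u k + b * v k) -> w k @[k --> \oo] --> 0.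
Proof.
move=> u0 v0 h; apply: (@squeeze_cvgr _ _ _ _ (cst 0) (fun k => a * u k + b * v k)).
- by apply: nearW => k; exact: h.
- exact: cvg_cst.
- have E : a * 0 + b * 0 = 0 by rewrite !mulr0 addr0.
  by rewrite -E; apply: cvgD; exact: cvg_scale.
Qed.

Lemma sqrt_cvg0 (u : nat -> R) :
  u k @[k --> \oo] --> 0 -> Num.sqrt (u k) @[k --> \oo] --> 0.
Proof.
move=> u0; have := cvg_comp _ _ u0 (@sqrt_continuous R 0); rewrite sqrtr0; exact.
Qed.

(** A function whose right derivative is nonpositive and which does not jump up
   from the left is nonincreasing. *)
Lemma dini_le y (T : R) : 0 <= T ->
  (forall t, 0 <= t < T -> forall e, 0 < e -> exists2 d, 0 < d &
     forall s, 0 < s < d -> y (t + s) <= y t + e * s) ->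
  (forall t, 0 < t <= T -> forall e, 0 < e -> exists2 d, 0 < d &
     forall s, 0 < s < d -> s <= t -> y t <= y (t - s) + e) ->
  y T <= y 0.
Proof.
move=> T0 dR cL; apply/ler_addgt0Pr => e e0.
pose e' := e / (T + 1); have e'0 : 0 < e' by rewrite divr_gt0//; lra.
pose A := [set t | 0 <= t <= T /\ forall r, 0 <= r <= t -> y r <= y 0 + e' * r].
have A0 : A 0.
  split=> [|r /andP[r0 r0']]; first by rewrite lexx.
  have -> : r = 0 by lra.
  by rewrite mulr0 addr0.
have supA : has_sup A by split; [exists 0|exists T => t [/andP[]]].
pose c := sup A; have c0 : 0 <= c by apply: sup_upper_bound.
have cT : c <= T by apply: sup_le_ub => [|t [/andP[]]//]; exists 0.
have below r : 0 <= r < c -> y r <= y 0 + e' * r.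
  move=> /andP[r0 rc]; have [t [_ At] rt] := sup_gt supA.1 rc.
  by apply: At; rewrite r0 ltW.
have yc : y c <= y 0 + e' * c.
  have [->|cn0] := eqVneq c 0; first by rewrite mulr0 addr0.
  have cp : 0 < c by rewrite lt_neqAle eq_sym cn0.
  apply/ler_addgt0Pr => x x0; have [|d d0 hd] := cL c _ x x0; first by rewrite cp.
  pose s := Num.min (d / 2) c; have s0 : 0 < s by rewrite lt_min divr_gt0.
  have sd : s <= d / 2 by rewrite ge_min lexx.
  have sc : s <= c by rewrite ge_min lexx orbT.
  have s0d : 0 < s < d by rewrite s0 /=; lra.
  have h := hd s s0d sc; have csc : 0 <= c - s < c by apply/andP; split; lra.
  by have := below _ csc; have := mulr_gt0 e'0 s0; lra.
have cE : c = T.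
  apply/eqP; rewrite eq_le cT /= leNgt; apply/negP => cT'.
  have [|d d0 hd] := dR c _ e' e'0; first by rewrite c0.
  pose s := Num.min (d / 2) (T - c).
  have s0 : 0 < s by rewrite lt_min divr_gt0//= subr_gt0.
  have sd : s <= d / 2 by rewrite ge_min lexx.
  have sT : s <= T - c by rewrite ge_min lexx orbT.
  have s0d : 0 < s < d by rewrite s0 /=; lra.
  suff : A (c + s) by move/(sup_upper_bound supA); rewrite -/c; lra.
  split=> [|r /andP[r0 rs]]; first by apply/andP; split; lra.
  have [rc|cr] := ltP r c; first by apply: below; rewrite r0.
  have [->//|rnc] := eqVneq r c.
  have rs0 : 0 < r - c < d.
    by apply/andP; split; [rewrite subr_gt0 lt_neqAle eq_sym rnc|lra].
  by have := hd _ rs0; rewrite [c + _]addrC subrK; lra.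
rewrite -cE; apply: le_trans yc _; rewrite lerD2l cE /e' mulrAC ler_pdivrMr; last lra.
by rewrite ler_wpM2l ?(ltW e0)//; lra.
Qed.

(** Multiply by [expR (a * t)] and apply the monotonicity criterion; one-sided
   derivatives suffice, which is all a semigroup offers at a vector of the domain. *)
Lemma gronwall y (a T : R) : 0 <= T ->
  (forall t, 0 <= t < T -> forall e, 0 < e -> exists2 d, 0 < d &
     forall s, 0 < s < d -> y (t + s) <= y t - a * s * y t + e * s) ->
  (forall t, 0 < t <= T -> forall e, 0 < e -> exists2 d, 0 < d &
     forall s, 0 < s < d -> s <= t -> `|y t - y (t - s)| <= e) ->
  y T <= expR (- a * T) * y 0.
Proof.
move=> T0 dR cL; pose z t := expR (a * t) * y t.
suff : z T <= z 0.
  rewrite /z mulr0 expR0 mul1r => h.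
  by rewrite mulNr expRN ler_pdivlMl ?expR_gt0.
have E0 t : 0 < expR (a * t) by exact: expR_gt0.
apply: dini_le => // t tT e e0.
- pose M := expR (`|a| * (T + 1)).
  have M0 : 0 < M by exact: expR_gt0.
  pose e' := e / (2 * M); have e'0 : 0 < e' by rewrite divr_gt0// mulr_gt0.
  have [d d0 hd] := dR t tT _ e'0.
  pose K := a ^+ 2 * M * `|y t| + 1; have K0 : 0 < K.
    by apply: ltr_wpDl => //; apply: mulr_ge0 => //; apply: mulr_ge0; [exact: sqr_ge0|exact: ltW].
  pose d' := Num.min (Num.min d 1) (Num.min (1 / (`|a| + 1)) (e / (2 * K))).
  have aK : 0 < `|a| + 1 by rewrite ltr_wpDl.
  exists d'; first by rewrite !lt_min d0 ltr01 !divr_gt0// mulr_gt0.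
  move=> s /andP[s0]; rewrite !lt_min => /andP[/andP[sd s1] /andP[sa sK]].
  have := hd s; rewrite s0 sd => /(_ isT) hs.
  have as1 : `|a * s| <= 1.
    rewrite normrM (ger0_norm (ltW s0)); move: sa; rewrite ltr_pdivlMr// => sa.
    by rewrite mulrC; nra.
  have as1' : a * s <= 1 by move: as1; rewrite ler_norml => /andP[].
  have bM : expR (a * (t + s)) <= M.
    rewrite ler_expR; apply: le_trans (ler_norm _) _; rewrite normrM ler_wpM2l//.
    by rewrite ger0_norm; case/andP: tT => t0 tT; lra.
  have bM' : expR (a * t) <= M.
    rewrite ler_expR; apply: le_trans (ler_norm _) _; rewrite normrM ler_wpM2l//.
    by rewrite ger0_norm; case/andP: tT => t0 tT; lra.
  rewrite /z; apply: le_trans (ler_wpM2l (ltW (E0 _)) hs) _.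
  rewrite (_ : y t - a * s * y t = (1 - a * s) * y t); last ring.
  rewrite mulrDr mulrA.
  have ex1 : expR (a * s) * (1 - a * s) <= 1.
    have := expR_ge1Dx (- (a * s)); rewrite expRN -(ler_pM2l (expR_gt0 (a * s))).
    by rewrite divff ?gt_eqF ?expR_gt0.
  have ex2 : 1 - (a * s) ^+ 2 <= expR (a * s) * (1 - a * s).
    have h1 : 0 <= 1 - a * s by lra.
    by have := ler_wpM2r h1 (expR_ge1Dx (a * s)); lra.
  have q1 : expR (a * (t + s)) * (1 - a * s) * y t <= expR (a * t) * y t + e / 2 * s.
    have -> : expR (a * (t + s)) = expR (a * t) * expR (a * s) by rewrite mulrDr expRD.
    set q := expR (a * s) * (1 - a * s) in ex1 ex2 *.
    rewrite (_ : _ * y t = expR (a * t) * (q * y t)); last by rewrite /q; ring.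
    rewrite -lerBlDl -mulrBr.
    have : `|q * y t - y t| <= (a * s) ^+ 2 * `|y t|.
      rewrite -[X in _ - X]mul1r -mulrBl normrM ler_wpM2r// ler_norml.
      by apply/andP; split; have := sqr_ge0 (a * s); lra.
    rewrite ler_norml => /andP[_ h]; apply: le_trans (ler_wpM2l (ltW (E0 t)) h) _.
    apply: le_trans (_ : _ <= M * ((a * s) ^+ 2 * `|y t|)) _.
      by apply: ler_wpM2r => //; rewrite mulr_ge0 ?sqr_ge0.
    have sKe : s * (2 * K) < e by rewrite -ltr_pdivlMr ?mulr_gt0.
    rewrite (_ : M * _ = s * (s * (a ^+ 2 * M * `|y t|))); last ring.
    rewrite [e / 2 * s]mulrC ler_wpM2l ?(ltW s0)//; move: sKe; rewrite /K; lra.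
  have q2 : expR (a * (t + s)) * (e' * s) <= e / 2 * s.
    rewrite mulrA ler_wpM2r ?(ltW s0)//.
    apply: le_trans (ler_wpM2r (ltW e'0) bM) _.
    rewrite /e' (_ : M * _ = e / 2)//; field.
    by rewrite gt_eqF.
  lra.
- pose M := expR (`|a| * T); have M0 : 0 < M by exact: expR_gt0.
  have M20 : 0 < 2 * M by rewrite mulr_gt0.
  have [d d0 hd] := cL t tT (e / (2 * M)) (divr_gt0 e0 M20).
  have yp : 0 < 2 * (`|y t| + 1) by rewrite mulr_gt0// ltr_wpDl.
  have ec : expR (a * (t - s)) @[s --> 0] --> expR (a * (t - 0)).
    apply: (@continuous_comp R R R (fun s => a * (t - s)) expR); last exact: continuous_expR.
    by apply: cvgMr; apply: cvgB; [exact: cvg_cst|exact: cvg_id].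
  have /cvgrPdist_lt/(_ _ (divr_gt0 e0 yp))/nbhs_ballP[d' /= d'0 hd'] := ec.
  exists (Num.min d d') => [|s /andP[s0]]; first by rewrite lt_min d0.
  rewrite lt_min => /andP[sd sd'] st.
  have s0d : 0 < s < d by rewrite s0.
  have h1 := hd s s0d st.
  have h2 : `|expR (a * t) - expR (a * (t - s))| < e / (2 * (`|y t| + 1)).
    by have := hd' s; rewrite /ball /= sub0r normrN gtr0_norm// subr0; apply.
  have bM : expR (a * (t - s)) <= M.
    rewrite ler_expR; apply: le_trans (ler_norm _) _; rewrite normrM ler_wpM2l//.
    by rewrite ger0_norm; case/andP: tT => t0 tT; lra.
  rewrite /z -lerBlDl (_ : _ - _ = expR (a * (t - s)) * (y t - y (t - s)) +
    (expR (a * t) - expR (a * (t - s))) * y t); last ring.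
  apply: le_trans (ler_norm _) _; apply: le_trans (ler_normD _ _) _; rewrite !normrM.
  have k1 : `|expR (a * (t - s))| * `|y t - y (t - s)| <= e / 2.
    rewrite (ger0_norm (expR_ge0 _)).
    apply: le_trans (_ : _ <= M * (e / (2 * M))) _.
      by apply: ler_pM => //; exact: expR_ge0.
    by rewrite (_ : M * _ = e / 2)//; field; rewrite gt_eqF.
  have k2 : `|expR (a * t) - expR (a * (t - s))| * `|y t| <= e / 2.
    apply: le_trans (_ : _ <= e / (2 * (`|y t| + 1)) * (`|y t| + 1)) _.
      by apply: ler_pM => //; [exact: ltW|lra].
    move: yp; set Y := `|y t| + 1 => yp; have Yn : Y != 0 by rewrite gt_eqF//; lra.
    by rewrite le_eqVlt; apply/orP; left; apply/eqP; field.
  lra.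
Qed.

End real_lemmas.

(** ** Positive semidefinite forms *)

Section semidefinite.
Context {R : realType} {T : Type}.
Implicit Types (f g h : T -> R) (a : R).

Definition lin a f g : T -> R := fun x => a * f x + g x.

Record psd (D : (T -> R) -> Prop) (B : (T -> R) -> (T -> R) -> R) : Prop := {
  psd_dom : forall a f g, D f -> D g -> D (lin a f g);
  psdC : forall f g, B f g = B g f;
  psd_lin : forall a f g h, D f -> D g -> D h -> B (lin a f g) h = a * B f h + B g h;
  psd_ge0 : forall f, 0 <= B f f }.

Variables (D : (T -> R) -> Prop) (B : (T -> R) -> (T -> R) -> R).
Hypothesis PB : psd D B.

Definition nrm f : R := Num.sqrt (B f f).

Lemma psd_linr a f g h : D f -> D g -> D h -> B h (lin a f g) = a * B h f + B h g.
Proof. by move=> Df Dg Dh; rewrite (psdC PB) (psd_lin PB)// !(psdC PB h). Qed.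

Lemma psd_sq a f g : D f -> D g ->
  B (lin a f g) (lin a f g) = a ^+ 2 * B f f + 2 * a * B f g + B g g.
Proof.
move=> Df Dg; have Dfg := psd_dom PB a Df Dg.
rewrite (psd_lin PB a Df Dg Dfg) (psd_linr a Df Dg Df) (psd_linr a Df Dg Dg) (psdC PB g f).
ring.
Qed.

Lemma psd_CS f g : D f -> D g -> (B f g) ^+ 2 <= B f f * B g g.
Proof.
by move=> Df Dg; apply: quad_disc => s; rewrite -(psd_sq s Df Dg) (psd_ge0 PB).
Qed.

Lemma nrm_ge0 f : 0 <= nrm f. Proof. exact: sqrtr_ge0. Qed.

Lemma nrm2 f : nrm f ^+ 2 = B f f.
Proof. by rewrite sqr_sqrtr// (psd_ge0 PB). Qed.

Lemma psd_le f g : D f -> D g -> `|B f g| <= nrm f * nrm g.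
Proof.
move=> Df Dg; rewrite -(@ler_pXn2r _ 2)// ?nnegrE ?mulr_ge0 ?nrm_ge0//.
by rewrite real_normK ?num_real// exprMn !nrm2 psd_CS.
Qed.

Lemma nrm_lin a f g : D f -> D g -> nrm (lin a f g) <= `|a| * nrm f + nrm g.
Proof.
move=> Df Dg; rewrite -(@ler_pXn2r _ 2)// ?nnegrE ?addr_ge0 ?mulr_ge0 ?nrm_ge0//.
rewrite nrm2 psd_sq// sqrrD exprMn !nrm2 real_normK ?num_real//.
have : a * B f g <= `|a| * (nrm f * nrm g).
  by apply: le_trans (ler_norm _) _; rewrite normrM ler_wpM2l// psd_le.
lra.
Qed.

Definition dst f g : R := nrm (lin (-1) g f).

Lemma dst_ge0 f g : 0 <= dst f g. Proof. exact: nrm_ge0. Qed.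

Lemma sub_dom f g : D f -> D g -> D (lin (-1) g f).
Proof. by move=> Df Dg; exact: (psd_dom PB). Qed.

Lemma dstC f g : D f -> D g -> dst f g = dst g f.
Proof.
move=> Df Dg; rewrite /dst /nrm !psd_sq// (psdC PB g f); congr Num.sqrt; ring.
Qed.

Lemma dst_tri g f h : D f -> D g -> D h -> dst f h <= dst f g + dst g h.
Proof.
move=> Df Dg Dh; rewrite {1}/dst (_ : lin (-1) h f = lin 1 (lin (-1) g f) (lin (-1) h g)).
  apply: le_trans (nrm_lin 1 _ _) _; try exact: sub_dom.
  by rewrite normr1 mul1r.
by apply/funext => x; rewrite /lin; ring.
Qed.

Lemma dstxx f : D f -> dst f f = 0.
Proof.
move=> Df; rewrite /dst /nrm psd_sq//.
by rewrite (_ : _ + _ + _ = 0) ?sqrtr0//; ring.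
Qed.

Lemma nrm_dst f g : D f -> D g -> nrm f <= nrm g + dst f g.
Proof.
move=> Df Dg; rewrite (_ : nrm f = nrm (lin 1 g (lin (-1) g f))).
  by apply: le_trans (nrm_lin 1 _ _) _; rewrite ?normr1 ?mul1r//; exact: sub_dom.
by congr nrm; apply/funext => x; rewrite /lin; ring.
Qed.

Lemma psd_dst_le f f' g g' : D f -> D f' -> D g -> D g' ->
  `|B f g - B f' g'| <= dst f f' * nrm g + nrm f' * dst g g'.
Proof.
move=> Df Df' Dg Dg'.
rewrite (_ : _ - _ = B (lin (-1) f' f) g + B f' (lin (-1) g' g)); last first.
  by rewrite (psd_lin PB)// psd_linr//; ring.
apply: le_trans (ler_normD _ _) _; apply: lerD; apply: psd_le => //; exact: sub_dom.
Qed.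

Lemma dst_lin a f f' g g' : D f -> D f' -> D g -> D g' ->
  dst (lin a f g) (lin a f' g') <= `|a| * dst f f' + dst g g'.
Proof.
move=> Df Df' Dg Dg'; apply: le_trans (nrm_lin a _ _); try exact: sub_dom.
rewrite /dst (_ : lin (-1) _ _ = lin a (lin (-1) f' f) (lin (-1) g' g))//.
by apply/funext => x; rewrite /lin; ring.
Qed.

Lemma psd_null f g : D f -> D g -> nrm f = 0 -> B f g = 0.
Proof.
move=> Df Dg f0; have := psd_le Df Dg; rewrite f0 mul0r normr_le0 => /eqP. by [].
Qed.

Lemma psd_cvg (u v : nat -> T -> R) f g : (forall k, D (u k)) -> (forall k, D (v k)) ->
  D f -> D g -> dst (u k) f @[k --> \oo] --> 0 -> dst (v k) g @[k --> \oo] --> 0 ->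
  B (u k) (v k) @[k --> \oo] --> B f g.
Proof.
move=> Du Dv Df Dg uf vg; apply/subr_cvg0; apply/norm_cvg0P.
apply: (@squeeze_cvgr _ _ _ _ (cst 0)
  (fun k => dst (u k) f * (nrm g + dst (v k) g) + nrm f * dst (v k) g)).
- apply: nearW => k; rewrite normr_ge0 /=; apply: le_trans (psd_dst_le _ _ _ _) _ => //.
  by rewrite lerD2r ler_wpM2l ?dst_ge0// nrm_dst.
- exact: cvg_cst.
- rewrite -[X in _ --> X](_ : 0 * (nrm g + 0) + nrm f * 0 = 0); last by rewrite mul0r mulr0 addr0.
  apply: cvgD; last by apply: cvgMr.
  by apply: cvgM => //; apply: cvgD => //; exact: cvg_cst.
Qed.

End semidefinite.

(** ** The operator of a form, resolvents *)

Section form_operator.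
Context {R : realType} {T : Type}.
Variables (H C : (T -> R) -> Prop) (ip en : (T -> R) -> (T -> R) -> R).
Hypothesis pH : psd H ip.
Hypothesis pC : psd C en.
Hypothesis CH : forall f, C f -> H f.
Hypothesis C0 : C (fun _ => 0).
Hypothesis complete : forall u : nat -> T -> R, (forall k, H (u k)) ->
  (forall k, ip (lin (-1) (u k) (u k.+1)) (lin (-1) (u k) (u k.+1)) <= 8 ^- k) ->
  exists2 f, H f & dst ip (u k) f @[k --> \oo] --> 0.
Implicit Types (f g h phi : T -> R) (u v w : nat -> T -> R).

(** Membership in the domain of the closed form, and below its operator, phrased for
   an abstract pair of semidefinite forms on function spaces: the vectors are
   functions, and equality in [L^2] is vanishing of [dst ip]. *)
Definition energy_approx u f := [/\ forall k, C (u k), H f, dst ip (u k) f @[k --> \oo] --> 0 &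
  forall e, 0 < e -> exists K, forall k l, (K <= k)%N -> (K <= l)%N -> dst en (u k) (u l) < e].

Definition fdom f := exists u, energy_approx u f.

Definition lap f g := [/\ fdom f, H g & forall phi, fdom phi ->
  exists u v, [/\ energy_approx u f, energy_approx v phi & en (u k) (v k) @[k --> \oo] --> ip g phi]].

Lemma approx_bounded u f : energy_approx u f -> exists2 M, 0 <= M & forall k, nrm en (u k) <= M.
Proof.
move=> [Cu _ _ cu]; have [K hK] := cu 1 ltr01.
have S0 : 0 <= \sum_(i < K) nrm en (u i) by apply: sumr_ge0 => i _; exact: nrm_ge0.
exists (\sum_(i < K) nrm en (u i) + (nrm en (u K) + 1)) => [|k].
  by rewrite addr_ge0// addr_ge0// nrm_ge0.
have [Kk|kK] := leqP K k.
  apply: le_trans (nrm_dst pC (Cu k) (Cu K)) _.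
  by have := hK k K Kk (leqnn K); lra.
rewrite (bigD1 (Ordinal kK))//=.
have : 0 <= \sum_(i < K | i != Ordinal kK) nrm en (u i).
  by apply: sumr_ge0 => i _; exact: nrm_ge0.
have := nrm_ge0 en (u K); lra.
Qed.

Lemma approx_form_cvg u v f g : energy_approx u f -> energy_approx v g ->
  exists l : R, en (u k) (v k) @[k --> \oo] --> l.
Proof.
move=> au av; have [M M0 uM] := approx_bounded au; have [M' M'0 vM] := approx_bounded av.
have [Cu _ _ cu] := au; have [Cv _ _ cv] := av.
apply: cauchy_real => e e0; pose d := e / (M + M' + 1).
have MM : 0 < M + M' + 1 by lra.
have d0 : 0 < d by rewrite divr_gt0.
have [K1 h1] := cu d d0; have [K2 h2] := cv d d0; exists (maxn K1 K2) => k l.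
rewrite !geq_max => /andP[k1 k2] /andP[l1 l2].
apply: le_lt_trans (psd_dst_le pC _ _ _ _) _ => //.
apply: le_lt_trans (_ : _ <= d * M' + M * d) _.
  by apply: lerD; apply: ler_pM; rewrite ?nrm_ge0 ?dst_ge0//; apply: ltW; [exact: h1|exact: h2].
have -> : e = d * (M + M' + 1) by rewrite /d divfK// gt_eqF.
by have := d0; lra.
Qed.

Lemma approx_lin a u v f g : energy_approx u f -> energy_approx v g ->
  energy_approx (fun k => lin a (u k) (v k)) (lin a f g).
Proof.
move=> [Cu Hf uf cu] [Cv Hg vg cv]; split.
- by move=> k; exact: (psd_dom pC).
- exact: (psd_dom pH).
- apply: (squeeze0 (a := `|a|) (b := 1) uf vg) => k.
  by rewrite dst_ge0 /= mul1r; apply: (dst_lin pH) => //; exact: CH.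
- move=> e e0; pose d := e / (`|a| + 1).
  have a1 : 0 < `|a| + 1 by rewrite ltr_wpDl.
  have d0 : 0 < d by rewrite divr_gt0.
  have [K1 h1] := cu d d0; have [K2 h2] := cv d d0; exists (maxn K1 K2) => k l.
  rewrite !geq_max => /andP[k1 k2] /andP[l1 l2].
  apply: le_lt_trans (dst_lin pC a _ _ _ _) _ => //.
  have -> : e = `|a| * d + d by rewrite -[X in _ + X]mul1r -mulrDl mulrC divfK// gt_eqF.
  by apply: ler_ltD; [apply: ler_wpM2l => //; apply: ltW; exact: h1|exact: h2].
Qed.

Section generator.
Variable P : R -> (T -> R) -> T -> R.
Hypothesis P_H : forall t f, 0 <= t -> H f -> H (P t f).
Hypothesis P_bd : forall t, 0 <= t -> exists2 K, 0 <= K & forall f, H f -> nrm ip (P t f) <= K * nrm ip f.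
Definition dquot t f : T -> R := lin (- t^-1) (P t f) (fun x => t^-1 * f x).
Hypothesis gen : forall f g, lap f g <-> [/\ H f, H g & forall e, 0 < e ->
  exists2 d, 0 < d & forall t, 0 < t < d -> dst ip (dquot t f) g < e].
Hypothesis nontrivial : exists2 g, H g & ip g g != 0.

Let H0 : H (fun _ => 0). Proof. exact: CH C0. Qed.

Let lin0 a f : lin a (fun _ => 0) f = f.
Proof. by apply/funext => x; rewrite /lin mulr0 add0r. Qed.

Let scaleE (a : R) f : (fun x => a * f x) = lin a f (fun _ => 0).
Proof. by apply/funext => x; rewrite /lin addr0. Qed.

Let nrm0 : nrm ip (fun _ => 0) = 0.
Proof.
rewrite -[RHS](dstxx pH H0) /dst; congr nrm.
by apply/funext => x; rewrite /lin; ring.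
Qed.

(** If a sequence vanishing in [L^2] kept its energy, adding multiples of it to the
   approximants would put every pair [(0, g)] in the graph of the operator, which
   is the graph of a generator. *)
Lemma closable u : (forall k, C (u k)) -> nrm ip (u k) @[k --> \oo] --> 0 ->
  (forall e, 0 < e -> exists K, forall k l, (K <= k)%N -> (K <= l)%N -> dst en (u k) (u l) < e) ->
  nrm en (u k) @[k --> \oo] --> 0.
Proof.
move=> Cu u0 cu.
have au : energy_approx u (fun _ => 0).
  split=> //; rewrite (_ : (fun k => dst ip (u k) _) = (fun k => nrm ip (u k)))//.
  by apply/funext => k; rewrite /dst; congr nrm; apply/funext => x; rewrite /lin; ring.
have [c uc] := approx_form_cvg au au.
have [c0|c0] := eqVneq c 0.
  by rewrite c0 in uc; exact: sqrt_cvg0 uc.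
have [g Hg] := nontrivial; case/eqP.
have /gen[_ _ lg] : lap (fun _ => 0) g.
  split=> //; first by exists u.
  move=> phi [v av]; have [l uvl] := approx_form_cvg au av.
  pose s := (ip g phi - l) / c.
  exists u, (fun k => lin s (u k) (v k)); split=> //.
    by rewrite -(lin0 s phi); exact: approx_lin.
  have [Cv _ _ _] := av.
  rewrite (_ : (fun k => _) = (fun k => s * en (u k) (u k) + en (u k) (v k))); last first.
    by apply/funext => k; rewrite (psd_linr pC).
  rewrite (_ : ip g phi = s * c + l); last by rewrite /s divfK// subrK.
  by apply: cvgD => //; exact: cvg_scale.
suff : nrm ip g = 0 by move=> ng; rewrite -(nrm2 pH) ng expr0n.
apply/eqP; rewrite eq_le nrm_ge0 andbT; apply/ler_addgt0Pr => e e0; rewrite add0r.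
have [d d0 hd] := lg e e0.
have t0 : 0 < d / 2 < d by apply/andP; split; lra.
have /andP[t00 _] := t0; have [K K0 hK] := P_bd (ltW t00).
have HP := P_H (ltW t00) H0.
have Hd : H (dquot (d / 2) (fun _ => 0)).
  by rewrite /dquot scaleE; do 2 apply: (psd_dom pH) => //.
apply: le_trans (nrm_dst pH Hg Hd) _; rewrite (dstC pH Hg Hd).
have : nrm ip (dquot (d / 2) (fun _ => 0)) <= 0.
  rewrite /dquot scaleE (lin0 _ (fun _ => 0)); apply: le_trans (nrm_lin pH _ HP H0) _.
  by rewrite nrm0 addr0; have := hK _ H0; rewrite nrm0 mulr0 => h; rewrite pmulr_rle0// normr_gt0 oppr_eq0 invr_eq0 gt_eqF.
by have := hd _ t0; lra.
Qed.

Lemma approx_unique u u' f : energy_approx u f -> energy_approx u' f -> dst en (u k) (u' k) @[k --> \oo] --> 0.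
Proof.
move=> au au'; have [Cu Hf uf _] := au; have [Cu' _ u'f _] := au'.
have [Ca _ _ ca] := approx_lin (-1) au' au.
apply: closable => //.
apply: (squeeze0 (a := 1) (b := 1) uf u'f) => k; rewrite nrm_ge0 /= !mul1r.
rewrite (dstC pH (CH (Cu' k)) Hf).
by apply: (dst_tri pH) => //; exact: CH.
Qed.

(** The value of the form does not depend on the approximating sequences, by
   closability. *)
Lemma lap_form f g u v phi : lap f g -> energy_approx u f -> energy_approx v phi ->
  en (u k) (v k) @[k --> \oo] --> ip g phi.
Proof.
move=> [_ _ lfg] au av; have [u' [v' [au' av' cv]]] := lfg phi (ex_intro _ v av).
have uu := approx_unique au au'; have vv := approx_unique av av'.
have [M M0 hM] := approx_bounded av; have [M' M'0 hM'] := approx_bounded au'.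
have [Cu _ _ _] := au; have [Cv _ _ _] := av; have [Cu' _ _ _] := au'; have [Cv' _ _ _] := av'.
rewrite -[ip g phi]add0r.
rewrite (_ : (fun k => _) = (fun k => (en (u k) (v k) - en (u' k) (v' k)) + en (u' k) (v' k))); last first.
  by apply/funext => k; rewrite subrK.
apply: cvgD => //; apply/norm_cvg0P.
apply: (squeeze0 (a := M) (b := M') uu vv) => k.
rewrite normr_ge0 /=; apply: le_trans (psd_dst_le pC _ _ _ _) _ => //.
by apply: lerD; rewrite 1?[M * _]mulrC; [apply: ler_wpM2l|apply: ler_wpM2r]; rewrite ?dst_ge0.
Qed.

Lemma lap_sym f g f' g' : lap f g -> lap f' g' -> ip g f' = ip f g'.
Proof.
move=> l1 l2; have [[u au] _ _] := l1; have [[v av] _ _] := l2.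
have c1 := lap_form l1 au av; have c2 := lap_form l2 av au.
rewrite (psdC pH f g'); apply: (seq_eq c1).
by rewrite (_ : (fun k => _) = (fun k => en (v k) (u k)))//; apply/funext => k; exact: (psdC pC).
Qed.

Lemma lap_pos f g : lap f g -> 0 <= ip g f.
Proof.
move=> l; have [[u au] _ _] := l; apply: (cvgr_to_ge (lap_form l au au)).
by apply: nearW => k; exact: (psd_ge0 pC).
Qed.

Section resolvent.
Variables (lam : R) (g : T -> R).
Hypothesis lam0 : 0 < lam.
Hypothesis Hg : H g.

Let Q f h := lam * en f h + ip f h.

Let pQ : psd C Q.
Proof.
split.
- exact: (psd_dom pC).
- by move=> f h; rewrite /Q (psdC pC) (psdC pH).
- move=> a f h k Cf Ch Ck; rewrite /Q (psd_lin pC)// (psd_lin pH); try exact: CH.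
  by ring.
- by move=> f; rewrite /Q addr_ge0 ?(psd_ge0 pH)// mulr_ge0 ?(psd_ge0 pC)// ltW.
Qed.

Let off f := lin (-1) g f.
Let Hoff f : C f -> H (off f). Proof. by move=> Cf; apply: (psd_dom pH) => //; exact: CH. Qed.
Let J f := lam * en f f + ip (off f) (off f).
Let A f h := lam * en f h + ip (off f) h.

Let J_lin s f h : C f -> C h -> J (lin s h f) = J f + 2 * s * A f h + s ^+ 2 * Q h h.
Proof.
move=> Cf Ch; rewrite /J /A /Q (_ : off (lin s h f) = lin s h (off f)); last first.
  by apply/funext => x; rewrite /off /lin; ring.
rewrite (psd_sq pC s Ch Cf) (psd_sq pH s (CH Ch) (Hoff Cf)) (psdC pC h f) (psdC pH h (off f)).
ring.
Qed.

Let m := inf [set J f | f in C].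
Let J_ge0 f : 0 <= J f.
Proof. by rewrite /J addr_ge0 ?(psd_ge0 pH)// mulr_ge0 ?(psd_ge0 pC)// ltW. Qed.
Let infJ : has_inf [set J f | f in C].
Proof. by split; [exists (J (fun _ => 0)); exists (fun _ => 0)|exists 0 => _ [f _ <-]]. Qed.
Let m_le f : C f -> m <= J f.
Proof. by move=> Cf; apply: ge_inf; [exact: infJ.2|exists f]. Qed.

Let gap f h : C f -> C h ->
  Q (lin (-1) f h) (lin (-1) f h) <= 2 * (J f - m) + 2 * (J h - m).
Proof.
move=> Cf Ch; have Cd := sub_dom pC Ch Cf.
have mid := m_le (psd_dom pC 2^-1 Cd Cf).
have E : lin 1 (lin (-1) f h) f = h by apply/funext => x; rewrite /lin; ring.
have := J_lin 1 Cf Cd; rewrite E => Jh; have := J_lin 2^-1 Cf Cd => Jm.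
rewrite Jm in mid; move: mid Jh; set q := Q _ _; set p := A _ _.
rewrite !expr2 => h1 h2; lra.
Qed.

(** The minimizing sequence of [lam * en f f + |f - g|^2] is Cauchy by the
   parallelogram identity, and its first variation vanishes. *)
Lemma resolvent : exists (u : T -> R) w, [/\ energy_approx w u,
  forall v, (forall k, C (v k)) -> (exists M, forall k, nrm en (v k) <= M /\ nrm ip (v k) <= M) ->
    lam * en (w k) (v k) + ip (lin (-1) g (w k)) (v k) @[k --> \oo] --> 0,
  lap u (lin (- lam^-1) u (fun x => lam^-1 * g x)) &
  C g -> ip (lin (-1) g u) (lin (-1) g u) <= lam * en g g].
Proof.
have e8 k : 0 < (8 ^- k / 4 : R) by rewrite divr_gt0 ?invr_gt0 ?exprn_gt0.
have ex k : exists2 f, C f & J f < m + 8 ^- k / 4.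
  have lt : m < m + 8 ^- k / 4 by rewrite ltrDl.
  by have [_ [f Cf <-] fm] := inf_lt infJ.1 lt; exists f.
pose w k := sval (cid2 (ex k)).
have Cw k : C (w k) by rewrite /w; case: cid2.
have Jw k : J (w k) < m + 8 ^- k / 4 by rewrite /w; case: cid2.
have gw k l : Q (lin (-1) (w k) (w l)) (lin (-1) (w k) (w l)) <= (8 ^- k + 8 ^- l) / 2.
  by apply: le_trans (gap (Cw k) (Cw l)) _; have := Jw k; have := Jw l; lra.
have [u Hu wu] : exists2 u, H u & dst ip (w k) u @[k --> \oo] --> 0.
  apply: complete => k; first exact: CH.
  have := gw k k.+1; rewrite {1}/Q exprSr invfM.
  have := psd_ge0 pC (lin (-1) (w k) (w k.+1)) => p0; have := mulr_ge0 (ltW lam0) p0.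
  by have := e8 k; lra.
have v8 : (8 ^- k : R) @[k --> \oo] --> 0.
  rewrite (_ : (fun k => _) = GRing.exp (8^-1 : R)); last by apply/funext => k; rewrite exprVn.
  by apply: cvg_expr; rewrite ger0_norm; lra.
have aw : energy_approx w u.
  split=> // e e0; have el : 0 < lam * e ^+ 2 by rewrite mulr_gt0// exprn_gt0.
  have /cvgrPdist_lt/(_ _ el)[K _ hK] := v8; exists K => k l Kk Kl.
  rewrite -(@ltr_pXn2r _ 2)// ?nnegrE ?dst_ge0 ?ltW// (nrm2 pC) -(ltr_pM2l lam0).
  have := gw l k; rewrite {1}/Q; have := psd_ge0 pH (lin (-1) (w l) (w k)).
  have := hK _ Kk; have := hK _ Kl; rewrite /= !sub0r !normrN.
  by rewrite !gtr0_norm ?invr_gt0 ?exprn_gt0//; lra.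
have Aw h k : C h -> `|A (w k) h| <= Num.sqrt (8 ^- k) * nrm Q h.
  move=> Ch; have dsc : A (w k) h ^+ 2 <= Q h h * (8 ^- k / 4).
    apply: quad_disc => s; have := m_le (psd_dom pC s Ch (Cw k)).
    by rewrite J_lin//; have := Jw k; lra.
  rewrite -(@ler_pXn2r _ 2)// ?nnegrE ?mulr_ge0 ?sqrtr_ge0 ?nrm_ge0//.
  rewrite real_normK ?num_real// exprMn (nrm2 pQ) sqr_sqrtr ?invr_ge0 ?exprn_ge0//.
  apply: le_trans dsc _; rewrite mulrC; apply: ler_wpM2r; first exact: (psd_ge0 pQ).
  by have := e8 k; lra.
have s8 : Num.sqrt (8 ^- k : R) @[k --> \oo] --> 0.
  exact: sqrt_cvg0 v8.
have first_var v : (forall k, C (v k)) -> (exists M, forall k, nrm en (v k) <= M /\ nrm ip (v k) <= M) ->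
    A (w k) (v k) @[k --> \oo] --> 0.
  move=> Cv [M vM]; apply/norm_cvg0P.
  apply: (squeeze0 (a := Num.sqrt (lam * M ^+ 2 + M ^+ 2)) (b := 0) s8 s8) => k.
  rewrite normr_ge0 /= mul0r addr0 mulrC; apply: le_trans (Aw _ k (Cv k)) _.
  rewrite ler_wpM2l ?sqrtr_ge0// /nrm ler_sqrt; last first.
    by rewrite addr_ge0 ?sqr_ge0// mulr_ge0 ?sqr_ge0// ltW.
  have [h1 h2] := vM k.
  have M0 : 0 <= M by apply: le_trans h1; exact: nrm_ge0.
  rewrite /Q -(nrm2 pC) -(nrm2 pH); apply: lerD.
    by rewrite ler_pM2l// lerXn2r ?nnegrE ?nrm_ge0.
  by rewrite lerXn2r ?nnegrE ?nrm_ge0.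
exists u, w; split=> //.
- split; first by exists w.
    by rewrite scaleE; do 2 apply: (psd_dom pH) => //.
  move=> phi [v av]; exists w, v; split=> //.
  have [Cv Hphi vphi _] := av; have [M M0 vM] := approx_bounded av.
  have fv : A (w k) (v k) @[k --> \oo] --> 0.
    apply: first_var => //.
    have /cvgrPdist_lt/(_ _ ltr01)[K _ hK] := vphi.
    have S0 : 0 <= \sum_(i < K) nrm ip (v i) by apply: sumr_ge0 => i _; exact: nrm_ge0.
    exists (M + (\sum_(i < K) nrm ip (v i) + (nrm ip phi + 1))) => k; split.
      by have := vM k; have := nrm_ge0 ip phi; lra.
    have [Kk|kK] := leqP K k.
      have := hK k Kk; rewrite /= sub0r normrN ger0_norm ?dst_ge0// => h.
      by have := nrm_dst pH (CH (Cv k)) Hphi; lra.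
    rewrite (bigD1 (Ordinal kK))//=.
    have : 0 <= \sum_(i < K | i != Ordinal kK) nrm ip (v i).
      by apply: sumr_ge0 => i _; exact: nrm_ge0.
    by have := nrm_ge0 ip phi; lra.
  have Hou : H (lin (-1) g u) by exact: (psd_dom pH).
  have ov : ip (off (w k)) (v k) @[k --> \oo] --> ip (lin (-1) g u) phi.
    apply: (psd_cvg pH) => //.
    - by move=> k; exact: Hoff.
    - by move=> k; exact: CH.
    rewrite (_ : (fun k => _) = (fun k => dst ip (w k) u))//; apply/funext => k.
    by rewrite /dst; congr nrm; apply/funext => x; rewrite /off /lin; ring.
  have l0 : lam != 0 by rewrite gt_eqF.
  rewrite (_ : (fun k => _) = (fun k => lam^-1 * (A (w k) (v k) - ip (off (w k)) (v k)))); last first.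
    by apply/funext => k; rewrite /A addrK mulKf.
  rewrite (_ : ip _ phi = lam^-1 * (0 - ip (lin (-1) g u) phi)).
    by apply: cvg_scale; apply: cvgB.
  rewrite scaleE (psd_lin pH)//; last by apply: (psd_dom pH).
  by rewrite !(psd_lin pH)// (psd_null pH H0 Hphi nrm0); field.
- move=> Cg; apply/ler_addgt0Pr => e e0.
  have Jg : J g = lam * en g g.
    rewrite /J (_ : ip _ _ = 0) ?addr0//.
    by have := dstxx pH Hg; rewrite /dst => h; rewrite -(nrm2 pH) h expr0n.
  have ou : ip (off (w k)) (off (w k)) @[k --> \oo] --> ip (lin (-1) g u) (lin (-1) g u).
    have d0 : dst ip (off (w k)) (lin (-1) g u) @[k --> \oo] --> 0.
      rewrite (_ : (fun k => _) = (fun k => dst ip (w k) u))//; apply/funext => k.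
      by rewrite /dst; congr nrm; apply/funext => x; rewrite /off /lin; ring.
    by apply: (psd_cvg pH) => //; try (by move=> k; exact: Hoff); exact: (psd_dom pH).
  have jm : (m + 8 ^- k / 4) @[k --> \oo] --> m + 0 / 4.
    by apply: cvgD; [exact: cvg_cst|apply: cvgM => //; exact: cvg_cst].
  apply: le_trans (_ : _ <= m) _.
    rewrite -[m]addr0 -[X in m + X](mul0r 4^-1); apply: (seq_le ou jm) => k.
    apply: ltW; apply: le_lt_trans (Jw k); rewrite /J lerDr mulr_ge0 ?(psd_ge0 pC)//.
    exact: ltW.
  by apply: le_trans (m_le Cg) _; rewrite Jg lerDl ltW.
Qed.

End resolvent.

(** The minimizing sequence of the resolvent equation solved by [f] pairs
   correctly with every bounded sequence, not only with those converging in
   energy. *)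
Lemma lap_test f h : lap f h -> exists2 w, energy_approx w f &
  forall v phi, (forall k, C (v k)) -> H phi -> dst ip (v k) phi @[k --> \oo] --> 0 ->
    (exists M, forall k, nrm en (v k) <= M) ->
    en (w k) (v k) @[k --> \oo] --> ip h phi.
Proof.
move=> lf; have [[p ap] Hh _] := lf; have [Cp Hf pf cp] := ap.
pose g := lin 1 f h; have Hg : H g by exact: (psd_dom pH).
have [u [w [aw fv lu _]]] := resolvent ltr01 Hg; have [Cw Hu wu cw] := aw.
set h' := lin _ u _ in lu.
have h'E : h' = lin (-1) (lin (-1) f u) h.
  by apply/funext => x; rewrite /h' /g /lin invr1; ring.
have fu : nrm ip (lin (-1) f u) = 0.
  set e := lin (-1) f u; have He : H e by exact: (psd_dom pH).
  have ae := approx_lin (-1) ap aw.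
  have c1 := lap_form lf ap ae; have c2 := lap_form lu aw ae.
  have Hh' : H h' by rewrite h'E; exact: (psd_dom pH).
  have e0 : 0 <= ip h' e - ip h e.
    rewrite subr_ge0; apply: (seq_le c1 c2) => k.
    have Ce : C (lin (-1) (p k) (w k)) by exact: (psd_dom pC).
    have := psd_ge0 pC (lin (-1) (p k) (w k)).
    by rewrite {1}(psd_lin pC (-1) (Cp k) (Cw k) Ce); lra.
  move: e0; rewrite h'E (psd_lin pH)// => e0; apply/eqP; rewrite sqrtr_eq0.
  lra.
have fu' : dst ip u f = 0 by [].
exists w.
  split=> //; apply: (squeeze0 (a := 1) (b := 0) wu wu) => k.
  rewrite dst_ge0 /= mul1r mul0r addr0; apply: le_trans (dst_tri pH (CH (Cw k)) Hu Hf) _.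
  by rewrite fu' addr0.
move=> v phi Cv Hphi vphi [M vM].
have fvk := fv v Cv.
have gk : ip (lin (-1) g (w k)) (v k) @[k --> \oo] --> ip (lin (-1) g u) phi.
  apply: (psd_cvg pH) => //.
  - by move=> k; apply: (psd_dom pH) => //; exact: CH.
  - by move=> k; exact: CH.
  - exact: (psd_dom pH).
  rewrite (_ : (fun k => _) = (fun k => dst ip (w k) u))//; apply/funext => k.
  by rewrite /dst; congr nrm; apply/funext => x; rewrite /lin; ring.
rewrite (_ : (fun k => _) = (fun k => (1 * en (w k) (v k) + ip (lin (-1) g (w k)) (v k)) -
  ip (lin (-1) g (w k)) (v k))); last by apply/funext => k; rewrite mul1r addrK.
rewrite (_ : ip h phi = 0 - ip (lin (-1) g u) phi).
  apply: cvgB => //; apply: fvk.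
  have /cvgrPdist_lt/(_ _ ltr01)[K _ hK] := vphi.
  have S0 : 0 <= \sum_(i < K) nrm ip (v i) by apply: sumr_ge0 => i _; exact: nrm_ge0.
  have M0 : 0 <= M by apply: le_trans (vM 0%N); exact: nrm_ge0.
  exists (M + (\sum_(i < K) nrm ip (v i) + (nrm ip phi + 1))) => k; split.
    by have := vM k; have := nrm_ge0 ip phi; lra.
  have [Kk|kK] := leqP K k.
    have := hK k Kk; rewrite /= sub0r normrN ger0_norm ?dst_ge0// => hk.
    by have := nrm_dst pH (CH (Cv k)) Hphi; lra.
  rewrite (bigD1 (Ordinal kK))//=.
  have : 0 <= \sum_(i < K | i != Ordinal kK) nrm ip (v i).
    by apply: sumr_ge0 => i _; exact: nrm_ge0.
  by have := nrm_ge0 ip phi; lra.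
have -> : lin (-1) g u = lin (-1) h (lin (-1) f u).
  by apply/funext => x; rewrite /g /lin; ring.
rewrite (psd_lin pH)//; last by apply: (psd_dom pH).
by rewrite (psd_null pH _ Hphi fu); [ring|exact: (psd_dom pH)].
Qed.

(** ** Evolution *)

Section evolution.
Hypothesis P_lin : forall t a f g, 0 <= t -> H f -> H g ->
  dst ip (P t (lin a f g)) (lin a (P t f) (P t g)) = 0.
Hypothesis P_0 : forall f, H f -> dst ip (P 0 f) f = 0.
Hypothesis P_add : forall s t f, 0 <= s -> 0 <= t -> H f ->
  dst ip (P (s + t) f) (P s (P t f)) = 0.
Hypothesis P_cont : forall f, H f -> forall e, 0 < e ->
  exists2 d, 0 < d & forall t, 0 < t < d -> dst ip (P t f) f < e.

Let linH a f g : H f -> H g -> H (lin a f g). Proof. exact: (psd_dom pH). Qed.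

Let P0H t f : 0 <= t -> H f -> nrm ip (P t (fun _ => 0)) = 0.
Proof.
move=> t0 Hf; have [K K0 hK] := P_bd t0.
by have := hK _ H0; rewrite nrm0 mulr0 => h; apply/eqP; rewrite eq_le nrm_ge0 h.
Qed.

Lemma dst0_nrm f g : H f -> H g -> dst ip f g = 0 -> nrm ip f = nrm ip g.
Proof.
move=> Hf Hg fg; apply/eqP; rewrite eq_le; apply/andP; split.
- by apply: le_trans (nrm_dst pH Hf Hg) _; rewrite fg addr0.
- by apply: le_trans (nrm_dst pH Hg Hf) _; rewrite (dstC pH) // fg addr0.
Qed.

Lemma dst0_ip f g h : H f -> H g -> H h -> dst ip f g = 0 -> ip f h = ip g h.
Proof.
move=> Hf Hg Hh fg; have : ip (lin (-1) g f) h = 0.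
  by apply: (psd_null pH) => //; exact: linH.
by rewrite (psd_lin pH)//; lra.
Qed.

Lemma dst0_dstl f g h : H f -> H g -> H h -> dst ip f g = 0 -> dst ip f h = dst ip g h.
Proof.
move=> Hf Hg Hh fg; apply/eqP; rewrite eq_le; apply/andP; split.
- by apply: le_trans (dst_tri pH Hf Hg Hh) _; rewrite fg add0r.
- by apply: le_trans (dst_tri pH Hg Hf Hh) _; rewrite (dstC pH Hg Hf) fg add0r.
Qed.

Lemma P_dst t K f g : 0 <= t -> (forall f, H f -> nrm ip (P t f) <= K * nrm ip f) ->
  H f -> H g -> dst ip (P t f) (P t g) <= K * dst ip f g.
Proof.
move=> t0 hK Hf Hg; have Hd : H (lin (-1) g f) by exact: linH.
apply: le_trans (hK _ Hd); rewrite {1}/dst -(dst0_nrm _ _ (P_lin (-1) t0 Hg Hf))//.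
- exact: P_H.
- by apply: linH; exact: P_H.
Qed.

Lemma P_scale t a f : 0 <= t -> H f ->
  nrm ip (P t (lin a f (fun _ => 0))) = `|a| * nrm ip (P t f).
Proof.
move=> t0 Hf; have HPf := P_H t0 Hf; have HP0 := P_H t0 H0.
rewrite (dst0_nrm _ _ (P_lin a t0 Hf H0)); first last.
- exact: linH.
- by apply: P_H => //; exact: linH.
rewrite -(ger0_norm (nrm_ge0 ip (P t f))) -normrM.
rewrite {1}/nrm (psd_sq pH a HPf HP0) (psdC pH) (psd_null pH HP0 HPf (P0H t0 Hf)).
rewrite -(nrm2 pH (P t (fun _ => 0))) (P0H t0 Hf) expr0n /= mulr0 !addr0.
by rewrite -(nrm2 pH) -exprMn sqrtr_sqr.
Qed.

(** The gliding hump: if the operator norms were unbounded near [0], a convergent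
   series of almost maximizing vectors would have unbounded image. *)
Lemma P_near0 : exists2 d, 0 < d &
  exists2 K, 0 <= K & forall t, 0 <= t <= d -> forall f, H f -> nrm ip (P t f) <= K * nrm ip f.
Proof.
apply: contrapT => nb.
have bad n : exists2 t, 0 <= t <= n.+1%:R^-1 & exists y, [/\ H y, nrm ip y <= 4 ^- n &
    exists2 N, 8 ^+ n < N & N / 2 * 4 ^- n < nrm ip (P t y) /\
    forall f, H f -> nrm ip (P t f) <= N * nrm ip f].
  apply: contrapT => h; apply: nb; exists n.+1%:R^-1; first by rewrite invr_gt0.
  exists (8 ^+ n); first by rewrite exprn_ge0.
  move=> t t0n f Hf; rewrite leNgt; apply/negP => ltf; apply: h.
  exists t => //; have /andP[t0 _] := t0n; have [K K0 hK] := P_bd t0.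
  have nf : 0 < nrm ip f.
    rewrite lt_neqAle eq_sym nrm_ge0 andbT; apply/eqP => nf0.
    by move: ltf; rewrite nf0 mulr0 => h; have := hK f Hf; rewrite nf0 mulr0; lra.
  pose E := [set nrm ip (P t y) / nrm ip y | y in [set y | H y /\ 0 < nrm ip y]].
  have supE : has_sup E.
    split; first by exists (nrm ip (P t f) / nrm ip f), f.
    by exists K => _ [y [Hy y0] <-]; rewrite ler_pdivrMr//; exact: hK.
  pose N := sup E.
  have fN : 8 ^+ n < N.
    apply: (@lt_le_trans _ _ (nrm ip (P t f) / nrm ip f)); first by rewrite ltr_pdivlMr.
    by apply: sup_upper_bound => //; exists f.
  have N0 : 0 < N by apply: le_lt_trans fN; rewrite exprn_ge0.
  have N2 : N / 2 < N by lra.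
  have [_ [y [Hy y0] <-] yN] := sup_gt supE.1 N2.
  have c0 : 0 < 4 ^- n / nrm ip y by rewrite divr_gt0// invr_gt0 exprn_gt0.
  exists (lin (4 ^- n / nrm ip y) y (fun _ => 0)); split; first exact: linH.
    apply: le_trans (nrm_lin pH _ Hy H0) _.
    by rewrite nrm0 addr0 gtr0_norm// divfK// gt_eqF.
  exists N => //; split.
    rewrite P_scale// gtr0_norm// mulrC mulrAC -mulrA.
    rewrite ltr_pM2l ?invr_gt0 ?exprn_gt0//; move: yN; rewrite mulrC; lra.
  move=> f' Hf'; have [f0|f0] := eqVneq (nrm ip f') 0.
    by rewrite f0 mulr0 -(mulr0 K) -f0; exact: hK.
  have f'0 : 0 < nrm ip f' by rewrite lt_neqAle eq_sym f0 nrm_ge0.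
  by rewrite -ler_pdivrMr//; apply: sup_upper_bound => //; exists f'.
pose t n := sval (cid2 (bad n)).
have tn n : 0 <= t n <= n.+1%:R^-1 by rewrite /t; case: cid2.
have ty n : exists y, [/\ H y, nrm ip y <= 4 ^- n &
    exists2 N, 8 ^+ n < N & N / 2 * 4 ^- n < nrm ip (P (t n) y) /\
    forall f, H f -> nrm ip (P (t n) f) <= N * nrm ip f].
  by rewrite /t; case: cid2.
pose y n := sval (cid (ty n)).
have yP n : [/\ H (y n), nrm ip (y n) <= 4 ^- n &
    exists2 N, 8 ^+ n < N & N / 2 * 4 ^- n < nrm ip (P (t n) (y n)) /\
    forall f, H f -> nrm ip (P (t n) f) <= N * nrm ip f].
  by rewrite /y; case: cid.
pose sg n (x : T -> R) : R :=
  if nrm ip (P (t n) (y n)) <= nrm ip (P (t n) (lin 1 (y n) x)) then 1 else -1.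
pose x := fix x n := if n is k.+1 then lin (sg k (x k)) (y k) (x k) else (fun _ => 0).
have Hx n : H (x n) by elim: n => //= n IH; have [Hy _ _] := yP n; exact: linH.
have sg1 n z : `|sg n z| = 1 by rewrite /sg; case: ifP; rewrite ?normrN normr1.
have stepd n : dst ip (x n.+1) (x n) <= 4 ^- n.
  have [Hy yn _] := yP n; apply: le_trans yn.
  rewrite /dst (_ : lin (-1) (x n) (x n.+1) = lin (sg n (x n)) (y n) (fun _ => 0)).
    by apply: le_trans (nrm_lin pH _ Hy H0) _; rewrite nrm0 addr0 sg1 mul1r.
  by apply/funext => s; rewrite /= /lin; ring.
have big n : nrm ip (P (t n) (y n)) <= nrm ip (P (t n) (x n.+1)).
  rewrite /= {1}/sg; case: ifP => // /negbT; rewrite -ltNge => lt1.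
  have [Hy _ _] := yP n; have /andP[t0 _] := tn n.
  have H1 : H (lin 1 (y n) (x n)) by exact: linH.
  have H2 : H (lin (-1) (y n) (x n)) by exact: linH.
  have := P_scale 2 t0 Hy; rewrite (_ : lin 2 (y n) (fun _ => 0) =
    lin (-1) (lin (-1) (y n) (x n)) (lin 1 (y n) (x n))); last first.
    by apply/funext => s; rewrite /lin; ring.
  rewrite (dst0_nrm _ _ (P_lin (-1) t0 H2 H1)); first last.
  - by apply: linH; exact: P_H.
  - by apply: P_H => //; exact: linH.
  have := nrm_lin pH (-1) (P_H t0 H2) (P_H t0 H1).
  rewrite normrN normr1 mul1r (ger0_norm (ler0n _ 2)); lra.
have e4 k : 4 ^- k.+1 = 4 ^- k / 4 :> R by rewrite exprSr invfM mulrC.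
have [z Hz xz] : exists2 z, H z & dst ip (x k) z @[k --> \oo] --> 0.
  apply: complete => // k; rewrite -(nrm2 pH).
  apply: (@le_trans _ _ ((4 ^- k) ^+ 2)).
    by rewrite lerXn2r ?nnegrE ?nrm_ge0 ?invr_ge0 ?exprn_ge0//; exact: stepd.
  rewrite -exprVn -exprVn exprAC; apply: lerXn2r; rewrite ?nnegrE ?exprn_ge0//; lra.
have tail n p : dst ip (x (n.+1 + p)%N) (x n.+1) <= (4 ^- n - 4 ^- (n + p)) / 3.
  elim: p => [|p IH]; first by rewrite !addn0 subrr mul0r (dstxx pH).
  rewrite !addnS; apply: le_trans (dst_tri pH (Hx _) (Hx (n.+1 + p)%N) (Hx _)) _.
  have := stepd (n.+1 + p)%N; rewrite addSn !e4 => h.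
  by move: IH; rewrite addSn; lra.
have zx n : dst ip z (x n.+1) <= 4 ^- n / 3.
  have c1 : (dst ip (x (k + n.+1)%N) z + 4 ^- n / 3) @[k --> \oo] --> (0 + 4 ^- n / 3 : R).
    by apply: cvgD; [rewrite (cvg_shiftn n.+1 (fun k => dst ip (x k) z))|exact: cvg_cst].
  rewrite -[X in _ <= X]add0r; apply: (seq_le (cvg_cst _) c1) => k.
  apply: le_trans (dst_tri pH Hz (Hx (k + n.+1)%N) (Hx _)) _.
  rewrite (dstC pH Hz (Hx _)) lerD2l addnC; apply: le_trans (tail n k) _.
  by rewrite ler_pM2r// gerBl invr_ge0 exprn_ge0.
have [d d0 hd] := P_cont Hz ltr01.
have grow n : 2 ^+ n / 6 <= nrm ip (P (t n) z).
  have [Hy _ [N N8 [yN hN]]] := yP n; have /andP[t0 _] := tn n.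
  have := nrm_dst pH (P_H t0 (Hx n.+1)) (P_H t0 Hz).
  have := P_dst t0 hN (Hx n.+1) Hz; rewrite (dstC pH (Hx _) Hz).
  have N0 : 0 < N by apply: le_lt_trans N8; rewrite exprn_ge0.
  have := ler_wpM2l (ltW N0) (zx n); have := big n.
  have : 2 ^+ n <= N * 4 ^- n.
    rewrite ler_pdivlMr ?exprn_gt0// -exprMn; apply: le_trans (ltW N8).
    by rewrite (_ : 2 * 4 = 8) //; ring.
  set a := N * 4 ^- n; have -> : N * (4 ^- n / 3) = a / 3 by rewrite /a; ring.
  move: yN; have -> : N / 2 * 4 ^- n = a / 2 by rewrite /a; ring.
  lra.
pose n := (Num.truncn d^-1 + Num.truncn (6 * (nrm ip z + 1)))%N.
have nd : n.+1%:R^-1 < d.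
  rewrite invf_plt ?posrE//; apply: lt_le_trans (truncnS_gt _) _.
  by rewrite ler_nat ltnS leq_addr.
have n6 : 6 * (nrm ip z + 1) < 2 ^+ n.+1.
  apply: lt_le_trans (truncnS_gt _) _; rewrite -natrX ler_nat.
  by apply: (@leq_trans n.+1); [rewrite ltnS leq_addl|exact/ltnW/ltn_expl].
have tn1 := tn n.+1; have gn := grow n.+1.
suff : nrm ip (P (t n.+1) z) < nrm ip z + 1 by lra.
case/andP: tn1 => t0 tle; have [t00|tn0] := eqVneq (t n.+1) 0.
  by rewrite t00 (dst0_nrm (P_H (lexx 0) Hz) Hz (P_0 Hz)); lra.
have tp : 0 < t n.+1 by rewrite lt_neqAle eq_sym tn0.
have := nrm_dst pH (P_H t0 Hz) Hz; have := hd (t n.+1).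
rewrite tp (le_lt_trans tle)//; last first.
  by apply: le_lt_trans nd; rewrite lef_pV2 ?posrE// ler_nat.
by move=> /(_ isT); lra.
Qed.

Lemma P_loc_bd Tm : exists2 K, 0 <= K &
  forall t, 0 <= t <= Tm -> forall f, H f -> nrm ip (P t f) <= K * nrm ip f.
Proof.
have [d d0 [K0 K00 hK0]] := P_near0.
pose K := K0 + 1; have K1 : 1 <= K by rewrite /K lerDr.
have hK t f : 0 <= t <= d -> H f -> nrm ip (P t f) <= K * nrm ip f.
  move=> td Hf; apply: le_trans (hK0 t td f Hf) _.
  by rewrite ler_wpM2r ?nrm_ge0// /K lerDl.
have ind m t f : 0 <= t <= m%:R * d -> H f -> nrm ip (P t f) <= K ^+ m * nrm ip f.
  elim: m t f => [|m IH] t f /andP[t0 tm] Hf.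
    have -> : t = 0 by move: tm; rewrite mul0r; lra.
    by rewrite (dst0_nrm (P_H (lexx 0) Hf) Hf (P_0 Hf)) expr0 mul1r.
  have [td|dt] := leP t d.
    apply: le_trans (hK t f _ Hf) _; first by rewrite t0.
    by rewrite ler_wpM2r ?nrm_ge0// exprS ler_peMr ?exprn_ege1//; lra.
  have td0 : 0 <= t - d by rewrite subr_ge0 ltW.
  have := P_add (ltW d0) td0 Hf; rewrite addrC subrK => E.
  have Htd := P_H td0 Hf.
  rewrite (dst0_nrm (P_H t0 Hf) (P_H (ltW d0) Htd) E).
  apply: le_trans (hK d _ _ Htd) _; first by rewrite lexx ltW.
  rewrite exprS -mulrA ler_wpM2l//; first by lra.
  by apply: IH => //; rewrite td0 /=; move: tm; rewrite -natr1; lra.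
exists (K ^+ (Num.truncn (Tm / d)).+1); first by rewrite exprn_ge0; lra.
move=> t /andP[t0 tT] f Hf; apply: ind => //; rewrite t0 /=.
by apply: le_trans tT _; rewrite -ler_pdivrMr//; exact/ltW/truncnS_gt.
Qed.

(** Strong continuity at [0] propagates through the semigroup law, with the local
   bound on the operator norms. *)
Lemma P_unif_cont Tm f : H f -> forall e, 0 < e -> exists2 d, 0 < d &
  forall s t, 0 <= s -> 0 <= t < d -> s + t <= Tm -> dst ip (P (s + t) f) (P s f) < e.
Proof.
move=> Hf e e0; have [K K0 hK] := P_loc_bd Tm.
have K1 : 0 < K + 1 by lra.
have [d d0 hd] := P_cont Hf (divr_gt0 e0 K1); exists d => // s t s0 /andP[t0 td] st.
have Ht := P_H t0 Hf.
rewrite (dst0_dstl _ _ _ (P_add s0 t0 Hf)); try by apply: P_H => //; rewrite ?addr_ge0.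
have hs g : H g -> nrm ip (P s g) <= K * nrm ip g by apply: hK; rewrite s0; lra.
apply: le_lt_trans (P_dst s0 hs Ht Hf) _.
have [->|tn0] := eqVneq t 0; first by rewrite P_0// mulr0.
have tp : 0 < t < d by rewrite lt_neqAle eq_sym tn0 t0.
apply: le_lt_trans (ler_wpM2l K0 (ltW (hd t tp))) _.
by rewrite mulrCA gtr_pMr// ltr_pdivrMr// mul1r ltrDl.
Qed.

Lemma lap_H f h : lap f h -> H f /\ H h.
Proof. by move=> /gen[]. Qed.

Lemma dquot_H t f : 0 <= t -> H f -> H (dquot t f).
Proof. by move=> t0 Hf; rewrite /dquot scaleE; apply: linH; [exact: P_H|exact: linH]. Qed.

Lemma P_comm s t f : 0 <= s -> 0 <= t -> H f -> dst ip (P s (P t f)) (P t (P s f)) = 0.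
Proof.
move=> s0 t0 Hf; have A1 := P_add s0 t0 Hf; have A2 := P_add t0 s0 Hf.
rewrite addrC in A2.
have H1 := P_H s0 (P_H t0 Hf); have H2 := P_H t0 (P_H s0 Hf).
have H3 := P_H (addr_ge0 s0 t0) Hf.
by rewrite -(dst0_dstl H3 H1 H2 A1).
Qed.

Lemma dquot_P s t f : 0 <= s -> 0 <= t -> H f -> dst ip (dquot s (P t f)) (P t (dquot s f)) = 0.
Proof.
move=> s0 t0 Hf; have HPf := P_H t0 Hf; have HPs := P_H s0 Hf; have HP0 := P_H t0 H0.
apply/eqP; rewrite eq_le dst_ge0 andbT /dquot !scaleE.
have Ha : H (lin s^-1 f (fun _ => 0)) by exact: linH.
have HPa := P_H t0 Ha; have HPts := P_H t0 HPs; have HPst := P_H s0 HPf.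
have Hb : H (lin s^-1 (P t f) (fun _ => 0)) by exact: linH.
have H1 : H (lin (- s^-1) (P t (P s f)) (P t (lin s^-1 f (fun _ => 0)))) by exact: linH.
have H2 : H (lin (- s^-1) (P s (P t f)) (lin s^-1 (P t f) (fun _ => 0))) by exact: linH.
have H3 : H (P t (lin (- s^-1) (P s f) (lin s^-1 f (fun _ => 0)))).
  by apply: P_H => //; exact: linH.
apply: le_trans (dst_tri pH H2 H1 H3) _.
rewrite (dstC pH H1 H3) (P_lin _ t0 HPs Ha) addr0.
apply: le_trans (dst_lin pH _ HPst HPts Hb HPa) _.
rewrite (P_comm s0 t0 Hf) mulr0 add0r.
have H4 := linH s^-1 HPf HP0.
apply: le_trans (dst_tri pH Hb H4 HPa) _.
rewrite (dstC pH H4 HPa) (P_lin _ t0 Hf H0) addr0.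
apply: le_trans (dst_lin pH _ HPf HPf H0 HP0) _.
rewrite (dstxx pH HPf) mulr0 add0r (dstC pH H0 HP0).
by rewrite /dst (_ : lin (-1) _ _ = P t (fun _ => 0)) ?(P0H t0 Hf)//; apply/funext => r; rewrite /lin mulr0 add0r.
Qed.

(** The difference quotients commute with the semigroup. *)
Lemma lap_P t f h : 0 <= t -> lap f h -> lap (P t f) (P t h).
Proof.
move=> t0 /gen[Hf Hh fh]; apply/gen; split; try exact: P_H.
move=> e e0; have [K K0 hK] := P_bd t0; have K1 : 0 < K + 1 by lra.
have [d d0 hd] := fh _ (divr_gt0 e0 K1); exists d => // s sd.
have /andP[s0 _] := sd; have s0' := ltW s0.
have Hq := dquot_H s0' Hf; have HPf := P_H t0 Hf.
rewrite (dst0_dstl (dquot_H s0' HPf) (P_H t0 Hq) (P_H t0 Hh) (dquot_P s0' t0 Hf)).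
apply: le_lt_trans (P_dst t0 hK Hq Hh) _.
apply: le_lt_trans (ler_wpM2l K0 (ltW (hd s sd))) _.
by rewrite mulrCA gtr_pMr// ltr_pdivrMr// mul1r ltrDl.
Qed.

Lemma step_dquot t s f : 0 <= t -> 0 < s -> H f ->
  dst ip (P (s + t) f) (lin (- s) (dquot s (P t f)) (P t f)) = 0.
Proof.
move=> t0 s0 Hf; rewrite (_ : lin _ _ _ = P s (P t f)); first exact: P_add (ltW s0) t0 Hf.
by apply/funext => x; rewrite /lin /dquot /lin; field; rewrite gt_eqF.
Qed.

(** The differential inequality for a convex functional [J] with derivative [th]
   along an orbit. *)
Lemma evolve (J : (T -> R) -> R) (th : (T -> R) -> T -> R) K a c0 Tm f h :
  0 <= Tm -> lap f h -> 0 <= K -> (forall u : T -> R, H u -> H (th u)) ->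
  (forall u v : T -> R, H u -> H v -> dst ip (th u) (th v) <= K * dst ip u v) ->
  (forall u v : T -> R, H u -> H v -> J v - J u <= ip (th v) (lin (-1) u v)) ->
  (forall t, 0 <= t < Tm -> a * (J (P t f) - c0) <= ip (th (P t f)) (P t h)) ->
  J (P Tm f) - c0 <= expR (- a * Tm) * (J f - c0).
Proof.
move=> T0 lf K0 thH thL Jc hJ; have [Hf Hh] := lap_H lf.
have J0 (u v : T -> R) : H u -> H v -> dst ip u v = 0 -> J u = J v.
  have le (u' v' : T -> R) : H u' -> H v' -> dst ip v' u' = 0 -> J v' - J u' <= 0.
    move=> Hu Hv vu; apply: le_trans (Jc _ _ Hu Hv) _.
    by rewrite (psdC pH) (psd_null pH (linH (-1) Hu Hv) (thH _ Hv) vu).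
  move=> Hu Hv uv; have := le u v Hu Hv; rewrite (dstC pH Hv Hu) => /(_ uv).
  by have := le v u Hv Hu uv; lra.
have <- : J (P 0 f) = J f by apply: J0; [exact: P_H|by []|exact: P_0].
apply: (gronwall (y := fun t => J (P t f) - c0)) => // t tT e e0.
- have /andP[t0 _] := tT; have lt := lap_P t0 lf.
  have Hu := P_H t0 Hf; have Hk := P_H t0 Hh.
  pose D := K * (nrm ip (P t h) + 1) + nrm ip (th (P t f)) + 1.
  have q0 : 0 <= K * (nrm ip (P t h) + 1) by rewrite mulr_ge0// addr_ge0// nrm_ge0.
  have D0 : 0 < D by have := nrm_ge0 ip (th (P t f)); rewrite /D; lra.
  pose e1 := Num.min 1 (e / D); have e10 : 0 < e1 by rewrite lt_min ltr01 divr_gt0.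
  have e11 : e1 <= 1 by rewrite ge_min lexx.
  have e1D : e1 * D <= e by rewrite -ler_pdivlMr// ge_min lexx orbT.
  have [d1 d10 hd1] := P_cont Hu e10; have /gen[_ _ gk] := lt.
  have [d2 d20 hd2] := gk _ e10.
  exists (Num.min d1 d2) => [|s /andP[s0]]; first by rewrite lt_min d10.
  rewrite lt_min => /andP[s1 s2].
  have c1 : dst ip (P s (P t f)) (P t f) < e1 by apply: hd1; rewrite s0.
  have c2 : dst ip (dquot s (P t f)) (P t h) < e1 by apply: hd2; rewrite s0.
  have Hq := dquot_H (ltW s0) Hu; have Hv : H (P (s + t) f) by apply: P_H => //; lra.
  have c3 : dst ip (P (s + t) f) (P t f) < e1.
    by rewrite (dst0_dstl Hv (P_H (ltW s0) Hu) Hu (P_add (ltW s0) t0 Hf)).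
  have c4 := thL _ _ Hv Hu; have c5 := nrm_dst pH Hq Hk.
  have := psd_dst_le pH (thH _ Hv) (thH _ Hu) Hq Hk.
  have c6 : dst ip (th (P (s + t) f)) (th (P t f)) * nrm ip (dquot s (P t f)) <=
      e1 * (K * (nrm ip (P t h) + 1)).
    rewrite mulrCA mulrA; apply: ler_pM; rewrite ?dst_ge0 ?nrm_ge0//.
    - by apply: le_trans c4 _; exact: (ler_wpM2l K0 (ltW c3)).
    - lra.
  have c7 : nrm ip (th (P t f)) * dst ip (dquot s (P t f)) (P t h) <= e1 * nrm ip (th (P t f)).
    by rewrite mulrC; apply: (ler_wpM2r (nrm_ge0 ip _) (ltW c2)).
  rewrite ler_norml => /andP[c8 _].
  have c9 : ip (th (P t f)) (P t h) - e <= ip (th (P (s + t) f)) (dquot s (P t f)).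
    by move: e1D; rewrite /D; lra.
  have := Jc _ _ Hu Hv.
  have -> : ip (th (P (s + t) f)) (lin (-1) (P t f) (P (s + t) f)) =
      - s * ip (th (P (s + t) f)) (dquot s (P t f)).
    have Hs : H (lin (- s) (dquot s (P t f)) (P t f)) by exact: linH.
    rewrite (psd_linr pH (-1) Hu Hv (thH _ Hv)) (psdC pH _ (P (s + t) f)).
    rewrite (dst0_ip Hv Hs (thH _ Hv) (step_dquot t0 s0 Hf)) (psd_lin pH _ Hq Hu (thH _ Hv)).
    by rewrite (psdC pH (th _) (P t f)) (psdC pH (th _) (dquot _ _)); ring.
  have := ler_wpM2l (ltW s0) c9; have := ler_wpM2l (ltW s0) (hJ t tT).
  by rewrite addrC [t + s]addrC; lra.
- have /andP[t0 tT'] := tT; have Hu := P_H (ltW t0) Hf.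
  pose D := nrm ip (th (P t f)) + K + 1.
  have D0 : 0 < D by have := nrm_ge0 ip (th (P t f)); rewrite /D; lra.
  pose e1 := Num.min 1 (e / D); have e10 : 0 < e1 by rewrite lt_min ltr01 divr_gt0.
  have e11 : e1 <= 1 by rewrite ge_min lexx.
  have e1D : e1 * D <= e by rewrite -ler_pdivlMr// ge_min lexx orbT.
  have [d d0 hd] := P_unif_cont Tm Hf e10; exists d => // s /andP[s0 sd] st.
  have ts : 0 <= t - s by rewrite subr_ge0.
  have Hv := P_H ts Hf.
  have c1 : dst ip (P t f) (P (t - s) f) < e1.
    by have := hd (t - s) s ts; rewrite subrK; apply => //; rewrite (ltW s0).
  have c2 := thL _ _ Hv Hu; have c3 := nrm_dst pH (thH _ Hv) (thH _ Hu).
  have c4 : nrm ip (th (P (t - s) f)) <= D.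
    apply: le_trans c3 _; rewrite (dstC pH Hv Hu) in c2.
    have := ler_wpM2l K0 (ltW c1); have := ler_wpM2l K0 e11; rewrite /D; lra.
  have c5 : nrm ip (th (P t f)) <= D by rewrite /D; lra.
  have bound (p q : T -> R) : H p -> H q -> nrm ip (th q) <= D -> dst ip q p < e1 -> J q - J p <= e.
    move=> Hp Hq nq qp; apply: le_trans (Jc _ _ Hp Hq) _; apply: le_trans (ler_norm _) _.
    apply: le_trans (psd_le pH (thH _ Hq) (linH (-1) Hp Hq)) _.
    by apply: le_trans e1D; rewrite mulrC; apply: ler_pM; rewrite ?nrm_ge0// ltW.
  have b1 := bound _ _ Hv Hu c5 c1; rewrite (dstC pH Hu Hv) in c1.
  have b2 := bound _ _ Hu Hv c4 c1.
  by rewrite ler_norml; apply/andP; split; lra.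
Qed.

Lemma lap_contract t f h : 0 <= t -> lap f h -> nrm ip (P t f) <= nrm ip f.
Proof.
move=> t0 lf; have [Hf Hh] := lap_H lf.
suff : ip (P t f) (P t f) - 0 <= expR (- 0 * t) * (ip f f - 0).
  rewrite oppr0 mul0r expR0 mul1r => h1.
  by rewrite -(@ler_pXn2r _ 2)// ?nnegrE ?nrm_ge0// !(nrm2 pH); lra.
apply: (evolve (J := fun u : T -> R => ip u u) (th := fun u : T -> R => lin 2 u (fun _ => 0)) (K := 2) t0 lf) => //.
- by move=> u Hu; exact: linH.
- move=> u v Hu Hv; apply: le_trans (dst_lin pH 2 Hu Hv H0 H0) _.
  by rewrite (dstxx pH H0) addr0 ger0_norm.
- move=> u v Hu Hv; have Hd := linH (-1) Hu Hv.
  rewrite (psd_lin pH 2 Hv H0 Hd) (psd_null pH H0 Hd nrm0) addr0 (psd_linr pH (-1) Hu Hv Hv).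
  by have := psd_ge0 pH (lin (-1) u v); rewrite (psd_sq pH (-1) Hu Hv) (psdC pH v u); lra.
- move=> s /andP[s0 _]; rewrite mul0r (psd_lin pH 2 (P_H s0 Hf) H0 (P_H s0 Hh)).
  rewrite (psd_null pH H0 (P_H s0 Hh) nrm0) addr0 (psdC pH) mulr_ge0//.
  exact: lap_pos (lap_P s0 lf).
Qed.

(** [ip (P s f) (P (Tm - s) g)] has vanishing derivative in [s]. *)
Lemma lap_symmetric Tm f g h k : 0 <= Tm -> lap f h -> lap g k -> ip (P Tm f) g = ip f (P Tm g).
Proof.
move=> T0 lf lg; have [Hf Hh] := lap_H lf; have [Hg Hk] := lap_H lg.
pose y s := ip (P s f) (P (Tm - s) g).
have [K K0 hK] := P_loc_bd Tm.
have deriv t : 0 <= t < Tm -> forall e, 0 < e -> exists2 d, 0 < d &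
    forall s, 0 < s < d -> `|y (t + s) - y t| <= e * s.
  move=> /andP[t0 tT] e e0; have Tt : 0 <= Tm - t by lra.
  have Hu := P_H t0 Hf; have Hhu := P_H t0 Hh; have Hv := P_H Tt Hg; have Hkv := P_H Tt Hk.
  have symE : ip (P t h) (P (Tm - t) g) = ip (P t f) (P (Tm - t) k).
    exact: lap_sym (lap_P t0 lf) (lap_P Tt lg).
  pose D := (nrm ip (P (Tm - t) g) + 1) + nrm ip (P t h) + nrm ip (P t f) * (K + 1) + 1.
  have n1 := nrm_ge0 ip (P (Tm - t) g); have n2 := nrm_ge0 ip (P t h).
  have n3 := nrm_ge0 ip (P t f).
  have n4 : 0 <= nrm ip (P t f) * (K + 1) by rewrite mulr_ge0//; lra.
  have D0 : 0 < D by rewrite /D; lra.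
  pose e1 := Num.min 1 (e / D); have e10 : 0 < e1 by rewrite lt_min ltr01 divr_gt0.
  have e11 : e1 <= 1 by rewrite ge_min lexx.
  have e1D : e1 * D <= e by rewrite -ler_pdivlMr// ge_min lexx orbT.
  have [d1 d10 hd1] := P_unif_cont Tm Hg e10; have [d2 d20 hd2] := P_unif_cont Tm Hk e10.
  have /gen[_ _ gf] := lap_P t0 lf; have [d3 d30 hd3] := gf _ e10.
  have /gen[_ _ gg] := lg; have [d4 d40 hd4] := gg _ e10.
  have Tt' : 0 < Tm - t by lra.
  exists (Num.min (Num.min d1 d2) (Num.min (Num.min d3 d4) (Tm - t))) => [|s /andP[s0]].
    by rewrite !lt_min d10 d20 d30 d40.
  rewrite !lt_min => /andP[/andP[s1 s2] /andP[/andP[s3 s4] s5]].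
  have s0' := ltW s0; have r0 : 0 <= Tm - (t + s) by lra.
  have rE : Tm - (t + s) + s = Tm - t by ring.
  have Hw := P_H r0 Hg; have Hqu := dquot_H s0' Hu; have Hqw := dquot_H s0' Hw.
  have c1 : dst ip (P (Tm - t) g) (P (Tm - (t + s)) g) < e1.
    by have := hd1 (Tm - (t + s)) s r0; rewrite rE; apply; [rewrite s0'|lra].
  have c2 : dst ip (P (Tm - t) k) (P (Tm - (t + s)) k) < e1.
    by have := hd2 (Tm - (t + s)) s r0; rewrite rE; apply; [rewrite s0'|lra].
  have c3 : dst ip (dquot s (P t f)) (P t h) < e1 by apply: hd3; rewrite s0.
  have c4 : dst ip (dquot s g) k < e1 by apply: hd4; rewrite s0.
  have Hqg := dquot_H s0' Hg; have Hkw := P_H r0 Hk.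
  have c5 : dst ip (dquot s (P (Tm - (t + s)) g)) (P (Tm - t) k) <= (K + 1) * e1.
    rewrite (dst0_dstl Hqw (P_H r0 Hqg) Hkv (dquot_P s0' r0 Hg)).
    apply: le_trans (dst_tri pH (P_H r0 Hqg) Hkw Hkv) _.
    have hKr f' : H f' -> nrm ip (P (Tm - (t + s)) f') <= K * nrm ip f'.
      by apply: hK; rewrite r0; lra.
    have := P_dst r0 hKr Hqg Hk; have := ler_wpM2l K0 (ltW c4).
    by rewrite (dstC pH Hkw Hkv); lra.
  have E : y (t + s) - y t = - s * (ip (dquot s (P t f)) (P (Tm - (t + s)) g) -
      ip (P t f) (dquot s (P (Tm - (t + s)) g))).
    have Hs : H (lin (- s) (dquot s (P t f)) (P t f)) by exact: linH.
    have Hs' : H (lin (- s) (dquot s (P (Tm - (t + s)) g)) (P (Tm - (t + s)) g)) by exact: linH.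
    have Hts : H (P (s + t) f) by apply: P_H => //; lra.
    rewrite /y {1}[t + s]addrC (dst0_ip Hts Hs Hw (step_dquot t0 s0 Hf)).
    have := step_dquot r0 s0 Hg; rewrite (_ : s + _ = Tm - t); last by ring.
    move=> z0; rewrite (psdC pH (P t f) (P (Tm - t) g)) (dst0_ip Hv Hs' Hu z0).
    rewrite (psd_lin pH _ Hqu Hu Hw) (psd_lin pH _ Hqw Hw Hu).
    by rewrite (psdC pH (P t f) (dquot _ _)) (psdC pH (P (Tm - (t + s)) g)); ring.
  rewrite E normrM normrN (gtr0_norm s0) mulrC ler_wpM2r//.
  have := psd_dst_le pH Hqu Hhu Hw Hv; have := psd_dst_le pH Hu Hu Hqw Hkv.
  rewrite (dstxx pH Hu) mul0r add0r (dstC pH Hw Hv) symE.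
  have := nrm_dst pH Hw Hv; rewrite (dstC pH Hw Hv) => c6.
  have c7 : dst ip (dquot s (P t f)) (P t h) * nrm ip (P (Tm - (t + s)) g) <=
      e1 * (nrm ip (P (Tm - t) g) + 1).
    by apply: ler_pM; rewrite ?dst_ge0 ?nrm_ge0//; lra.
  have c8 : nrm ip (P t h) * dst ip (P (Tm - t) g) (P (Tm - (t + s)) g) <= nrm ip (P t h) * e1.
    by rewrite ler_wpM2l// ltW.
  have c9 := ler_wpM2l n3 c5.
  move: e1D; rewrite /D => e1D.
  rewrite !ler_norml => /andP[x1 x2] /andP[x3 x4]; apply/andP; split; lra.
have left t : 0 < t <= Tm -> forall e, 0 < e -> exists2 d, 0 < d &
    forall s, 0 < s < d -> s <= t -> `|y t - y (t - s)| <= e.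
  move=> /andP[t0 tT] e e0; have Tt : 0 <= Tm - t by lra.
  have Hu := P_H (ltW t0) Hf; have Hv := P_H Tt Hg.
  pose D := nrm ip (P (Tm - t) g) + K * nrm ip f + 1.
  have n1 := nrm_ge0 ip (P (Tm - t) g).
  have n2 : 0 <= K * nrm ip f by rewrite mulr_ge0// nrm_ge0.
  have D0 : 0 < D by rewrite /D; lra.
  have [d1 d10 hd1] := P_unif_cont Tm Hf (divr_gt0 e0 D0).
  have [d2 d20 hd2] := P_unif_cont Tm Hg (divr_gt0 e0 D0).
  exists (Num.min d1 d2) => [|s /andP[s0]]; first by rewrite lt_min d10.
  rewrite lt_min => /andP[s1 s2] st; have s0' := ltW s0.
  have r0 : 0 <= t - s by lra.
  have r1 : 0 <= Tm - (t - s) by lra.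
  have c1 : dst ip (P t f) (P (t - s) f) < e / D.
    by have := hd1 (t - s) s r0; rewrite subrK; apply => //; rewrite s0'.
  have c2 : dst ip (P (Tm - (t - s)) g) (P (Tm - t) g) < e / D.
    have := hd2 (Tm - t) s Tt; rewrite (_ : Tm - t + s = Tm - (t - s)); last by ring.
    by apply; [rewrite s0'|lra].
  have HPf := P_H r0 Hf; have HPg := P_H r1 Hg.
  apply: le_trans (psd_dst_le pH Hu HPf Hv HPg) _; rewrite (dstC pH Hv HPg).
  have c3 : nrm ip (P (t - s) f) <= K * nrm ip f by apply: hK => //; rewrite r0; lra.
  have -> : e = e / D * D by rewrite divfK// gt_eqF.
  apply: le_trans (_ : _ <= e / D * nrm ip (P (Tm - t) g) + (K * nrm ip f) * (e / D)) _.
    apply: lerD; first by rewrite ler_wpM2r// ltW.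
    by apply: ler_pM; rewrite ?nrm_ge0 ?dst_ge0// ltW.
  by have q0 := divr_gt0 e0 D0; set q := e / D in q0 *; clearbody q; rewrite /D; lra.
have yT : y Tm = y 0.
  apply/eqP; rewrite eq_le; apply/andP; split.
  - apply: dini_le => // t tT e e0.
      have [d d0 hd] := deriv t tT e e0; exists d => // s sd.
      by have := hd s sd; rewrite ler_norml => /andP[_]; lra.
    have [d d0 hd] := left t tT e e0; exists d => // s sd st.
    by have := hd s sd st; rewrite ler_norml => /andP[_]; lra.
  - rewrite -lerN2; apply: (dini_le (y := fun t => - y t)) => // t tT e e0.
      have [d d0 hd] := deriv t tT e e0; exists d => // s sd.
      by have := hd s sd; rewrite ler_norml => /andP[+ _]; lra.
    have [d d0 hd] := left t tT e e0; exists d => // s sd st.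
    by have := hd s sd st; rewrite ler_norml => /andP[+ _]; lra.
have HT := P_H T0 Hf; have HT' := P_H T0 Hg.
move: yT; rewrite /y subrr subr0.
rewrite (psdC pH (P Tm f)) (dst0_ip (P_H (lexx 0) Hg) Hg HT (P_0 Hg)).
by rewrite (dst0_ip (P_H (lexx 0) Hf) Hf HT' (P_0 Hf)) (psdC pH g).
Qed.

Definition hdom f := H f /\ forall e, 0 < e -> exists (u h : T -> R), lap u h /\ dst ip u f < e.

(** Resolvents of [f] lie in the domain and converge to [f] as [lam] tends to [0]. *)
Lemma C_hdom f : C f -> hdom f.
Proof.
move=> Cf; have Hf := CH Cf; split=> // e e0; have ef := psd_ge0 pC f.
have l0 : 0 < e ^+ 2 / (2 * (en f f + 1)) by rewrite divr_gt0 ?exprn_gt0// mulr_gt0//; lra.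
have [u [w [aw _ lu /(_ Cf) uf]]] := resolvent l0 Hf.
exists u, (lin (- (e ^+ 2 / (2 * (en f f + 1)))^-1) u
  (fun x => (e ^+ 2 / (2 * (en f f + 1)))^-1 * f x)); split=> //.
have [Hu _] := lap_H lu.
rewrite (dstC pH Hu Hf) -(@ltr_pXn2r _ 2)// ?nnegrE ?dst_ge0 ?ltW// (nrm2 pH).
have := nrm2 pH (lin (-1) u f); rewrite -/(dst ip f u) => nf.
have le : ip (lin (-1) u f) (lin (-1) u f) = ip (lin (-1) f u) (lin (-1) f u).
  by rewrite (psd_sq pH (-1) Hu Hf) (psd_sq pH (-1) Hf Hu) (psdC pH u f); ring.
rewrite le; apply: le_lt_trans uf _.
rewrite mulrAC ltr_pdivrMr; last by rewrite mulr_gt0//; lra.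
by rewrite ltr_pM2l ?exprn_gt0//; lra.
Qed.

Lemma hdom_P t f : 0 <= t -> hdom f -> hdom (P t f).
Proof.
move=> t0 [Hf hf]; split=> [|e e0]; first exact: P_H.
have [K K0 hK] := P_bd t0; have K1 : 0 < K + 1 by lra.
have [u [h [lu uf]]] := hf _ (divr_gt0 e0 K1); exists (P t u), (P t h); split; first exact: lap_P.
apply: le_lt_trans (P_dst t0 hK (lap_H lu).1 Hf) _.
apply: le_lt_trans (ler_wpM2l K0 (ltW uf)) _.
by rewrite mulrCA gtr_pMr// ltr_pdivrMr// mul1r ltrDl.
Qed.

Lemma hdom_lim t f : 0 <= t -> hdom f -> forall e, 0 < e -> exists (u h : T -> R),
  [/\ lap u h, dst ip u f < e & dst ip (P t u) (P t f) < e].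
Proof.
move=> t0 [Hf hf] e e0; have [K K0 hK] := P_bd t0; have K1 : 0 < K + 1 by lra.
have [u [h [lu uf]]] := hf _ (divr_gt0 e0 K1); exists u, h; split=> //.
  by apply: lt_le_trans uf _; rewrite ler_pdivrMr// ler_peMr ?(ltW e0)//; lra.
apply: le_lt_trans (P_dst t0 hK (lap_H lu).1 Hf) _.
apply: le_lt_trans (ler_wpM2l K0 (ltW uf)) _.
by rewrite mulrCA gtr_pMr// ltr_pdivrMr// mul1r ltrDl.
Qed.

Lemma hdom_contract t f : 0 <= t -> hdom f -> nrm ip (P t f) <= nrm ip f.
Proof.
move=> t0 hf; have Hf := hf.1; apply/ler_addgt0Pr => e e0.
have e2 : 0 < e / 2 by lra.
have [u [h [lu uf Puf]]] := hdom_lim t0 hf e2; have [Hu _] := lap_H lu.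
have := lap_contract t0 lu; have := nrm_dst pH Hu Hf.
have := nrm_dst pH (P_H t0 Hf) (P_H t0 Hu); rewrite (dstC pH (P_H t0 Hf) (P_H t0 Hu)).
lra.
Qed.

Lemma hdom_symmetric t f g : 0 <= t -> hdom f -> hdom g -> ip (P t f) g = ip f (P t g).
Proof.
move=> t0 hf hg; have Hf := hf.1; have Hg := hg.1; have HPf := P_H t0 Hf; have HPg := P_H t0 Hg.
suff h e : 0 < e -> `|ip (P t f) g - ip f (P t g)| <= e.
  by apply/eqP; rewrite -subr_eq0 -normr_le0; apply/ler_addgt0Pr => e /h; rewrite add0r.
move=> e0; have n1 := nrm_ge0 ip f; have n2 := nrm_ge0 ip g.
pose D := 2 * (nrm ip f + nrm ip g + 1); have D0 : 0 < D by rewrite /D; lra.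
pose e1 := Num.min 1 (e / D); have e10 : 0 < e1 by rewrite lt_min ltr01 divr_gt0.
have e11 : e1 <= 1 by rewrite ge_min lexx.
have e1D : e1 * D <= e by rewrite -ler_pdivlMr// ge_min lexx orbT.
have [u [a [lu uf Puf]]] := hdom_lim t0 hf e10.
have [v [b [lv vg Pvg]]] := hdom_lim t0 hg e10.
have [Hu _] := lap_H lu; have [Hv _] := lap_H lv.
have HPu := P_H t0 Hu; have HPv := P_H t0 Hv.
have := psd_dst_le pH HPu HPf Hv Hg; have := psd_dst_le pH Hu Hf HPv HPg.
rewrite (lap_symmetric t0 lu lv).
have m1 : nrm ip v <= nrm ip g + 1 by have := nrm_dst pH Hv Hg; lra.
have m2 : nrm ip (P t v) <= nrm ip g + 1 by apply: le_trans (lap_contract t0 lv) _.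
have m3 := hdom_contract t0 hf.
have c1 : dst ip (P t u) (P t f) * nrm ip v <= e1 * (nrm ip g + 1).
  by apply: ler_pM; rewrite ?dst_ge0 ?nrm_ge0// ltW.
have c2 : nrm ip (P t f) * dst ip v g <= nrm ip f * e1.
  by apply: ler_pM; rewrite ?dst_ge0 ?nrm_ge0// ltW.
have c3 : dst ip u f * nrm ip (P t v) <= e1 * (nrm ip g + 1).
  by apply: ler_pM; rewrite ?dst_ge0 ?nrm_ge0// ltW.
have c4 : nrm ip f * dst ip (P t v) (P t g) <= nrm ip f * e1.
  by apply: ler_pM; rewrite ?dst_ge0 ?nrm_ge0// ltW.
move: e1D; rewrite /D !ler_norml => e1D /andP[x1 x2] /andP[x3 x4]; apply/andP; split; lra.
Qed.

End evolution.

End generator.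
End form_operator.

(** * The heat semigroup of a complex *)

Section cvg_helpers.
Context {R : realType}.

Lemma cvg_fin (I : Type) (F : set_system I) (FF : Filter F) (a : I -> R) (l : R) :
  ((a k)%:E @[k --> F] --> l%:E)%E <-> a k @[k --> F] --> l.
Proof.
split=> [h|h]; last by apply: cvg_EFin => //; apply: nearW.
by have /fine_cvgP[_] := h.
Qed.

Lemma cvg_right0 (N : R -> \bar R) (a : R -> R) : (forall t, 0 < t -> N t = (a t)%:E) ->
  (forall t, 0 <= a t) -> (N t @[t --> 0^'+] --> 0%E)%E <->
  forall e, 0 < e -> exists2 d, 0 < d & forall t, 0 < t < d -> a t < e.
Proof.
move=> Na a0; have E : (N t @[t --> 0^'+] --> 0%E)%E <-> (a t @[t --> 0^'+] --> (0 : R)).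
  have nE : \forall t \near 0^'+, N t = (a t)%:E.
    by near=> t; apply: Na; near: t; exact: nbhs_right_gt.
  split=> h.
  - apply/cvg_fin; apply: cvg_trans h; apply: near_eq_cvg.
    by near=> t; apply: Na; near: t; exact: nbhs_right_gt.
  - move/cvg_fin: h => h; apply: cvg_trans h; apply: near_eq_cvg.
    by near=> t; apply/esym/Na; near: t; exact: nbhs_right_gt.
split=> [/E/cvgrPdist_lt h e e0|h].
- have := h e e0 => /nbhs_ballP[d /= d0 hd].
  exists d => // t /andP[t0 td]; have := hd t; rewrite /ball /= sub0r normrN gtr0_norm//.
  by move=> /(_ td t0); rewrite sub0r normrN ger0_norm.
- apply/E/cvgrPdist_lt => e e0; have [d d0 hd] := h e e0.
  apply/nbhs_ballP; exists d => //= t; rewrite /ball /= sub0r normrN => td t0.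
  by rewrite sub0r normrN ger0_norm//; apply: hd; rewrite t0 -(gtr0_norm t0).
Unshelve. all: by end_near.
Qed.

End cvg_helpers.

Section heat.
Context {R : realType} {T : pointedType} (X : pcomplex R T).
Hypothesis PX : polyhedral_complex X.
Local Notation S := (points X).
Implicit Types (x y z : S) (f g h u : S -> R).
Local Notation lipc := (@lipschitz_compact R T X).
Local Notation H := (sqi (mu X)).
Local Notation ipm := (ip (mu X)).
Local Notation en := (@en R T X).

Lemma psd_ip : psd H ipm.
Proof.
split.
- by move=> a f g; exact: sqi_lin.
- exact: ipC.
- by move=> a f g h; exact: ip_lin.
- exact: ip_ge0.
Qed.

Lemma psd_en : psd lipc en.
Proof.
split.
- by move=> a f g; exact: lipc_lin.
- exact: enC.
- by move=> a f g h; exact: (en_lin PX).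
- exact: en_ge0.
Qed.

Lemma lipc0 : lipc (fun _ => 0).
Proof.
apply: (@lipX_lipc R T X 0) => [y z l _|]; first by rewrite subrr normr0 mul0r.
rewrite (_ : [set x | _] = set0); first by rewrite closure0; exact: compact0.
by apply/seteqP; split=> // x /=; rewrite eqxx.
Qed.

Lemma H_complete (u : nat -> S -> R) : (forall k, H (u k)) ->
  (forall k, ipm (lin (-1) (u k) (u k.+1)) (lin (-1) (u k) (u k.+1)) <= 8 ^- k) ->
  exists2 f, H f & dst ipm (u k) f @[k --> \oo] --> 0.
Proof.
have E (f g : S -> R) : lin (-1) g f = (fun x => f x - g x).
  by apply/funext => x; rewrite /lin mulN1r addrC.
move=> Hu hu; have [k|f Hf uf] := sqi_complete Hu; first by have := hu k; rewrite E.
exists f => //; rewrite (_ : (fun k => _) = (fun k => Num.sqrt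
  (ipm (fun x => u k x - f x) (fun x => u k x - f x)))); last first.
  by apply/funext => k; rewrite /dst /nrm E.
exact: sqrt_cvg0.
Qed.

Lemma ae_dst0 f g : H f -> H g -> {ae mu X, forall x, f x = g x} -> dst ipm f g = 0.
Proof.
move=> Hf Hg fg; have Hd : H (lin (-1) g f) by exact: (psd_dom psd_ip).
rewrite /dst /nrm (@ip_ae _ _ _ _ _ (fun _ => 0)) //; last 3 first.
- exact: Hd.1.
- exact: Hd.1.
- have AF : Filter (almost_everywhere (mu X)) by exact: ae_filter_ringOfSetsType.
  by apply: filterS fg => x E; rewrite /lin E; ring.
by rewrite ip_def; under eq_integral do rewrite mul0r; rewrite integral0 sqrtr0.
Qed.

Lemma norm2_dst f g : H f -> H g -> norm2 (f \- g) = (dst ipm f g)%:E.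
Proof.
move=> Hf Hg; rewrite /norm2 (_ : f \- g = lin (-1) g f).
  by rewrite norm2_sqi//; exact: (psd_dom psd_ip).
by apply/funext => x; rewrite /lin /= mulN1r addrC.
Qed.

Lemma L2H f : L2 f <-> H f. Proof. exact: Lfun_sqi. Qed.

Lemma approxE (u : nat -> S -> R) f : form_approx (X := X) u f <-> energy_approx H lipc ipm en u f.
Proof.
have dE k (Cu : forall k, lipc (u k)) (Hf : H f) : norm2 (u k \- f) = (dst ipm (u k) f)%:E.
  by apply: norm2_dst => //; exact: (lipc_sqi PX).
have eE k l (Cu : forall k, lipc (u k)) : energy (u k \- u l) = ((dst en (u k) (u l)) ^+ 2)%:E.
  rewrite (_ : u k \- u l = lin (-1) (u l) (u k)); last first.
    by apply/funext => x; rewrite /lin /= mulN1r addrC.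
  rewrite (energyE PX); last exact: lipc_lin.
  by rewrite (nrm2 psd_en).
split=> -[Cu Hf uf cu].
- have Hf' := (L2H f).1 Hf; split=> //.
    by apply/cvg_fin; rewrite (_ : (fun k => _) = (fun k => norm2 (u k \- f)))//; apply/funext => k; rewrite dE.
  move=> e e0; have [K hK] := cu _ (exprn_gt0 2 e0); exists K => k l Kk Kl.
  have := hK k l Kk Kl; rewrite eE// lte_fin ltr_pXn2r ?nnegrE ?dst_ge0//; exact: ltW.
- split=> //; first exact/L2H.
    move/cvg_fin: uf; rewrite (_ : (fun k => (dst _ _ _)%:E) = (fun k => norm2 (u k \- f)))//.
    by apply/funext => k; rewrite dE.
  move=> e e0; have s0 : 0 < Num.sqrt e by rewrite sqrtr_gt0.
  have [K hK] := cu _ s0; exists K => k l Kk Kl; rewrite eE// lte_fin.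
  rewrite -[ltRHS](sqr_sqrtr (ltW e0)) ltr_pXn2r ?nnegrE ?dst_ge0//; exact: hK.
Qed.

(** Translation between the extended-real formulation of the operator and the
   abstract one. *)
Lemma laplacianE f g : laplacian (X := X) f g <-> lap H lipc ipm en f g.
Proof.
have domE phi : form_dom (X := X) phi <-> fdom H lipc ipm en phi.
  by split=> -[u /approxE hu]; exists u.
have ipE' phi : inner2 (X := X) g phi = ipm g phi by rewrite ip_def.
split=> -[/domE df Hg lfg]; split=> //; try exact/L2H; move=> phi /domE dphi;
  have [u [v [au av uv]]] := lfg phi dphi; exists u, v;
  (split; [exact/approxE|exact/approxE|move: uv]); rewrite ipE'.
- rewrite (_ : (fun k => energy_form _ _) = (fun k => en (u k) (v k)))//; apply/funext => k.
  by apply: (energy_formE PX); [case: au|case: av].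
- rewrite (_ : (fun k => energy_form _ _) = (fun k => en (u k) (v k)))//; apply/funext => k.
  by apply: (energy_formE PX); [case: au|case: av].
Qed.

Definition lapX f h := lap H lipc ipm en f h.
Definition hspace f := hdom H lipc ipm en f.

Section semigroup.
Variable P : R -> (S -> R) -> S -> R.
Hypothesis HP : heat_semigroup P.
Hypothesis nontrivial : exists2 g, H g & ipm g g != 0.

Lemma P_H t f : 0 <= t -> H f -> H (P t f).
Proof. by move=> t0 Hf; apply/L2H; apply: (heat_L2 HP) => //; exact/L2H. Qed.

Let P_bd t : 0 <= t -> exists2 K, 0 <= K & forall f, H f -> nrm ipm (P t f) <= K * nrm ipm f.
Proof.
move=> t0; have [K hK] := heat_bounded HP t0; exists `|K| => // f Hf.
have := hK f ((L2H f).2 Hf); rewrite /norm2 !norm2_sqi//; last exact: P_H.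
rewrite -EFinM lee_fin => h; apply: le_trans h _.
by rewrite ler_wpM2r ?sqrtr_ge0// ler_norm.
Qed.

Let gen f g : lap H lipc ipm en f g <-> [/\ H f, H g & forall e, 0 < e ->
  exists2 d, 0 < d & forall t, 0 < t < d -> dst ipm (dquot P t f) g < e].
Proof.
have N (Hf : H f) (Hg : H g) : norm2 (fun x => t^-1 * (f x - P t f x) - g x) @[t --> 0^'+] --> 0%E <->
    forall e, 0 < e -> exists2 d, 0 < d & forall t, 0 < t < d -> dst ipm (dquot P t f) g < e.
  apply: (cvg_right0 (a := fun t => dst ipm (dquot P t f) g)) => [t t0|t]; last exact: dst_ge0.
  rewrite -(norm2_dst _ Hg); last first.
    by apply: (psd_dom psd_ip); [apply: P_H Hf; exact: ltW|exact: sqiZ].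
  by congr norm2; apply/funext => x; rewrite /= /dquot /lin; ring.
split=> [/laplacianE/(heat_generator HP)[/L2H Hf /L2H Hg /N h]|[Hf Hg h]].
- by split=> //; exact: h.
- by apply/laplacianE/(heat_generator HP); split; [exact/L2H|exact/L2H|exact/N].
Qed.

Let P_lin t a f g : 0 <= t -> H f -> H g ->
  dst ipm (P t (lin a f g)) (lin a (P t f) (P t g)) = 0.
Proof.
move=> t0 Hf Hg; have HPf := P_H t0 Hf; have HPg := P_H t0 Hg.
apply: ae_dst0.
- by apply: P_H => //; exact: (psd_dom psd_ip).
- exact: (psd_dom psd_ip).
- exact: (heat_linear HP a t0 ((L2H f).2 Hf) ((L2H g).2 Hg)).
Qed.

Let P_0 f : H f -> dst ipm (P 0 f) f = 0.
Proof. by move=> Hf; apply: ae_dst0 => //; [exact: P_H|exact: (heat_0 HP ((L2H f).2 Hf))]. Qed.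

Let P_add s t f : 0 <= s -> 0 <= t -> H f -> dst ipm (P (s + t) f) (P s (P t f)) = 0.
Proof.
move=> s0 t0 Hf; apply: ae_dst0.
- by apply: P_H => //; exact: addr_ge0.
- by apply: P_H => //; exact: P_H.
- exact: (heat_add HP s0 t0 ((L2H f).2 Hf)).
Qed.

Let P_cont f : H f -> forall e, 0 < e ->
  exists2 d, 0 < d & forall t, 0 < t < d -> dst ipm (P t f) f < e.
Proof.
move=> Hf; apply/(cvg_right0 (N := fun t => norm2 (P t f \- f))) => [t t0|t|].
- by rewrite norm2_dst//; apply: P_H => //; exact: ltW.
- exact: dst_ge0.
- exact: (heat_continuous HP ((L2H f).2 Hf)).
Qed.

Let CH f : lipc f -> H f. Proof. exact: (lipc_sqi PX). Qed.

Lemma heat_test f h : lapX f h -> exists2 w, energy_approx H lipc ipm en w f &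
  forall v phi, (forall k, lipc (v k)) -> H phi -> dst ipm (v k) phi @[k --> \oo] --> 0 ->
    (exists M, forall k, nrm en (v k) <= M) ->
    en (w k) (v k) @[k --> \oo] --> ipm h phi.
Proof. exact: (lap_test psd_ip psd_en CH lipc0 H_complete P_H P_bd gen nontrivial). Qed.

Lemma heat_evolve (J : (S -> R) -> R) (th : (S -> R) -> S -> R) K a c0 Tm f h :
  0 <= Tm -> lapX f h -> 0 <= K -> (forall u : S -> R, H u -> H (th u)) ->
  (forall u v : S -> R, H u -> H v -> dst ipm (th u) (th v) <= K * dst ipm u v) ->
  (forall u v : S -> R, H u -> H v -> J v - J u <= ipm (th v) (lin (-1) u v)) ->
  (forall t, 0 <= t < Tm -> a * (J (P t f) - c0) <= ipm (th (P t f)) (P t h)) ->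
  J (P Tm f) - c0 <= expR (- a * Tm) * (J f - c0).
Proof. exact: (evolve psd_ip CH lipc0 H_complete P_H P_bd gen P_lin P_0 P_add P_cont). Qed.

Lemma heat_lap t f h : 0 <= t -> lapX f h -> lapX (P t f) (P t h).
Proof. exact: (lap_P psd_ip CH lipc0 P_H P_bd gen P_lin P_add). Qed.

Lemma lapX_H f h : lapX f h -> H f /\ H h.
Proof. exact: (lap_H gen). Qed.

Lemma heat_lim t f : 0 <= t -> hspace f -> forall e, 0 < e -> exists (u h : S -> R),
  [/\ lapX u h, dst ipm u f < e & dst ipm (P t u) (P t f) < e].
Proof. exact: (hdom_lim psd_ip P_H P_bd gen P_lin). Qed.

Lemma heat_contract t f : 0 <= t -> hspace f -> nrm ipm (P t f) <= nrm ipm f.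
Proof.
exact: (hdom_contract psd_ip psd_en CH lipc0 H_complete P_H P_bd gen nontrivial P_lin P_0 P_add P_cont).
Qed.

Lemma heat_symmetric t f g : 0 <= t -> hspace f -> hspace g -> ipm (P t f) g = ipm f (P t g).
Proof.
exact: (hdom_symmetric psd_ip psd_en CH lipc0 H_complete P_H P_bd gen nontrivial P_lin P_0 P_add P_cont).
Qed.

Lemma heat_hspace t f : 0 <= t -> hspace f -> hspace (P t f).
Proof. exact: (hdom_P psd_ip CH lipc0 P_H P_bd gen P_lin P_add). Qed.

Lemma lipc_hspace f : lipc f -> hspace f.
Proof. exact: (C_hdom psd_ip psd_en CH lipc0 H_complete gen). Qed.

Lemma heat_dst t : 0 <= t -> exists2 K, 0 <= K & forall f g, H f -> H g ->
  dst ipm (P t f) (P t g) <= K * dst ipm f g.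
Proof.
by move=> t0; have [K K0 hK] := P_bd t0; exists K => // f g; exact: (P_dst psd_ip P_H P_lin).
Qed.

Lemma heat_add0 s t f : 0 <= s -> 0 <= t -> H f -> dst ipm (P (s + t) f) (P s (P t f)) = 0.
Proof. exact: P_add. Qed.

End semigroup.

Lemma heat_resolvent (lam : R) g : 0 < lam -> H g -> exists (u : S -> R) w,
  [/\ energy_approx H lipc ipm en w u,
  forall v, (forall k, lipc (v k)) -> (exists M, forall k, nrm en (v k) <= M /\ nrm ipm (v k) <= M) ->
    lam * en (w k) (v k) + ipm (lin (-1) g (w k)) (v k) @[k --> \oo] --> 0,
  lapX u (lin (- lam^-1) u (fun x => lam^-1 * g x)) &
  lipc g -> ipm (lin (-1) g u) (lin (-1) g u) <= lam * en g g].
Proof. exact: (resolvent psd_ip psd_en (fun f => lipc_sqi PX (f:=f)) lipc0 H_complete). Qed.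

End heat.

(** ** Weighted and L^1 estimates *)

Section soft_absolute_value.
Context {R : realType}.
Implicit Types (a b e x : R).

Lemma lip_continuous (K : R) (th : R -> R) :
  (forall a b, `|th a - th b| <= K * `|a - b|) -> continuous th.
Proof.
move=> hK x; apply/cvgrPdist_lt => e e0; have K0 : 0 <= K.
  by have := hK 0 1; rewrite sub0r normrN normr1 mulr1; apply: le_trans.
have K1 : 0 < K + 1 by lra.
apply/nbhs_ballP; exists (e / (K + 1)) => /=; first exact: divr_gt0.
move=> y; rewrite /ball /= ltr_pdivlMr// => xy; apply: le_lt_trans (hK _ _) _.
by have := normr_ge0 (x - y); lra.
Qed.

Lemma expR_lip (C a b : R) : `|a| <= C -> `|b| <= C -> `|expR a - expR b| <= expR C * `|a - b|.
Proof.
have le p q : `|p| <= C -> expR p - expR q <= expR C * `|p - q|.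
  move=> pC; have : expR p * (p - q) <= expR C * `|p - q|.
    apply: le_trans (ler_norm _) _; rewrite normrM ger0_norm ?expR_ge0// ler_wpM2r// ler_expR.
    by apply: le_trans pC; exact: ler_norm.
  have -> : expR q = expR p * expR (q - p) by rewrite -expRD addrC subrK.
  by have := ler_wpM2l (expR_ge0 p) (expR_ge1Dx (q - p)); lra.
move=> ha hb; rewrite ler_norml; apply/andP; split; last exact: le.
by have := le b a hb; rewrite (distrC b a); lra.
Qed.

Lemma ler_sq a b : 0 <= a -> 0 <= b -> a ^+ 2 <= b ^+ 2 -> a <= b.
Proof. by move=> a0 b0; rewrite ler_pXn2r ?nnegrE. Qed.

(** A smooth convex approximation of the absolute value, vanishing at [0] so that it
   keeps compact supports and square integrability. *)
Definition soft e x := Num.sqrt (x ^+ 2 + e ^+ 2) - e.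
Definition dsoft e x := x / Num.sqrt (x ^+ 2 + e ^+ 2).

Variable e : R.
Hypothesis e0 : 0 < e.

Let q x := Num.sqrt (x ^+ 2 + e ^+ 2).
Let q2 x : q x ^+ 2 = x ^+ 2 + e ^+ 2.
Proof. by rewrite sqr_sqrtr// addr_ge0 ?sqr_ge0. Qed.
Let q_ge x : e <= q x.
Proof.
apply: ler_sq; [exact: ltW|exact: sqrtr_ge0|rewrite q2].
by rewrite lerDr sqr_ge0.
Qed.
Let q_abs x : `|x| <= q x.
Proof.
rewrite -(@ler_pXn2r _ 2) ?nnegrE ?sqrtr_ge0// q2 real_normK ?num_real//.
by rewrite lerDl sqr_ge0.
Qed.
Let q0 x : 0 < q x. Proof. exact: lt_le_trans (q_ge x). Qed.

Lemma soft_ge0 x : 0 <= soft e x.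
Proof. by rewrite subr_ge0 q_ge. Qed.

Lemma soft_le_abs x : soft e x <= `|x|.
Proof.
rewrite lerBlDr; apply: ler_sq; [exact: sqrtr_ge0|exact: addr_ge0 (normr_ge0 x) (ltW e0)|].
rewrite -/(q x) q2 sqrrD real_normK ?num_real//.
by have := mulr_ge0 (normr_ge0 x) (ltW e0); lra.
Qed.

Lemma abs_le_soft x : `|x| <= soft e x + e.
Proof. by rewrite subrK q_abs. Qed.

Lemma soft_le_sq x : soft e x <= e^-1 * x ^+ 2.
Proof.
have h : 0 <= e^-1 * x ^+ 2 by rewrite mulr_ge0 ?sqr_ge0// invr_ge0 ltW.
rewrite lerBlDr; apply: ler_sq; [exact: sqrtr_ge0|exact: addr_ge0 h (ltW e0)|].
rewrite -/(q x) q2 sqrrD.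
rewrite (_ : e^-1 * x ^+ 2 * e = x ^+ 2); last by field; rewrite gt_eqF.
by have := sqr_ge0 (e^-1 * x ^+ 2); have := sqr_ge0 x; lra.
Qed.

(** Convexity with the derivative as slope; after clearing denominators this is the
   Cauchy-Schwarz inequality in the plane. *)
Lemma soft_convex a b : soft e b - soft e a <= dsoft e b * (b - a).
Proof.
rewrite /soft /dsoft -/(q b) -/(q a).
have cs : e ^+ 2 + a * b <= q a * q b.
  apply: le_trans (ler_norm _) _.
  rewrite -(@ler_pXn2r _ 2) ?nnegrE ?mulr_ge0 ?sqrtr_ge0// real_normK ?num_real// exprMn !q2.
  by have := sqr_ge0 (e * a - e * b); lra.
rewrite -(ler_pM2r (q0 b)) (_ : b / q b * (b - a) * q b = b * (b - a)); last first.
  by field; rewrite gt_eqF.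
by have := q2 b; lra.
Qed.

Lemma dsoft_le1 x : `|dsoft e x| <= 1.
Proof. by rewrite normrM normfV (gtr0_norm (q0 x)) ler_pdivrMr// mul1r q_abs. Qed.

Lemma soft_lip a b : `|soft e a - soft e b| <= 1 * `|a - b|.
Proof.
have le p s : soft e p - soft e s <= `|p - s|.
  apply: le_trans (soft_convex s p) _; apply: le_trans (ler_norm _) _.
  by rewrite normrM ler_piMl ?dsoft_le1.
rewrite mul1r ler_norml; apply/andP; split; last exact: le.
by have := le b a; rewrite (distrC b a); lra.
Qed.

Lemma dsoft_mono : {homo dsoft e : a b / a <= b}.
Proof.
move=> a b; rewrite le_eqVlt => /orP[/eqP->//|ab].
have := soft_convex a b; have := soft_convex b a => h1 h2.
have ba : 0 < b - a by lra.
by rewrite -subr_ge0 -(pmulr_lge0 _ ba); lra.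
Qed.

Lemma dsoft_lip a b : `|dsoft e a - dsoft e b| <= 2 * e^-1 * `|a - b|.
Proof.
have qab : `|q a - q b| <= `|a - b|.
  have := soft_lip a b; rewrite /soft -/(q a) -/(q b) mul1r.
  by rewrite (_ : _ - _ - _ = q a - q b)//; ring.
rewrite /dsoft -/(q a) -/(q b).
have -> : a / q a - b / q b = (a - b) / q b + a / q a * ((q b - q a) / q b).
  by field; rewrite !gt_eqF.
apply: le_trans (ler_normD _ _) _.
have v0 : 0 <= (q b)^-1 by rewrite invr_ge0 ltW.
have ve : (q b)^-1 <= e^-1 by rewrite lef_pV2 ?posrE//; exact: q_ge.
have h1 : `|(a - b) / q b| <= e^-1 * `|a - b|.
  by rewrite normrM (ger0_norm v0) mulrC ler_wpM2r.
have h2 : `|a / q a * ((q b - q a) / q b)| <= e^-1 * `|a - b|.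
  rewrite normrM -[X in _ <= X]mul1r; apply: ler_pM => //; first exact: dsoft_le1.
  by rewrite normrM (ger0_norm v0) mulrC (distrC (q b)); apply: ler_pM.
by rewrite (_ : 2 / e * _ = e^-1 * `|a - b| + e^-1 * `|a - b|); [exact: lerD|ring].
Qed.

End soft_absolute_value.

Lemma soft_anti {R : realType} (e e' x : R) : 0 < e' -> e' <= e -> soft e x <= soft e' x.
Proof.
move=> e0 ee; rewrite /soft lerBlDr -addrA.
set q := Num.sqrt (x ^+ 2 + e' ^+ 2).
have q2 : q ^+ 2 = x ^+ 2 + e' ^+ 2 by rewrite sqr_sqrtr// addr_ge0 ?sqr_ge0.
have qe : e' <= q.
  by apply: ler_sq; [exact: ltW|exact: sqrtr_ge0|rewrite q2 lerDr sqr_ge0].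
apply: ler_sq; [exact: sqrtr_ge0|rewrite addr_ge0 ?sqrtr_ge0//; lra|].
rewrite sqr_sqrtr ?addr_ge0 ?sqr_ge0// sqrrD q2.
have d0 : 0 <= e - e' by lra.
have h : e' * (e - e') <= q * (e - e') by rewrite ler_wpM2r.
by rewrite (addrC (- e')); move: h; rewrite !expr2; lra.
Qed.

Section measure_helpers.
Context d (T : measurableType d) (R : realType) (m : {measure set T -> \bar R}).

Lemma fine_ge0_ae (a : T -> R) : measurable_fun setT a -> {ae m, forall x, 0 <= a x} ->
  0 <= fine (\int[m]_x (a x)%:E)%E.
Proof.
move=> ma a0; rewrite (@ae_eq_integral _ _ _ m setT (fun x => (Num.max 0 (a x))%:E)) //.
- by apply: fine_ge0; apply: integral_ge0 => x _; rewrite lee_fin le_max lexx.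
- exact/measurable_EFinP.
- by apply/measurable_EFinP; apply: measurable_maxr.
- have AF : Filter (almost_everywhere m) by exact: ae_filter_ringOfSetsType.
  by apply: filterS a0 => x a0 _; rewrite max_r.
Qed.

Lemma fine_integralZ (c : R) (a : T -> R) : m.-integrable setT (fun x => (a x)%:E) ->
  fine (\int[m]_x (c * a x)%:E)%E = c * fine (\int[m]_x (a x)%:E)%E.
Proof.
move=> ia; have /integrableP[/measurable_EFinP ma _] := ia.
rewrite (@fine_integral_lin _ _ _ m c a (fun _ => 0) (fun x => c * a x)) //.
- by rewrite integral0 addr0.
- exact: integrable0.
- exact: measurable_funM.
- by apply: (aeW m) => x; rewrite addr0.
Qed.

Lemma fine_le_ae (a b : T -> R) : m.-integrable setT (fun x => (a x)%:E) ->
  m.-integrable setT (fun x => (b x)%:E) -> {ae m, forall x, a x <= b x} ->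
  fine (\int[m]_x (a x)%:E)%E <= fine (\int[m]_x (b x)%:E)%E.
Proof.
move=> ia ib ab; have /integrableP[/measurable_EFinP ma _] := ia.
have /integrableP[/measurable_EFinP mb _] := ib.
have md : measurable_fun setT (fun x => b x - a x) by exact: measurable_funB.
have AF : Filter (almost_everywhere m) by exact: ae_filter_ringOfSetsType.
have := @fine_integral_lin _ _ _ m (-1) a b (fun x => b x - a x) ia ib md => E.
rewrite -subr_ge0 (_ : _ - _ = fine (\int[m]_x (b x - a x)%:E)%E).
  by apply: fine_ge0_ae => //; apply: filterS ab => x; rewrite subr_ge0.
rewrite E ?mulN1r 1?addrC//; apply: (aeW m) => x; ring.
Qed.

Lemma abs_integral_le (f : T -> R) (c : \bar R) : measurable_fun setT f ->
  (forall e : R, 0 < e -> (\int[m]_x (soft e (f x))%:E <= c)%E) ->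
  (\int[m]_x (`|f x|)%:E <= c)%E.
Proof.
move=> mf h; pose s k x := ((soft (harm k : R) (f x))%:E)%E.
have h0 k : 0 < harm k :> R by exact: harm_gt0.
have harm_le k l : (k <= l)%N -> harm l <= harm k :> R.
  by move=> kl; rewrite lef_pV2 ?posrE// ler_nat.
have ms k : measurable_fun setT (s k).
  apply/measurable_EFinP; apply: (measurableT_comp (f := soft (harm k : R))) => //.
  by apply: continuous_measurable_fun; apply: lip_continuous; exact: soft_lip.
have -> : (\int[m]_x (`|f x|)%:E = \int[m]_x (limn (s^~ x)))%E.
  apply: eq_integral => x _; apply/esym/cvg_lim => //; apply/cvg_fin.
  apply: (@squeeze_cvgr _ _ _ _ (fun k => `|f x| - harm k) (cst `|f x|)).
  - apply: nearW => k; rewrite soft_le_abs// andbT.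
    by have := abs_le_soft (harm k) (f x); lra.
  - rewrite -[X in _ --> X]subr0; apply: cvgB; [exact: cvg_cst|exact: harm_cvg].
  - exact: cvg_cst.
rewrite monotone_convergence//.
- apply: lime_le; last by apply: nearW => k; exact: h.
  apply: ereal_nondecreasing_is_cvgn => k l kl; apply: ge0_le_integral => //.
  + by move=> x _; rewrite lee_fin soft_ge0.
  + by move=> x _; rewrite lee_fin soft_anti// harm_le.
- by move=> k x _; rewrite lee_fin soft_ge0.
- by move=> x _ k l kl; rewrite lee_fin soft_anti// harm_le.
Qed.

End measure_helpers.

Section heat_estimates.
Context {R : realType} {T : pointedType} (X : pcomplex R T).
Hypothesis PX : polyhedral_complex X.
Local Notation S := (points X).
Implicit Types (x y z : S) (f g h u : S -> R).
Local Notation lipc := (@lipschitz_compact R T X).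
Local Notation H := (sqi (mu X)).
Local Notation ipm := (ip (mu X)).
Local Notation en := (@en R T X).
Local Notation lipX := (@lipX R T X).
Local Notation pH := (psd_ip X).
Local Notation pC := (psd_en PX).

Let AF : Filter (almost_everywhere (mu X)).
Proof. exact: ae_filter_ringOfSetsType. Qed.

(** Difference quotients give the bound without a chain rule, so the Lipschitz
   function [th] need not be differentiable. *)
Lemma Gam_comp_le (K : R) th u x : (forall a b, `|th a - th b| <= K * `|a - b|) ->
  diffpt u x -> diffpt (fun y => th (u y)) x ->
  Gam (fun y => th (u y)) (fun y => th (u y)) x <= K ^+ 2 * Gam u u x.
Proof.
move=> hK [[[i b] lx] du] [_ dth]; have [/= Mi Ib xE] := lx.
rewrite xE !GamE// mulr_sumr; apply: ler_sum => j _; rewrite !mxE.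
have h0 k : harm k != 0 :> R by apply/lt0r_neq0/harm_gt0.
have cu := quot_cvg (du _ lx j) h0 harm_cvg.
have cth := quot_cvg (dth _ lx j) h0 harm_cvg.
set F := quot _ _ _ in cu; set G := quot _ _ _ in cth.
have c1 : (F (harm k) * F (harm k)) @[k --> \oo] --> 'D_(delta_mx 0 j) (fun w : 'rV[R]_(cdim i) => u (chart w)) b *
    'D_(delta_mx 0 j) (fun w : 'rV[R]_(cdim i) => u (chart w)) b by apply: cvgM.
have c2 : (G (harm k) * G (harm k)) @[k --> \oo] --> 'D_(delta_mx 0 j) (fun w : 'rV[R]_(cdim i) => th (u (chart w))) b *
    'D_(delta_mx 0 j) (fun w : 'rV[R]_(cdim i) => th (u (chart w))) b by apply: cvgM.
suff le k : G (harm k) * G (harm k) <= K ^+ 2 * (F (harm k) * F (harm k)).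
  exact (seq_le c2 (cvg_scale c1) le).
rewrite /F /G /quot /=.
set c := _^-1; set p := u _; set q := u _.
have /(ler_pM (normr_ge0 _) (normr_ge0 _) (hK p q)) : `|th p - th q| <= K * `|p - q| by exact: hK.
have sqE (r : R) : `|r| * `|r| = r * r by rewrite -normrM -expr2 ger0_norm ?sqr_ge0.
rewrite sqE (_ : K * _ * _ = K ^+ 2 * (`|p - q| * `|p - q|)); last by ring.
rewrite sqE => h.
by have := ler_wpM2l (sqr_ge0 c) h; rewrite /GRing.scale /= !expr2; lra.
Qed.

Lemma lipX_diff L f : 0 <= L -> lipX L f -> {ae mu X, forall x, diffpt f x}.
Proof. exact: (ae_diffpt PX). Qed.

Lemma en_comp (K : R) th u : 0 <= K -> (forall a b, `|th a - th b| <= K * `|a - b|) ->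
  th 0 = 0 -> lipc u ->
  lipc (fun y => th (u y)) /\ en (fun y => th (u y)) (fun y => th (u y)) <= K ^+ 2 * en u u.
Proof.
move=> K0 hK th0 cu; have [L L0 uL] := lipc_lipX cu.
have tL := lipX_comp K0 hK uL; have KL : 0 <= K * L by exact: mulr_ge0.
have ct : lipc (fun y => th (u y)).
  by apply: (lipc_sub cu tL) => x ->.
split=> //; rewrite !en_def.
have iu := Gam_integrable PX cu cu.
have -> : K ^+ 2 * fine (\int[mu X]_x (Gam u u x)%:E)%E =
    fine (\int[mu X]_x (K ^+ 2 * Gam u u x)%:E)%E.
  by rewrite fine_integralZ.
apply: fine_le_ae; first exact: (Gam_integrable PX ct ct).
- rewrite (_ : (fun x => _) = (fun x => (K ^+ 2)%:E * (Gam u u x)%:E)%E)//.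
  exact: integrableZl.
- apply: filterS2 (lipX_diff L0 uL) (lipX_diff KL tL) => x du dt.
  exact: Gam_comp_le.
Qed.

Lemma en_mul (L B : R) q u : 0 <= L -> lipX L q -> (forall x, `|q x| <= B) -> lipc u ->
  lipc (fun y => q y * u y) /\
  en (fun y => q y * u y) (fun y => q y * u y) <= 2 * B ^+ 2 * en u u + 2 * L ^+ 2 * ipm u u.
Proof.
move=> L0 qL qB cu; have [Lu Lu0 uL] := lipc_lipX cu; have [Bu Bu0 uB] := lipc_bounded cu.
have B0 : 0 <= B by apply: le_trans (qB point); exact: normr_ge0.
have tL := lipX_mul qB uB qL uL.
have KL : 0 <= B * Lu + Bu * L by rewrite addr_ge0 ?mulr_ge0.
have ct : lipc (fun y => q y * u y).
  by apply: (lipc_sub cu tL) => x ->; rewrite mulr0.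
have Hu := lipc_sqi PX cu; split=> //; rewrite !en_def ip_def.
have iu := Gam_integrable PX cu cu; have iuu := sqi_integrable Hu Hu.
have mu' := Hu.1.
rewrite -mulrA -[in leRHS]mulrA -mulrDr.
have E : fine (\int[mu X]_x (B ^+ 2 * Gam u u x + L ^+ 2 * (u x * u x))%:E)%E =
    B ^+ 2 * fine (\int[mu X]_x (Gam u u x)%:E)%E + L ^+ 2 * fine (\int[mu X]_x (u x * u x)%:E)%E.
  have iL : (mu X).-integrable setT (fun x => (L ^+ 2 * (u x * u x))%:E).
    rewrite (_ : (fun x => _) = (fun x => (L ^+ 2)%:E * (u x * u x)%:E)%E)//; exact: integrableZl.
  rewrite (@fine_integral_lin _ _ _ (mu X) (B ^+ 2) (Gam u u) (fun x => L ^+ 2 * (u x * u x)))//.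
  - congr (_ + _).
    exact: fine_integralZ.
  - apply: measurable_funD; apply: measurable_funM => //; last exact: measurable_funM.
    exact: (measurable_Gam PX Lu0 Lu0 uL uL).
  - by apply: (aeW (mu X)).
rewrite -E.
have iS : (mu X).-integrable setT (fun x => (B ^+ 2 * Gam u u x + L ^+ 2 * (u x * u x))%:E).
  rewrite (_ : (fun x => _) = (fun x => (B ^+ 2)%:E * (Gam u u x)%:E + (L ^+ 2)%:E * (u x * u x)%:E)%E)//.
  by apply: integrableD => //; exact: integrableZl.
have -> : 2 * fine (\int[mu X]_x (B ^+ 2 * Gam u u x + L ^+ 2 * (u x * u x))%:E)%E =
   fine (\int[mu X]_x (2 * (B ^+ 2 * Gam u u x + L ^+ 2 * (u x * u x)))%:E)%E.
  by rewrite fine_integralZ.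
apply: fine_le_ae; first exact: (Gam_integrable PX ct ct).
- rewrite (_ : (fun x => _) = (fun x => 2%:E * (B ^+ 2 * Gam u u x + L ^+ 2 * (u x * u x))%:E)%E)//.
  exact: integrableZl.
- near=> x; have dq : diffpt q x by near: x; exact: (lipX_diff L0 qL).
  have du : diffpt u x by near: x; exact: (lipX_diff Lu0 uL).
  have qG : Gam q q x <= L ^+ 2 by near: x; exact: (ae_Gam_le PX L0 qL).
  have [[p lx] _] := du; have [Mi Ib xE] := lx; case: p lx Mi Ib xE => i b lx /= Mi Ib xE.
  have g1 := cgradM dq du lx; rewrite /= in g1.
  move: qG; rewrite [in Gam q q x]xE [in Gam u u x]xE [in Gam _ _ x]xE !GamE// g1 => qG.
  set U := cgrad u b in qG *; set Q := cgrad q b in qG *.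
  rewrite !dotDl !dotDr !dotZl !dotZr.
  have s1 : 0 <= dot (q x *: U - u x *: Q) (q x *: U - u x *: Q) by exact: dot_ge0.
  move: s1; rewrite -scaleNr !dotDl !dotDr !dotZl !dotZr (dotC Q U) => s1.
  have s2 : (q x) ^+ 2 * dot U U <= B ^+ 2 * dot U U.
    rewrite ler_wpM2r ?dot_ge0// -(@real_normK _ (q x)) ?num_real//.
    by rewrite lerXn2r ?nnegrE.
  have s3 : (u x) ^+ 2 * dot Q Q <= L ^+ 2 * (u x * u x).
    by rewrite mulrC -expr2 ler_wpM2r ?sqr_ge0.
  by move: s1 s2 s3; rewrite !expr2; lra.
Unshelve. all: by end_near.
Qed.


Lemma energy_approx_bounded w f : energy_approx H lipc ipm en w f -> exists2 M, 0 <= M &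
  forall k, nrm en (w k) <= M /\ nrm ipm (w k) <= M.
Proof.
move=> aw; have [M M0 hM] := approx_bounded pC aw; have [Cw Hf wf _] := aw.
have /cvg_ex/cvg_seq_bounded[M' [_ hM']] : exists l : R, dst ipm (w k) f @[k --> \oo] --> l by exists 0.
have hd k : dst ipm (w k) f <= `|M'| + 1.
  have M'1 : M' < `|M'| + 1 by have := ler_norm M'; lra.
  by have := hM' _ M'1 k I; apply: le_trans; exact: ler_norm.
exists (M + (nrm ipm f + (`|M'| + 1))) => [|k].
  by rewrite addr_ge0// addr_ge0 ?nrm_ge0// addr_ge0.
have := hM k; have := nrm_dst pH (lipc_sqi PX (Cw k)) Hf; have := hd k.
have := nrm_ge0 ipm f; have := normr_ge0 M'.
move=> y1 y2 y3 y4 y5; split.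
  by apply: le_trans y5 _; rewrite lerDl addr_ge0// addr_ge0.
apply: le_trans y4 _; rewrite -[leLHS]add0r; apply: lerD => //.
by rewrite lerD2l.
Qed.

Section weight.
Variables (xi B : R) (phi : S -> R).
Hypothesis phiL : lipX 1 phi.
Hypothesis phiB : forall x, `|phi x| <= B.
Let w x := expR (xi * phi x).
Let W := expR (`|xi| * B).
Let LW := W * (`|xi| * 1).

Let W0 : 0 < W. Proof. exact: expR_gt0. Qed.
Let LW0 : 0 <= LW. Proof. by rewrite /LW !mulr_ge0// ltW. Qed.

Let xphi x : `|xi * phi x| <= `|xi| * B.
Proof. by rewrite normrM ler_wpM2l. Qed.

Lemma weight_bound x : `|w x| <= W.
Proof. by rewrite ger0_norm ?expR_ge0// ler_expR; apply: le_trans (xphi x); exact: ler_norm. Qed.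

Lemma weight_lipX : lipX LW w.
Proof.
move=> y z l yz; apply: le_trans (expR_lip (xphi y) (xphi z)) _.
rewrite -/W /LW -mulrA ler_wpM2l ?(ltW W0)//.
by rewrite -mulrBr normrM -mulrA ler_wpM2l//; exact: phiL yz.
Qed.

Lemma weight_measurable : measurable_fun setT w.
Proof. exact: (lipX_measurable PX LW0 weight_lipX). Qed.

Lemma weight_sqi f : H f -> H (fun x => w x * f x).
Proof. by move=> Hf; have [] := sqi_mul weight_measurable weight_bound Hf. Qed.

Lemma weight_nrm f : H f -> nrm ipm (fun x => w x * f x) <= W * nrm ipm f.
Proof.
move=> Hf; have [_ h] := sqi_mul weight_measurable weight_bound Hf.
apply: ler_sq; rewrite ?nrm_ge0 ?mulr_ge0 ?nrm_ge0 ?(ltW W0)//.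
by rewrite exprMn !(nrm2 pH).
Qed.

Let w2_sqi f : H f -> H (fun x => w x * (w x * f x)).
Proof. by move=> Hf; do 2 apply: weight_sqi. Qed.

(** The square completed pointwise in [Gam_weight], integrated. *)
Lemma en_weight u : lipc u ->
  - xi ^+ 2 * ipm (fun x => w x * u x) (fun x => w x * u x) <= en u (fun x => w x * (w x * u x)).
Proof.
move=> cu; have [L L0 uL] := lipc_lipX cu.
have [cv _] := en_mul LW0 weight_lipX weight_bound cu.
have [cvv _] := en_mul LW0 weight_lipX weight_bound cv.
have Hv := weight_sqi (lipc_sqi PX cu).
have iv := sqi_integrable Hv Hv; rewrite ip_def en_def -fine_integralZ//.
apply: fine_le_ae; last 2 first.
- exact: (Gam_integrable PX cu cvv).
- have h1 : {ae mu X, forall x, diffpt phi x} by exact: (lipX_diff ler01 phiL).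
  have h2 : {ae mu X, forall x, diffpt w x} by exact: (lipX_diff LW0 weight_lipX).
  have h3 : {ae mu X, forall x, diffpt u x} by exact: (lipX_diff L0 uL).
  have h4 : {ae mu X, forall x, Gam phi phi x <= 1 ^+ 2} by exact: (ae_Gam_le PX ler01 phiL).
  apply: filterS2 (filterI h1 h2) (filterI h3 h4) => x [d1 d2] [d3 d4].
  by rewrite expr1n in d4; rewrite -expr2; exact: (Gam_weight PX d1 d2 d3 d4).
- rewrite (_ : (fun x => _) = (fun x => (- xi ^+ 2)%:E * (w x * u x * (w x * u x))%:E)%E)//.
  exact: integrableZl.
Qed.

Section heat_weight.
Variable P : R -> (S -> R) -> S -> R.
Hypothesis HP : heat_semigroup P.
Hypothesis nontrivial : exists2 g, H g & ipm g g != 0.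

Let lap_weight f h : lapX f h ->
  - xi ^+ 2 * ipm (fun x => w x * f x) (fun x => w x * f x) <= ipm h (fun x => w x * (w x * f x)).
Proof.
move=> lf; have [u au hu] := heat_test PX HP nontrivial lf.
have [Cu Hf uf _] := au; have [M M0 hM] := energy_approx_bounded au.
have Hu k := lipc_sqi PX (Cu k).
have dw (a b : S -> R) : H a -> H b ->
    dst ipm (fun x => w x * a x) (fun x => w x * b x) <= W * dst ipm a b.
  move=> Ha Hb; apply: le_trans (weight_nrm (psd_dom pH (-1) Hb Ha)).
  by rewrite /dst le_eqVlt; apply/orP; left; apply/eqP; congr nrm; apply/funext => x; rewrite /lin; ring.
have c1 : dst ipm (fun x => w x * u k x) (fun x => w x * f x) @[k --> \oo] --> 0.
  apply: (squeeze0 (a := W) (b := 0) uf uf) => k.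
  by rewrite dst_ge0 /= mul0r addr0; exact: dw.
have c2 : dst ipm (fun x => w x * (w x * u k x)) (fun x => w x * (w x * f x)) @[k --> \oo] --> 0.
  apply: (squeeze0 (a := W) (b := 0) c1 c1) => k.
  by rewrite dst_ge0 /= mul0r addr0; apply: dw; exact: weight_sqi.
have cw k : lipc (fun x => w x * u k x) by have [] := en_mul LW0 weight_lipX weight_bound (Cu k).
have ew k := (en_mul LW0 weight_lipX weight_bound (Cu k)).2.
have eww k := en_mul LW0 weight_lipX weight_bound (cw k).
have bd : exists M', forall k, nrm en (fun x => w x * (w x * u k x)) <= M'.
  pose A := 2 * W ^+ 2; pose A' := 2 * LW ^+ 2.
  have A0 : 0 <= A by rewrite mulr_ge0// sqr_ge0.
  have A'0 : 0 <= A' by rewrite mulr_ge0// sqr_ge0.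
  exists (Num.sqrt (A * (A * M ^+ 2 + A' * M ^+ 2) + A' * (W * M) ^+ 2)) => k.
  have [h1 h2] := hM k.
  have e1 : en (u k) (u k) <= M ^+ 2 by rewrite -(nrm2 pC) lerXn2r ?nnegrE ?nrm_ge0.
  have e2 : ipm (u k) (u k) <= M ^+ 2 by rewrite -(nrm2 pH) lerXn2r ?nnegrE ?nrm_ge0.
  have e3 : ipm (fun x => w x * u k x) (fun x => w x * u k x) <= (W * M) ^+ 2.
    rewrite -(nrm2 pH) lerXn2r ?nnegrE ?nrm_ge0 ?mulr_ge0 ?(ltW W0)//.
    by apply: le_trans (weight_nrm (Hu k)) _; rewrite ler_wpM2l// ltW.
  have N1 : 0 <= A * M ^+ 2 + A' * M ^+ 2 by rewrite addr_ge0// mulr_ge0// sqr_ge0.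
  have N2 : 0 <= A * (A * M ^+ 2 + A' * M ^+ 2) + A' * (W * M) ^+ 2.
    by apply: addr_ge0; apply: mulr_ge0 => //; exact: sqr_ge0.
  rewrite /nrm (ler_sqrt _ N2).
  apply: le_trans (eww k).2 _; apply: lerD; apply: ler_wpM2l => //.
  by apply: le_trans (ew k) _; apply: lerD; apply: ler_wpM2l.
have lim1 := hu _ _ (fun k => (eww k).1) (w2_sqi Hf) c2 bd.
have lim2 := psd_cvg pH (fun k => weight_sqi (Hu k)) (fun k => weight_sqi (Hu k))
  (weight_sqi Hf) (weight_sqi Hf) c1 c1.
by apply: (seq_le (cvg_scale lim2) lim1) => k; exact: en_weight.
Qed.

(** The energy of the orbit against [w ^+ 2] times itself is bounded below by
   [- xi ^+ 2] times the squared weighted norm, since [psi] has gradient at most one; Gronwall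
   then gives the exponential. The domain of the Laplacian is dense. *)
Lemma davies t f : 0 <= t -> hspace f ->
  nrm ipm (fun x => w x * P t f x) <= expR (xi ^+ 2 * t) * nrm ipm (fun x => w x * f x).
Proof.
move=> t0 hf; have main u h : lapX u h ->
    nrm ipm (fun x => w x * P t u x) <= expR (xi ^+ 2 * t) * nrm ipm (fun x => w x * u x).
  move=> lu; have [Hu Hh] := lapX_H PX HP lu.
  have := @heat_evolve _ _ _ PX _ HP
    (fun v : S -> R => ipm (fun x => w x * v x) (fun x => w x * v x))
    (fun v : S -> R => fun x => 2 * (w x * (w x * v x))) (2 * (W * W)) (- 2 * xi ^+ 2) 0 t u h t0 lu.
  rewrite !subr0 => ev; apply: ler_sq; rewrite ?mulr_ge0 ?nrm_ge0 ?expR_ge0//.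
  rewrite exprMn !(nrm2 pH) -expRM_natl (_ : 2%:R * (xi ^+ 2 * t) = - (- 2 * xi ^+ 2) * t); last by ring.
  apply: ev.
  - by rewrite !mulr_ge0// ltW.
  - by move=> v Hv; apply: sqiZ; exact: w2_sqi.
  - move=> v v' Hv Hv'; have Hd := psd_dom pH (-1) Hv' Hv.
    rewrite /dst (_ : lin (-1) _ _ = lin 2 (fun x => w x * (w x * lin (-1) v' v x)) (fun _ => 0)); last first.
      by apply/funext => x; rewrite /lin; ring.
    have H0 := lipc_sqi PX (lipc0 X).
    apply: le_trans (nrm_lin pH 2 (w2_sqi Hd) H0) _.
    have -> : nrm ipm (fun _ => 0) = 0.
      by have := dstxx pH H0; rewrite /dst => E; rewrite -[RHS]E; congr nrm; apply/funext => x; rewrite /lin; ring.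
    rewrite addr0 (ger0_norm (ler0n _ 2)) -!mulrA ler_wpM2l//.
    apply: le_trans (weight_nrm (weight_sqi Hd)) _; rewrite ler_wpM2l ?(ltW W0)//.
    exact: weight_nrm.
  - move=> v v' Hv Hv'; have Hwv := weight_sqi Hv; have Hwv' := weight_sqi Hv'.
    rewrite (_ : ipm (fun x => 2 * (w x * (w x * v' x))) (lin (-1) v v') =
      2 * ipm (fun x => w x * v' x) (lin (-1) (fun x => w x * v x) (fun x => w x * v' x))).
      rewrite (psd_linr pH (-1) Hwv Hwv' Hwv').
      have := psd_ge0 pH (lin (-1) (fun x => w x * v x) (fun x => w x * v' x)).
      rewrite (psd_sq pH (-1) Hwv Hwv') (psdC pH (fun x => w x * v' x)); lra.
    have Hd : H (lin (-1) (fun x => w x * v x) (fun x => w x * v' x)) by exact: (psd_dom pH).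
    rewrite !ip_def -fine_integralZ; last exact: sqi_integrable.
    by congr fine; apply: eq_integral => x _; congr EFin; rewrite /lin; ring.
  - move=> s /andP[s0 _]; rewrite subr0; have ls := heat_lap PX HP s0 lu.
    have [Hs Hhs] := lapX_H PX HP ls; have := lap_weight ls.
    rewrite (_ : ipm (fun x => 2 * _) (P s h) = 2 * ipm (P s h) (fun x => w x * (w x * P s u x))).
      by lra.
    rewrite !ip_def -fine_integralZ; last by apply: sqi_integrable => //; exact: w2_sqi.
    by congr fine; apply: eq_integral => x _; congr EFin; ring.
have dw (a b : S -> R) : H a -> H b -> nrm ipm (fun x => w x * a x) <=
    nrm ipm (fun x => w x * b x) + W * dst ipm a b.
  move=> Ha Hb; apply: le_trans (nrm_dst pH (weight_sqi Ha) (weight_sqi Hb)) _.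
  rewrite lerD2l; apply: le_trans (weight_nrm (psd_dom pH (-1) Hb Ha)).
  by rewrite /dst le_eqVlt; apply/orP; left; apply/eqP; congr nrm; apply/funext => x; rewrite /lin; ring.
have Hf := hf.1; have HPf := P_H HP t0 Hf.
apply/ler_addgt0Pr => e e0; set E := expR _; have E0 : 0 < E by exact: expR_gt0.
pose D := W * (1 + E); have D0 : 0 < D by rewrite mulr_gt0//; lra.
have [u [h [lu uf Puf]]] := heat_lim PX HP t0 hf (divr_gt0 e0 D0).
have [Hu _] := lapX_H PX HP lu; have HPu := P_H HP t0 Hu.
have h1 := dw _ _ HPf HPu; have h2 := dw _ _ Hu Hf; have h3 := main u h lu.
rewrite (dstC pH HPf HPu) in h1.
have h4 := ler_wpM2l (ltW E0) h2; rewrite -/E in h3.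
have h5 := ler_wpM2l (ltW W0) (ltW Puf).
have h6 := ler_wpM2l (mulr_ge0 (ltW E0) (ltW W0)) (ltW uf).
have : e = e / D * D by rewrite divfK// gt_eqF.
by set q := e / D in h5 h6 *; clearbody q; rewrite /D; lra.
Qed.

End heat_weight.
End weight.
End heat_estimates.

Section heat_l1.
Context {R : realType} {T : pointedType} (X : pcomplex R T).
Hypothesis PX : polyhedral_complex X.
Local Notation S := (points X).
Implicit Types (x y z : S) (f g h u : S -> R) (e : R).
Local Notation lipc := (@lipschitz_compact R T X).
Local Notation H := (sqi (mu X)).
Local Notation ipm := (ip (mu X)).
Local Notation en := (@en R T X).
Local Notation lipX := (@lipX R T X).
Local Notation pH := (psd_ip X).
Local Notation pC := (psd_en PX).

Lemma nrm_mono f g : H f -> H g -> (forall x, `|f x| <= `|g x|) -> nrm ipm f <= nrm ipm g.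
Proof.
move=> Hf Hg fg; rewrite /nrm ler_sqrt ?ip_ge0// !ip_def.
apply: fine_le_ae; try exact: sqi_integrable.
apply: (aeW (mu X)) => x; rewrite -!expr2 -(real_normK (num_real (f x))) -(real_normK (num_real (g x))).
by rewrite lerXn2r ?nnegrE.
Qed.

Lemma nrm_scale (c : R) f : H f -> nrm ipm (fun x => c * f x) = `|c| * nrm ipm f.
Proof.
move=> Hf; rewrite /nrm; have -> : ipm (fun x => c * f x) (fun x => c * f x) = c ^+ 2 * ipm f f.
  rewrite !ip_def -fine_integralZ; last exact: sqi_integrable.
  by congr fine; apply: eq_integral => x _; congr EFin; ring.
by rewrite sqrtrM ?sqr_ge0// sqrtr_sqr.
Qed.

Lemma comp_sqi (K : R) (th : R -> R) f : 0 <= K -> continuous th ->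
  (forall a, `|th a| <= K * `|a|) -> H f -> H (fun x => th (f x)).
Proof.
move=> K0 cth hth Hf; have [mf _] := Hf; have [mKf Koo] := sqiZ K Hf.
have mth : measurable_fun setT (fun x => th (f x)).
  by apply: (measurableT_comp (f := th)) => //; exact: continuous_measurable_fun.
split=> //; apply: le_lt_trans Koo; apply: rintegral_le => //.
- exact: measurable_funX.
- exact: measurable_funX.
- by move=> x; exact: sqr_ge0.
move=> x _; rewrite -(real_normK (num_real (th _))) -(real_normK (num_real (K * _))).
by rewrite lerXn2r ?nnegrE// normrM (ger0_norm K0).
Qed.

Lemma comp_dst (K : R) (th : R -> R) f g : 0 <= K -> (forall a b, `|th a - th b| <= K * `|a - b|) ->
  th 0 = 0 -> H f -> H g ->
  dst ipm (fun x => th (f x)) (fun x => th (g x)) <= K * dst ipm f g.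
Proof.
move=> K0 hK th0 Hf Hg; have cth := lip_continuous hK.
have hth a : `|th a| <= K * `|a| by have := hK a 0; rewrite th0 !subr0.
have Hd := psd_dom pH (-1) Hg Hf.
have -> : K * dst ipm f g = nrm ipm (fun x => K * lin (-1) g f x).
  by rewrite nrm_scale// ger0_norm.
apply: nrm_mono.
- by apply: (psd_dom pH); exact: comp_sqi K0 cth hth _.
- exact: sqiZ.
- move=> x; rewrite /lin normrM (ger0_norm K0) !mulN1r !(addrC (- _)); exact: hK.
Qed.

Section soft.
Variables (e : R).
Hypothesis e0 : 0 < e.
Let K := 2 * e^-1.
Let K0 : 0 <= K. Proof. by rewrite mulr_ge0// invr_ge0 ltW. Qed.
Let th0 : dsoft e 0 = 0. Proof. by rewrite /dsoft mul0r. Qed.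

Lemma dsoft_sqi f : H f -> H (fun x => dsoft e (f x)).
Proof.
apply: (comp_sqi K0); first exact: lip_continuous (dsoft_lip e0).
by move=> a; have := dsoft_lip e0 a 0; rewrite th0 !subr0.
Qed.

Lemma measurable_soft f : measurable_fun setT f -> measurable_fun setT (fun x => soft e (f x)).
Proof.
move=> mf; apply: (measurableT_comp (f := soft e)) => //.
by apply: continuous_measurable_fun; apply: lip_continuous; exact: soft_lip.
Qed.

Lemma soft_integrable f : H f -> (mu X).-integrable setT (fun x => (soft e (f x))%:E).
Proof.
move=> Hf; have [mf foo] := Hf; have ms := measurable_soft mf.
apply/integrableP; split; first exact/measurable_EFinP.
under eq_integral do rewrite abse_EFin (ger0_norm (soft_ge0 e0 _)).
apply: (@le_lt_trans _ _ (\int[mu X]_x (e^-1 * f x ^+ 2)%:E)%E).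
  apply: rintegral_le => //.
  - by apply: measurable_funM => //; exact: measurable_funX.
  - by move=> x; exact: soft_ge0.
  - by move=> x _; exact: soft_le_sq.
rewrite rintegralZ//.
- by rewrite lte_mul_pinfty// lee_fin invr_ge0 ltW.
- exact: measurable_funX.
- by move=> x; exact: sqr_ge0.
- by rewrite invr_ge0 ltW.
Qed.

Definition soft_mass f := fine (\int[mu X]_x (soft e (f x))%:E)%E.

Lemma soft_massE f : H f -> (\int[mu X]_x (soft e (f x))%:E)%E = (soft_mass f)%:E.
Proof. by move=> Hf; rewrite fineK//; apply: integrable_fin_num => //; exact: soft_integrable. Qed.

Lemma soft_mass_convex u v : H u -> H v ->
  soft_mass v - soft_mass u <= ipm (fun x => dsoft e (v x)) (lin (-1) u v).
Proof.
move=> Hu Hv; have iu := soft_integrable Hu; have iv := soft_integrable Hv.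
have mu' := measurable_soft Hu.1; have mv' := measurable_soft Hv.1.
have Hd := psd_dom pH (-1) Hu Hv.
have -> : soft_mass v - soft_mass u = fine (\int[mu X]_x (soft e (v x) - soft e (u x))%:E)%E.
  rewrite (@fine_integral_lin _ _ _ (mu X) (-1) (fun x => soft e (u x)) (fun x => soft e (v x)))//.
  - by rewrite mulN1r addrC.
  - exact: measurable_funB.
  - by apply: (aeW (mu X)) => x; rewrite mulN1r addrC.
rewrite ip_def; apply: fine_le_ae.
- by under eq_fun do rewrite EFinB; exact: integrableB.
- by apply: sqi_integrable => //; exact: dsoft_sqi.
- apply: (aeW (mu X)) => x; rewrite /lin mulN1r [X in _ <= _ * X]addrC; exact: soft_convex.
Qed.

Lemma en_dsoft u : lipc u -> 0 <= en u (fun x => dsoft e (u x)).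
Proof.
move=> cu; have [L L0 uL] := lipc_lipX cu.
have [cv _] := en_comp PX K0 (dsoft_lip e0) th0 cu.
have [L' L'0 vL] := lipc_lipX cv; rewrite en_def; apply: fine_ge0_ae.
  exact: (measurable_Gam PX L0 L'0 uL vL).
have AF : Filter (almost_everywhere (mu X)) by exact: ae_filter_ringOfSetsType.
have h1 : {ae mu X, forall x, diffpt u x} by exact: (lipX_diff PX L0 uL).
have h2 : {ae mu X, forall x, diffpt (fun x => dsoft e (u x)) x} by exact: (lipX_diff PX L'0 vL).
by apply: filterS2 h1 h2 => x d1 d2; exact: (Gam_mono PX (dsoft_mono e0) d1 d2).
Qed.

Lemma dsoft_bounded (w : nat -> S -> R) : (forall k, lipc (w k)) ->
  (exists2 M, 0 <= M & forall k, nrm en (w k) <= M /\ nrm ipm (w k) <= M) ->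
  exists M, forall k, nrm en (fun x => dsoft e (w k x)) <= M /\ nrm ipm (fun x => dsoft e (w k x)) <= M.
Proof.
move=> Cw [M M0 hM]; exists (K * M) => k; have [h1 h2] := hM k; split.
  have [cv hv] := en_comp PX K0 (dsoft_lip e0) th0 (Cw k).
  apply: ler_sq; [exact: nrm_ge0|exact: mulr_ge0|rewrite (nrm2 pC) exprMn; apply: le_trans hv _].
  by rewrite ler_wpM2l ?sqr_ge0// -(nrm2 pC) lerXn2r ?nnegrE ?nrm_ge0.
have Hk := lipc_sqi PX (Cw k).
apply: (@le_trans _ _ (nrm ipm (fun x => K * w k x))).
  apply: nrm_mono; [exact: dsoft_sqi|exact: sqiZ|move=> x].
  by rewrite [leRHS]normrM (ger0_norm K0); have := dsoft_lip e0 (w k x) 0; rewrite th0 !subr0.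
by rewrite nrm_scale// (ger0_norm K0) ler_wpM2l.
Qed.

Lemma dsoft_cvg (w : nat -> S -> R) f : (forall k, H (w k)) -> H f -> dst ipm (w k) f @[k --> \oo] --> 0 ->
  dst ipm (fun x => dsoft e (w k x)) (fun x => dsoft e (f x)) @[k --> \oo] --> 0.
Proof.
move=> Hw Hf wf; apply: (squeeze0 (a := K) (b := 0) wf wf) => k.
by rewrite dst_ge0 /= mul0r addr0; exact: comp_dst K0 (dsoft_lip e0) th0 (Hw k) Hf.
Qed.


Section semigroup.
Variable P : R -> (S -> R) -> S -> R.
Hypothesis HP : heat_semigroup P.
Hypothesis nontrivial : exists2 g, H g & ipm g g != 0.

(** The function [dsoft e] is nondecreasing, so the energy pairing of [u] with
   [dsoft e (u)] is nonnegative. *)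
Lemma soft_mass_heat t f h : 0 <= t -> lapX f h -> soft_mass (P t f) <= soft_mass f.
Proof.
move=> t0 lf.
have := @heat_evolve _ _ _ PX _ HP soft_mass (fun v : S -> R => fun x => dsoft e (v x)) K 0 0 t f h t0 lf K0.
rewrite !subr0 oppr0 mul0r expR0 mul1r; apply.
- exact: dsoft_sqi.
- by move=> u v Hu Hv; exact: comp_dst K0 (dsoft_lip e0) th0 Hu Hv.
- exact: soft_mass_convex.
move=> s /andP[s0 _]; rewrite mul0r; have ls := heat_lap PX HP s0 lf.
have [w aw hw] := heat_test PX HP nontrivial ls; have [Cw Hs ws _] := aw.
have Hw k := lipc_sqi PX (Cw k).
have [M hM] := dsoft_bounded Cw (energy_approx_bounded PX aw).
have Cv k : lipc (fun x => dsoft e (w k x)) by have [] := en_comp PX K0 (dsoft_lip e0) th0 (Cw k).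
have lim := hw _ _ Cv (dsoft_sqi Hs) (dsoft_cvg Hw Hs ws) (ex_intro _ M (fun k => (hM k).1)).
by rewrite ipC; apply: (cvgr_to_ge lim); apply: nearW => k; exact: en_dsoft.
Qed.

End semigroup.
End soft.

(** Minimizers of the resolvent functional do not increase the convex functional
   [soft_mass e], uniformly in [e]. *)
Lemma resolvent_soft (lam : R) g : 0 < lam -> lipc g -> exists (u h : S -> R), [/\ lapX u h,
  ipm (lin (-1) g u) (lin (-1) g u) <= lam * en g g &
  forall e, 0 < e -> soft_mass e u <= soft_mass e g].
Proof.
move=> lam0 cg; have Hg := lipc_sqi PX cg.
have [u [w [aw hw lu /(_ cg) ug]]] := heat_resolvent PX lam0 Hg; have [Cw Hu wu _] := aw.
exists u, (lin (- lam^-1) u (fun x => lam^-1 * g x)); split=> // e e0.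
have Hw k := lipc_sqi PX (Cw k).
have K0 : 0 <= 2 * e^-1 by rewrite mulr_ge0// invr_ge0 ltW.
have th0 : dsoft e 0 = 0 by rewrite /dsoft mul0r.
have [M hM] := dsoft_bounded e0 Cw (energy_approx_bounded PX aw).
have Cv k : lipc (fun x => dsoft e (w k x)) by have [] := en_comp PX K0 (dsoft_lip e0) th0 (Cw k).
have lim := hw _ Cv (ex_intro _ M hM).
have gw : dst ipm (lin (-1) g (w k)) (lin (-1) g u) @[k --> \oo] --> 0.
  rewrite (_ : (fun k => _) = (fun k => dst ipm (w k) u))//; apply/funext => k.
  by rewrite /dst; congr nrm; apply/funext => x; rewrite /lin; ring.
have lim2 := psd_cvg pH (fun k => psd_dom pH (-1) Hg (Hw k)) (fun k => dsoft_sqi e0 (Hw k))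
  (psd_dom pH (-1) Hg Hu) (dsoft_sqi e0 Hu) gw (dsoft_cvg e0 Hw Hu wu).
have : ipm (lin (-1) g u) (fun x => dsoft e (u x)) <= 0.
  apply: (seq_le lim2 lim) => k; rewrite lerDr mulr_ge0 ?(ltW lam0)//; exact: en_dsoft.
by have := soft_mass_convex e0 Hg Hu; rewrite ipC; lra.
Qed.

Definition mass f : \bar R := (\int[mu X]_x (`|f x|)%:E)%E.

Lemma lipc_mass f : lipc f -> (mass f < +oo)%E.
Proof.
move=> cf; have [L L0 fL] := lipc_lipX cf; have [B B0 fB] := lipc_bounded cf.
have [K [cK Koo fK]] := lipc_support PX cf; have mK := closed_msets PX cK.
have mf := lipX_measurable PX L0 fL.
apply: (@le_lt_trans _ _ (\int[mu X]_x (B * \1_K x)%:E)%E).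
  apply: rintegral_le => //.
  - exact: measurableT_comp.
  - by apply: measurable_funM => //; exact: measurable_indic.
  - move=> x _; rewrite indicE; have [Kx|nKx] := pselect (K x).
      by rewrite mem_set// mulr1.
    by rewrite memNset// mulr0 fK// normr0.
have i0 x : 0 <= \1_K x :> R by rewrite indicE.
rewrite (rintegralZ (mu X) measurableT (measurable_indic mK) i0 B0).
by rewrite integral_indic// setIT lte_mul_pinfty.
Qed.

Lemma soft_mass_le f e : 0 < e -> H f -> ((soft_mass e f)%:E <= mass f)%E.
Proof.
move=> e0 Hf; rewrite -soft_massE//; apply: rintegral_le => //.
- apply: (measurable_soft e0); exact Hf.1.
- apply: measurableT_comp => //; exact Hf.1.
- by move=> x; exact: soft_ge0.
- by move=> x _; exact: soft_le_abs.
Qed.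

(** Elements of the domain of the Laplacian that approximate [g] in [L^2] and
   whose orbits do not exceed the mass of [g]. *)
Lemma mass_approx P g : heat_semigroup P -> (exists2 g, H g & ipm g g != 0) -> lipc g ->
  forall e, 0 < e -> exists (u h : S -> R), [/\ lapX u h, dst ipm u g < e &
    forall t, 0 <= t -> (mass (P t u) <= mass g)%E].
Proof.
move=> HP nt cg e e0; have Hg := lipc_sqi PX cg; have eg := psd_ge0 pC g.
have D0 : 0 < 2 * (en g g + 1) by rewrite mulr_gt0//; lra.
have l0 : 0 < e ^+ 2 / (2 * (en g g + 1)) by rewrite divr_gt0 ?exprn_gt0.
have [u [h [lu ug us]]] := resolvent_soft l0 cg; exists u, h; split=> //.
- rewrite -(@ltr_pXn2r _ 2)// ?nnegrE ?dst_ge0 ?ltW// (nrm2 pH); apply: le_lt_trans ug _.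
  by rewrite mulrAC ltr_pdivrMr// ltr_pM2l ?exprn_gt0//; lra.
- move=> t t0; have [Hu _] := lapX_H PX HP lu; have HPu := P_H HP t0 Hu.
  apply: abs_integral_le; first exact: HPu.1.
  move=> d d0; rewrite soft_massE//; apply: le_trans (soft_mass_le d0 Hg).
  by rewrite lee_fin; apply: le_trans (us d d0); exact: (soft_mass_heat d0 HP nt t0 lu).
Qed.

End heat_l1.

(** ** The local Poincare inequality at small scales *)

(** Completing the square bounds [x ^+ 2] by [2 * x * y] up to [(x - y) ^+ 2]; the
   difference is measured through approximations [g] and [g'] of [x] and [y], to be
   values of a Lipschitz function. *)
Lemma near_quad {R : realDomainType} (x y g g' : R) :
  x ^+ 2 <= 2 * (`|x| * `|y|) +
    (3 * (x - g) ^+ 2 + (3 * (y - g') ^+ 2 + 3 * (g' - g) ^+ 2)).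
Proof.
have h6 : x * y <= `|x| * `|y| by rewrite -normrM ler_norm.
have E : (x - y) ^+ 2 <= 3 * (x - g) ^+ 2 + 3 * (y - g') ^+ 2 + 3 * (g' - g) ^+ 2.
  have := sqr_ge0 ((x - g) + (y - g')); have := sqr_ge0 ((x - g) + (g' - g)).
  by have := sqr_ge0 ((y - g') - (g' - g)); rewrite !expr2; lra.
by have := sqr_ge0 y; move: E h6; rewrite !expr2; lra.
Qed.

Section near_pairs.
Context {R : realType} {k : nat}.
Variables (P : @polytope R k) (G : 'rV[R]_k -> R) (L : R).
Hypothesis L0 : 0 <= L.
Hypothesis GL : forall x y, body P x -> body P y -> `|G x - G y| <= L * enorm (x - y).
Variables (a : Rk R k -> R) (c s V : R).
Local Notation U := (inner P).
Hypothesis ma : measurable_fun U a.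
Hypothesis mG : measurable_fun U (fun t => G (vec t)).
Hypothesis c0 : 0 <= c.
Hypothesis s0 : 0 < s.
Hypothesis V0 : 0 <= V.
Hypothesis fat : forall t, U t -> (c%:E <= leb k (U `&` eball (vec t) s))%E.
Hypothesis ballV : (leb k (eball 0 s) <= V%:E)%E.

Let mU : measurable U. Proof. exact: measurable_inner. Qed.
Let chi : Rk R k -> R := \1_U.
Let bet : Rk R k -> R := \1_(eball 0 s).
Let al t := chi t * a t.
Let b t := chi t * (a t - G (vec t)).
Let q t := chi t * G (vec t).
Let plus (t z : Rk R k) := affine 1 (vec z) t.

Let vec_plus t z : vec (plus t z) = vec t + vec z.
Proof. by rewrite vec_affine scale1r. Qed.

Let plusC t z : plus t z = plus z t.
Proof.
by apply: (can_inj (@vecK R k)); rewrite !vec_plus addrC.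
Qed.

Let mplus : measurable_fun setT (fun p : Rk R k * Rk R k => plus p.1 p.2).
Proof.
apply/measurable_fun_tnthP => j.
rewrite (_ : _ \o _ = (fun p : Rk R k * Rk R k => 1 * tnth p.1 j + tnth p.2 j)); last first.
  by apply/funext => p /=; rewrite tnth_mktuple mxE.
apply: measurable_funD; first apply: measurable_funM => //.
- by apply: (measurableT_comp (measurable_tnth j)); exact: measurable_fst.
- by apply: (measurableT_comp (measurable_tnth j)); exact: measurable_snd.
Qed.

Let mplus_r z : measurable_fun setT (fun t => plus t z).
Proof. exact: measurable_affine. Qed.

Let mplus_l t : measurable_fun setT (fun z => plus t z).
Proof. by under eq_fun do rewrite plusC; exact: mplus_r. Qed.

Let mchi : measurable_fun setT chi. Proof. exact: measurable_indic. Qed.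
Let mbet : measurable_fun setT bet. Proof. by apply: measurable_indic; exact: measurable_eball. Qed.
Let chi0 t : 0 <= chi t. Proof. by rewrite /chi indicE. Qed.
Let bet0 t : 0 <= bet t. Proof. by rewrite /bet indicE. Qed.
Let chi1 t : U t -> chi t = 1. Proof. by move=> Ut; rewrite /chi indicE mem_set. Qed.
Let chiN t : ~ U t -> chi t = 0. Proof. by move=> Ut; rewrite /chi indicE memNset. Qed.
Let bet1 t : eball 0 s t -> bet t = 1. Proof. by move=> Ut; rewrite /bet indicE mem_set. Qed.
Let betN t : ~ eball 0 s t -> bet t = 0. Proof. by move=> Ut; rewrite /bet indicE memNset. Qed.

Let cut (f : Rk R k -> R) : measurable_fun U f -> measurable_fun setT (fun t => chi t * f t).
Proof.
move=> mf; have := (measurable_restrictT f mU).1 mf.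
apply: eq_measurable_fun => t _; rewrite patchE; case: ifPn => tU.
  by rewrite chi1 ?mul1r//; exact: set_mem.
by rewrite chiN ?mul0r// => Ut; move: tU; rewrite mem_set.
Qed.

Let mal : measurable_fun setT al. Proof. exact: cut. Qed.
Let mb : measurable_fun setT b. Proof. by apply: cut; exact: measurable_funB. Qed.
Let mq : measurable_fun setT q. Proof. exact: cut. Qed.

Let chi_int (f : Rk R k -> R) : (\int[leb k]_t (chi t * f t)%:E = \int[leb k]_(t in U) (f t)%:E)%E.
Proof.
rewrite [RHS]integral_mkcond; apply: eq_integral => t _; rewrite patchE.
case: ifPn => tU; first by rewrite chi1 ?mul1r//; exact: set_mem.
by rewrite chiN ?mul0r// => Ut; move: tU; rewrite mem_set.
Qed.

Let shift_int (f : Rk R k -> R) z : measurable_fun setT f -> (forall t, 0 <= f t) ->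
  (\int[leb k]_t (f (plus t z))%:E = \int[leb k]_t (f t)%:E)%E.
Proof.
move=> mf f0.
have := @integral_translate R k (vec z) setT (fun t => (f t)%:E) measurableT.
by rewrite preimage_setT; apply => [|t]; [exact/measurable_EFinP|rewrite lee_fin].
Qed.

Let m1 (f : Rk R k -> R) : measurable_fun setT f -> measurable_fun setT (fun p : Rk R k * Rk R k => f p.1).
Proof. by move=> mf; apply: (measurableT_comp mf); exact: measurable_fst. Qed.
Let m2 (f : Rk R k -> R) : measurable_fun setT f -> measurable_fun setT (fun p : Rk R k * Rk R k => f p.2).
Proof. by move=> mf; apply: (measurableT_comp mf); exact: measurable_snd. Qed.
Let m3 (f : Rk R k -> R) : measurable_fun setT f -> measurable_fun setT (fun p : Rk R k * Rk R k => f (plus p.1 p.2)).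
Proof. by move=> mf; apply: (measurableT_comp mf). Qed.

Let F1 (p : Rk R k * Rk R k) := bet p.2 * chi (plus p.1 p.2) * al p.1 ^+ 2.
Let F2 (p : Rk R k * Rk R k) := 2 * (`|al p.1| * `|al (plus p.1 p.2)|).
Let F3 (p : Rk R k * Rk R k) := bet p.2 * (3 * b p.1 ^+ 2).
Let F4 (p : Rk R k * Rk R k) := bet p.2 * (3 * b (plus p.1 p.2) ^+ 2 +
  3 * (chi p.1 * chi (plus p.1 p.2) * (q (plus p.1 p.2) - q p.1) ^+ 2)).

Let le_F p : F1 p <= F2 p + (F3 p + F4 p).
Proof.
case: p => t z; rewrite /F1 /F2 /F3 /F4 /=; set t' := plus t z.
have [Bz|nBz] := pselect (eball 0 s z); last first.
  by rewrite betN// !mul0r !addr0 !mulr_ge0.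
rewrite bet1// !mul1r.
have h2 : 0 <= 2 * (`|al t| * `|al t'|) by rewrite !mulr_ge0.
have h3 : 0 <= 3 * b t ^+ 2 by rewrite mulr_ge0// sqr_ge0.
have h4 : 0 <= 3 * b t' ^+ 2 by rewrite mulr_ge0// sqr_ge0.
have h5 : 0 <= 3 * (chi t * chi t' * (q t' - q t) ^+ 2).
  by apply: mulr_ge0 => //; apply: mulr_ge0; [exact: mulr_ge0|exact: sqr_ge0].
have R0 := addr_ge0 h2 (addr_ge0 h3 (addr_ge0 h4 h5)).
have [Ut|nUt] := pselect (U t); last first.
  have E0 : chi t' * al t ^+ 2 = 0 by rewrite /al (chiN nUt) mul0r expr0n mulr0.
  by rewrite E0; exact: R0.
have [Ut'|nUt'] := pselect (U t'); last first.
  have E0 : chi t' * al t ^+ 2 = 0 by rewrite (chiN nUt') mul0r.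
  by rewrite E0; exact: R0.
clear R0 h2 h3 h4 h5.
rewrite /al /b /q !chi1// !mul1r.
exact: near_quad.
Qed.

Let mF1 : measurable_fun setT F1.
Proof.
apply: measurable_funM; first by apply: measurable_funM; [exact: m2|exact: m3].
by apply: measurable_funX; exact: m1.
Qed.
Let mF2 : measurable_fun setT F2.
Proof.
apply: measurable_funM => //; apply: measurable_funM; apply: measurableT_comp => //; [exact: m1|exact: m3].
Qed.
Let mF3 : measurable_fun setT F3.
Proof.
apply: measurable_funM; first exact: m2.
by apply: measurable_funM => //; apply: measurable_funX; exact: m1.
Qed.
Let mF4 : measurable_fun setT F4.
Proof.
apply: measurable_funM; first exact: m2.
apply: measurable_funD; apply: measurable_funM => //.
  by apply: measurable_funX; exact: m3.
apply: measurable_funM; first by apply: measurable_funM; [exact: m1|exact: m3].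
by apply: measurable_funX; apply: measurable_funB; [exact: m3|exact: m1].
Qed.
Let F1_0 p : 0 <= F1 p.
Proof. exact: (mulr_ge0 (mulr_ge0 (bet0 _) (chi0 _)) (sqr_ge0 _)). Qed.
Let F2_0 p : 0 <= F2 p.
Proof. by rewrite /F2 !mulr_ge0. Qed.
Let F3_0 p : 0 <= F3 p.
Proof. exact: (mulr_ge0 (bet0 _) (mulr_ge0 (ler0n _ 3) (sqr_ge0 _))). Qed.
Let F4_0 p : 0 <= F4 p.
Proof. apply: (mulr_ge0 (bet0 _)); apply: addr_ge0; apply: (mulr_ge0 (ler0n _ 3)); first exact: sqr_ge0.
exact: (mulr_ge0 (mulr_ge0 (chi0 _) (chi0 _)) (sqr_ge0 _)). Qed.

Let A2 := (\int[leb k]_(t in U) (a t ^+ 2)%:E)%E.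
Let A1 := (\int[leb k]_(t in U) (`|a t|)%:E)%E.
Let B2 := (\int[leb k]_(t in U) ((a t - G (vec t)) ^+ 2)%:E)%E.
Let D := (\int[leb k]_(t in U) (dot (grad G (vec t)) (grad G (vec t)))%:E)%E.

Let al2 : (\int[leb k]_t (al t ^+ 2)%:E = A2)%E.
Proof.
rewrite /A2 -chi_int; apply: eq_integral => t _; rewrite /al; congr EFin.
by have [Ut|nUt] := pselect (U t); [rewrite chi1// !mul1r|rewrite chiN// !mul0r expr0n].
Qed.

Let al1 : (\int[leb k]_t (`|al t|)%:E = A1)%E.
Proof.
rewrite /A1 -chi_int; apply: eq_integral => t _; rewrite /al; congr EFin.
by rewrite normrM (ger0_norm (chi0 t)).
Qed.

Let b2 : (\int[leb k]_t (b t ^+ 2)%:E = B2)%E.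
Proof.
rewrite /B2 -chi_int; apply: eq_integral => t _; rewrite /b; congr EFin.
by have [Ut|nUt] := pselect (U t); [rewrite chi1// !mul1r|rewrite chiN// !mul0r expr0n].
Qed.

Let bet_int : (\int[leb k]_t (bet t)%:E <= V%:E)%E.
Proof. by rewrite integral_indic ?setIT//; exact: measurable_eball. Qed.

Let lower : (c%:E * A2 <= \int[leb k \x leb k]_p (F1 p)%:E)%E.
Proof.
rewrite fubini_tonelli1//; last exact/measurable_EFinP.
rewrite -al2 -(rintegralZ (leb k) measurableT) //; last 2 first.
- exact: measurable_funX.
- by move=> t; exact: sqr_ge0.
apply: ge0_le_integral => //.
- by move=> t _; rewrite lee_fin mulr_ge0// sqr_ge0.
- by apply/measurable_EFinP; apply: measurable_funM => //; exact: measurable_funX.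
- by apply: measurable_fun_fubini_tonelli_F => //; exact/measurable_EFinP.
move=> t _; have [Ut|nUt] := pselect (U t); last first.
  rewrite {1}/al chiN// mul0r expr0n /= mulr0.
  by apply: integral_ge0 => z _; rewrite lee_fin.
rewrite /fubini_F /F1 /=; under eq_integral do rewrite mulrC.
rewrite (rintegralZ (leb k) measurableT); last 3 first.
- exact (measurable_funM mbet (measurableT_comp mchi (mplus_l t))).
- by move=> z; exact (mulr_ge0 (bet0 _) (chi0 _)).
- exact: sqr_ge0.
rewrite EFinM muleC lee_wpmul2l ?lee_fin ?sqr_ge0//.
have mS : measurable (U `&` eball (vec t) s) by apply: measurableI => //; exact: measurable_eball.
rewrite (_ : (fun z => _) = (fun z => ((\1_(U `&` eball (vec t) s) : Rk R k -> R) (plus z t))%:E)); last first.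
  apply/funext => z; congr EFin; rewrite indicI /= /bet /chi plusC mulrC; congr (_ * _).
  rewrite !indicE; congr (_ %:R); congr nat_of_bool; apply/idP/idP => /set_mem h; apply/mem_set; move: h;
    by rewrite /eball /= vec_plus subr0 addrK.
by rewrite shift_int ?integral_indic ?setIT//; exact: fat.
Qed.

Let upper2 : (\int[leb k \x leb k]_p (F2 p)%:E <= 2%:E * (A1 * A1))%E.
Proof.
rewrite fubini_tonelli1//; last exact/measurable_EFinP.
have mal' : measurable_fun setT (fun t => `|al t|) by exact: measurableT_comp.
have A10 : (0 <= A1)%E by apply: integral_ge0 => t _; rewrite lee_fin.
rewrite (_ : (fun x => _) = (fun t => (2%:E * A1) * (`|al t|)%:E)%E).
  rewrite ge0_integralZl//.
  - by rewrite al1 muleA.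
  - exact/measurable_EFinP.
  - by rewrite mule_ge0.
apply/funext => t; rewrite /fubini_F /F2 /=; under eq_integral do rewrite mulrA.
rewrite (rintegralZ (leb k) measurableT) ?mulr_ge0//.
  under eq_integral do rewrite plusC.
  by rewrite (shift_int t mal') // al1 EFinM -!muleA; congr (_ * _)%E; rewrite muleC.
have mpt : measurable_fun setT (fun z => plus t z).
  exact: mplus_l.
by apply: measurableT_comp => //; exact: (measurableT_comp mal mpt).
Qed.

Let B20 : (0 <= B2)%E. Proof. by apply: integral_ge0 => t _; rewrite lee_fin sqr_ge0. Qed.
Let D0 : (0 <= D)%E. Proof. by apply: integral_ge0 => t _; rewrite lee_fin dot_ge0. Qed.

Let upper3 : (\int[leb k \x leb k]_p (F3 p)%:E <= V%:E * (3%:E * B2))%E.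
Proof.
rewrite fubini_tonelli2//; last exact/measurable_EFinP.
have mb2 : measurable_fun setT (fun t => 3 * b t ^+ 2).
  by apply: measurable_funM => //; exact: measurable_funX.
have b20 t : 0 <= 3 * b t ^+ 2 by rewrite mulr_ge0// sqr_ge0.
rewrite (_ : (fun x => _) = (fun z => (3%:E * B2) * (bet z)%:E)%E).
  rewrite ge0_integralZl//.
  - by rewrite muleC lee_wpmul2r// mule_ge0.
  - exact/measurable_EFinP.
  - by move=> z _; rewrite lee_fin.
  - by rewrite mule_ge0.
apply/funext => z; rewrite /fubini_G /F3 /=.
rewrite (rintegralZ (leb k) measurableT) // (rintegralZ (leb k) measurableT) //.
- by rewrite b2 muleC.
- exact: measurable_funX.
- by move=> t; exact: sqr_ge0.
Qed.

Let upper4 : (\int[leb k \x leb k]_p (F4 p)%:E <= V%:E * (3%:E * B2 + 3%:E * ((s ^+ 2)%:E * D)))%E.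
Proof.
rewrite fubini_tonelli2//; last exact/measurable_EFinP.
set Z := (_ + _)%E; have Z0 : (0 <= Z)%E.
  by rewrite adde_ge0// mule_ge0// mule_ge0// lee_fin sqr_ge0.
apply: (@le_trans _ _ (\int[leb k]_z (Z * (bet z)%:E))%E); last first.
  rewrite ge0_integralZl//.
  - by rewrite muleC lee_wpmul2r.
  - exact/measurable_EFinP.
  - by move=> z _; rewrite lee_fin.
apply: ge0_le_integral => //.
- by move=> z _; apply: integral_ge0 => t _; rewrite lee_fin.
- by apply: measurable_fun_fubini_tonelli_G => //; exact/measurable_EFinP.
- by apply: measurable_funeM; exact/measurable_EFinP.
move=> z _; rewrite /fubini_G /F4 /=.
have [Bz|nBz] := pselect (eball 0 s z); last first.
  by rewrite betN// mule0; under eq_integral do rewrite mul0r; rewrite integral0.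
rewrite bet1// mule1; under eq_integral do rewrite mul1r.
have mpz : measurable_fun setT (fun t => plus t z).
  exact: mplus_r.
have mb2 : measurable_fun setT (fun t => b (plus t z) ^+ 2).
  by apply: measurable_funX; exact: (measurableT_comp mb).
have mg2 : measurable_fun setT (fun t => chi t * chi (plus t z) * (q (plus t z) - q t) ^+ 2).
  exact (measurable_funM (measurable_funM mchi (measurableT_comp mchi mpz))
    (measurable_funX 2 (measurable_funB (measurableT_comp mq mpz) mq))).
have g20 t : 0 <= chi t * chi (plus t z) * (q (plus t z) - q t) ^+ 2.
  by apply: mulr_ge0; [exact: mulr_ge0|exact: sqr_ge0].
rewrite (rintegralD (leb k) measurableT); last 4 first.
- exact: measurable_funM.
- exact: measurable_funM.
- by move=> t; rewrite mulr_ge0// sqr_ge0.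
- by move=> t; rewrite mulr_ge0.
rewrite !(rintegralZ (leb k) measurableT)//; last by move=> t; exact: sqr_ge0.
apply: leeD.
  rewrite (shift_int (f := fun t => b t ^+ 2)) ?b2//; first exact: measurable_funX.
  by move=> t; exact: sqr_ge0.
rewrite lee_wpmul2l//.
have dz : dot (vec z) (vec z) <= s ^+ 2.
  move: Bz; rewrite /eball /= subr0 /enorm => h.
  rewrite -(sqr_sqrtr (dot_ge0 (vec z))) lerXn2r ?nnegrE ?sqrtr_ge0 ?(ltW s0)//.
apply: (@le_trans _ _ ((dot (vec z) (vec z))%:E * D)%E); last by rewrite lee_wpmul2r// lee_fin.
apply: le_trans (translate_le_grad L0 GL (vec z)).
rewrite le_eqVlt; apply/orP; left; apply/eqP.
rewrite [RHS]integral_mkcond; apply: eq_integral => t _; rewrite patchE.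
case: ifPn => [/set_mem[Ut Utz]|nt].
  by rewrite /q !chi1// !mul1r vec_plus.
have [Ut|nUt] := pselect (U t); last by rewrite (chiN nUt) !mul0r.
have [Utz|nUtz] := pselect (U (plus t z)); last by rewrite (chiN nUtz) mulr0 mul0r.
by move: nt; rewrite mem_set.
Qed.

(** Integrate [near_quad] over the pairs [(t, t + z)] in the cell with [z] in the ball
   of radius [s]. On the left the fatness of the cell bounds the volume of the
   admissible [z] from below; on the right the products factor, and the differences
   of the Lipschitz function are controlled by its gradient. *)
Lemma near_pairs : (c%:E * A2 <= 2%:E * (A1 * A1) +
  V%:E * (6%:E * B2 + 3%:E * ((s ^+ 2)%:E * D)))%E.
Proof.
apply: le_trans lower _.
apply: (@le_trans _ _ (\int[leb k \x leb k]_p (F2 p + (F3 p + F4 p))%:E)%E).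
  apply: rintegral_le => //.
  by apply: measurable_funD => //; exact: measurable_funD.
have mF34 : measurable_fun setT (fun p => F3 p + F4 p) by exact: measurable_funD.
have F34_0 p : 0 <= F3 p + F4 p by exact: addr_ge0.
rewrite (rintegralD _ measurableT mF2 mF34 F2_0 F34_0) (rintegralD _ measurableT mF3 mF4 F3_0 F4_0).
apply: leeD => //; apply: le_trans (leeD upper3 upper4) _.
have T0 : (0 <= 3%:E * ((s ^+ 2)%:E * D))%E by rewrite mule_ge0// mule_ge0// lee_fin sqr_ge0.
have T3 : (0 <= 3%:E * B2)%E by rewrite mule_ge0.
have E6 : (3%:E * B2 + 3%:E * B2 = 6%:E * B2)%E.
  by rewrite -ge0_muleDl// -EFinD (_ : 3 + 3 = 6 :> R)//; ring.
by rewrite -(ge0_muleDr _ T3 (adde_ge0 T3 T0)) addeA E6.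
Qed.

End near_pairs.

(** ** Nash inequality and ultracontractivity *)

Lemma esum_scale_le {R : realType} {I : choiceType} (D : set I) (r : R) (a : I -> \bar R) :
  0 <= r -> (forall i, 0 <= a i)%E ->
  (\esum_(i in D) (r%:E * a i) <= r%:E * \esum_(i in D) a i)%E.
Proof.
move=> r0 a0; rewrite ge_ereal_sup => //= _ [A [finA AD]] <-.
rewrite -ge0_mule_fsumr//; apply: lee_wpmul2l; first by rewrite lee_fin.
by apply: esum_ge; exists A.
Qed.

Lemma esumZ {R : realType} {I : choiceType} (D : set I) (r : R) (a : I -> \bar R) :
  0 <= r -> (forall i, 0 <= a i)%E ->
  (\esum_(i in D) (r%:E * a i) = r%:E * \esum_(i in D) a i)%E.
Proof.
move=> r0 a0; apply/eqP; rewrite eq_le esum_scale_le//=.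
have [->|rn0] := eqVneq r 0; first by rewrite mul0e esum_ge0// => i _; rewrite mul0e.
have rp : 0 < r by rewrite lt_neqAle eq_sym rn0.
have ra0 i : (0 <= r%:E * a i)%E by rewrite mule_ge0.
have := @esum_scale_le _ _ D r^-1 (fun i => r%:E * a i)%E; rewrite invr_ge0 => /(_ r0 ra0) h.
have -> : (\esum_(i in D) a i = \esum_(i in D) (r^-1%:E * (r%:E * a i)))%E.
  by apply: eq_esum => i _; rewrite muleA -EFinM mulVf// mul1e.
apply: le_trans (lee_wpmul2l _ h) _; first by rewrite lee_fin.
by rewrite muleA -EFinM mulfV// mul1e.
Qed.

(** Iterating costs a factor [b] per step in the first term and gains [del] in the
   second; as [del * b <= 1 / 2] the geometric series is at most [2 * a] and the
   bounded remainder vanishes in the limit. *)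
Lemma absorb {R : realType} (F : nat -> R) (a b del Q : R) : 0 <= a -> 1 <= b -> 0 <= del ->
  del * b <= 2^-1 -> (forall k, F k <= a * b ^+ k + del * F k.+1) -> (forall k, F k <= Q) ->
  0 <= Q -> F 0%N <= 2 * a.
Proof.
move=> a0 b1 d0 db hF FQ Q0.
have d2 : del <= 2^-1 by apply: le_trans db; rewrite ler_peMr.
have ind k : F 0%N <= 2 * a * (1 - 2^-1 ^+ k) + del ^+ k * F k.
  elim: k => [|k IH]; first by rewrite !expr0 subrr mulr0 add0r mul1r.
  apply: le_trans IH _; have dk : 0 <= del ^+ k by rewrite exprn_ge0.
  have h := ler_wpM2l dk (hF k).
  have h2 : del ^+ k * b ^+ k <= 2^-1 ^+ k.
    by rewrite -exprMn lerXn2r ?nnegrE ?mulr_ge0//; lra.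
  have h3 := ler_wpM2l a0 h2.
  rewrite !exprSr; have : del ^+ k * (del * F k.+1) = del ^+ k * del * F k.+1 by rewrite mulrA.
  by lra.
apply/ler_addgt0Pr => e e0.
have /cvgrPdist_lt/(_ _ e0)[k _ hk] := exp2V_cvg Q.
have := hk k (leqnn k); rewrite /= sub0r normrN ger0_norm ?mulr_ge0 ?invr_ge0 ?exprn_ge0// => hQ.
have dk : del ^+ k <= 2^-1 ^+ k by rewrite lerXn2r ?nnegrE.
have dk0 : 0 <= del ^+ k by rewrite exprn_ge0.
have := ind k; have := ler_wpM2l dk0 (FQ k); have := ler_wpM2r Q0 dk.
have p0 : 0 <= 2^-1 ^+ k :> R by rewrite exprn_ge0.
have := mulr_ge0 a0 p0; rewrite -exprVn in hQ; lra.
Qed.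

Section nash.
Context {R : realType} {T : pointedType} (X : pcomplex R T).
Hypothesis PX : polyhedral_complex X.
Local Notation S := (points X).
Implicit Types (x y z : S) (f g h u w : S -> R).
Local Notation lipc := (@lipschitz_compact R T X).
Local Notation H := (sqi (mu X)).
Local Notation ipm := (ip (mu X)).
Local Notation en := (@en R T X).
Local Notation lipX := (@lipX R T X).
Local Notation pH := (psd_ip X).
Local Notation pC := (psd_en PX).
Variables (n : nat) (c l0 : R).
Hypothesis dimn : forall i, maximal_cell X i -> cdim i = n.
Hypothesis c0 : 0 < c.
Hypothesis l00 : 0 < l0.
Hypothesis fat : forall i (x : 'rV[R]_(cdim i)) (r : R), maximal_cell X i ->
  body (cpoly i) x -> 0 < r -> r <= l0 ->
  ((c * r ^+ n)%:E <= leb (cdim i) (@vec R _ @^-1` body (cpoly i) `&` eball x r))%E.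

Lemma ball_volume : exists2 K : R, 0 < K & forall i, maximal_cell X i -> forall s, 0 < s ->
  (leb (cdim i) (eball 0 s) <= (K * s ^+ n)%:E)%E.
Proof.
pose v := fine (leb n (eball (0 : 'rV[R]_n) 1)).
have vE : leb n (eball (0 : 'rV[R]_n) 1) = v%:E.
  by rewrite fineK// ge0_fin_numE//; exact: leb_eball_lty.
have v0 : 0 <= v by apply: fine_ge0.
exists (v + 1) => [|i Mi s s0]; first by lra.
rewrite (dimn Mi); have := @leb_affine R n s 0 (eball 0 s) s0 (@measurable_eball _ _ 0 s).
rewrite (_ : affine s 0 @^-1` eball 0 s = eball 0 1); last first.
  apply/seteqP; split=> t; rewrite /eball /= !subr0 vec_affine addr0 enormZ (gtr0_norm s0).
    by rewrite -[X in _ <= X]mulr1 ler_pM2l.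
  by move=> h; rewrite -[X in _ <= X]mulr1 ler_pM2l.
rewrite vE => E.
have -> : leb n (eball 0 s) = ((s ^+ n)%:E * v%:E)%E.
  by rewrite E muleA -EFinM mulfV ?mul1e// expf_neq0// gt_eqF.
by rewrite -EFinM lee_fin mulrC ler_wpM2r ?exprn_ge0 ?(ltW s0)// lerDl.
Qed.

(** The boundary of a cell is a null set. *)
Lemma inner_integral (i : cell X) (f : Rk R (cdim i) -> R) : measurable_fun (@cell_body R T X i) f ->
  (forall t, 0 <= f t) ->
  (\int[leb (cdim i)]_(t in @cell_body R T X i) (f t)%:E =
   \int[leb (cdim i)]_(t in inner (cpoly i)) (f t)%:E)%E.
Proof.
move=> mf f0; have mB := @measurable_cell_body R T X i.
have mN : measurable (@cell_body R T X i `\` inner (cpoly i)).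
  by apply: measurableD => //; exact: measurable_inner.
rewrite (@ge0_negligible_integral _ _ _ _ _ _ _ mN mB)//.
- congr (integral _ _ _); rewrite setDD; apply/seteqP; split=> [t [_ It]|t It]; first exact: It.
  by split; [exact (inner_body It)|exact It].
- exact/measurable_EFinP.
- by move=> t _; rewrite lee_fin.
- exact: boundary_null.
Qed.

(** The inequality of [near_pairs] summed over the cells, at scale [s]. Its form with
   an element [u] of [L^2] near a Lipschitz function [w] suits the orbits of the
   semigroup, which need not be Lipschitz. *)
Definition local_poincare (K : R) := forall (s m : R) u w, 0 < s -> s <= l0 -> 0 <= m ->
  H u -> lipc w -> (mass u <= m%:E)%E ->
  c * s ^+ n * ipm u u <= 2 * m ^+ 2 +
    K * s ^+ n * (6 * ipm (lin (-1) w u) (lin (-1) w u) + 3 * (s ^+ 2 * en w w)).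

Lemma pre_nash : exists2 K : R, 0 < K & local_poincare K.
Proof.
have [K K0 hK] := ball_volume; exists K => // s m u w s0 sl m0 Hu cw um.
have [L L0 wL] := lipc_lipX cw; have Hw := lipc_sqi PX cw.
have Hd := psd_dom pH (-1) Hw Hu; have sn0 : 0 <= s ^+ n by rewrite exprn_ge0 ?ltW.
pose A2 (i : cell X) := (\int[leb (cdim i)]_(t in inner (cpoly i)) (u (chart (vec t)) ^+ 2)%:E)%E.
pose A1 (i : cell X) := (\int[leb (cdim i)]_(t in inner (cpoly i)) (`|u (chart (vec t))|)%:E)%E.
pose B2 (i : cell X) := (\int[leb (cdim i)]_(t in inner (cpoly i)) ((u (chart (vec t)) - w (chart (vec t))) ^+ 2)%:E)%E.
pose D (i : cell X) := (\int[leb (cdim i)]_(t in inner (cpoly i)) (dot (cgrad w (vec t)) (cgrad w (vec t)))%:E)%E.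
have A20 (i : cell X) : (0 <= A2 i)%E by apply: integral_ge0 => t _; rewrite lee_fin sqr_ge0.
have A10 (i : cell X) : (0 <= A1 i)%E by apply: integral_ge0 => t _; rewrite lee_fin.
have B20 (i : cell X) : (0 <= B2 i)%E by apply: integral_ge0 => t _; rewrite lee_fin sqr_ge0.
have D0 (i : cell X) : (0 <= D i)%E by apply: integral_ge0 => t _; rewrite lee_fin dot_ge0.
have cells (f : S -> R) : measurable_fun setT f -> (forall x, 0 <= f x) ->
    (\int[mu X]_x (f x)%:E = \esum_(i in maximal_cell X)
      \int[leb (cdim i)]_(t in inner (cpoly i)) (f (chart (vec t)))%:E)%E.
  move=> mf f0; rewrite mu_integral; [|exact/measurable_EFinP|by move=> x; rewrite lee_fin].
  apply: eq_esum => i Mi.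
  rewrite -(inner_integral (f := fun t => f (chart (vec t)))) => [//||t]; last exact: f0.
  exact: (measurable_cell_chart mf).
have mud : measurable_fun setT (fun x => u x - w x).
  by apply: measurable_funB; [exact: Hu.1|exact: Hw.1].
have EA2 : (\esum_(i in maximal_cell X) A2 i = (ipm u u)%:E)%E.
  rewrite -ipE// (cells (fun x => u x ^+ 2))//; last by move=> x; exact: sqr_ge0.
  by apply: measurable_funX; exact: Hu.1.
have EA1 : (\esum_(i in maximal_cell X) A1 i <= m%:E)%E.
  apply: le_trans um; rewrite /mass (cells (fun x => `|u x|))//.
  by apply: measurableT_comp => //; exact: Hu.1.
have EB2 : (\esum_(i in maximal_cell X) B2 i = (ipm (lin (-1) w u) (lin (-1) w u))%:E)%E.
  rewrite -ipE// (_ : (fun x => _) = (fun x => ((u x - w x) ^+ 2)%:E)); last first.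
    by apply/funext => x; rewrite /lin mulN1r addrC.
  rewrite (cells (fun x => (u x - w x) ^+ 2))//; last by move=> x; exact: sqr_ge0.
  exact: measurable_funX.
have ED : (\esum_(i in maximal_cell X) D i = (en w w)%:E)%E.
  rewrite -(energyE PX cw); apply: eq_esum => i Mi; apply: eq_integral => t _.
  by congr EFin; apply: eq_bigr => j _; rewrite !mxE expr2.
have A1m (i : cell X) : maximal_cell X i -> (A1 i <= m%:E)%E.
  move=> Mi; apply: le_trans EA1; apply: esum_ge; exists [set i].
    by split; [exact: finite_set1|move=> j ->].
  by rewrite fsbig_set1.
have csn : 0 <= c * s ^+ n by rewrite mulr_ge0// ltW.
have Ksn : 0 <= K * s ^+ n by rewrite mulr_ge0// ltW.
have bod (i : cell X) : measurable_fun (inner (cpoly i)) (fun t : Rk R (cdim i) => u (chart (vec t))).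
  apply: (@measurable_funS _ _ _ _ (@cell_body R T X i)); first exact: measurable_cell_body.
    exact: inner_body.
  exact: (measurable_cell_chart Hu.1).
have bodw (i : cell X) : measurable_fun (inner (cpoly i)) (fun t : Rk R (cdim i) => w (chart (vec t))).
  apply: (@measurable_funS _ _ _ _ (@cell_body R T X i)); first exact: measurable_cell_body.
    exact: inner_body.
  exact: (measurable_cell_chart Hw.1).
have key (i : cell X) : maximal_cell X i -> ((c * s ^+ n)%:E * A2 i <= 2%:E * (m%:E * A1 i) +
    (K * s ^+ n)%:E * (6%:E * B2 i + 3%:E * ((s ^+ 2)%:E * D i)))%E.
  move=> Mi.
  have GL (a b : 'rV[R]_(cdim i)) : body (cpoly i) a -> body (cpoly i) b ->
      `|w (chart a) - w (chart b)| <= L * enorm (a - b).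
    exact: lipX_cell wL.
  have fati (t : Rk R (cdim i)) : inner (cpoly i) t ->
      ((c * s ^+ n)%:E <= leb (cdim i) (inner (cpoly i) `&` eball (vec t) s))%E.
    move=> It; apply: le_trans (fat Mi (inner_body It) s0 sl) _.
    have mB := @measurable_cell_body R T X i; have mE := @measurable_eball R (cdim i) (vec t) s.
    have mI := @measurable_inner R (cdim i) (cpoly i).
    apply: (@le_trans _ _ (leb (cdim i) ((inner (cpoly i) `&` eball (vec t) s) `|`
        (@cell_body R T X i `\` inner (cpoly i))))%E).
      apply: le_measure; rewrite ?inE.
      - exact: measurableI.
      - by apply: measurableU; [exact: measurableI|exact: measurableD].
      - move=> r [Br Er]; have [Ir|nIr] := pselect (inner (cpoly i) r); first by left.
        by right.
    apply: le_trans (measureU2 _ _ _) _; [exact: measurableI|exact: measurableD|].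
    by rewrite [X in (_ + X)%E]boundary_null adde0.
  have := near_pairs L0 GL (bod i) (bodw i) csn s0 fati (hK i Mi s s0).
  move=> np; apply: le_trans np _; apply: leeD => //.
  by apply: lee_wpmul2l => //; exact (lee_wpmul2r (A10 i) (A1m i Mi)).
have := le_esum key; rewrite esumZ// EA2.
have T1 (i : cell X) : (0 <= 2%:E * (m%:E * A1 i))%E by rewrite mule_ge0// mule_ge0// lee_fin.
have T2 (i : cell X) : (0 <= 6%:E * B2 i)%E by rewrite mule_ge0.
have T30 (i : cell X) : (0 <= (s ^+ 2)%:E * D i)%E by rewrite mule_ge0// lee_fin sqr_ge0.
have T3 (i : cell X) : (0 <= 3%:E * ((s ^+ 2)%:E * D i))%E by rewrite mule_ge0.
have T4 (i : cell X) : (0 <= 6%:E * B2 i + 3%:E * ((s ^+ 2)%:E * D i))%E by rewrite adde_ge0.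
rewrite esumD//; last by move=> i _; rewrite mule_ge0// lee_fin.
rewrite (esumZ _ (a := fun i => m%:E * A1 i)%E)//; last by move=> i; rewrite mule_ge0// lee_fin.
have ES : (\esum_(i in maximal_cell X) (6%:E * B2 i + 3%:E * ((s ^+ 2)%:E * D i)) =
    6%:E * (\esum_(i in maximal_cell X) B2 i) +
    3%:E * ((s ^+ 2)%:E * (\esum_(i in maximal_cell X) D i)))%E.
  rewrite (esumD (fun i _ => T2 i) (fun i _ => T3 i)).
  have Z6 : 0 <= 6 :> R by []. have Z3 : 0 <= 3 :> R by [].
  by rewrite (esumZ _ Z6 B20) (esumZ _ Z3 T30) (esumZ _ (sqr_ge0 s) D0).
rewrite (esumZ _ m0 A10) (esumZ _ Ksn T4) ES EB2 ED => h.
rewrite -lee_fin; apply: (@le_trans _ _ ((c * s ^+ n)%:E * (ipm u u)%:E)%E); first by rewrite -EFinM.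
apply: le_trans h _.
have -> : ((2 * m ^+ 2 + K * s ^+ n * (6 * ipm (lin (-1) w u) (lin (-1) w u) +
    3 * (s ^+ 2 * en w w)))%:E = 2%:E * (m%:E * m%:E) + (K * s ^+ n)%:E *
    (6%:E * (ipm (lin (-1) w u) (lin (-1) w u))%:E + 3%:E * ((s ^+ 2)%:E * (en w w)%:E)))%E.
  by rewrite [m ^+ 2]expr2.
apply: leeD => //.
by apply: lee_wpmul2l => //; apply: lee_wpmul2l => //; rewrite lee_fin.
Qed.

Section semigroup.
Variable P : R -> (S -> R) -> S -> R.
Hypothesis HP : heat_semigroup P.
Hypothesis nontrivial : exists2 g, H g & ipm g g != 0.

Variable K : R.
Hypothesis K0 : 0 < K.
Hypothesis hK : local_poincare K.

Lemma mass_ae f g : H f -> H g -> {ae mu X, forall x, f x = g x} -> mass f = mass g.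
Proof.
move=> Hf Hg fg; apply: ae_eq_integral => //.
- by apply/measurable_EFinP; apply: measurableT_comp => //; exact: Hf.1.
- by apply/measurable_EFinP; apply: measurableT_comp => //; exact: Hg.1.
- have AF : Filter (almost_everywhere (mu X)) by exact: ae_filter_ringOfSetsType.
  by apply: filterS fg => x -> _.
Qed.

(** Applied at the orbit, [pre_nash] is a linear differential inequality for the
   squared norm, with relaxation rate of order [s ^- 2] towards the level fixed by
   the mass and the scale. *)
Lemma nash_step (s m t0 t : R) f h : 0 < s -> s <= l0 -> 0 <= m ->
  0 <= t0 -> 0 <= t -> lapX f h -> (forall r, 0 <= r -> (mass (P r f) <= m%:E)%E) ->
  ipm (P (t + t0) f) (P (t + t0) f) <= 2 * m ^+ 2 / (c * s ^+ n) +
    expR (- (2 * c / (3 * K) / s ^+ 2) * t) * ipm (P t0 f) (P t0 f).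
Proof.
move=> s0 sl m0 t00 tt lf mf.
have [Hf Hh] := lapX_H PX HP lf; have lg := heat_lap PX HP t00 lf.
have Hg := P_H HP t00 Hf; have Hk := P_H HP t00 Hh.
have mg r : 0 <= r -> (mass (P r (P t0 f)) <= m%:E)%E.
  move=> r0; have rt := addr_ge0 r0 t00; rewrite -(mass_ae (P_H HP rt Hf) (P_H HP r0 Hg)).
    exact: mf.
  exact: (heat_add HP r0 t00 ((L2H f).2 Hf)).
have Ht := P_H HP (addr_ge0 tt t00) Hf; have Htg := P_H HP tt Hg.
rewrite -(nrm2 pH) (dst0_nrm pH Ht Htg (heat_add0 HP tt t00 Hf)) (nrm2 pH).
set g := P t0 f in lg Hg mg Htg *; set k := P t0 h in lg Hk.
pose q := c * s ^+ n; have q0 : 0 < q by rewrite mulr_gt0// exprn_gt0.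
have H0 := lipc_sqi PX (lipc0 X).
have n0 : nrm ipm (fun _ => 0) = 0.
  by have := dstxx pH H0; rewrite /dst => E; rewrite -[RHS]E; congr nrm; apply/funext => x; rewrite /lin; ring.
suff : ipm (P t g) (P t g) - 2 * m ^+ 2 / q <=
    expR (- (2 * c / (3 * K) / s ^+ 2) * t) * (ipm g g - 2 * m ^+ 2 / q).
  have : 0 <= expR (- (2 * c / (3 * K) / s ^+ 2) * t) * (2 * m ^+ 2 / q).
    by rewrite mulr_ge0 ?expR_ge0// divr_ge0 ?(ltW q0)// mulr_ge0// sqr_ge0.
  by rewrite -/q mulrBr; lra.
apply: (@heat_evolve _ _ _ PX _ HP (fun v : S -> R => ipm v v)
   (fun v : S -> R => lin 2 v (fun _ => 0)) 2 _ _ t g k tt lg) => //.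
- by move=> u Hu; exact: (psd_dom pH).
- move=> u v Hu Hv; apply: le_trans (dst_lin pH 2 Hu Hv H0 H0) _.
  by rewrite (dstxx pH H0) addr0 ger0_norm.
- move=> u v Hu Hv; have Hd := psd_dom pH (-1) Hu Hv.
  rewrite (psd_lin pH 2 Hv H0 Hd) (psd_null pH H0 Hd n0) addr0 (psd_linr pH (-1) Hu Hv Hv).
  by have := psd_ge0 pH (lin (-1) u v); rewrite (psd_sq pH (-1) Hu Hv) (psdC pH v u); lra.
move=> r /andP[r0 _]; have lr := heat_lap PX HP r0 lg.
have Hr := P_H HP r0 Hg; have Hkr := P_H HP r0 Hk.
rewrite (psd_lin pH 2 Hr H0 Hkr) (psd_null pH H0 Hkr n0) addr0 (psdC pH).
have [w aw hw] := heat_test PX HP nontrivial lr; have [Cw _ wr _] := aw.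
have [M M0 hM] := energy_approx_bounded PX aw.
have ew := hw w _ Cw Hr wr (ex_intro _ M (fun k => (hM k).1)).
have Hw j := lipc_sqi PX (Cw j).
have dw : ipm (lin (-1) (w j) (P r g)) (lin (-1) (w j) (P r g)) @[j --> \oo] --> (0 : R).
  rewrite (_ : (fun j => _) = (fun j => dst ipm (w j) (P r g) * dst ipm (w j) (P r g))).
    by rewrite -[X in _ --> X](mulr0 (0 : R)); apply: cvgM.
  by apply/funext => j; rewrite -expr2 (dstC pH (Hw j) Hr) (nrm2 pH).
have lim : (2 * m ^+ 2 + K * s ^+ n * (6 * ipm (lin (-1) (w j) (P r g)) (lin (-1) (w j) (P r g)) +
    3 * (s ^+ 2 * en (w j) (w j)))) @[j --> \oo] -->
    (2 * m ^+ 2 + K * s ^+ n * (6 * 0 + 3 * (s ^+ 2 * ipm (P r k) (P r g))) : R).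
  apply: cvgD; first exact: cvg_cst.
  by apply: cvg_scale; apply: cvgD; apply: cvg_scale => //; exact: cvg_scale.
have := seq_le (cvg_cst (q * ipm (P r g) (P r g))) lim
  (fun j => hK s0 sl m0 Hr (Cw j) (mg r r0)).
rewrite mulr0 add0r /q; set U := ipm _ _; set E := ipm (P r k) _ => ineq.
have p0 : 0 < s ^+ n by rewrite exprn_gt0.
have s20 : 0 < s ^+ 2 by rewrite exprn_gt0.
have -> : 2 * c / (3 * K) / s ^+ 2 * (U - 2 * m ^+ 2 / (c * s ^+ n)) =
    (2 / (3 * K * s ^+ 2 * s ^+ n)) * (c * s ^+ n * U - 2 * m ^+ 2).
  by field; rewrite !gt_eqF.
have D0 : 0 < 2 / (3 * K * s ^+ 2 * s ^+ n) by rewrite divr_gt0// !mulr_gt0.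
have -> : 2 * E = (2 / (3 * K * s ^+ 2 * s ^+ n)) * (K * s ^+ n * (3 * (s ^+ 2 * E))).
  by field; rewrite !gt_eqF.
rewrite (ler_pM2l D0) lerBlDr addrC.
exact: ineq.
Qed.

Definition nash_eps (T0 : R) := Num.min (2 * c / (3 * K) / 2 ^+ n.+2) (l0 ^+ 2 / T0).

Lemma nash_eps_gt0 T0 : 0 < T0 -> 0 < nash_eps T0.
Proof. by move=> T00; rewrite lt_min !divr_gt0// ?exprn_gt0// mulr_gt0. Qed.

(** Apply [nash_step] between the times [t / 4 ^+ k.+1] and [t / 4 ^+ k] with the
   parabolic scales [s / 2 ^+ k]; contraction gives the uniform bound that [absorb]
   asks for. *)
Lemma nash (T0 t m : R) f : 0 < T0 -> 0 < t -> t <= T0 -> 0 <= m -> lipc f -> (mass f <= m%:E)%E ->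
  ipm (P t f) (P t f) <= 4 / c * m ^+ 2 / Num.sqrt (nash_eps T0 * t) ^+ n.
Proof.
move=> T00 t0 tT m0 cf fm; pose k0 := 2 * c / (3 * K).
have k00 : 0 < k0 by rewrite divr_gt0// mulr_gt0.
have eps0 := nash_eps_gt0 T00; set eps := nash_eps T0 in eps0 *.
have epsK : eps <= k0 / 2 ^+ n.+2 by rewrite ge_min lexx.
have epsl : eps * T0 <= l0 ^+ 2 by rewrite -ler_pdivlMr// ge_min lexx orbT.
pose s := Num.sqrt (eps * t).
have et : 0 < eps * t by exact: mulr_gt0.
have s0 : 0 < s by rewrite sqrtr_gt0.
have s2 : s ^+ 2 = eps * t by rewrite sqr_sqrtr// ltW.
have sl : s <= l0.
  apply: ler_sq; [exact: ltW|exact: ltW|rewrite s2; apply: le_trans epsl].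
  by rewrite ler_pM2l.
rewrite -/s; have Hf := lipc_sqi PX cf; have t0' := ltW t0.
have bound u h : lapX u h -> (forall r, 0 <= r -> (mass (P r u) <= m%:E)%E) ->
    ipm (P t u) (P t u) <= 4 / c * m ^+ 2 / s ^+ n.
  move=> lu mu'; have [Hu _] := lapX_H PX HP lu.
  pose F k := ipm (P (t / 4 ^+ k) u) (P (t / 4 ^+ k) u).
  have := @absorb R F (2 * m ^+ 2 / (c * s ^+ n)) (2 ^+ n) (2 ^- n.+1) (ipm u u).
  rewrite /F expr0 divr1 => ab; apply: le_trans (ab _ _ _ _ _ _ _) _.
  - by rewrite divr_ge0// mulr_ge0 ?sqr_ge0 ?exprn_ge0// ltW.
  - by rewrite exprn_ege1// ler1n.
  - by rewrite invr_ge0 exprn_ge0.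
  - by rewrite exprSr invfM mulrAC mulVf ?mul1r// expf_neq0.
  - move=> k; pose sk := s / 2 ^+ k; have k2 : 0 < 2 ^+ k :> R by rewrite exprn_gt0.
    have sk0 : 0 < sk by rewrite divr_gt0.
    have skl : sk <= l0.
      by apply: le_trans sl; rewrite ler_pdivrMr// ler_peMr ?(ltW s0)// exprn_ege1// ler1n.
    have k4 : 0 < 4 ^+ k :> R by rewrite exprn_gt0.
    have tk0 : 0 <= t / 4 ^+ k.+1 by rewrite divr_ge0 ?exprn_ge0.
    have dk0 : 0 <= 3 * (t / 4 ^+ k.+1) by rewrite mulr_ge0.
    have := nash_step sk0 skl m0 tk0 dk0 lu mu'; rewrite -/k0.
    have -> : 3 * (t / 4 ^+ k.+1) + t / 4 ^+ k.+1 = t / 4 ^+ k.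
      by rewrite exprSr; field; rewrite gt_eqF.
    move=> h1; apply: le_trans h1 _; apply: lerD.
      rewrite /sk expr_div_n -exprM mulnC exprM le_eqVlt; apply/orP; left; apply/eqP.
      by field; rewrite !gt_eqF ?exprn_gt0.
    apply: ler_wpM2r; first exact: (psd_ge0 pH).
    have sk2 : sk ^+ 2 = eps * t / 4 ^+ k.
      rewrite /sk expr_div_n s2 -exprM mulnC exprM (_ : 2 ^+ 2 = 4 :> R)//; ring.
    rewrite sk2 exprSr.
    have -> : - (k0 / (eps * t / 4 ^+ k)) * (3 * (t / (4 ^+ k * 4))) = - (k0 * 3 / (eps * 4)).
      by field; rewrite !gt_eqF.
    rewrite expRN lef_pV2 ?posrE ?expR_gt0 ?exprn_gt0//.
    have : k0 * 3 / (eps * 4) >= 2 ^+ n.+1.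
      have e4 : 0 < eps * 4 by rewrite mulr_gt0.
      rewrite ler_pdivlMr//; move: epsK; rewrite ler_pdivlMr ?exprn_gt0// !exprS.
      have := k00; set z := 2 ^+ n; set x := eps; lra.
    by have := expR_ge1Dx (k0 * 3 / (eps * 4)); lra.
  - move=> k; have tk0 : 0 <= t / 4 ^+ k by rewrite divr_ge0 ?exprn_ge0.
    rewrite -!(nrm2 pH) lerXn2r ?nnegrE ?nrm_ge0//.
    apply: (heat_contract PX HP nontrivial tk0); split=> // e e0.
    by exists u, h; split=> //; rewrite (dstxx pH Hu).
  - exact: (psd_ge0 pH).
  - have p0 : 0 < s ^+ n by rewrite exprn_gt0.
    by rewrite le_eqVlt; apply/orP; left; apply/eqP; field; rewrite !gt_eqF.
have B0 : 0 <= 4 / c * m ^+ 2 / s ^+ n.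
  by rewrite divr_ge0 ?exprn_ge0 ?(ltW s0)// mulr_ge0 ?sqr_ge0// divr_ge0// ltW.
rewrite -(nrm2 pH) -[leRHS](sqr_sqrtr B0) lerXn2r ?nnegrE ?nrm_ge0 ?sqrtr_ge0//.
apply/ler_addgt0Pr => e e0; have [Kt Kt0 hKt] := heat_dst HP t0'.
have [d d0 hd] : exists2 d, 0 < d & forall u, H u -> dst ipm u f < d -> dst ipm (P t u) (P t f) < e.
  have K1 : 0 < Kt + 1 by lra.
  exists (e / (Kt + 1)) => [|u Hu uf]; first exact: divr_gt0.
  apply: le_lt_trans (hKt u f Hu Hf) _; apply: le_lt_trans (ler_wpM2l Kt0 (ltW uf)) _.
  by rewrite mulrCA gtr_pMr// ltr_pdivrMr// mul1r ltrDl.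
have [u [h [lu uf mu']]] := mass_approx PX HP nontrivial cf d0.
have [Hu _] := lapX_H PX HP lu.
have b := bound u h lu (fun r r0 => le_trans (mu' r r0) fm).
have HPf := P_H HP t0' Hf; have HPu := P_H HP t0' Hu.
apply: le_trans (nrm_dst pH HPf HPu) _; rewrite (dstC pH HPf HPu).
apply: lerD; last exact/ltW/hd.
by rewrite /nrm ler_sqrt.
Qed.

End semigroup.
End nash.

(** ** Off-diagonal estimates *)

Section off_diagonal.
Context {R : realType} {T : pointedType} (X : pcomplex R T).
Hypothesis PX : polyhedral_complex X.
Local Notation S := (points X).
Implicit Types (x y z : S) (f g h u w psi : S -> R).
Local Notation lipc := (@lipschitz_compact R T X).
Local Notation H := (sqi (mu X)).
Local Notation ipm := (ip (mu X)).
Local Notation lipX := (@lipX R T X).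
Local Notation pH := (psd_ip X).
Variables (n : nat) (T0 eps B : R).
Variable P : R -> (S -> R) -> S -> R.
Hypothesis HP : heat_semigroup P.
Hypothesis nontrivial : exists2 g, H g & ipm g g != 0.
Hypothesis eps0 : 0 < eps.
Hypothesis B0 : 0 < B.
Hypothesis ultra : forall t m f, 0 < t -> t <= T0 -> 0 <= m -> lipc f -> (mass f <= m%:E)%E ->
  ipm (P t f) (P t f) <= B * m ^+ 2 / Num.sqrt (eps * t) ^+ n.

Let sq t := Num.sqrt (eps * t) ^+ n.

Let sq_gt0 t : 0 < t -> 0 < sq t.
Proof. by move=> t0; rewrite exprn_gt0// sqrtr_gt0 mulr_gt0. Qed.

(** The distance function [psi] is only used beyond the level [rho], where the data
   vanish. *)
Definition excess psi (rho : R) x := Num.max 0 (psi x - rho).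

Lemma excess_lip psi rho : lipX 1 psi -> lipX 1 (excess psi rho).
Proof.
move=> pL; rewrite -[1](mulr1 1); apply: (lipX_comp (th := fun a => Num.max 0 (a - rho)) ler01) => //.
move=> a b; rewrite mul1r.
have [ha|ha] := leP 0 (a - rho); have [hb|hb] := leP 0 (b - rho);
  rewrite ler_norml; apply/andP; split; have := ler_norm (a - b); have := ler_norm (b - a);
  rewrite (distrC b a); lra.
Qed.

Lemma sq_int f (c : R) : H f -> ipm (fun x => c * f x) (fun x => c * f x) = c ^+ 2 * ipm f f.
Proof.
move=> Hf; rewrite !ip_def -fine_integralZ; last exact: sqi_integrable.
by congr fine; apply: eq_integral => x _; congr EFin; ring.
Qed.

Lemma ip_le f g : H f -> H g -> (forall x, `|f x| <= `|g x|) -> ipm f f <= ipm g g.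
Proof. by move=> Hf Hg fg; rewrite -!(nrm2 pH) lerXn2r ?nnegrE ?nrm_ge0// nrm_mono. Qed.

Let cst := 2 * (expR 2 * 2 ^+ n * B).

Let cst0 : 0 <= cst.
Proof. by rewrite /cst !mulr_ge0 ?expR_ge0 ?exprn_ge0// ltW. Qed.

Let hrel t s f : 0 <= t -> 0 <= s -> H f -> dst ipm (P (t + s) f) (P t (P s f)) = 0.
Proof. exact: (heat_add0 HP). Qed.

(** The weights at successive scales [4 ^- k * t] and rates [2 ^+ k * xi] are
   compared through Davies' estimate, the unweighted part being controlled by
   ultracontractivity. *)
Lemma weighted_excess psi (Bp xi rho t m : R) f : lipX 1 psi -> (forall x, `|psi x| <= Bp) ->
  0 < xi -> 0 < t -> t <= T0 -> xi ^+ 2 * t <= 1 -> 0 <= m -> lipc f -> (mass f <= m%:E)%E ->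
  (forall x, rho < psi x -> f x = 0) ->
  let w x := expR (xi * excess psi (rho + (n.+3)%:R / 2 / xi) x) in
  ipm (fun x => w x * P t f x) (fun x => w x * P t f x) <= cst * m ^+ 2 / sq t.
Proof.
move=> pL pB xi0 t0 tT xt m0 cf fm supp /=; have Hf := lipc_sqi PX cf; have hf := lipc_hspace PX HP cf.
pose A := (n.+3)%:R / 4 : R.
pose rk k := rho + 2 * A * 2 ^- k / xi; pose xk k := xi * 2 ^+ k; pose tk k := t / 4 ^+ k.
pose phi k := excess psi (rk k).
have k2 k : 0 < 2 ^+ k :> R by rewrite exprn_gt0.
have k4 k : 0 < 4 ^+ k :> R by rewrite exprn_gt0.
have k42 k : (2 ^+ k) ^+ 2 = 4 ^+ k :> R.
  by rewrite -exprM mulnC exprM (_ : 2 ^+ 2 = 4 :> R)//; ring.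
have A0 : 0 <= A by rewrite divr_ge0.
have rk_rho k : rho <= rk k by rewrite lerDl divr_ge0 ?(ltW xi0)// mulr_ge0 ?mulr_ge0// invr_ge0 ltW.
have tk0 k : 0 < tk k by rewrite divr_gt0.
have tkT k : tk k <= T0.
  by apply: le_trans tT; rewrite ler_pdivrMr// ler_peMr ?(ltW t0)// exprn_ege1//; lra.
have phiL k : lipX 1 (phi k) by exact: excess_lip.
have phiB k x : `|phi k x| <= Bp + `|rk k|.
  rewrite /phi /excess ger0_norm ?le_max ?lexx// ge_max; apply/andP; split.
    by apply: addr_ge0 => //; apply: le_trans (pB x).
  by apply: lerD; [apply: le_trans (pB x); exact: ler_norm|rewrite -normrN ler_norm].
pose W k x := expR (xk k * phi k x).
have HW k g : H g -> H (fun x => W k x * g x).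
  by move=> Hg; exact: (weight_sqi PX (xk k) (phiL k) (phiB k) Hg).
pose F k := ipm (fun x => W k x * P (tk k) f x) (fun x => W k x * P (tk k) f x).
have HPk k : H (P (tk k) f) by apply: P_H => //; exact: ltW.
have dv k s g : 0 <= s -> hspace g -> xk k ^+ 2 * s <= 1 ->
    ipm (fun x => W k x * P s g x) (fun x => W k x * P s g x) <=
    expR 2 * ipm (fun x => W k x * g x) (fun x => W k x * g x).
  move=> s0 hg xs; have := davies PX (xk k) (phiL k) (phiB k) HP nontrivial s0 hg.
  rewrite -/(W k) => dd; have Hg := hg.1; have HPg := P_H HP s0 Hg.
  rewrite -!(nrm2 pH) (_ : expR 2 = expR 1 ^+ 2); last by rewrite -expRM_natl mulr1.
  rewrite -exprMn lerXn2r ?nnegrE ?nrm_ge0 ?mulr_ge0 ?nrm_ge0 ?expR_ge0//.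
  by apply: le_trans dd _; rewrite ler_wpM2r ?nrm_ge0// ler_expR.
have xtk k : xk k ^+ 2 * tk k = xi ^+ 2 * t.
  by rewrite /xk /tk exprMn k42; field; rewrite gt_eqF.
have tS k : tk k = 3 * tk k.+1 + tk k.+1.
  by rewrite /tk exprSr; field; rewrite gt_eqF.
have rec k : F k <= expR 2 * 2 ^+ n * B * m ^+ 2 / sq t * (2 ^+ n) ^+ k + expR (2 - 4 * A) * F k.+1.
  have h1 : 0 <= tk k.+1 by exact: ltW.
  have h3 : 0 <= 3 * tk k.+1 by rewrite mulr_ge0.
  have hg := heat_hspace PX HP h1 hf.
  have xs : xk k ^+ 2 * (3 * tk k.+1) <= 1.
    by apply: le_trans xt; rewrite -(xtk k) ler_wpM2l ?sqr_ge0// (tS k) lerDl.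
  have E : F k = ipm (fun x => W k x * P (3 * tk k.+1) (P (tk k.+1) f) x)
      (fun x => W k x * P (3 * tk k.+1) (P (tk k.+1) f) x).
    have Ha := HW k _ (HPk k); have Hb := HW k _ (P_H HP h3 hg.1).
    rewrite /F -!(nrm2 pH) (dst0_nrm pH Ha Hb)//.
    apply/eqP; rewrite eq_le dst_ge0 andbT.
    have Hd := psd_dom pH (-1) (P_H HP h3 hg.1) (HPk k).
    have := weight_nrm PX (xk k) (phiL k) (phiB k) Hd.
    have := hrel h3 h1 Hf; rewrite -(tS k) /dst => ->; rewrite mulr0 => h.
    apply: le_trans h; rewrite le_eqVlt; apply/orP; left; apply/eqP.
    by congr nrm; apply/funext => x; rewrite /lin -/(W k x); ring.
  rewrite E; apply: le_trans (dv k _ _ h3 hg xs) _.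
  have un := ultra (tk0 k.+1) (tkT k.+1) m0 cf fm.
  have split_w : ipm (fun x => W k x * P (tk k.+1) f x) (fun x => W k x * P (tk k.+1) f x) <=
      ipm (P (tk k.+1) f) (P (tk k.+1) f) + expR (- (4 * A)) * F k.+1.
    have Hu := HPk k.+1; have HWu := HW k.+1 _ Hu; have HWk := HW k _ Hu.
    rewrite /F !ip_def addrC -(@fine_integral_lin _ _ _ (mu X) (expR (- (4 * A)))
      (fun x => (W k.+1 x * P (tk k.+1) f x) * (W k.+1 x * P (tk k.+1) f x))
      (fun x => P (tk k.+1) f x * P (tk k.+1) f x)
      (fun x => expR (- (4 * A)) * ((W k.+1 x * P (tk k.+1) f x) * (W k.+1 x * P (tk k.+1) f x)) +
         P (tk k.+1) f x * P (tk k.+1) f x)); first last.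
    - by apply: (aeW (mu X)).
    - apply: measurable_funD; first apply: measurable_funM => //.
        by apply: measurable_funM; exact HWu.1.
      by apply: measurable_funM; exact Hu.1.
    - exact: (sqi_integrable Hu Hu).
    - exact: (sqi_integrable HWu HWu).
    apply: fine_le_ae.
    - exact: (sqi_integrable HWk HWk).
    - rewrite (_ : (fun x => _) = (fun x => (expR (- (4 * A)))%:E *
        ((W k.+1 x * P (tk k.+1) f x) * (W k.+1 x * P (tk k.+1) f x))%:E +
        (P (tk k.+1) f x * P (tk k.+1) f x)%:E)%E)//.
      apply: integrableD => //; last exact: (sqi_integrable Hu Hu).
      by apply: integrableZl => //; exact: (sqi_integrable HWu HWu).
    apply: (aeW (mu X)) => x; set v := P _ f x.
    suff wle : W k x ^+ 2 <= 1 + expR (- (4 * A)) * W k.+1 x ^+ 2.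
      by have := ler_wpM2r (sqr_ge0 v) wle; rewrite !expr2; lra.
    rewrite /W -!expRM_natl -expRD /phi /excess.
    have [le0|gt0] := leP (psi x - rk k) 0.
      by rewrite !mulr0 expR0 lerDl expR_ge0.
    set d := psi x - rk k.
    have dE : psi x - rk k.+1 = d + A * 2 ^- k / xi.
      by rewrite /d /rk exprSr; field; rewrite !gt_eqF.
    have d1 : 0 <= d + A * 2 ^- k / xi.
      by rewrite addr_ge0 ?(ltW gt0)// divr_ge0 ?(ltW xi0)// mulr_ge0// invr_ge0 ltW.
    rewrite dE max_r//.
    have -> : - (4 * A) + 2%:R * (xk k.+1 * (d + A * 2 ^- k / xi)) = 4 * xk k * d.
      by rewrite /xk exprSr; field; rewrite !gt_eqF.
    rewrite -[leLHS]add0r; apply: lerD => //; rewrite ler_expR.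
    have : 0 <= xk k * d by rewrite mulr_ge0 ?mulr_ge0 ?(ltW xi0) ?(ltW (k2 _)) ?(ltW gt0).
    by rewrite -!mulrA; lra.
  apply: le_trans (ler_wpM2l (expR_ge0 2) split_w) _; rewrite mulrDr; apply: lerD; last first.
    by rewrite mulrA -expRD lexx.
  rewrite -!mulrA ler_wpM2l ?expR_ge0//; apply: le_trans un _.
  have -> : Num.sqrt (eps * tk k.+1) ^+ n = sq t / (2 ^+ n * (2 ^+ n) ^+ k).
    have -> : eps * tk k.+1 = eps * t * (2 ^- k.+1) ^+ 2.
      by rewrite /tk -k42 exprVn mulrA.
    have et : 0 <= eps * t by rewrite mulr_ge0 ?ltW.
    rewrite sqrtrM// sqrtr_sqr ger0_norm ?invr_ge0 ?exprn_ge0// exprMn exprVn.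
    have -> : (2 ^+ k.+1) ^+ n = 2 ^+ n * (2 ^+ n) ^+ k :> R.
      by rewrite -[in LHS]exprM mulnC exprM exprS.
    by [].
  have p0 := sq_gt0 t0; have p2 : 0 < 2 ^+ n :> R by rewrite exprn_gt0.
  have p3 : 0 < (2 ^+ n) ^+ k :> R by rewrite exprn_gt0.
  rewrite le_eqVlt; apply/orP; left; apply/eqP.
  by move: p0 p2 p3; set a := sq t; set b := 2 ^+ n; set d := b ^+ k => p0 p2 p3; field; rewrite !gt_eqF.
have base : ipm (fun x => expR (xi * excess psi (rho + (n.+3)%:R / 2 / xi) x) * P t f x)
    (fun x => expR (xi * excess psi (rho + (n.+3)%:R / 2 / xi) x) * P t f x) = F 0%N.
  rewrite /F /W /phi /tk /xk /rk expr0 divr1 mulr1 invr1 mulr1.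
  by rewrite (_ : 2 * A = n.+3%:R / 2)// /A; field.
rewrite base (_ : cst * m ^+ 2 / sq t = 2 * (expR 2 * 2 ^+ n * B * m ^+ 2 / sq t)); last first.
  by rewrite /cst; ring.
have Q0 : 0 <= expR 2 * ipm f f by rewrite mulr_ge0 ?expR_ge0 ?(psd_ge0 pH).
apply: (@absorb R F _ (2 ^+ n) (expR (2 - 4 * A)) (expR 2 * ipm f f)) => //.
- by rewrite divr_ge0 ?(ltW (sq_gt0 t0))// !mulr_ge0 ?expR_ge0 ?exprn_ge0 ?sqr_ge0// ltW.
- by rewrite exprn_ege1// ler1n.
- have -> : 2 - 4 * A = - (n.+1)%:R :> R by rewrite /A -!natr1; field.
  rewrite expRN -[(n.+1)%:R]mulr1 expRM_natl ler_pdivrMl ?exprn_gt0 ?expR_gt0//.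
  have e2 : 2 <= expR 1 :> R by have := expR_ge1Dx (1 : R); lra.
  have : 2 ^+ n.+1 <= expR 1 ^+ n.+1 :> R by rewrite lerXn2r ?nnegrE ?expR_ge0.
  by rewrite [2 ^+ n.+1]exprSr; lra.
- move=> k; have xs : xk k ^+ 2 * tk k <= 1 by rewrite xtk.
  apply: le_trans (dv k _ _ (ltW (tk0 k)) hf xs) _; rewrite ler_wpM2l ?expR_ge0//.
  apply: ip_le => // [|x]; first exact: HW.
  have [px|px] := leP (psi x) rho; last by rewrite supp// mulr0.
  rewrite /W /phi /excess max_l ?mulr0 ?expR0 ?mul1r//.
  by rewrite subr_le0; apply: le_trans px _.
Qed.

Definition cstW := cst * expR (n.+3)%:R + B.

Lemma cstW_gt0 : 0 < cstW.
Proof. by rewrite /cstW ltr_wpDl// mulr_ge0// expR_ge0. Qed.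

(** Beyond [rho + (n.+3)%:R / 2 / xi] the weight [expR (xi * psi)] is the one of
   [weighted_excess], and below it is bounded by its value at that level. *)
Lemma weighted psi (Bp xi rho t m : R) f : lipX 1 psi -> (forall x, `|psi x| <= Bp) ->
  0 <= xi -> 0 < t -> t <= T0 -> xi ^+ 2 * t <= 1 -> 0 <= m -> lipc f -> (mass f <= m%:E)%E ->
  (forall x, rho < psi x -> f x = 0) ->
  nrm ipm (fun x => expR (xi * psi x) * P t f x) <=
  expR (xi * rho) * (m * Num.sqrt (cstW / sq t)).
Proof.
move=> pL pB xi0 t0 tT xt m0 cf fm supp; have s0 := sq_gt0 t0; have C0 := cstW_gt0.
have r0 : 0 <= expR (xi * rho) * (m * Num.sqrt (cstW / sq t)).
  by rewrite !mulr_ge0 ?expR_ge0 ?sqrtr_ge0.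
have HPf : H (P t f) by apply: P_H => //; [exact: ltW|exact: (lipc_sqi PX)].
have qq : 0 <= cstW / sq t by exact: (divr_ge0 (ltW C0) (ltW s0)).
apply: ler_sq; [exact: nrm_ge0|exact: r0|rewrite (nrm2 pH) !exprMn (sqr_sqrtr qq)].
have [x0|xn0] := eqVneq xi 0.
  rewrite x0 mul0r expR0 expr1n mul1r.
  rewrite (_ : (fun x => _) = P t f); last by apply/funext => x; rewrite mul0r expR0 mul1r.
  apply: le_trans (ultra t0 tT m0 cf fm) _.
  rewrite (_ : m ^+ 2 * (cstW / sq t) = cstW * m ^+ 2 / sq t); last by ring.
  apply: ler_wpM2r; first by rewrite invr_ge0 ltW.
  apply: ler_wpM2r; first exact: sqr_ge0.
  by rewrite /cstW lerDr mulr_ge0// expR_ge0.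
have xp : 0 < xi by rewrite lt_neqAle eq_sym xn0.
have := weighted_excess pL pB xp t0 tT xt m0 cf fm supp.
set r1 := rho + _; move=> /= we.
have HW : H (fun x => expR (xi * excess psi r1 x) * P t f x).
  apply: (weight_sqi PX xi (excess_lip r1 pL) (B := Bp + `|r1|)) => // x.
  rewrite /excess ger0_norm ?le_max ?lexx// ge_max; apply/andP; split.
    by apply: addr_ge0 => //; apply: le_trans (pB x).
  by apply: lerD; [apply: le_trans (pB x); exact: ler_norm|rewrite -normrN ler_norm].
apply: (@le_trans _ _ (expR (xi * r1) ^+ 2 * (cst * m ^+ 2 / sq t))).
  apply: le_trans (ler_wpM2l (sqr_ge0 _) we); rewrite -sq_int//.
  apply: ip_le.
  - exact: (weight_sqi PX xi pL pB).
  - exact: sqiZ.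
  move=> x; rewrite mulrA !normrM ler_wpM2r// -normrM -expRD !ger0_norm ?expR_ge0// ler_expR.
  rewrite -mulrDr ler_wpM2l// -lerBlDl /excess le_max lexx orbT//.
have -> : expR (xi * r1) ^+ 2 = expR (xi * rho) ^+ 2 * expR (n.+3)%:R.
  rewrite -!expRM_natl -expRD; congr expR; rewrite /r1; field.
  by rewrite gt_eqF.
rewrite -mulrA ler_wpM2l ?sqr_ge0// mulrA [leRHS]mulrA ler_wpM2r ?invr_ge0 ?(ltW s0)//.
by rewrite mulrA [leRHS]mulrC ler_wpM2r ?sqr_ge0// mulrC /cstW lerDl ltW.
Qed.

(** Split the time as [s + (t - 2 * s) + s]: the outer pieces are smoothed by
   [weighted] with opposite weights, the middle one by Davies' estimate, and the
   weights cancel in the pairing. *)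
Lemma off_diagonal psi (Bp D r t s xi mf mg : R) f g : lipX 1 psi -> (forall x, `|psi x| <= Bp) ->
  0 <= xi -> 0 < s -> 2 * s <= t -> s <= T0 -> xi ^+ 2 * s <= 1 ->
  0 <= mf -> 0 <= mg -> lipc f -> lipc g -> (mass f <= mf%:E)%E -> (mass g <= mg%:E)%E ->
  (forall x, psi x < D - r -> f x = 0) -> (forall x, r < psi x -> g x = 0) ->
  ipm (P t f) g <= expR (xi ^+ 2 * t - xi * D + 2 * xi * r) * (mf * mg * (cstW / sq s)).
Proof.
move=> pL pB xi0 s0 st sT xs mf0 mg0 cf cg fm gm sf sg.
have Hf := lipc_sqi PX cf; have Hg := lipc_sqi PX cg.
have hf := lipc_hspace PX HP cf; have hg := lipc_hspace PX HP cg.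
have s0' := ltW s0; have r0 : 0 <= t - 2 * s by lra.
pose psi' x := - psi x.
have pL' : lipX 1 psi' by move=> y z l yz; rewrite /psi' -opprD normrN; exact: pL.
have pB' x : `|psi' x| <= Bp by rewrite normrN.
have sf' x : - (D - r) < psi' x -> f x = 0 by rewrite /psi' ltrN2; exact: sf.
have wf := weighted pL' pB' xi0 s0 sT xs mf0 cf fm sf'.
have wg := weighted pL pB xi0 s0 sT xs mg0 cg gm sg.
have hPf := heat_hspace PX HP s0' hf; have HPf := hPf.1; have HPg := P_H HP s0' Hg.
have dv := davies PX xi pL' pB' HP nontrivial r0 hPf.
have HQ := P_H HP r0 HPf.
have E : ipm (P t f) g = ipm (fun x => expR (xi * psi' x) * P (t - 2 * s) (P s f) x)
    (fun x => expR (xi * psi x) * P s g x).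
  have ts : 0 <= t - s by lra.
  have E1 := hrel s0' ts Hf; rewrite [s + _]addrC subrK in E1.
  have Hts := P_H HP ts Hf; have hts := heat_hspace PX HP ts hf.
  have Ht : H (P t f) by apply: P_H => //; lra.
  rewrite (dst0_ip pH Ht (P_H HP s0' Hts) Hg E1) (heat_symmetric PX HP nontrivial s0' hts hg).
  have E2 := hrel r0 s0' Hf; rewrite (_ : t - 2 * s + s = t - s) in E2; last by ring.
  rewrite (dst0_ip pH Hts HQ HPg E2) !ip_def; congr fine; apply: eq_integral => x _; congr EFin.
  by rewrite mulrACA -expRD /psi' mulrN addNr expR0 mul1r.
have HA := weight_sqi PX xi pL' pB' HQ; have HB := weight_sqi PX xi pL pB HPg.
rewrite E; apply: le_trans (ler_norm _) _; apply: le_trans (psd_le pH HA HB) _.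
apply: (@le_trans _ _ ((expR (xi ^+ 2 * t) * (expR (xi * - (D - r)) * (mf * Num.sqrt (cstW / sq s)))) *
   (expR (xi * r) * (mg * Num.sqrt (cstW / sq s))))).
  apply: ler_pM; rewrite ?nrm_ge0//; apply: le_trans dv _.
  apply: ler_pM; rewrite ?expR_ge0 ?nrm_ge0// ler_expR.
  by rewrite ler_wpM2l ?sqr_ge0//; lra.
have q0 : 0 <= cstW / sq s by rewrite divr_ge0 ?(ltW cstW_gt0)// ltW// sq_gt0.
have -> : expR (xi ^+ 2 * t - xi * D + 2 * xi * r) =
    expR (xi ^+ 2 * t) * expR (xi * - (D - r)) * expR (xi * r).
  by rewrite -!expRD; congr expR; ring.
have := sqr_sqrtr q0; set Q := Num.sqrt _; move=> <-.
rewrite le_eqVlt; apply/orP; left; apply/eqP; ring.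
Qed.

End off_diagonal.

(** * Pointwise bounds for the heat kernel *)

Section tents.
Context {R : realType} {T : pointedType} (X : pcomplex R T).
Hypothesis PX : polyhedral_complex X.
Local Notation S := (points X).
Implicit Types (x y z : S) (f g : S -> R).
Local Notation spath := (@segment_path R T X).
Local Notation ed := (@path_edist R T X).
Local Notation lipc := (@lipschitz_compact R T X).
Local Notation lipX := (@lipX R T X).

Lemma continuous_measurable_points f : continuous f -> measurable_fun setT f.
Proof.
move=> cf; apply: (measurability _ (RGenOInfty.measurableE R)) => //.
move=> _ [_ [x ->] <-]; rewrite setTI; apply: (open_msets PX).
rewrite (_ : _ @^-1` _ = f @^-1` [set y | x < y]); last first.
  by apply/seteqP; split => y /=; rewrite in_itv/= andbT.
by apply: open_comp => [y _|]; [exact: cf|exact: open_gt].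
Qed.

Lemma compact_cellset i : compact (@cellset R T X i).
Proof.
apply: continuous_compact; last exact: body_compact.
apply/subspace_continuousP => a Pa A /nbhs_cballP[r r0 rA].
have := @enormB_continuous R (cdim i) a a.
move=> /cvgrPdist_lt/(_ _ r0) h; rewrite /fmap /= /within /=.
apply: filterS h => b; rewrite subrr enorm0 sub0r normrN ger0_norm ?enorm_ge0// => br Pb.
apply: rA; apply/edist_ltP; exists (enorm (b - a)) => //.
exact: (path_chart PX).
Qed.

(** A small closed ball lies in finitely many cells, each of which is compact. *)
Lemma compact_near x : exists2 r, 0 < r & forall s : R, s < r ->
  compact [set y | (ed x y <= s%:E)%E].
Proof.
have [r r0 /finite_seqP[s sE]] := cells_locally_finite PX x; exists r => // s' sr.
have [K cK hK] : exists2 K : set S, compact K & forall i, i \in s -> cellset i `<=` K.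
  elim: {sE} s => [|i s [K cK hK]]; first by exists set0 => //; exact: compact0.
  exists (cellset i `|` K); first by apply: compactU => //; exact: compact_cellset.
  move=> j; rewrite inE => /orP[/eqP->|js]; first by move=> y; left.
  by move=> y jy; right; exact: hK jy.
apply: (subclosed_compact _ cK); first exact: closed_edist.
move=> y /= xy; have [i Mi iy] := maximal_cover PX y; apply: (hK i) => //.
suff : [set i | cellset i `&` @cball R T X x r !=set0] i by rewrite sE.
by exists y; split=> //; apply: le_lt_trans xy _; rewrite lte_fin.
Qed.

(** Truncation keeps the function finite where the distance is infinite. *)
Definition trunc (r : R) x y : R := fine (Order.min r%:E (ed x y)).

Lemma truncE r x y : 0 <= r -> (trunc r x y)%:E = Order.min r%:E (ed x y).
Proof.
move=> r0; rewrite /trunc fineK// ge0_fin_numE.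
  by rewrite gt_min ltry.
by rewrite le_min lee_fin r0 path_edist_ge0.
Qed.

Lemma trunc_ge0 r x y : 0 <= r -> 0 <= trunc r x y.
Proof. by move=> r0; rewrite -lee_fin truncE// le_min lee_fin r0 path_edist_ge0. Qed.

Lemma trunc_le r x y : 0 <= r -> trunc r x y <= r.
Proof. by move=> r0; rewrite -lee_fin truncE// ge_min lexx. Qed.

Lemma trunc_le_edist r x y : 0 <= r -> ((trunc r x y)%:E <= ed x y)%E.
Proof. by move=> r0; rewrite truncE// ge_min lexx orbT. Qed.

Lemma trunc_lip r x : 0 <= r -> lipX 1 (trunc r x).
Proof.
move=> r0; have le y z l : spath y z l -> trunc r x z <= trunc r x y + l.
  move=> yz; have l0 := path_ge0 yz; rewrite -lee_fin EFinD !truncE//.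
  have h := edist_path x yz; rewrite ge_min.
  have [ry|yr] := leP r%:E (ed x y).
    by rewrite -EFinD lee_fin lerDl l0.
  by apply/orP; right.
move=> y z l yz; rewrite mul1r ler_norml; apply/andP; split.
  by have := le _ _ _ yz; lra.
by have := le _ _ _ (path_sym yz); lra.
Qed.

Definition tent (r : R) x y : R := r - trunc r x y.

Lemma tent_ge0 r x y : 0 <= r -> 0 <= tent r x y.
Proof. by move=> r0; rewrite subr_ge0 trunc_le. Qed.

Lemma tent_support r x y : 0 <= r -> tent r x y != 0 -> (ed x y < r%:E)%E.
Proof.
move=> r0; apply: contraNT; rewrite -leNgt => rx.
by rewrite /tent subr_eq0 eq_sym -(inj_eq (@EFin_inj R)) truncE// min_l.
Qed.

Lemma tent_lip r x : 0 <= r -> lipX 1 (tent r x).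
Proof.
move=> r0 y z l yz; have := trunc_lip x r0 yz; rewrite /tent.
by rewrite (_ : _ - _ - _ = - (trunc r x y - trunc r x z)) ?normrN//; ring.
Qed.

Lemma tent_half r x y : 0 < r -> (ed x y < (r / 2)%:E)%E -> r / 2 <= tent r x y.
Proof.
move=> r0 xy; have : ((trunc r x y)%:E <= (r / 2)%:E)%E.
  by apply: le_trans (trunc_le_edist x y (ltW r0)) (ltW xy).
by rewrite lee_fin /tent; lra.
Qed.

Lemma tent_lipc x : exists2 r0, 0 < r0 & forall r, 0 <= r -> r < r0 -> lipc (tent r x).
Proof.
have [r0 r00 cr] := compact_near x; exists r0 => // r rp rr.
apply: (lipX_lipc (tent_lip x rp)); apply: (subclosed_compact _ (cr r rr)).
  exact: closed_closure.
have -> : [set y | (ed x y <= r%:E)%E] = closure [set y | (ed x y <= r%:E)%E].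
  by apply/closure_id; exact: closed_edist.
by apply: closureS => y /= /(tent_support rp)/ltW.
Qed.

Section fat.
Variables (n : nat) (c l0 : R).
Hypothesis c0 : 0 < c.
Hypothesis l00 : 0 < l0.
Hypothesis fat : forall i (x : 'rV[R]_(cdim i)) (r : R), maximal_cell X i ->
  body (cpoly i) x -> 0 < r -> r <= l0 ->
  ((c * r ^+ n)%:E <= leb (cdim i) (@vec R _ @^-1` body (cpoly i) `&` eball x r))%E.

Lemma measurable_cball x r : measurable (@cball R T X x r).
Proof. by apply: (open_msets PX); apply/open_dopenP; exact: dopen_cball. Qed.

Lemma ball_mass x r : 0 < r -> (0 < mu X (@cball R T X x r))%E.
Proof.
move=> r0; have [i Mi [a Pa ax]] := maximal_cover PX x.
pose s := Num.min l0 (r / 2); have s0 : 0 < s by rewrite lt_min l00 divr_gt0.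
have sr : s < r.
  by apply: (@le_lt_trans _ _ (r / 2)); [rewrite ge_min lexx orbT|lra].
apply: (@lt_le_trans _ _ (c * s ^+ n)%:E); first by rewrite lte_fin mulr_gt0// exprn_gt0.
apply: le_trans (fat Mi Pa s0 _) _; first by rewrite ge_min lexx.
apply: (@le_trans _ _ (leb (cdim i) (@chart_pre R T X i (@cball R T X x r)))).
  apply: le_measure; rewrite ?inE.
  - by apply: measurableI; [exact: measurable_polytope|exact: measurable_eball].
  - exact: (@measurable_cball x r i).
  - move=> t [Pt at_]; split=> //; apply/edist_ltP; exists (enorm (vec t - a)).
      by rewrite -ax; exact: (path_chart PX).
    exact: le_lt_trans at_ sr.
rewrite /mu; apply: esum_ge; exists [set i].
  by split; [exact: finite_set1|move=> j ->].
by rewrite fsbig_set1.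
Qed.

Lemma tent_mass r x : 0 < r -> lipc (tent r x) ->
  0 < fine (\int[mu X]_y (tent r x y)%:E)%E /\
  0 < ip (mu X) (tent r x) (tent r x).
Proof.
move=> r0 ct; have Ht := lipc_sqi PX ct; have r2 : 0 < r / 2 by lra.
have mt : measurable_fun setT (tent r x) by exact: Ht.1.
have big (k : nat) : (0 < \int[mu X]_y (tent r x y ^+ k)%:E)%E.
  apply: (@lt_le_trans _ _ (\int[mu X]_y ((r / 2) ^+ k * \1_(@cball R T X x (r / 2)) y)%:E)%E).
    have i0 y : 0 <= \1_(@cball R T X x (r / 2)) y :> R by rewrite indicE.
    have rk0 : 0 <= (r / 2) ^+ k by rewrite exprn_ge0// ltW.
    rewrite (rintegralZ (mu X) measurableT (measurable_indic (measurable_cball x _)) i0 rk0).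
    rewrite integral_indic ?setIT//; last exact: measurable_cball.
    by rewrite mule_gt0 ?ball_mass// lte_fin exprn_gt0.
  apply: rintegral_le => //.
  - by apply: measurable_funM => //; apply: measurable_indic; exact: measurable_cball.
  - exact: measurable_funX.
  - by move=> y; rewrite mulr_ge0 ?indicE// exprn_ge0// ltW.
  move=> y _; have t0 := tent_ge0 x y (ltW r0).
  rewrite indicE; have [By|nBy] := pselect (@cball R T X x (r / 2) y).
    rewrite mem_set// mulr1 lerXn2r ?nnegrE ?(ltW r2)//; exact: tent_half.
  by rewrite memNset// mulr0 exprn_ge0.
split.
- have := big 1%N; under eq_integral do rewrite expr1.
  move=> b1; apply: fine_gt0; rewrite b1 /=; apply: le_lt_trans (lipc_mass PX ct).
  rewrite /mass le_eqVlt; apply/orP; left; apply/eqP; apply: eq_integral => y _.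
  by rewrite ger0_norm// tent_ge0// ltW.
- by have := big 2; rewrite ipE// lte_fin.
Qed.

End fat.
End tents.

Section kernel.
Context {R : realType} {T : pointedType} (X : pcomplex R T).
Hypothesis PX : polyhedral_complex X.
Local Notation S := (points X).
Implicit Types (x y z : S) (f g : S -> R).
Local Notation ed := (@path_edist R T X).
Local Notation lipc := (@lipschitz_compact R T X).
Local Notation H := (sqi (mu X)).
Local Notation ipm := (ip (mu X)).
Variables (n : nat) (c l0 K T0 : R).
Hypothesis dimn : forall i, maximal_cell X i -> cdim i = n.
Hypothesis c0 : 0 < c.
Hypothesis l00 : 0 < l0.
Hypothesis fat : forall i (x : 'rV[R]_(cdim i)) (r : R), maximal_cell X i ->
  body (cpoly i) x -> 0 < r -> r <= l0 ->
  ((c * r ^+ n)%:E <= leb (cdim i) (@vec R _ @^-1` body (cpoly i) `&` eball x r))%E.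
Hypothesis K0 : 0 < K.
Hypothesis hK : local_poincare X n c l0 K.
Hypothesis T00 : 0 < T0.

Let eps := nash_eps n c l0 K T0.
Let W := cstW n (4 / c).

Let eps0 : 0 < eps. Proof. exact: nash_eps_gt0. Qed.
Let W0 : 0 < W. Proof. by apply: cstW_gt0; exact: divr_gt0. Qed.

Section one_kernel.
Variables (h : R -> S -> S -> R) (P : R -> (S -> R) -> S -> R).
Hypothesis hcont : forall t, 0 < t -> continuous (fun p : S * S => h t p.1 p.2).
Hypothesis HP : heat_semigroup P.
Hypothesis hP : forall t f, 0 < t -> L2 f ->
  {ae mu X, forall x, (P t f x)%:E = (\int[mu X]_y (h t x y * f y)%:E)%E}.

Let nontrivial : exists2 g, H g & ipm g g != 0.
Proof.
have [r0 r00 ct] := tent_lipc PX (point : S).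
have r2 : 0 < r0 / 2 by lra.
have r2r : r0 / 2 < r0 by lra.
have cf := ct _ (ltW r2) r2r; have [_ p] := tent_mass PX c0 l00 fat r2 cf.
by exists (tent (r0 / 2) (point : S)); [exact: (lipc_sqi PX)|rewrite gt_eqF].
Qed.

Let meas (r : R) x := fine (\int[mu X]_y (tent r x y)%:E)%E.

Let mass_tent r x : 0 < r -> lipc (tent r x) -> mass (tent r x) = (meas r x)%:E.
Proof.
move=> r0 ct; have E : mass (tent r x) = (\int[mu X]_y (tent r x y)%:E)%E.
  by apply: eq_integral => y _; rewrite ger0_norm// tent_ge0// ltW.
rewrite /meas -E fineK// ge0_fin_numE; first exact: (lipc_mass PX).
by apply: integral_ge0 => y _; rewrite lee_fin.
Qed.

Let tent_integrable r x : 0 < r -> lipc (tent r x) ->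
  (mu X).-integrable setT (fun y => (tent r x y)%:E).
Proof.
move=> r0 ct; apply/integrableP; split.
  by apply/measurable_EFinP; exact: (lipc_sqi PX ct).1.
under eq_integral do rewrite abse_EFin; exact: (lipc_mass PX).
Qed.

(** Testing against tents recovers the continuous kernel. *)
Lemma kernel_lower t x y eta r : 0 < t -> 0 < r -> lipc (tent r x) -> lipc (tent r y) ->
  (forall x' y', (ed x x' < r%:E)%E -> (ed y y' < r%:E)%E -> `|h t x y - h t x' y'| < eta) ->
  (h t x y - eta) * (meas r y * meas r x) <= ipm (P t (tent r y)) (tent r x).
Proof.
move=> t0 r0 cx cy near; have Hx := lipc_sqi PX cx; have Hy := lipc_sqi PX cy.
have HPy := P_H HP (ltW t0) Hy; have ix := tent_integrable r0 cx; have iy := tent_integrable r0 cy.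
rewrite ip_def mulrA -fine_integralZ//; apply: fine_le_ae.
- rewrite (_ : (fun z => _) = (fun z => ((h t x y - eta) * meas r y)%:E * (tent r x z)%:E)%E)//.
  exact: integrableZl.
- exact: sqi_integrable.
have AF : Filter (almost_everywhere (mu X)) by exact: ae_filter_ringOfSetsType.
apply: filterS (hP t0 ((L2H _).2 Hy)) => x' E.
have [->|gx] := eqVneq (tent r x x') 0; first by rewrite !mulr0.
suff low : (h t x y - eta) * meas r y <= P t (tent r y) x'.
  exact (ler_wpM2r (tent_ge0 x x' (ltW r0)) low).
have xx' := tent_support (ltW r0) gx.
have hc : continuous (fun y' : S => h t x' y').
  move=> y' A /(@hcont t t0 (x', y'))[[B C] /= [Bx Cy] BC].
  change (nbhs y' [set z | A (h t x' z)]); apply: filterS Cy => z Cz.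
  by apply: (BC (x', z)); split=> //=; exact: nbhs_singleton Bx.
have mh := continuous_measurable_points PX hc.
rewrite -[P t _ x']/(fine (P t (tent r y) x')%:E) E -fine_integralZ//.
have bd y' : `|h t x' y' * tent r y y'| <= (`|h t x y| + eta) * tent r y y'.
  have ty := tent_ge0 y y' (ltW r0).
  have [->|gy] := eqVneq (tent r y y') 0; first by rewrite !mulr0 normr0.
  rewrite normrM (ger0_norm ty) ler_wpM2r//.
  have := near x' y' xx' (tent_support (ltW r0) gy).
  by have := ler_normB (h t x y) (h t x y - h t x' y'); rewrite subKr; lra.
apply: fine_le_ae.
- rewrite (_ : (fun z => _) = (fun z => (h t x y - eta)%:E * (tent r y z)%:E)%E)//.
  exact: integrableZl.
- apply: (@le_integrable _ _ _ _ _ measurableT _ (fun z => (`|h t x y| + eta)%:E * (tent r y z)%:E)%E).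
  + by apply/measurable_EFinP; apply: measurable_funM => //; exact: Hy.1.
  + move=> y' _; rewrite -EFinM !abse_EFin lee_fin; apply: le_trans (bd y') _; exact: ler_norm.
  + exact: integrableZl.
- apply: (aeW (mu X)) => y'; have ty := tent_ge0 y y' (ltW r0).
  have [->|gy] := eqVneq (tent r y y') 0; first by rewrite !mulr0.
  rewrite ler_wpM2r//; have := near x' y' xx' (tent_support (ltW r0) gy).
  by rewrite ltr_norml => /andP[_]; lra.
Qed.

(** Tents of radius [r] around [x] and [y] turn the off-diagonal estimate into a bound
   on [h t x y] with an error that vanishes as [r] tends to [0]; the masses of the
   tents cancel. *)
Lemma kernel_bound_aux t x y (xi s : R) : 0 < t -> 0 <= xi -> 0 < s -> 2 * s <= t -> s <= T0 ->
  xi ^+ 2 * s <= 1 ->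
  h t x y <= expR (xi ^+ 2 * t - xi * path_dist x y) * (W / Num.sqrt (eps * s) ^+ n).
Proof.
move=> t0 xi0 s0 st sT xs; set D := path_dist x y; set U := W / _.
have D0 : 0 <= D by apply: fine_ge0; exact: path_edist_ge0.
have Dxy : (D%:E <= ed x y)%E.
  rewrite /D /path_dist; have := path_edist_ge0 x y.
  by case: (ed x y) => [d||]//= _; rewrite leey.
have [rx rx0 cx] := tent_lipc PX x; have [ry ry0 cy] := tent_lipc PX y.
have step k : h t x y <= expR (xi ^+ 2 * t - xi * D + 2 * xi * harm k) * U + harm k.
  have hk := @harm_gt0 R k.
  have /cvgrPdist_lt/(_ _ hk) := @hcont t t0 (x, y).
  move=> [[A B] /= [/nbhs_cballP[r1 r10 r1A] /nbhs_cballP[r2 r20 r2B]] AB].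
  pose r := Num.min (Num.min r1 r2) (Num.min (harm k) (Num.min rx ry / 2)).
  have m0 : 0 < Num.min rx ry / 2 by rewrite divr_gt0// lt_min rx0.
  have r0 : 0 < r by rewrite !lt_min r10 r20 hk.
  have rr1 : r <= r1 by rewrite !ge_min lexx.
  have rr2 : r <= r2 by rewrite !ge_min lexx orbT.
  have rk : r <= harm k by rewrite !ge_min lexx !orbT.
  have rm : r <= Num.min rx ry / 2 by rewrite /r !ge_min lexx !orbT.
  have mx : Num.min rx ry <= rx by rewrite ge_min lexx.
  have my : Num.min rx ry <= ry by rewrite ge_min lexx orbT.
  have mm : 0 < Num.min rx ry by rewrite lt_min rx0.
  have rrx : r < rx by lra.
  have rry : r < ry by lra.
  have ctx := cx r (ltW r0) rrx; have cty := cy r (ltW r0) rry.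
  have [mx0 _] := tent_mass PX c0 l00 fat r0 ctx; have [my0 _] := tent_mass PX c0 l00 fat r0 cty.
  rewrite -/(meas r x) in mx0; rewrite -/(meas r y) in my0.
  have low : (h t x y - harm k) * (meas r y * meas r x) <= ipm (P t (tent r y)) (tent r x).
    apply: kernel_lower => // x' y' xx' yy'.
    have /= := AB (x', y'); apply; split=> /=.
    - by apply: r1A; apply: lt_le_trans xx' _; rewrite lee_fin.
    - by apply: r2B; apply: lt_le_trans yy' _; rewrite lee_fin.
  have pL := trunc_lip x D0.
  have pB z : `|trunc D x z| <= D by rewrite ger0_norm ?trunc_ge0// trunc_le.
  have Ty : trunc D x y = D.
    by apply: (@EFin_inj R); rewrite truncE// min_l.
  have supy z : trunc D x z < D - r -> tent r y z = 0.
    move=> zD; apply/eqP; apply: contraT => /(tent_support (ltW r0))/edist_ltP[l yz lr].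
    by have := pL _ _ _ yz; rewrite mul1r Ty ler_norml => /andP[_]; lra.
  have supx z : r < trunc D x z -> tent r x z = 0.
    move=> rz; apply/eqP; apply: contraT => /(tent_support (ltW r0)) xz.
    have := le_lt_trans (trunc_le_edist x z D0) xz; rewrite lte_fin; lra.
  have ultra t' m f : 0 < t' -> t' <= T0 -> 0 <= m -> lipc f -> (mass f <= m%:E)%E ->
      ipm (P t' f) (P t' f) <= 4 / c * m ^+ 2 / Num.sqrt (eps * t') ^+ n.
    exact: (nash PX c0 l00 HP nontrivial K0 hK T00).
  have myE : (mass (tent r y) <= (meas r y)%:E)%E by rewrite mass_tent.
  have mxE : (mass (tent r x) <= (meas r x)%:E)%E by rewrite mass_tent.
  have c4 : 0 < 4 / c by exact: divr_gt0.
  have up := off_diagonal PX HP nontrivial eps0 c4 ultra pL pB xi0 s0 st sT xs (ltW my0) (ltW mx0)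
    cty ctx myE mxE supy supx.
  have mm0 : 0 < meas r y * meas r x by exact: mulr_gt0.
  have := le_trans low up; set mm' := meas r y * meas r x in mm0 *.
  rewrite -/W -/U; set e0 := expR (_ + 2 * xi * r).
  rewrite (_ : e0 * (mm' * U) = e0 * U * mm'); last by ring.
  rewrite (ler_pM2r mm0) => fin; rewrite -lerBlDr; apply: le_trans fin _.
  have U0 : 0 <= U by rewrite divr_ge0 ?(ltW W0)// exprn_ge0// sqrtr_ge0.
  apply: ler_wpM2r => //; rewrite ler_expR lerD2l ler_wpM2l// mulr_ge0//.
have lim : (expR (xi ^+ 2 * t - xi * D + 2 * xi * harm k) * U + harm k) @[k --> \oo] -->
    (expR (xi ^+ 2 * t - xi * D + 2 * xi * 0) * U + 0 : R).
  apply: cvgD; last exact: harm_cvg.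
  apply: cvgM; last exact: cvg_cst.
  have c1 : (xi ^+ 2 * t - xi * D + 2 * xi * harm k) @[k --> \oo] -->
      (xi ^+ 2 * t - xi * D + 2 * xi * 0 : R).
    by apply: cvgD; [exact: cvg_cst|apply: cvg_scale; exact: harm_cvg].
  exact: (cvg_comp _ _ c1 (@continuous_expR R _)).
suff : h t x y <= expR (xi ^+ 2 * t - xi * D + 2 * xi * 0) * U + 0 by rewrite mulr0 !addr0.
exact (seq_le (cvg_cst (h t x y)) lim step).
Qed.

(** The choice of the rate [D / (2 * t)] and of the time [s]. *)
Lemma kernel_bound t x y : 0 < t ->
  h t x y <= W / Num.sqrt (eps / 2) ^+ n / Num.sqrt (Num.min t T0) ^+ n *
    expR (- (path_dist x y ^+ 2 / (4 * t))) * Num.sqrt (1 + path_dist x y ^+ 2 / t) ^+ n.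
Proof.
move=> t0; set D := path_dist x y; pose q := D ^+ 2 / t; pose m := Num.min t T0.
have q0 : 0 <= q by rewrite divr_ge0 ?sqr_ge0// ltW.
have m0 : 0 < m by rewrite lt_min t0.
have mt : m <= t by rewrite ge_min lexx.
have mT : m <= T0 by rewrite ge_min lexx orbT.
have D0 : 0 <= D by apply: fine_ge0; exact: path_edist_ge0.
have d0 : 0 < 2 * (1 + q) by lra.
pose s := m / (2 * (1 + q)); pose xi := D / (2 * t).
have s0 : 0 < s by exact: divr_gt0.
have sm : 2 * s * (1 + q) = m by rewrite /s; field; rewrite gt_eqF//; lra.
have sq : 0 <= s * q by rewrite mulr_ge0// ltW.
have sm2 : 2 * s <= m by lra.
have xi0 : 0 <= xi by rewrite divr_ge0// mulr_ge0// ltW.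
have xs : xi ^+ 2 * s <= 1.
  have -> : xi ^+ 2 * s = s * q / (4 * t) by rewrite /xi /q; field; rewrite gt_eqF.
  by rewrite ler_pdivrMr ?mulr_gt0//; lra.
have := @kernel_bound_aux t x y xi s t0 xi0 s0 (le_trans sm2 mt) _ xs; rewrite -/D.
have -> : xi ^+ 2 * t - xi * D = - (D ^+ 2 / (4 * t)) by rewrite /xi; field; rewrite gt_eqF.
have -> : Num.sqrt (eps * s) ^+ n =
    Num.sqrt (eps / 2) ^+ n * Num.sqrt m ^+ n / Num.sqrt (1 + q) ^+ n.
  have q1 : 0 < 1 + q by lra.
  have e2 : 0 <= eps / 2 by rewrite divr_ge0// ltW.
  rewrite -exprMn -expr_div_n -sqrtrM// -sqrtrV ?(ltW q1)// -sqrtrM ?mulr_ge0 ?(ltW m0) ?(ltW eps0)//.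
  by congr (Num.sqrt _ ^+ n); rewrite /s; field; rewrite gt_eqF.
move=> h1; apply: le_trans (h1 _) _; first by lra.
rewrite -/q -/m le_eqVlt; apply/orP; left; apply/eqP.
have p1 : 0 < Num.sqrt (eps / 2) ^+ n by rewrite exprn_gt0// sqrtr_gt0 divr_gt0.
have p2 : 0 < Num.sqrt m ^+ n by rewrite exprn_gt0// sqrtr_gt0.
have p3 : 0 < Num.sqrt (1 + q) ^+ n by rewrite exprn_gt0// sqrtr_gt0; lra.
by field; rewrite !gt_eqF.
Qed.

End one_kernel.
End kernel.

Lemma powR_half {R : realType} (a : R) n : 0 <= a -> a `^ (n%:R / 2) = Num.sqrt a ^+ n.
Proof.
by move=> a0; rewrite -powR_mulrn ?sqrtr_ge0// -powR12_sqrt// -powRrM mulrC.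
Qed.

Theorem corollary3p1p5 (R : realType) (T : pointedType) (X : pcomplex R T)
    (n M : nat) (alpha R0 : R)
    (hn : (0 < n)%N)
    (hX : euclidean_complex X n)
    (hM : degree_le X M)
    (halpha : 0 < alpha)
    (hsolid : solid_angle_bound X n alpha)
    (hedge : edges_bounded_below X)
    (hR0 : 0 < R0) :
  exists C : R, 0 < C /\
    forall N : R, volume_doubling X N R0 ->
    forall h : R -> points X -> points X -> R, heat_kernel h ->
    forall (x y : points X) (t : R), 0 < t ->
      h t x y <=
        C / (M%:R * sphere_measure n * Num.min t (R0 ^+ 2) `^ (n%:R / 2))
        * expR (- (path_dist x y ^+ 2 / (4 * t)))
        * (1 + path_dist x y ^+ 2 / t) `^ (N / 2).
Proof.
have [PX [dimn _] _] := hX.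
have [l0 l00 hl] : exists2 l0 : R, 0 < l0 & (l0%:E <= ereal_inf [set path_edist p.1 p.2 | p in
    [set p : points X * points X |
      [/\ @skeleton R T X 0 p.1, @skeleton R T X 0 p.2 & p.1 <> p.2]]])%E.
  move: hedge; rewrite /edges_bounded_below; case: ereal_inf => [l||]//.
  - by rewrite lte_fin => l0; exists l.
  - by move=> _; exists 1 => //; exact: leey.
have hl0 (p q : points X) : @skeleton R T X 0 p -> @skeleton R T X 0 q -> p <> q ->
    (l0%:E <= path_edist p q)%E.
  by move=> sp sq' pq; apply: le_trans hl _; apply: ereal_inf_lbound; exists (p, q).
have [c c0 fat] := cell_fat PX dimn halpha hsolid l00 hl0.
have sig0 : 0 < sphere_measure n :> R.
  have [i Mi _] := maximal_cover PX (point : points X).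
  have [p Ip] := body_full (cpoly i).
  have [v [z [va _ _]]] := vertex_descent (interior_subset Ip).
  by have [] := vertex_fat PX dimn halpha hsolid l00 hl0 Mi va l00 (lexx _).
have M0 : 0 < M%:R :> R by rewrite ltr0n; exact: (degree_pos PX dimn hn hM).
have [K K0 hK] := pre_nash PX dimn c0 fat.
have T00 : 0 < R0 ^+ 2 by rewrite exprn_gt0.
pose C1 := cstW n (4 / c) / Num.sqrt (nash_eps n c l0 K (R0 ^+ 2) / 2) ^+ n.
have C10 : 0 < C1.
  rewrite divr_gt0//; first by apply: cstW_gt0; exact: divr_gt0.
  by rewrite exprn_gt0// sqrtr_gt0 divr_gt0// nash_eps_gt0.
exists (M%:R * sphere_measure n * C1); split.
  by apply: mulr_gt0 => //; exact: mulr_gt0.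
move=> N dbl h [hcont [P HP hP]] x y t t0.
have nN := doubling_dim PX dimn halpha hsolid l00 hl0 hR0 dbl.
have m0 : 0 < Num.min t (R0 ^+ 2) by rewrite lt_min t0.
have kb := kernel_bound PX c0 l00 fat K0 hK T00 hcont HP hP x y t0.
apply: le_trans kb _.
have p0 : 0 < Num.min t (R0 ^+ 2) `^ (n%:R / 2) by exact: powR_gt0.
rewrite -(powR_half n (ltW m0)) -/C1.
have -> : M%:R * sphere_measure n * C1 /
    (M%:R * sphere_measure n * Num.min t (R0 ^+ 2) `^ (n%:R / 2)) =
    C1 / Num.min t (R0 ^+ 2) `^ (n%:R / 2).
  by field; rewrite !gt_eqF.
have q0 : 0 <= path_dist x y ^+ 2 / t by rewrite divr_ge0 ?sqr_ge0// ltW.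
have q1 : 0 <= 1 + path_dist x y ^+ 2 / t by lra.
apply: ler_wpM2l; first by rewrite mulr_ge0 ?expR_ge0// divr_ge0// ltW.
rewrite -(powR_half n q1); apply: ler_powR; first by lra.
by rewrite ler_pM2r// invr_gt0.
Qed.
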